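(* Let $\lambda>0$, $\mu\ge0$, let $H(t)$ be the height at time $t$ of the random tree process $G$ with parameters $\lambda,\mu$, let $p^*(s)=\int_0^\infty e^{-st}p(t)\,dt$ be the Laplace transform of the vertex lifetime distribution function $p$, and let \[ b(s,c)=\frac sc+\log\left[\frac{\lambda(1-sp^*(s))}{s}\right]. \] Then with probability $1$, \[ \lim_{t\to\infty}\frac{H(t)}{t}=\delta, \] where $\delta\ge0$ is uniquely defined from the system of equations (in the unknowns $s$, real and positive, and $\delta$) \[ b(s,\delta)=\frac{\partial b(s,\delta)}{\partial s}=0. \] In the ergodic case, $\delta=0$.
   Context: The process $G=\{G(t),t\ge0\}$ is a continuous-time Markov chain whose state space is the set of finite directed trees rooted at a fixed vertex $v_0$. At time $0$, $G(0)$ consists of the single vertex $v_0$. Transitions: (adjunction) at each vertex $v$ of the current tree, independently, a new edge with origin $v$ and ending at a new leaf is appended at the epochs of a Poisson process of rate $\lambda>0$; (deletion) each vertex other than the root, as long as it is a leaf (has no descendant), is deleted at rate $\mu\ge0$ ($\mu=0$ is the pure birth case, with no deletion). The root is never deleted. ''Ergodic'' means positive recurrent. $H(t)$ is the maximal distance (number of edges) from the root to a vertex of $G(t)$. The lifetime of a non-root vertex is the length of time between its birth and its deletion ($\infty$ if it is never deleted); all non-root vertices have the same, possibly defective, lifetime distribution function, denoted $p(t)$ (so $p\equiv0$ if $\mu=0$).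
   Formalization: In the ergodic case δ=0, b(s,0) is undefined and the system has no solution with s,δ>0, so existence of a solution (s,δ) is asserted only in the non-ergodic case; in the ergodic case δ=0 is stated directly. Any solution with s,δ>0 has second component δ. *)

(* Defs.v *)
From HB Require Import structures.
From mathcomp Require Import all_boot all_order all_algebra finmap.
From mathcomp Require Import all_classical all_reals all_analysis.
Set Implicit Arguments.
Unset Strict Implicit.
Unset Printing Implicit Defensive.
Import Order.TTheory GRing.Theory Num.Theory.
Import numFieldNormedType.Exports.
Local Open Scope classical_set_scope.
Local Open Scope ring_scope.

(** A vertex is named by the word of child indices read along the path from
    the root: the root is the empty word and the children of [v] are the words
    [rcons v k].  The distance from [v] to the root is [size v].  A finite tree
    is a finite set of words containing the root and closed under taking
    parents. *)
Notation vertex := (seq nat).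

Definition root_vertex : vertex := [::].
Definition parent (v : vertex) : vertex := take (size v).-1 v.

Definition is_tree (A : {fset vertex}) : bool :=
  (root_vertex \in A) && all (fun v => parent v \in A) (enum_fset A).

Record tree := Tree { vertices :> {fset vertex}; treeP : is_tree vertices }.
HB.instance Definition _ := [isSub for vertices].
HB.instance Definition _ := [Countable of tree by <:].

Lemma is_tree_root : is_tree [fset root_vertex]%fset.
Proof.
rewrite /is_tree in_fset1 eqxx /=; apply/allP => v.
by rewrite in_fset1 => /eqP ->; rewrite in_fset1.
Qed.

Definition root_tree : tree := Tree is_tree_root.

Definition is_leaf (x : tree) (v : vertex) : bool :=
  all (fun w => (w == root_vertex) || (parent w != v)) (enum_fset x).

Definition deletable (x : tree) (v : vertex) : bool :=
  [&& v \in vertices x, v != root_vertex & is_leaf x v].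

(** The new child of [v] gets the least index not used by a present child of
    [v].  A name may thus be used again after a deletion; an individual vertex
    is identified by its name together with the jump at which it was born. *)
Definition fresh_index (x : tree) (v : vertex) : nat :=
  find (fun k => rcons v k \notin vertices x) (iota 0 (size (enum_fset x)).+1).
Definition fresh_child (x : tree) (v : vertex) : vertex :=
  rcons v (fresh_index x v).

(** The default value of [insubd] is never used for [v] in [x], resp. for a
    deletable [v]: see [vertices_add_leaf] and [vertices_del_leaf]. *)
Definition add_leaf (x : tree) (v : vertex) : tree :=
  insubd x (fresh_child x v |` vertices x)%fset.
Definition del_leaf (x : tree) (v : vertex) : tree :=
  insubd x (vertices x `\ v)%fset.

Definition height (x : tree) : nat := \max_(v <- enum_fset x) size v.

Lemma fresh_childN (x : tree) v : fresh_child x v \notin vertices x.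
Proof.
rewrite /fresh_child /fresh_index.
set a := fun k => _; set s := iota _ _.
have [as_|nas] := boolP (has a s).
  have := nth_find 0%N as_.
  by rewrite nth_iota ?add0n //; move: as_; rewrite has_find size_iota.
have sub : {subset [seq rcons v k | k <- s] <= enum_fset x}.
  move=> w /mapP[k ks ->]; move/hasPn: nas => /(_ k ks).
  by rewrite /a negbK.
have us : uniq [seq rcons v k | k <- s].
  by rewrite map_inj_uniq ?iota_uniq// => i j /rcons_inj[].
by have := uniq_leq_size us sub; rewrite size_map size_iota ltnn.
Qed.

Lemma parent_rcons v k : parent (rcons v k) = v.
Proof. by rewrite /parent size_rcons /= -cats1 take_size_cat. Qed.

Lemma vertices_add_leaf (x : tree) v : v \in vertices x ->
  vertices (add_leaf x v) = (fresh_child x v |` vertices x)%fset.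
Proof.
move=> vx; rewrite /add_leaf.
apply: (@insubdK _ is_tree tree).
have /andP[rx /allP px] := treeP x.
rewrite unfold_in /is_tree in_fset1U rx orbT /=; apply/allP => w.
rewrite !in_fset1U => /orP[/eqP ->|/px ->]; last by rewrite orbT.
by rewrite parent_rcons vx orbT.
Qed.

Lemma vertices_del_leaf (x : tree) v : deletable x v ->
  vertices (del_leaf x v) = (vertices x `\ v)%fset.
Proof.
move=> /and3P[vx vr /allP lf]; rewrite /del_leaf.
apply: (@insubdK _ is_tree tree).
have /andP[rx /allP px] := treeP x.
rewrite unfold_in /is_tree in_fsetD1 rx eq_sym vr /=; apply/allP => w.
rewrite !in_fsetD1 => /andP[wv wx]; rewrite px // andbT.
have /orP[/eqP ->|//] := lf _ wx.
by rewrite /parent /= eq_sym.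
Qed.

Section ctmc.
Context {R : realType} {T : choiceType}.
Variable q : T -> T -> R.

(** The sum is over a set of finite support for chains with finitely many
    possible transitions out of each state. *)
Definition exit_rate (x : T) : R := \sum_(y \in [set~ x]) q x y.

Definition jump_prob (x y : T) : R :=
  if y == x then 0 else q x y / exit_rate x.

Context {d : measure_display} {Omega : measurableType d}.
Variables (Y : nat -> Omega -> T) (S : nat -> Omega -> R).

(** [S k] is the time spent in the [k]-th state, so that state [Y n] is entered
    at time [jump_time S n]. *)
Definition jump_time (n : nat) (w : Omega) : R := \sum_(k < n) S k w.

(** [G] is the Markov chain started at [x0], with transition rates [q], jump
    chain [Y] and holding times [S], none of the states being absorbing: [Y] is
    a discrete-time chain with transition matrix [jump_prob], and, given [Y],
    the [S k] are independent exponential variables with parameters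
    [exit_rate (Y k)]. *)
Definition is_ctmc (P : probability Omega R) (x0 : T) (G : R -> Omega -> T) :
    Prop :=
  [/\ forall n y, measurable [set w | Y n w = y],
      forall n, measurable_fun setT (S n),
      forall n w, 0 < S n w,
      forall (n : nat) (y : nat -> T) (s : nat -> R),
        (forall k, 0 <= s k) ->
        P [set w | (forall k, (k <= n)%N -> Y k w = y k) /\
                   (forall k, (k < n)%N -> s k < S k w)]
        = ((y 0%N == x0)%:R *
           \prod_(k < n) (expR (- (exit_rate (y k) * s k)) *
                          jump_prob (y k) (y k.+1)))%:E
    & forall n t w, jump_time n w <= t < jump_time n.+1 w -> G t w = Y n w].

(** Time of the first return to the initial state, [+oo] if there is none. *)
Definition return_time (w : Omega) : \bar R :=
  ereal_inf [set (jump_time n w)%:E | n in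
              [set n | (0 < n)%N /\ Y n w = Y 0%N w]].

(** For an irreducible chain this does not depend on the initial state. *)
Definition positive_recurrent (P : probability Omega R) : Prop :=
  (\int[P]_w return_time w < +oo)%E.

End ctmc.
Arguments return_time {R T d Omega} Y S w.
Arguments positive_recurrent {R T d Omega} Y S P.

Section random_tree.
Context {R : realType}.

Definition tree_rate (lambda mu : R) (x y : tree) : R :=
  \sum_(v <- enum_fset x) lambda * (y == add_leaf x v)%:R +
  \sum_(v <- enum_fset x | deletable x v) mu * (y == del_leaf x v)%:R.

Lemma add_leaf_neq (x : tree) v : v \in vertices x -> add_leaf x v != x.
Proof.
move=> vx; apply/eqP => /(congr1 vertices); rewrite vertices_add_leaf//.
move=> /fsetP/(_ (fresh_child x v)).
by rewrite in_fset1U eqxx /= (negbTE (fresh_childN _ _)).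
Qed.

Lemma del_leaf_neq (x : tree) v : deletable x v -> del_leaf x v != x.
Proof.
move=> dx; apply/eqP => /(congr1 vertices); rewrite vertices_del_leaf//.
by move=> /fsetP/(_ v); case/and3P: dx => ->; rewrite in_fsetD1 eqxx.
Qed.

Lemma sum_eq_indic (I : Type) (T : eqType) (r : seq I) (Q : pred I) (s : seq T)
    (f : I -> T) (c : R) : uniq s -> (forall i, Q i -> f i \in s) ->
  \sum_(y <- s) \sum_(i <- r | Q i) c * (y == f i)%:R = \sum_(i <- r | Q i) c.
Proof.
move=> us fs; rewrite exchange_big; apply: eq_bigr => i Qi.
rewrite (bigD1_seq (f i)) ?fs//= eqxx mulr1 big1 ?addr0// => y /negbTE ->.
by rewrite mulr0.
Qed.

Lemma exit_rate_tree (lambda mu : R) (x : tree) :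
  exit_rate (tree_rate lambda mu) x =
  lambda *+ #|` x| + mu *+ count (deletable x) (enum_fset x).
Proof.
set s := undup ([seq add_leaf x v | v <- enum_fset x] ++
  [seq del_leaf x v | v <- enum_fset x & deletable x v]).
have us : uniq s by exact: undup_uniq.
have sx y : y \in s -> y <> x.
  rewrite mem_undup mem_cat => /orP[|] /mapP[v].
    by move=> vx -> /eqP; rewrite (negbTE (add_leaf_neq vx)).
  rewrite mem_filter => /andP[dv _] -> /eqP.
  by rewrite (negbTE (del_leaf_neq dv)).
rewrite /exit_rate -(@fsbig_widen _ _ _ _ [set` s] [set~ x])/=; first last.
- move=> y [/= yx ys]; rewrite /tree_rate !big1_seq ?addr0//.
  + move=> v /andP[dv vx]; case: eqP => [yE|]; last by rewrite mulr0.
    exfalso; apply: ys; rewrite /= mem_undup mem_cat yE; apply/orP; right.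
    by apply/mapP; exists v => //; rewrite mem_filter dv.
  + move=> v /andP[_ vx]; case: eqP => [yE|]; last by rewrite mulr0.
    exfalso; apply: ys; rewrite /= mem_undup mem_cat yE; apply/orP; left.
    by apply/mapP; exists v.
- by move=> y /= /sx.
rewrite -fsbig_seq// big_split /=; congr (_ + _).
- rewrite big_seq; under eq_bigr do rewrite big_seq.
  rewrite -big_seq sum_eq_indic//.
    by rewrite -big_seq big_const_seq count_predT iter_addr_0.
  move=> v vx; rewrite mem_undup mem_cat; apply/orP; left.
  by apply/mapP; exists v.
- under eq_bigr do rewrite big_seq_cond.
  rewrite sum_eq_indic//.
    by rewrite -big_seq_cond big_const_seq iter_addr_0.
  move=> v /andP[vx dv]; rewrite mem_undup mem_cat; apply/orP; right.
  by apply/mapP; exists v => //; rewrite mem_filter dv.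
Qed.

Context {d : measure_display} {Omega : measurableType d}.
Variables (Y : nat -> Omega -> tree) (S : nat -> Omega -> R).

(** A vertex with name [v] is born at the [n.+1]-st jump. *)
Definition born (v : vertex) (n : nat) : set Omega :=
  [set w | v \notin vertices (Y n w) /\ v \in vertices (Y n.+1 w)].

(** Lifetime of that vertex, [+oo] if it is never deleted. *)
Definition lifetime (v : vertex) (n : nat) (w : Omega) : \bar R :=
  ereal_inf [set (jump_time S m w - jump_time S n.+1 w)%:E | m in
              [set m | (n.+1 < m)%N /\ v \notin vertices (Y m w)]].

(** Given its birth, every vertex has lifetime distribution function [p]. *)
Definition lifetime_distribution (P : probability Omega R) (p : R -> R) : Prop :=
  forall (v : vertex) (n : nat) (t : R),
    P (born v n `&` [set w | (lifetime v n w <= t%:E)%E]) =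
    (P (born v n) * (p t)%:E)%E.

End random_tree.

Section height_speed.
Context {R : realType}.

Definition laplace (p : R -> R) (s : R) : R :=
  \int[lebesgue_measure]_(t in `[0%R, +oo[) (expR (- (s * t)) * p t).

Definition b_fun (lambda : R) (p : R -> R) (s c : R) : R :=
  s / c + ln (lambda * (1 - s * laplace p s) / s).

Definition solves_b (lambda : R) (p : R -> R) (s c : R) : Prop :=
  [/\ 0 < s, 0 < c, b_fun lambda p s c = 0
    & is_derive s (1 : R) (fun u : R => b_fun lambda p u c : R) 0].

End height_speed.

(* Main.v *)
Require Import Defs.
From HB Require Import structures.
From mathcomp Require Import all_boot all_order all_algebra finmap.
From mathcomp Require Import all_classical all_reals all_analysis.
From mathcomp Require Import measurable_realfun ring lra zify.
Set Implicit Arguments.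
Unset Strict Implicit.
Unset Printing Implicit Defensive.
Import Order.TTheory GRing.Theory Num.Theory.
Import numFieldNormedType.Exports.
Local Open Scope classical_set_scope.
Local Open Scope ring_scope.

(** Let [P t] be the probability that a vertex is still present at age [t].
    The number of living children of a vertex that cannot be deleted is Poisson
    at each time, so [beta t = exp (- lambda int_0^t P)] is the probability that
    it has none, and [P] solves the renewal equation [P + mu (beta * P) = 1].
    In the same way the probability [f_n t] that the tree has reached height
    [n] at time [t] satisfies [f_0 = 1] and
    [f_(n+1) = 1 - exp (- lambda P * f_n)].  The corresponding functionals of
    the current tree are products over its vertices; they solve the backward
    equation in its mild form, and as the chain does not explode they are the
    actual probabilities of the process.  Supersolutions of the same equation
    control what happens inside a unit time interval, so that by Borel-Cantelli
    it is enough to estimate [f_n] at integer times.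

    Put [m s = lambda int_0^oo exp (- s t) P t dt = lambda (1 - s p^*(s)) / s].
    Then [f_n t <= exp (s t) (m s)^n], which bounds the speed by any [c] with
    [s / c + ln (m s) < 0] for some [s].  If [int P] is infinite then [P] is
    bounded below by a positive constant, [- ln (m s) / s] has a positive
    maximum [1 / delta], and the convexity of [ln m] makes [delta] the only
    solution of the system.  When [c < delta], tilting the convolution powers
    of [lambda P] shows that for some [N] a vertex has on average more than one
    descendant of generation [N] born within time [N / c]; the recursion for
    [f_n] turns this into a positive lower bound for [f_n (n / c)], and one
    more generation into an exponential one.  The process is positive recurrent
    exactly when [int P] is finite; then
    [s m(s) / lambda <= (1 - m s)^2] with [m <= 1], so that
    [s / c + ln (m s) < 0] for [s] small, whatever [c > 0]: the speed is [0]
    and the system has no solution. *)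

(** * Integrals over segments and convolution *)

(** The hypotheses give only the joint law of the jump chain and the holding times, so neither
    independence of subtrees nor a Markov property at fixed times is at hand. Independence enters as
    algebra: a product over the vertices is differentiated and found to solve the backward equation.
    The expectation of u (t - J, Y) at the successive jump times J is then conserved, up to what has
    already been collected. The renewal equation comes from an undeletable vertex whose deletion
    clock is kept running all the same. When the clock first rings while the vertex is childless,
    the vertex is back in its initial state. With Q t the probability that a deletable vertex is
    present and childless at age t, this gives beta = Q + mu (Q * beta) and P t = 1 - mu int_0^t Q;
    eliminating Q leaves the equation for P. The function P is constructed as a solution of that
    equation before any process is considered. That 1 - P is the given lifetime law is proved on the
    child born at the first jump, and there too P is found to be nonincreasing. *)

Section integrals.
Context {R : realType}.
Local Notation mu := (@lebesgue_measure R).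
Implicit Types (f g h : R -> R) (a b c t : R).

Definition integral_seg f a b : R := \int[mu]_(r in `[a, b]) f r.

Lemma continuous_integrable_seg f a b :
  continuous f -> mu.-integrable `[a, b] (EFin \o f).
Proof.
move=> cf; apply: continuous_compact_integrable; first exact: segment_compact.
exact: continuous_subspaceT.
Qed.

Lemma integral_segE f a b : continuous f ->
  (integral_seg f a b)%:E = (\int[mu]_(r in `[a, b]) (f r)%:E)%E.
Proof.
move=> cf; rewrite fineK//; apply: integrable_fin_num => //.
exact: (continuous_integrable_seg a b cf).
Qed.

Lemma eq_integral_seg f g a b : (forall r, a <= r <= b -> f r = g r) ->
  integral_seg f a b = integral_seg g a b.
Proof.
by move=> fg; apply: eq_Rintegral => r; rewrite inE/= in_itv/=; exact: fg.
Qed.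

Lemma integral_segD f g a b : continuous f -> continuous g ->
  integral_seg (fun r => f r + g r) a b = integral_seg f a b + integral_seg g a b.
Proof.
by move=> cf cg; rewrite /integral_seg RintegralD//; exact: continuous_integrable_seg.
Qed.

Lemma integral_segZ f k a b : continuous f ->
  integral_seg (fun r => k * f r) a b = k * integral_seg f a b.
Proof.
by move=> cf; rewrite /integral_seg RintegralZl//; exact: continuous_integrable_seg.
Qed.

Lemma integral_seg_lt f a b : b < a -> integral_seg f a b = 0.
Proof.
by move=> ba; rewrite /integral_seg set_itv_ge ?Rintegral_set0// bnd_simp -ltNge.
Qed.

Lemma integral_seg_xx f a : integral_seg f a a = 0.
Proof. by rewrite /integral_seg set_itv1 Rintegral_set1. Qed.

Lemma integral_seg_le0 f t : t <= 0 -> integral_seg f 0 t = 0.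
Proof.
by rewrite le_eqVlt => /predU1P[->|/integral_seg_lt//]; exact: integral_seg_xx.
Qed.

Lemma le_integral_seg f g a b : continuous f -> continuous g ->
  (forall r, a <= r <= b -> f r <= g r) -> integral_seg f a b <= integral_seg g a b.
Proof.
move=> cf cg fg; by apply: le_Rintegral => //; exact: continuous_integrable_seg.
Qed.

Lemma integral_seg_ge0 f a b : (forall r, a <= r <= b -> 0 <= f r) ->
  0 <= integral_seg f a b.
Proof.
by move=> f0; apply: Rintegral_ge0 => r /=; rewrite in_itv/=; exact: f0.
Qed.

Lemma integral_seg_cst k a b : a <= b -> integral_seg (fun=> k) a b = k * (b - a).
Proof.
move=> ab; rewrite /integral_seg Rintegral_cst//.
rewrite [X in fine X](_ : _ = mu `[a, b])// lebesgue_measure_itv/= lte_fin.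
by have [//|ba] := ltP; rewrite (_ : b = a) ?subrr//; apply/eqP; rewrite eq_le ba.
Qed.

Lemma continuous_norm f : continuous f -> continuous (fun r => `|f r|).
Proof. by move=> cf x; apply: cvg_norm; exact: cf. Qed.

Lemma le_norm_integral_seg f a b : continuous f ->
  `|integral_seg f a b| <= integral_seg (fun r => `|f r|) a b.
Proof. by move=> cf; apply: le_normr_Rintegral => //; exact: continuous_integrable_seg. Qed.

Lemma integral_seg_split f a b c : continuous f -> a <= b -> b <= c ->
  integral_seg f a c = integral_seg f a b + integral_seg f b c.
Proof.
move=> cf ab bc; apply/eqP; rewrite addrC -subr_eq; apply/eqP.
rewrite {3}/integral_seg -Rintegral_itv_obnd_cbnd; last first.
  by apply: integrableS (continuous_integrable_seg b c cf) => //; exact: subset_itv_oc_cc.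
by apply: Rintegral_itvB; rewrite ?bnd_simp//; exact: continuous_integrable_seg.
Qed.

Lemma continuous_bounded_seg f t : continuous f ->
  exists2 M, 0 < M & forall r, 0 <= r <= t -> `|f r| <= M.
Proof.
move=> cf; have [t0|t0] := ltP t 0.
  by exists 1 => // r /andP[r0 rt]; have := le_lt_trans (le_trans r0 rt) t0; rewrite ltxx.
have /= := @EVT_max R (fun r => `|f r|) 0 t t0.
case; first by apply: continuous_subspaceT; exact: continuous_norm.
move=> c c0t cm; exists (`|f c| + 1); first by rewrite ltr_wpDl.
by move=> r r0t; apply: (le_trans (cm r _)); rewrite ?in_itv//= lerDl.
Qed.

Lemma derivable_integral_seg f t : continuous f -> 0 < t ->
  is_derive t 1 (integral_seg f 0) (f t).
Proof.
move=> cf t0.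
have tt1 : t < t + 1 by rewrite ltrDl.
have [dF FE] := continuous_FTC1_closed tt1 (continuous_integrable_seg 0 (t + 1) cf) t0 (cf t).
by apply: DeriveDef; [exact: dF|rewrite -derive1E].
Qed.

Lemma integral_seg_lip f t s (M : R) : continuous f -> (forall r, 0 <= r <= t -> `|f r| <= M) ->
  0 <= M -> s <= t -> `|integral_seg f 0 t - integral_seg f 0 s| <= M * (t - s).
Proof.
move=> cf fM M0 st; have [s0|s0] := leP s 0; last first.
  rewrite (@integral_seg_split f 0 s t)//; last exact: ltW.
  rewrite addrC addKr (le_trans (le_norm_integral_seg _ _ _))//.
  rewrite -integral_seg_cst//; apply: le_integral_seg => //.
  - exact: continuous_norm.
  - by move=> x; exact: cvg_cst.
  - by move=> r /andP[sr rt]; apply: fM; rewrite rt andbT (le_trans _ sr)// ltW.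
rewrite (integral_seg_le0 f s0) subr0.
have [t0|t0] := leP t 0.
  by rewrite integral_seg_le0// normr0 mulr_ge0// subr_ge0.
rewrite (le_trans (le_norm_integral_seg _ _ _))//.
rewrite (@le_trans _ _ (integral_seg (fun=> M) 0 t))//.
  apply: le_integral_seg => //; first exact: continuous_norm.
  by move=> x; exact: cvg_cst.
by rewrite (integral_seg_cst _ (ltW t0)) ler_wpM2l// subr0 lerBrDl gerDr.
Qed.

Lemma continuous_integral_seg f : continuous f -> continuous (integral_seg f 0).
Proof.
move=> cf x.
have [M M0 fM] := @continuous_bounded_seg f (x + 1) cf.
apply/cvgrPdist_le => e e0.
have d0 : 0 < Num.min 1 (e / M) by rewrite lt_min ltr01 divr_gt0.
move/cvgrPdist_lt: (@cvg_id _ (nbhs x)) => /(_ _ d0); apply: filterS => y /=.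
rewrite lt_min => /andP[yx1 /ltW yx].
have {}yx1 : y <= x + 1.
  by rewrite -lerBlDl (le_trans (ler_norm _))// distrC ltW.
have [xy|yx'] := leP x y.
- rewrite distrC (le_trans (@integral_seg_lip f y x M _ _ _ _))//.
  + by move=> r /andP[r0 ry]; apply: fM; rewrite r0 (le_trans ry).
  + exact: ltW.
  + by rewrite mulrC -ler_pdivlMr// (le_trans (ler_norm _))// distrC.
- rewrite (le_trans (@integral_seg_lip f x y M _ _ _ _))//; [|exact: ltW..|].
  + by move=> r /andP[r0 ry]; apply: fM; rewrite r0 (le_trans ry)// lerDl.
  + by rewrite mulrC -ler_pdivlMr// (le_trans (ler_norm _)).
Qed.

Lemma integral_seg_reflect f t : continuous f -> 0 <= t ->
  integral_seg (fun r => f (t - r)) 0 t = integral_seg f 0 t.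
Proof.
move=> cf t0; rewrite /integral_seg /Rintegral; congr fine.
have D : (fun r : R => t - r)^`()%classic = cst (-1)%R.
  by apply/funext => z; rewrite derive1E deriveB// derive_cst derive_id sub0r.
have := @integration_by_substitution_decreasing R (fun r => t - r) f 0 t t0.
rewrite subrr subr0 => ->.
- apply: eq_integral => x _; rewrite !fctE D; congr EFin.
  by rewrite /cst/= opprK mulr1.
- by move=> x y _ _ /=; rewrite ltrD2l ltrN2.
- by rewrite D => ? _; exact: cvg_cst.
- by rewrite D; exact: is_cvg_cst.
- by rewrite D; exact: is_cvg_cst.
- split => //.
  + apply: cvg_at_right_filter; apply: cvgB; [exact: cvg_cst|exact: cvg_id].
  + apply: cvg_at_left_filter; apply: cvgB; [exact: cvg_cst|exact: cvg_id].
- exact: continuous_subspaceT.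
Qed.

Lemma integral_seg_shift f c a b : continuous f -> a <= b ->
  integral_seg (fun r => f (r - c)) a b = integral_seg f (a - c) (b - c).
Proof.
move=> cf ab; rewrite /integral_seg /Rintegral; congr fine.
have D : (fun r : R => r - c)^`()%classic = cst 1%R.
  by apply/funext => z; rewrite derive1E derive_val; rewrite subr0.
have := @integration_by_substitution_increasing R (fun r => r - c) f a b ab.
move=> ->.
- by apply: eq_integral => x _; rewrite !fctE D /cst/= mulr1.
- by move=> x y _ _ /=; rewrite ltrD2r.
- by rewrite D => ? _; exact: cvg_cst.
- by rewrite D; exact: is_cvg_cst.
- by rewrite D; exact: is_cvg_cst.
- split => //.
  + apply: cvg_at_right_filter; apply: cvgB; [exact: cvg_id|exact: cvg_cst].
  + apply: cvg_at_left_filter; apply: cvgB; [exact: cvg_id|exact: cvg_cst].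
- exact: continuous_subspaceT.
Qed.

End integrals.

(** * Convolution on the half line *)

Section convol.
Context {R : realType}.
Local Notation mu := (@lebesgue_measure R).
Implicit Types (f g h : R -> R) (a b c t : R).

Definition convol f g t : R := integral_seg (fun r => f r * g (t - r)) 0 t.

Lemma continuousM_ f g : continuous f -> continuous g ->
  continuous (fun r => f r * g r).
Proof. by move=> cf cg x; apply: cvgM; [exact: cf|exact: cg]. Qed.

Lemma continuousD_ f g : continuous f -> continuous g ->
  continuous (fun r => f r + g r).
Proof. by move=> cf cg x; apply: cvgD; [exact: cf|exact: cg]. Qed.

Lemma continuousB_ f g : continuous f -> continuous g ->
  continuous (fun r => f r - g r).
Proof. by move=> cf cg x; apply: cvgB; [exact: cf|exact: cg]. Qed.

Lemma continuousN_ f : continuous f -> continuous (fun r => - f r).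
Proof. by move=> cf x; apply: cvgN; exact: cf. Qed.

Lemma continuousZ_ k f : continuous f -> continuous (fun r => k * f r).
Proof. by move=> cf; apply: continuousM_ => // x; exact: cvg_cst. Qed.

Lemma continuous_cst_ (k : R) : continuous ((fun=> k) : R -> R).
Proof. by move=> x; exact: cvg_cst. Qed.

Lemma continuous_id_ : continuous ((fun x => x) : R -> R).
Proof. by move=> x; exact: cvg_id. Qed.

Lemma continuous_comp_ f g : continuous f -> continuous g ->
  continuous (fun r => f (g r)).
Proof. by move=> cf cg x; apply: continuous_comp; [exact: cg|exact: cf]. Qed.

Lemma continuous_expR_ f : continuous f -> continuous (fun r => expR (f r)).
Proof. by move=> cf; apply: continuous_comp_ => //; exact: continuous_expR. Qed.

Lemma continuous_refl_ f t : continuous f -> continuous (fun r => f (t - r)).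
Proof.
move=> cf; apply: (@continuous_comp_ f (fun r => t - r)) => //.
by apply: continuousB_; [exact: continuous_cst_|exact: continuous_id_].
Qed.

Lemma continuous_convol_body f g t : continuous f -> continuous g ->
  continuous (fun r => f r * g (t - r)).
Proof. by move=> cf cg; apply: continuousM_ => //; exact: continuous_refl_. Qed.

Lemma convol_le0 f g t : t <= 0 -> convol f g t = 0.
Proof. exact: integral_seg_le0. Qed.

Lemma convolC f g t : continuous f -> continuous g -> convol f g t = convol g f t.
Proof.
move=> cf cg; have [t0|t0] := leP t 0; first by rewrite !convol_le0.
rewrite /convol -[LHS]integral_seg_reflect ?ltW//; last exact: continuous_convol_body.
by apply: eq_integral_seg => r _; rewrite mulrC; congr (g _ * _); ring.
Qed.

Lemma eq_convol f f' g g' t : (forall r, 0 <= r <= t -> f r = f' r) ->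
  (forall r, 0 <= r <= t -> g r = g' r) -> convol f g t = convol f' g' t.
Proof.
move=> ff' gg'; apply: eq_integral_seg => r /andP[r0 rt].
by rewrite ff' ?r0// gg'// subr_ge0 rt lerBlDr lerDl.
Qed.

Lemma convolDl f f' g t : continuous f -> continuous f' -> continuous g ->
  convol (fun r => f r + f' r) g t = convol f g t + convol f' g t.
Proof.
move=> cf cf' cg; rewrite /convol -integral_segD//; try exact: continuous_convol_body.
by apply: eq_integral_seg => r _; rewrite mulrDl.
Qed.

Lemma convolZl k f g t : continuous f -> continuous g ->
  convol (fun r => k * f r) g t = k * convol f g t.
Proof.
move=> cf cg; rewrite /convol -integral_segZ//; try exact: continuous_convol_body.
by apply: eq_integral_seg => r _; rewrite mulrA.
Qed.

Lemma convolDr f g g' t : continuous f -> continuous g -> continuous g' ->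
  convol f (fun r => g r + g' r) t = convol f g t + convol f g' t.
Proof.
move=> cf cg cg'; rewrite /convol -integral_segD//; try exact: continuous_convol_body.
by apply: eq_integral_seg => r _; rewrite mulrDr.
Qed.

Lemma convolZr k f g t : continuous f -> continuous g ->
  convol f (fun r => k * g r) t = k * convol f g t.
Proof.
move=> cf cg; rewrite /convol -integral_segZ//; try exact: continuous_convol_body.
by apply: eq_integral_seg => r _; rewrite mulrCA.
Qed.

Lemma convolBl f f' g t : continuous f -> continuous f' -> continuous g ->
  convol (fun r => f r - f' r) g t = convol f g t - convol f' g t.
Proof.
move=> cf cf' cg.
rewrite -[X in _ - X]mul1r -mulNr -convolZl// -convolDl//; last exact: continuousZ_.
by apply: eq_convol => // r _; rewrite mulN1r.
Qed.

Lemma convolBr f g g' t : continuous f -> continuous g -> continuous g' ->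
  convol f (fun r => g r - g' r) t = convol f g t - convol f g' t.
Proof.
move=> cf cg cg'; rewrite convolC//; last exact: continuousB_.
by rewrite convolBl// !(convolC _ cf).
Qed.

Lemma convol_ge0 f g t : (forall r, 0 <= r <= t -> 0 <= f r) ->
  (forall r, 0 <= r <= t -> 0 <= g r) -> 0 <= convol f g t.
Proof.
move=> f0 g0; apply: integral_seg_ge0 => r /andP[r0 rt].
by rewrite mulr_ge0// ?f0 ?r0// g0// subr_ge0 rt lerBlDr lerDl.
Qed.

Lemma le_convol f f' g g' t :
  continuous f -> continuous f' -> continuous g -> continuous g' ->
  (forall r, 0 <= r <= t -> 0 <= f r <= f' r) ->
  (forall r, 0 <= r <= t -> 0 <= g r <= g' r) -> convol f g t <= convol f' g' t.
Proof.
move=> cf cf' cg cg' ff' gg'; apply: le_integral_seg => [||r /andP[r0 rt]].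
- exact: continuous_convol_body.
- exact: continuous_convol_body.
have /andP[f0 fle] : 0 <= f r <= f' r by rewrite ff' ?r0.
have /andP[g0 gle] : 0 <= g (t - r) <= g' (t - r).
  by rewrite gg'// subr_ge0 rt lerBlDr lerDl.
exact: ler_pM.
Qed.

Lemma norm_convol f g t : continuous f -> continuous g ->
  `|convol f g t| <= convol (fun r => `|f r|) (fun r => `|g r|) t.
Proof.
move=> cf cg; rewrite (le_trans (le_norm_integral_seg _ _ _))//.
  exact: continuous_convol_body.
by rewrite /convol; under eq_integral_seg do rewrite normrM.
Qed.

Lemma convol1l f t : continuous f -> convol (fun=> 1) f t = integral_seg f 0 t.
Proof.
move=> cf; rewrite convolC//; last exact: continuous_cst_.
by apply: eq_integral_seg => r _; rewrite mulr1.
Qed.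

(** The variable upper limit is removed by extending [g - g 0] by zero, hence continuously, to
    negative arguments. Near each point the convolution is then [g 0] times a primitive of [f] plus
    an integral over a fixed segment, to which continuity under the integral sign applies. *)
Lemma continuous_convol f g : continuous f -> continuous g -> continuous (convol f g).
Proof.
move=> cf cg.
pose g1 := fun s => g (Num.max s 0) - g 0.
have cmax : continuous (fun s : R => Num.max s 0).
  by move=> s; apply: (@continuous_max _ _ (fun x => x) (fun=> 0)); [exact: cvg_id|exact: cvg_cst].
have cg1 : continuous g1.
  apply: continuousB_; last exact: continuous_cst_.
  exact: (@continuous_comp_ g (fun s => Num.max s 0)).
have E T t : t <= T -> 0 <= T ->
    convol f g t = g 0 * integral_seg f 0 t + integral_seg (fun r => f r * g1 (t - r)) 0 T.
  move=> tT T0; have [t0|t0] := leP t 0.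
    rewrite convol_le0// integral_seg_le0// mulr0 add0r.
    rewrite (@eq_integral_seg _ _ (fun=> 0)) ?integral_seg_cst ?mul0r//.
    move=> r /andP[r0 rT]; rewrite /g1 (_ : Num.max _ _ = 0) ?subrr ?mulr0//.
    by apply/max_idPr; rewrite subr_le0 (le_trans t0).
  rewrite (integral_seg_split _ (ltW t0) tT); last exact: continuous_convol_body.
  rewrite [X in _ + (_ + X)](_ : _ = 0) ?addr0; last first.
    rewrite (@eq_integral_seg _ _ (fun=> 0)) ?integral_seg_cst ?mul0r//.
    move=> r /andP[r0 rT]; rewrite /g1 (_ : Num.max _ _ = 0) ?subrr ?mulr0//.
    by apply/max_idPr; rewrite subr_le0.
  rewrite -integral_segZ// -integral_segD; [|exact: continuousZ_|exact: continuous_convol_body].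
  apply: eq_integral_seg => r /andP[r0 rt]; rewrite /g1.
  by rewrite (_ : Num.max _ _ = t - r); [ring|apply/max_idPl; rewrite subr_ge0].
move=> x.
pose T := `|x| + 1.
have xT : x < T by rewrite /T (le_lt_trans (ler_norm _))// ltrDl.
have T0 : 0 < T by rewrite /T ltr_wpDl.
have : {near x, (fun t => g 0 * integral_seg f 0 t + integral_seg (fun r => f r * g1 (t - r)) 0
  T) =1 convol f g}.
  have : \forall t \near x, t < T by exact: lt_nbhsl.
  by apply: filterS => t tT; rewrite (E T)// ltW.
move=> /near_eq_cvg H; apply: cvg_trans H _.
rewrite (E T x) ?ltW//.
apply: cvgD.
  by apply: cvgM; [exact: cvg_cst|exact: continuous_integral_seg].
have [Mf Mf0 fM] := @continuous_bounded_seg R f T cf.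
have [Mg Mg0 gM] := @continuous_bounded_seg R g1 T cg1.
have := @continuity_under_integral R _ _ mu (fun t r => f r * g1 (t - r)) `[0, T]
  (measurable_itv _) (x - 1) T.
move=> /(_ _ _ (fun=> Mf * Mg) _ _ x); apply.
- by move=> t _; apply: continuous_integrable_seg; exact: continuous_convol_body.
- apply/aeW => r _ t _; apply: cvgM; first exact: cvg_cst.
  apply: (@continuous_comp_ g1 (fun s => s - r)) => //.
  by apply: continuousB_; [exact: continuous_id_|exact: continuous_cst_].
- exact: (@continuous_integrable_seg R (fun=> Mf * Mg) 0 T (@continuous_cst_ _)).
- move=> t /=; rewrite in_itv/= => /andP[_ tT]; apply/aeW => r /=.
  rewrite in_itv/= => r0T; have /andP[r0 rT] := r0T.
  rewrite normrM ler_pM ?fM//; have [rt|tr] := leP r t.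
    by rewrite gM// subr_ge0 rt/= lerBlDr (le_trans (ltW tT))// lerDl.
  rewrite /g1 (_ : Num.max _ _ = 0) ?subrr ?normr0 ?ltW//.
  by apply/max_idPr; rewrite subr_le0 ltW.
- by rewrite inE/= in_itv/= xT andbT ltrBlDr ltrDl.
Qed.

Lemma measurable_continuous f : continuous f -> measurable_fun setT f.
Proof. by move=> cf; exact: continuous_measurable_fun. Qed.

(** Fubini on the triangle 0 <= r <= a <= t for the kernel f r g (a - r) h (t - a). The kernel
    carries three indicators, so that both iterated integrals run over the whole line. *)
Lemma convolA f g h t : continuous f -> continuous g -> continuous h ->
  convol f (convol g h) t = convol (convol f g) h t.
Proof.
move=> cf cg ch; have [t0|t0] := ltP t 0; first by rewrite !convol_le0// ltW.
have [Mf Mf0 fM] := @continuous_bounded_seg R f t cf.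
have [Mg Mg0 gM] := @continuous_bounded_seg R g t cg.
have [Mh Mh0 hM] := @continuous_bounded_seg R h t ch.
have segE (k : R -> R) (a b : R) : continuous k ->
    (integral_seg k a b)%:E = (\int[mu]_r (k r * \1_`[a, b] r)%:E)%E.
  move=> ck; rewrite integral_segE// integral_mkcond; apply: eq_integral => r _.
  by rewrite patchE indicE; case: ifP => _; rewrite ?mulr1 ?mulr0.
pose K (z : R * R) : R := f z.1 * (g (z.2 - z.1) * h (t - z.2)) *
  (\1_`[0, t] z.1 * (\1_`[0, t] z.2 * \1_`[0, +oo[ (z.2 - z.1))).
pose F z := (K z)%:E.
have mind (D : set R) (k : R * R -> R) : measurable D -> measurable_fun setT k ->
    measurable_fun setT (fun z => (\1_D (k z) : R)).
  by move=> mD mk; apply: (measurableT_comp _ mk); exact: measurable_indic.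
have m1 : measurable_fun setT (fun z : R * R => z.1) by exact: measurable_fst.
have m2 : measurable_fun setT (fun z : R * R => z.2) by exact: measurable_snd.
have m21 : measurable_fun setT (fun z : R * R => z.2 - z.1) by exact:
  measurable_realfun.measurable_funB.
have mt2 : measurable_fun setT (fun z : R * R => t - z.2) by exact:
  measurable_realfun.measurable_funB.
have mK : measurable_fun setT K.
  apply: measurable_funM; [apply: measurable_funM|apply: measurable_funM].
  - by apply: (measurableT_comp _ m1); exact: measurable_continuous.
  - apply: measurable_funM.
    + by apply: (measurableT_comp _ m21); exact: measurable_continuous.
    + by apply: (measurableT_comp _ mt2); exact: measurable_continuous.
  - exact: mind.
  - by apply: measurable_funM; exact: mind.
have mF : measurable_fun setT F by exact/measurable_EFinP.
pose B := Mf * (Mg * Mh).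
have KB r a : `|K (r, a)| <= B * \1_`[0, t] a * \1_`[0, t] r.
  rewrite /K/= !indicE.
  have [/set_mem/=|] := boolP (r \in _); last by rewrite !mul0r !mulr0 normr0.
  rewrite in_itv/= => r0t; have [/set_mem/=|] := boolP (a \in _); last by rewrite !mul0r !mulr0
    normr0.
  rewrite in_itv/= => a0t; have [/set_mem/=|] := boolP (a - r \in _); last first.
    by rewrite !mulr0 normr0 !mulr1 /B !mulr_ge0// ltW.
  rewrite in_itv/= andbT => ra; rewrite !mulr1 !normrM.
  move/andP: r0t => [r0 rt]; move/andP: a0t => [a0 at_].
  rewrite ler_pM ?mulr_ge0 ?fM ?r0//.
  by rewrite ler_pM// ?gM ?hM// ?ra/= ?subr_ge0 ?at_/= ?lerBlDr ?lerDl// (le_trans at_)// lerDl.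
have B0 : 0 <= B by rewrite /B !mulr_ge0// ltW.
have iK : (mu \x mu)%E.-integrable setT F.
  apply/integrable12ltyP => //.
  apply: (@le_lt_trans _ _ (\int[mu]_r \int[mu]_a (B * \1_`[0, t] a * \1_`[0, t] r)%:E)%E).
    apply: ge0_le_integral => //.
    - by move=> r _; exact: integral_ge0.
    - apply: (@measurable_fun_fubini_tonelli_F _ _ _ _ _ mu (abse \o F)) => //=.
      exact: measurableT_comp.
    - apply: (@measurable_fun_fubini_tonelli_F _ _ _ _ _ mu (fun z => (B * \1_`[0, t] z.2 *
      \1_`[0, t] z.1)%:E)) => //=.
      + apply/measurable_EFinP; apply: measurable_funM; last exact: mind.
        by apply: measurable_funM => //; exact: mind.
      + by move=> z; rewrite lee_fin !indicE; apply: mulr_ge0 => //; apply: mulr_ge0.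
    - move=> r _; apply: ge0_le_integral => //.
      + by apply: measurableT_comp => //; exact: measurableT_comp mF (measurable_pair1 _).
      + apply/measurable_EFinP; apply: measurable_funM => //.
        by apply: measurable_funM => //; exact: measurable_indic.
      + by move=> a _; rewrite lee_fin KB.
  rewrite (_ : integral _ _ _ = \int[mu]_r (B * t * \1_`[0%R, t] r)%:E)%E; last first.
    apply: eq_integral => r _.
    rewrite -(_ : integral_seg (fun=> B * \1_`[0, t] r) 0 t = B * t * \1_`[0, t] r); last first.
      by rewrite integral_seg_cst// subr0 mulrAC.
    rewrite segE; last exact: continuous_cst_.
    by apply: eq_integral => a _; rewrite mulrAC.
  rewrite -(segE (fun=> B * t)) ?ltry//; exact: continuous_cst_.
apply: EFin_inj.
have -> : (convol f (convol g h) t)%:E = (\int[mu]_r (f r * convol g h (t - r) * \1_`[0%R, t]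
  r)%:E)%E.
  rewrite -(segE (fun r => f r * convol g h (t - r))) //.
  by apply: continuous_convol_body => //; exact: continuous_convol.
have -> : (convol (convol f g) h t)%:E = (\int[mu]_r (convol f g r * h (t - r) * \1_`[0%R, t]
  r)%:E)%E.
  rewrite -(segE (fun r => convol f g r * h (t - r))) //.
  by apply: continuous_convol_body => //; exact: continuous_convol.
transitivity (\int[mu]_r \int[mu]_a F (r, a))%E.
  apply: eq_integral => r _; rewrite /convol /F /K/=.
  have [/set_mem/=|nr] := boolP (r \in `[0, t]%classic); last first.
    rewrite indicE (negbTE nr) mulr0 integral0_eq// => a _.
    by rewrite ?indicE ?(negbTE nr) ?mul0r mulr0.
  rewrite in_itv/= => /andP[r0 rt].
  rewrite (_ : integral_seg _ _ _ = integral_seg (fun a => g (a - r) * h (t - a)) r t); last first.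
    have := @integral_seg_shift R (fun q => g q * h (t - r - q)) r r t.
    rewrite subrr => <- //; last exact: continuous_convol_body.
    by apply: eq_integral_seg => a _; congr (_ * h _); ring.
  rewrite indicE mem_set ?mulr1; last by rewrite /= in_itv/= r0.
  rewrite -integral_segZ; last first.
    by apply: continuousM_; [apply: (@continuous_comp_ g (fun a => a - r)) => //; apply:
      continuousB_; [exact: continuous_id_|exact: continuous_cst_]|exact: continuous_refl_].
  rewrite segE; last first.
    apply: continuousZ_.
    by apply: continuousM_; [apply: (@continuous_comp_ g (fun a => a - r)) => //; apply:
      continuousB_; [exact: continuous_id_|exact: continuous_cst_]|exact: continuous_refl_].
  apply: eq_integral => a _; congr (_ * _)%:E.
  rewrite ?indicE ?mem_setE ?in_itv/= ?r0 ?rt/= ?mul1r subr_ge0 andbT.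
  case: (leP r a) => ra; rewrite ?mulr0// mulr1/=.
  by rewrite (le_trans r0 ra).
rewrite Fubini//.
apply: eq_integral => a _; rewrite /convol /F /K/=.
have [/set_mem/=|nr] := boolP (a \in `[0, t]%classic); last first.
  rewrite indicE (negbTE nr) mulr0 integral0_eq// => r _.
  by rewrite ?(negbTE nr) ?mul0r !mulr0.
rewrite in_itv/= => /andP[a0 at_].
rewrite indicE mem_set ?mulr1; last by rewrite /= in_itv/= a0.
rewrite mulrC -integral_segZ; last exact: continuous_convol_body.
rewrite segE; last by apply: continuousZ_; exact: continuous_convol_body.
apply: eq_integral => r _; rewrite [h _ * _]mulrC -!mulrA; congr ((_ * (_ * (_ * _)))%:E).
rewrite ?indicE ?mem_setE ?in_itv/= ?a0 ?at_/= ?mul1r subr_ge0 andbT.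
case: (leP 0 r) => r0/=; rewrite ?mul0r//.
case: (leP r a) => ra/=; rewrite ?mulr0// mulr1.
by rewrite (le_trans ra at_).
Qed.

End convol.

(** * Differentiable functions on the half line *)

Section has_deriv.
Context {R : realType}.
Implicit Types (f g h : R -> R) (a b c t : R).

(** The derivative is required at positive times only, since a convolution vanishes on the negative
    half line and may have a corner at 0. Continuity of both functions everywhere still gives the
    integral formula from 0. *)
Definition has_deriv f f' := [/\ continuous f, continuous f' &
  forall t, 0 < t -> is_derive t (1 : R) f (f' t)].

Lemma has_deriv_int f f' t : has_deriv f f' -> 0 <= t ->
  f t = f 0 + integral_seg f' 0 t.
Proof.
move=> [cf cf' df]; rewrite le_eqVlt => /predU1P[<-|t0].
  by rewrite integral_seg_xx addr0.
apply/eqP; rewrite addrC -subr_eq; apply/eqP.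
have H : (\int[lebesgue_measure]_(x in `[0%R, t]) (f' x)%:E = (f t)%:E - (f 0)%:E)%E.
  apply: continuous_FTC2 => //.
  - exact: continuous_subspaceT.
  - split.
    + by move=> x; rewrite in_itv/= => /andP[x0 _]; case: (df x x0).
    + exact/cvg_at_right_filter/cf.
    + exact/cvg_at_left_filter/cf.
  - move=> x; rewrite in_itv/= => /andP[x0 _]; rewrite derive1E.
    by case: (df x x0).
by apply: EFin_inj; rewrite integral_segE// H.
Qed.

Lemma has_deriv_integral g : continuous g -> has_deriv (integral_seg g 0) g.
Proof.
move=> cg; split => //; first exact: continuous_integral_seg.
by move=> t t0; exact: derivable_integral_seg.
Qed.

Lemma has_deriv_ext f g f' : has_deriv f f' -> continuous g ->
  (forall t, 0 <= t -> f t = g t) -> has_deriv g f'.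
Proof.
move=> [cf cf' df] cg fg; split => // t t0.
apply: near_eq_is_derive (df t t0).
have : \forall s \near t, 0 < s by exact: lt_nbhsr.
by apply: filterS => s s0; apply: fg; exact: ltW.
Qed.

Lemma has_deriv_ext' f f' g' : has_deriv f f' -> continuous g' ->
  (forall t, 0 < t -> f' t = g' t) -> has_deriv f g'.
Proof. by move=> [cf cf' df] cg fg; split => // t t0; rewrite -fg//; exact: df. Qed.

Lemma has_deriv_cst c : has_deriv (fun=> c) (fun=> 0).
Proof. by split=> [||t _]; [exact: continuous_cst_|exact: continuous_cst_|exact: is_derive_cst].
  Qed.

Lemma has_deriv_id : has_deriv (fun x => x) (fun=> 1).
Proof. by split=> [||t _]; [exact: continuous_id_|exact: continuous_cst_|exact: is_derive_id]. Qed.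

Lemma has_derivD f f' g g' : has_deriv f f' -> has_deriv g g' ->
  has_deriv (fun t => f t + g t) (fun t => f' t + g' t).
Proof.
move=> [cf cf' df] [cg cg' dg]; split; [exact: continuousD_|exact: continuousD_|].
by move=> t t0; apply: is_deriveD; [exact: df|exact: dg].
Qed.

Lemma has_derivM f f' g g' : has_deriv f f' -> has_deriv g g' ->
  has_deriv (fun t => f t * g t) (fun t => f' t * g t + f t * g' t).
Proof.
move=> [cf cf' df] [cg cg' dg]; split; [exact: continuousM_| |].
  by apply: continuousD_; exact: continuousM_.
move=> t t0; have := @is_deriveM _ _ f g t 1 _ _ (df t t0) (dg t t0).
by move=> H; apply: (is_derive_eq H); rewrite /GRing.scale/= addrC [g t * _]mulrC.
Qed.

Lemma has_derivZ k f f' : has_deriv f f' ->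
  has_deriv (fun t => k * f t) (fun t => k * f' t).
Proof.
move=> df; apply: has_deriv_ext' (has_derivM (has_deriv_cst k) df) _ _.
  by case: df => _ cf' _; exact: continuousZ_.
by move=> t _; rewrite mul0r add0r.
Qed.

Lemma has_derivN f f' : has_deriv f f' ->
  has_deriv (fun t => - f t) (fun t => - f' t).
Proof.
move=> df; have := has_derivZ (-1) df; case: df => cf cf' _ df.
apply: has_deriv_ext (has_deriv_ext' df _ _) _ _; try exact: continuousN_.
  by move=> t _; rewrite mulN1r.
by move=> t _; rewrite mulN1r.
Qed.

Lemma has_derivB f f' g g' : has_deriv f f' -> has_deriv g g' ->
  has_deriv (fun t => f t - g t) (fun t => f' t - g' t).
Proof. by move=> df dg; exact: has_derivD df (has_derivN dg). Qed.

Lemma has_deriv_exp f f' : has_deriv f f' ->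
  has_deriv (fun t => expR (f t)) (fun t => f' t * expR (f t)).
Proof.
move=> [cf cf' df]; split; [exact: continuous_expR_| |].
  by apply: continuousM_ => //; exact: continuous_expR_.
move=> t t0; have dft := df t t0.
by have H := is_derive1_comp (is_derive_expR (f t)) dft; apply: (is_derive_eq H); rewrite
  /GRing.scale/= mulrC.
Qed.

Lemma has_deriv_ge0 f f' s t : has_deriv f f' -> (forall r, 0 <= r -> 0 <= f' r) ->
  0 <= s -> s <= t -> f s <= f t.
Proof.
move=> df f'0 s0 st; rewrite (has_deriv_int df s0) (has_deriv_int df (le_trans s0 st)).
case: df => _ cf' _; rewrite lerD2l (integral_seg_split cf' s0 st) lerDl.
by apply: integral_seg_ge0 => r /andP[sr _]; apply: f'0; exact: le_trans sr.
Qed.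

(** As [f] is [f 0] plus the convolution of 1 with [f'], associativity exhibits [convol f g] as the
    primitive of the claimed derivative, without differentiating an integral with a moving limit. *)
Lemma has_deriv_convol f f' g : has_deriv f f' -> continuous g ->
  has_deriv (convol f g) (fun t => f 0 * g t + convol f' g t).
Proof.
move=> df cg; have [cf cf' _] := df.
have cF : continuous (fun t => f 0 * g t + convol f' g t).
  by apply: continuousD_; [exact: continuousZ_|exact: continuous_convol].
apply: has_deriv_ext (has_deriv_integral cF) (continuous_convol cf cg) _ => t t0.
rewrite integral_segD//; [|exact: continuousZ_|exact: continuous_convol].
rewrite integral_segZ//.
rewrite -(convol1l _ (continuous_convol cf' cg)) convolA//; last exact: continuous_cst_.
rewrite -(convol1l _ cg) -convolZl//; last exact: continuous_cst_.
rewrite -convolDl//.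
- apply: eq_convol => // r /andP[r0 _]; rewrite mulr1 convol1l//.
  by rewrite (has_deriv_int df r0).
- by apply: continuousZ_; exact: continuous_cst_.
- by apply: continuous_convol => //; exact: continuous_cst_.
Qed.

End has_deriv.

(** * The renewal equation *)

Section geometric.
Context {R : realType}.

(** The intervals of radius 2 c / 2^k around [u k] are nested, so their left ends increase to a
    point common to all of them. *)
Lemma geometric_limit (u : nat -> R) (c : R) :
  (forall k, `|u k.+1 - u k| <= c / 2 ^+ k) ->
  exists l, forall k, `|u k - l| <= 2 * c / 2 ^+ k.
Proof.
move=> uc.
pose a k := u k - 2 * c / 2 ^+ k; pose b k := u k + 2 * c / 2 ^+ k.
have p2 k : 2 * c / 2 ^+ k.+1 = c / 2 ^+ k :> R.
  by rewrite exprS invfM mulrA [2 * c]mulrC mulfK// pnatr_eq0.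
have d2 k : 2 * c / 2 ^+ k = c / 2 ^+ k + c / 2 ^+ k :> R by field; rewrite expf_neq0// pnatr_eq0.
have nda : nondecreasing_seq a.
  apply/nondecreasing_seqP => k; rewrite /a p2 d2.
  by have := uc k; rewrite ler_norml => /andP[+ _]; lra.
have nib : nonincreasing_seq b.
  apply/nonincreasing_seqP => k; rewrite /b p2 d2.
  by have := uc k; rewrite ler_norml => /andP[_]; lra.
have c0 k : 0 <= 2 * c / 2 ^+ k.
  rewrite d2 addr_ge0// (le_trans _ (uc k))//.
have ab k m : a k <= b m.
  rewrite (@le_trans _ _ (a (maxn k m)))//; first by apply: nda; exact: leq_maxl.
  rewrite (@le_trans _ _ (b (maxn k m)))//; last by apply: nib; exact: leq_maxr.
  by rewrite /a /b lerD2l ge0_cp.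
have cva : cvgn a.
  by apply: nondecreasing_is_cvgn => //; exists (b 0%N) => _ [k _ <-].
exists (limn a) => k; rewrite ler_distl; apply/andP; split.
  by rewrite lerBlDr -/(b k); apply: limr_le => //; apply: nearW => m; exact: ab.
by rewrite -lerBlDr -/(a k); exact: nondecreasing_cvgn_le.
Qed.

End geometric.

Section survival.
Context {R : realType}.
Variables (lambda mu : R).
Hypotheses (lambda_gt0 : 0 < lambda) (mu_ge0 : 0 <= mu).
Implicit Types (P Q f g : R -> R) (t : R).

Definition expN (t : R) : R := expR (- (mu * t)).
Definition empty_prob P t : R := expR (- (lambda * integral_seg P 0 t)).
Definition birth_convol P t : R := convol (fun r => lambda * (P r * empty_prob P r)) P t.
(* The renewal equation [P + mu (beta * P) = 1], solved for [P] in a form whose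
   right-hand side preserves [unit_valued]. *)
Definition survival_map P t : R := expN t + mu * convol expN (birth_convol P) t.

Definition unit_valued P := forall t, 0 <= t -> 0 <= P t <= 1.

Lemma has_deriv_expN : has_deriv expN (fun t => - mu * expN t).
Proof.
have cm : continuous (fun t : R => - (mu * t)).
  by apply: continuousN_; apply: continuousZ_; exact: continuous_id_.
have H := has_deriv_exp (has_deriv_ext (has_derivZ (- mu) (@has_deriv_id R)) cm (fun t _ =>
  mulNr mu t)).
apply: (has_deriv_ext' H) => [|t _]; last by rewrite mulr1.
by apply: continuousZ_; exact: continuous_expR_.
Qed.

Lemma has_deriv_empty_prob P : continuous P ->
  has_deriv (empty_prob P) (fun t => - (lambda * (P t * empty_prob P t))).
Proof.
move=> cP; have H := has_deriv_exp (has_derivN (has_derivZ lambda (has_deriv_integral cP))).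
have [cH _ _] := H.
apply: (has_deriv_ext' H) => [|t _]; last by rewrite mulrA mulNr.
by apply: continuousN_; apply: continuousZ_; exact: continuousM_.
Qed.

Lemma continuous_expN : continuous expN.
Proof. by case: has_deriv_expN. Qed.

Lemma continuous_empty_prob P : continuous P -> continuous (empty_prob P).
Proof. by move/has_deriv_empty_prob; case. Qed.

Lemma empty_prob0 P : empty_prob P 0 = 1.
Proof. by rewrite /empty_prob integral_seg_xx mulr0 oppr0 expR0. Qed.

Lemma empty_prob_unit P : unit_valued P -> unit_valued (empty_prob P).
Proof.
move=> P01 t t0; rewrite expR_ge0/= -expR0 ler_expR oppr_le0 mulr_ge0 ?(ltW lambda_gt0)//.
by apply: integral_seg_ge0 => r /andP[r0 _]; case/andP: (P01 r r0).
Qed.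

Lemma expN_unit : unit_valued expN.
Proof. by move=> t t0; rewrite expR_ge0/= -expR0 ler_expR oppr_le0 mulr_ge0. Qed.

Lemma expN_int t : 0 <= t -> expN t + mu * integral_seg expN 0 t = 1.
Proof.
move=> t0; rewrite (has_deriv_int has_deriv_expN t0) integral_segZ; last exact: continuous_expN.
by rewrite {1}/expN mulr0 oppr0 expR0; ring.
Qed.

Lemma continuous_birth P : continuous P -> continuous (fun r => lambda * (P r * empty_prob P r)).
Proof.
by move=> cP; apply: continuousZ_; apply: continuousM_ => //; exact: continuous_empty_prob.
Qed.

Lemma empty_prob_int P t : continuous P -> 0 <= t ->
  integral_seg (fun r => lambda * (P r * empty_prob P r)) 0 t = 1 - empty_prob P t.
Proof.
move=> cP t0; rewrite (has_deriv_int (has_deriv_empty_prob cP) t0) empty_prob0.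
rewrite [X in _ - (_ + X)](_ : _ = -1 * integral_seg (fun r => lambda * (P r * empty_prob P r))
  0 t); first by ring.
rewrite -integral_segZ; last exact: continuous_birth.
by apply: eq_integral_seg => r _; rewrite mulN1r.
Qed.

Lemma continuous_birth_convol P : continuous P -> continuous (birth_convol P).
Proof. by move=> cP; apply: continuous_convol => //; exact: continuous_birth. Qed.

Lemma birth_ge0 P t : unit_valued P -> 0 <= t -> 0 <= lambda * (P t * empty_prob P t).
Proof.
move=> P01 t0; rewrite mulr_ge0 ?(ltW lambda_gt0)// mulr_ge0 ?expR_ge0//.
by case/andP: (P01 t t0).
Qed.

Lemma birth_convol_unit P : continuous P -> unit_valued P -> unit_valued (birth_convol P).
Proof.
move=> cP P01 t t0; apply/andP; split.
  apply: convol_ge0 => r /andP[r0 _]; first exact: birth_ge0.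
  by case/andP: (P01 r r0).
apply: (@le_trans _ _ (convol (fun r => lambda * (P r * empty_prob P r)) (fun=> 1) t)).
  apply: le_convol => //; try exact: continuous_birth.
  - exact: continuous_cst_.
  - by move=> r /andP[r0 _]; rewrite lexx birth_ge0.
  - by move=> r /andP[r0 _]; exact: P01.
rewrite convolC; [|exact: continuous_birth|exact: continuous_cst_].
rewrite convol1l; last exact: continuous_birth.
by rewrite empty_prob_int// gerBl expR_ge0.
Qed.

Lemma continuous_survival_map P : continuous P -> continuous (survival_map P).
Proof.
move=> cP; apply: continuousD_; first exact: continuous_expN.
apply: continuousZ_; apply: continuous_convol; first exact: continuous_expN.
exact: continuous_birth_convol.
Qed.

Lemma survival_map_unit P : continuous P -> unit_valued P -> unit_valued (survival_map P).
Proof.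
move=> cP P01 t t0; have cB := continuous_birth_convol cP.
have B01 := birth_convol_unit cP P01; have cE := continuous_expN.
apply/andP; split.
  rewrite addr_ge0 ?expR_ge0// mulr_ge0// convol_ge0// => r /andP[r0 _].
    by rewrite expR_ge0.
  by case/andP: (B01 r r0).
rewrite -(expN_int t0) lerD2l ler_wpM2l//.
have c1 := @continuous_cst_ R 1.
rewrite -(convol1l _ cE) convolC//.
apply: le_convol => //.
- by move=> r /andP[r0 _]; exact: B01.
- by move=> r /andP[r0 _]; rewrite lexx expR_ge0.
Qed.

Lemma integral_expR_le (K t : R) : 0 < K -> 0 <= t ->
  integral_seg (fun r => expR (K * r)) 0 t <= expR (K * t) / K.
Proof.
move=> K0 t0.
have H := has_derivZ K^-1 (has_deriv_exp (has_derivZ K (@has_deriv_id R))).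
have := has_deriv_int H t0; rewrite mulr0 expR0 => E.
rewrite [leRHS]mulrC E (@eq_integral_seg _ (fun r => K^-1 * _) (fun r => expR (K * r))).
  by rewrite lerDr mulr1 invr_ge0 ltW.
by move=> r _; rewrite mulr1 mulrA mulVf ?mul1r// gt_eqF.
Qed.

(** Convolution gains a factor 1 / K on functions bounded by a multiple of exp (K r); this gain
    turns [survival_map] into a contraction. *)
Lemma convol_le_exp f g (M c K t : R) : continuous f -> continuous g -> 0 < K -> 0 <= t ->
  0 <= c -> (forall r, 0 <= r <= t -> `|f r| <= M) ->
  (forall r, 0 <= r <= t -> `|g r| <= c * expR (K * r)) ->
  `|convol f g t| <= M * c / K * expR (K * t).
Proof.
move=> cf cg K0 t0 c0 fM gc.
have M0 : 0 <= M by rewrite (le_trans _ (fM 0 _))// lexx.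
have cE : continuous (fun r => expR (K * r)).
  by apply: continuous_expR_; apply: continuousZ_; exact: continuous_id_.
rewrite (le_trans (norm_convol _ cf cg))//.
apply: (@le_trans _ _ (convol (fun=> M) (fun r => c * expR (K * r)) t)).
  apply: le_convol => //; do ?exact: continuous_norm.
  - exact: continuous_cst_.
  - exact: continuousZ_.
  - by move=> r r0; rewrite normr_ge0 fM.
  - by move=> r r0; rewrite normr_ge0 gc.
rewrite convolZr//; last exact: continuous_cst_.
rewrite (_ : convol (fun=> M) _ t = M * convol (fun=> 1) (fun r => expR (K * r)) t); last first.
  rewrite -convolZl//; last exact: continuous_cst_.
  by apply: eq_convol => // r _; rewrite mulr1.
rewrite convol1l// mulrA [c * M]mulrC -!mulrA ler_wpM2l// ler_wpM2l//.
by rewrite [K^-1 * _]mulrC integral_expR_le.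
Qed.

Lemma expR_lip (a b : R) : a <= 0 -> b <= 0 -> `|expR a - expR b| <= `|a - b|.
Proof.
wlog ab : a b / a <= b => [H a0 b0|].
  have [/H|/ltW/H] := leP a b; first exact.
  by move=> /(_ b0 a0); rewrite distrC [leRHS]distrC.
move=> a0 b0; rewrite distrC [leRHS]distrC !ger0_norm ?subr_ge0 ?ler_expR//.
have -> : expR b - expR a = expR b * (1 - expR (a - b)).
  by rewrite mulrBr mulr1 -expRD; congr (_ - expR _); ring.
rewrite (@le_trans _ _ (1 * (1 - expR (a - b))))//.
  rewrite ler_wpM2r// ?subr_ge0 -expR0 ler_expR// subr_le0//.
by rewrite mul1r; have := expR_ge1Dx (a - b); lra.
Qed.

(** Rate of the weight exp (K t) under which [survival_map] contracts by 1/2. The bound lambda <= K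
    controls the change of [empty_prob]; the two further convolutions leave the factor 3 lambda mu /
    K^2, at most 1/2 because 6 lambda mu <= K <= K^2. *)
Let K := 1 + lambda + 6 * (lambda * mu).

Let lm_ge0 : 0 <= lambda * mu.
Proof. by rewrite mulr_ge0// ltW. Qed.

Let K_gt0 : 0 < K.
Proof. by rewrite /K -addrA ltr_wpDr ?addr_ge0 ?mulr_ge0// ltW. Qed.

Let K_ge1 : 1 <= K.
Proof. by rewrite /K -addrA lerDl addr_ge0 ?mulr_ge0// ltW. Qed.

Let K_ge_lambda : lambda <= K.
Proof. by rewrite /K -addrA addrC -addrA lerDl addr_ge0// mulr_ge0. Qed.

Let K_ge6 : 6 * (lambda * mu) <= K.
Proof. by rewrite /K lerDr addr_ge0// ltW. Qed.

Lemma survival_map_lip P Q (e : R) : continuous P -> continuous Q ->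
  unit_valued P -> unit_valued Q -> 0 <= e ->
  (forall t, 0 <= t -> `|P t - Q t| <= e * expR (K * t)) ->
  forall t, 0 <= t -> `|survival_map P t - survival_map Q t| <= e / 2 * expR (K * t).
Proof.
move=> cP cQ P01 Q01 e0 PQ t t0.
have cBP := continuous_birth cP; have cBQ := continuous_birth cQ.
have dbeta r : 0 <= r -> `|empty_prob P r - empty_prob Q r| <= e * expR (K * r).
  move=> r0; rewrite (le_trans (expR_lip _ _))//.
  - rewrite oppr_le0 mulr_ge0 ?(ltW lambda_gt0)//; apply: integral_seg_ge0 => s /andP[s0 _].
    by case/andP: (P01 s s0).
  - rewrite oppr_le0 mulr_ge0 ?(ltW lambda_gt0)//; apply: integral_seg_ge0 => s /andP[s0 _].
    by case/andP: (Q01 s s0).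
  rewrite opprK addrC -mulrBr normrM (gtr0_norm lambda_gt0).
  rewrite distrC.
  have -> : integral_seg P 0 r - integral_seg Q 0 r = convol (fun=> 1) (fun s => P s - Q s) r.
    rewrite convol1l; last exact: continuousB_.
    rewrite -[X in _ - X]mul1r -mulNr -integral_segZ// -integral_segD//.
      by apply: eq_integral_seg => s _; rewrite mulN1r.
    exact: continuousZ_.
  rewrite (@le_trans _ _ (lambda * (1 * e / K * expR (K * r))))//.
    rewrite ler_wpM2l ?(ltW lambda_gt0)//; apply: convol_le_exp => //.
    - exact: continuous_cst_.
    - exact: continuousB_.
    - by move=> s _; rewrite normr1.
    - by move=> s /andP[s0 _]; exact: PQ.
  rewrite mul1r mulrA ler_wpM2r ?expR_ge0//.
  by rewrite mulrCA ler_piMr// ler_pdivrMr// mul1r.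
pose A := fun r => lambda * (P r * empty_prob P r).
pose B := fun r => lambda * (Q r * empty_prob Q r).
have BQ r : 0 <= r -> `|B r| <= lambda.
  move=> r0; rewrite /B ger0_norm ?birth_ge0//.
  rewrite ler_piMr ?(ltW lambda_gt0)//; case/andP: (Q01 r r0) => Q0 Q1.
  by case/andP: (empty_prob_unit Q01 r0) => b0 b1; rewrite mulr_ile1.
have AE r : birth_convol P r = convol A P r by [].
have BE r : birth_convol Q r = convol B Q r by [].
have dA r : 0 <= r -> `|A r - B r| <= 2 * lambda * e * expR (K * r).
  move=> r0; rewrite /A /B -mulrBr normrM (gtr0_norm lambda_gt0) [2 * _]mulrC -!mulrA ler_wpM2l
    ?(ltW lambda_gt0)//.
  have -> : P r * empty_prob P r - Q r * empty_prob Q r =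
    P r * (empty_prob P r - empty_prob Q r) + (P r - Q r) * empty_prob Q r by ring.
  rewrite (le_trans (ler_normD _ _))// !normrM (_ : 2 = 1 + 1)// mulrDl !mul1r lerD//.
    rewrite -[leRHS]mul1r ler_pM// ?dbeta//.
    by case/andP: (P01 r r0) => P0 P1; rewrite ger0_norm.
  rewrite -[leRHS]mulr1 ler_pM// ?PQ//.
  by case/andP: (empty_prob_unit Q01 r0) => P0 P1; rewrite ger0_norm.
rewrite -/A -/B in cBP cBQ; clearbody A B.
have dBC r : 0 <= r -> `|birth_convol P r - birth_convol Q r| <= 3 * lambda * e / K * expR (K * r).
  move=> r0.
  rewrite AE BE; have -> : convol A P r - convol B Q r =
      convol (fun s => A s - B s) P r + convol B (fun s => P s - Q s) r.
    by rewrite convolBl// convolBr// addrA subrK.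
  rewrite (le_trans (ler_normD _ _))//.
  rewrite (_ : 3 * lambda * e / K * expR (K * r) = 1 * (2 * lambda * e) / K * expR (K * r) +
    lambda * e / K * expR (K * r)); last by ring.
  rewrite lerD//.
    rewrite convolC//; last exact: continuousB_.
    apply: convol_le_exp => //; first exact: continuousB_.
    - by rewrite !mulr_ge0// (ltW lambda_gt0).
    - by move=> s /andP[s0 _]; case/andP: (P01 s s0) => P0 P1; rewrite ger0_norm.
    - by move=> s /andP[s0 _]; exact: dA.
  apply: convol_le_exp => //; first exact: continuousB_.
  - by move=> s /andP[s0 _]; exact: BQ.
  - by move=> s /andP[s0 _]; exact: PQ.
rewrite /survival_map opprD addrACA subrr add0r -mulrBr normrM ger0_norm//.
rewrite -convolBr//; [|exact: continuous_expN|exact: continuous_birth_convol|exact: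
  continuous_birth_convol].
rewrite (@le_trans _ _ (mu * (1 * (3 * lambda * e / K) / K * expR (K * t))))//.
  rewrite ler_wpM2l//; apply: convol_le_exp => //; first exact: continuous_expN.
  - by apply: continuousB_; exact: continuous_birth_convol.
  - by rewrite !mulr_ge0// ?invr_ge0 ?(ltW lambda_gt0) ?(ltW K_gt0).
  - by move=> s /andP[s0 _]; case/andP: (expN_unit s0) => P0 P1; rewrite ger0_norm.
  - by move=> s /andP[s0 _]; exact: dBC.
rewrite mulrA ler_wpM2r ?expR_ge0//.
have -> : mu * (1 * (3 * lambda * e / K) / K) = e * (3 * (lambda * mu) / K / K).
  by field; rewrite gt_eqF.
rewrite ler_wpM2l// ler_pdivrMr// ler_pdivrMr//.
have H : 6 * (lambda * mu) <= K * K by rewrite (le_trans K_ge6)// ler_peMl// ltW.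
by rewrite -mulrA; move: H; set x := lambda * mu; set y := K * K; lra.
Qed.

(** Picard iteration from [expN]. Successive differences are at most exp (K t) / 2^k at positive
    times, a bound that is uniform on bounded sets of times, so continuity passes to the limit. *)
Lemma survival_exists : exists P, [/\ continuous P, unit_valued P &
  forall t, P t = survival_map P t].
Proof.
pose u := fun k => iter k survival_map expN.
have cu k : continuous (u k).
  by elim: k => [|k IH]; [exact: continuous_expN|exact: continuous_survival_map].
have u01 k : unit_valued (u k).
  by elim: k => [|k IH]; [exact: expN_unit|exact: survival_map_unit].
have du k t : 0 <= t -> `|u k.+1 t - u k t| <= expR (K * t) / 2 ^+ k.
  elim: k t => [|k IH] t t0.
    rewrite expr0 divr1 (@le_trans _ _ 1)//; last first.
      by rewrite -expR0 ler_expR mulr_ge0// (ltW K_gt0).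
    have /andP[a0 a1] := u01 1%N t t0; have /andP[b0 b1] := u01 0%N t t0.
    by rewrite ler_norml; lra.
  rewrite [leRHS](_ : _ = (2 ^+ k)^-1 / 2 * expR (K * t)); last first.
    by rewrite exprS invfM [RHS]mulrC [_ / 2]mulrC.
  apply: (survival_map_lip (cu k.+1) (cu k) (u01 _) (u01 _)) => //.
  by move=> r r0; rewrite mulrC; exact: IH.
(* Convolutions vanish at negative times, so every iterate equals [expN] there; the fixed point
   equation is claimed at all times. *)
have uneg k t : t < 0 -> u k t = expN t.
  move=> t0; case: k => [//|k]; rewrite /u iterS /survival_map convol_le0 ?ltW//.
  by rewrite mulr0 addr0.
pose w t := expR (K * Num.max t 0).
have du' t k : `|u k.+1 t - u k t| <= w t / 2 ^+ k.
  have [t0|t0] := leP 0 t.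
    by rewrite /w (max_idPl t0); exact: du.
  by rewrite !uneg// subrr normr0 divr_ge0 ?expR_ge0// exprn_ge0.
have /choice[P Pu] t := geometric_limit (du' t).
have w0 t : 0 < w t by exact: expR_gt0.
have small (c e : R) : 0 < e -> exists k, c / 2 ^+ k <= e.
  move=> e0; have [c0|c0] := leP c 0.
    by exists 0%N; rewrite expr0 divr1 (le_trans c0)// ltW.
  have := @cvg_geometric R (c) 2^-1.
  rewrite ger0_norm// => /(_ _)/cvgrPdist_le.
  have -> : 2^-1 < 1 :> R by lra.
  move=> /(_ isT e e0)[k _ /(_ k (leqnn k))] /=; rewrite sub0r normrN exprVn => H.
  by exists k; rewrite (le_trans _ H)// ler_norm.
have P01 : unit_valued P.
  move=> t t0; apply/andP; split; apply/ler_addgt0Pr => e e0;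
    have [k ke] := small (2 * w t) e e0; have := Pu t k; rewrite ler_norml => /andP[H1 H2];
    have /andP[a b] := u01 k t t0; lra.
have cP : continuous P.
  move=> x; apply/cvgrPdist_le => e e0.
  have e30 : 0 < e / 3 by rewrite divr_gt0.
  have [k ke] := small (2 * w (x + 1)) (e / 3) e30.
  have := cu k x => /cvgrPdist_le /(_ _ e30).
  have : \forall t \near x, t < x + 1 by apply: lt_nbhsl; rewrite ltrDl.
  apply: filterS2 => t tx uk.
  have wle s : s <= x + 1 -> 2 * w s / 2 ^+ k <= e / 3.
    move=> sx; rewrite (le_trans _ ke)// ler_pM2r ?invr_gt0 ?exprn_gt0//.
    rewrite ler_pM2l// ler_expR ler_pM2l// ge_max !le_max sx lexx /= orbT//.
  have xx1 : x <= x + 1 by rewrite lerDl.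
  have := le_trans (Pu x k) (wle x xx1); have := le_trans (Pu t k) (wle t (ltW tx)).
  move: uk; rewrite !ler_norml => /andP[? ?] /andP[? ?] /andP[? ?]; lra.
exists P; split => // t.
have [t0|t0] := ltP t 0.
  rewrite /survival_map convol_le0 ?ltW// mulr0 addr0.
  apply/eqP; rewrite -subr_eq0 -normr_le0; apply/ler_addgt0Pr => e e0.
  have [k ke] := small (2 * w t) e e0; rewrite add0r -(uneg k t t0) distrC.
  exact: le_trans (Pu t k) ke.
apply/eqP; rewrite -subr_eq0 -normr_le0; apply/ler_addgt0Pr => e e0; rewrite add0r.
have e20 : 0 < e / 2 by rewrite divr_gt0.
have [k ke] := small (2 * w t) (e / 2) e20.
have k1 : `|u k.+1 t - P t| <= e / 2.
  rewrite (le_trans (Pu t k.+1))// (le_trans _ ke)// ler_wpM2l ?mulr_ge0 ?expR_ge0//.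
  by rewrite lef_pV2 ?posrE ?exprn_gt0// exprS ler_peMl ?exprn_ge0// ler1n.
have k2 : `|u k.+1 t - survival_map P t| <= e / 2.
  apply: (@le_trans _ _ (2 / 2 ^+ k / 2 * expR (K * t))).
    apply: (survival_map_lip (cu k) cP (u01 _) P01) => //.
    move=> r r0; rewrite (le_trans (Pu r k))// /w (max_idPl r0).
    by rewrite mulrAC.
  rewrite (le_trans _ ke)// /w (max_idPl t0).
  have : 0 <= expR (K * t) / 2 ^+ k by rewrite divr_ge0 ?expR_ge0// exprn_ge0.
  rewrite (_ : 2 / 2 ^+ k / 2 * expR (K * t) = expR (K * t) / 2 ^+ k); last first.
    by field; rewrite expf_neq0// pnatr_eq0.
  by rewrite -mulrA; lra.
move: k1 k2; rewrite !ler_norml => /andP[? ?] /andP[? ?]; lra.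
Qed.

(** Since [empty_prob] is 1 minus the primitive of the birth density, its convolution with [P] is
    the difference of the primitives of [P] and of [birth_convol P]. Integrating the fixed point
    equation shows that mu times this difference is [1 - P t]. *)
Lemma survival_equation P t : continuous P -> (forall s, P s = survival_map P s) ->
  0 <= t -> P t + mu * convol (empty_prob P) P t = 1.
Proof.
move=> cP PE t0.
have cE := continuous_expN; have cb := continuous_empty_prob cP.
have cB := continuous_birth cP; have cBC := continuous_birth_convol cP.
have c1 := @continuous_cst_ R 1.
have bE : convol (empty_prob P) P t = integral_seg P 0 t - integral_seg (birth_convol P) 0 t.
  rewrite -(convol1l _ cP) -(convol1l _ cBC) /birth_convol convolA// -convolBl//; last exact:
    continuous_convol.
  apply: eq_convol => // r /andP[r0 _]; rewrite convol1l// empty_prob_int//; ring.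
have PI : P t + mu * integral_seg P 0 t = 1 + mu * integral_seg (birth_convol P) 0 t.
  have -> : integral_seg P 0 t = integral_seg expN 0 t + mu * convol (convol (fun=> 1) expN)
    (birth_convol P) t.
    rewrite -(convol1l _ cP) -(convol1l _ cE) -convolA// -convolZr//; last exact: continuous_convol.
    rewrite -convolDr//; last by apply: continuousZ_; exact: continuous_convol.
    by apply: eq_convol => // r _; rewrite PE.
  rewrite [in LHS]PE /survival_map.
  have cc := continuous_convol c1 cE.
  have -> : integral_seg (birth_convol P) 0 t = convol expN (birth_convol P) t + mu * convol
    (convol (fun=> 1) expN) (birth_convol P) t.
    rewrite -(convol1l _ cBC) -convolZl// -convolDl//; last exact: continuousZ_.
    by apply: eq_convol => // r /andP[r0 _]; rewrite convol1l// expN_int.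
  by rewrite -[X in _ = X + _](expN_int t0); ring.
by rewrite bE mulrBr addrA PI addrK.
Qed.

End survival.

(** * The system of equations for the heights *)

Section system.
Context {R : realType}.
Variables (lambda mu : R) (P : R -> R).
Hypotheses (lambda_gt0 : 0 < lambda) (mu_ge0 : 0 <= mu).
Hypotheses (cP : continuous P) (P01 : unit_valued P).
Hypothesis PE : forall t, 0 <= t -> P t + mu * convol (empty_prob lambda P) P t = 1.
Implicit Types t : R.

(* [tall_alive n t]: a vertex of age [t] is present and has a descendant at
   distance [n].  [low_prob n t]: the subtree of a vertex of age [t] that
   cannot be deleted has height less than [n]. *)
Fixpoint tall_alive n : R -> R := if n is m.+1 then
  fun t => lambda * convol P (fun r => tall_alive m r * empty_prob lambda (tall_alive m) r) t
  else P.

Definition low_prob n : R -> R :=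
  if n is m.+1 then empty_prob lambda (tall_alive m) else fun=> 0.

Lemma continuous_tall_alive n : continuous (tall_alive n).
Proof.
elim: n => [//|n IH] /=; apply: continuousZ_; apply: continuous_convol => //.
by apply: continuousM_ => //; exact: continuous_empty_prob.
Qed.

Lemma continuous_low_prob n : continuous (low_prob n).
Proof.
case: n => [|n]; first exact: continuous_cst_.
by apply: continuous_empty_prob; exact: continuous_tall_alive.
Qed.

Lemma has_deriv_low_prob n : has_deriv (low_prob n.+1)
  (fun t => - (lambda * (tall_alive n t * low_prob n.+1 t))).
Proof. exact: has_deriv_empty_prob (@continuous_tall_alive n). Qed.

Lemma low_prob_ge0 n t : 0 <= low_prob n t.
Proof. by case: n => [//|n]; exact: expR_ge0. Qed.

Lemma low_prob0 n : low_prob n.+1 0 = 1.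
Proof. exact: empty_prob0. Qed.

Lemma tall_alive_ge0 n t : 0 <= t -> 0 <= tall_alive n t.
Proof.
elim: n t => [|n IH] t t0 /=; first by case/andP: (P01 t0).
rewrite mulr_ge0 ?(ltW lambda_gt0)// convol_ge0// => r /andP[r0 _].
  by case/andP: (P01 r0).
by rewrite mulr_ge0 ?IH// expR_ge0.
Qed.

Let cb : continuous (empty_prob lambda P).
Proof. exact: continuous_empty_prob. Qed.

(** The equation of [P] is convolved with the density of [1 - low_prob n.+1], whose convolution with
    [P] is [tall_alive n.+1]. The left side splits the event that an undeletable vertex is tall
    according to whether a deletion would already have occurred. *)
Lemma tall_alive_renewal n t : 0 <= t ->
  tall_alive n t + mu * convol (empty_prob lambda P) (tall_alive n) t = 1 - low_prob n t.
Proof.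
case: n => [|n] t0; first by rewrite [LHS]PE// subr0.
have cV := @continuous_tall_alive n.
have cVR : continuous (fun r => tall_alive n r * empty_prob lambda (tall_alive n) r).
  by apply: (continuousM_ cV); exact: continuous_empty_prob.
rewrite /low_prob -(empty_prob_int _ cV t0) integral_segZ//.
rewrite /tall_alive -/(tall_alive n).
set h := (fun r => _) in cVR *.
rewrite convolZr//; last exact: continuous_convol.
rewrite mulrCA -mulrDr convolA//; congr (_ * _).
rewrite -convolZl//; last exact: continuous_convol.
rewrite -convolDl//; last by apply: continuousZ_; exact: continuous_convol.
rewrite (@eq_convol _ _ (fun=> 1) h h)//; last by move=> r /andP[r0 _]; exact: PE.
by rewrite convol1l.
Qed.

Lemma tall_alive_le n t : 0 <= t -> tall_alive n t <= 1 - low_prob n t.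
Proof.
move=> t0; rewrite -tall_alive_renewal// lerDl mulr_ge0// convol_ge0// => r /andP[r0 _].
  exact: expR_ge0.
exact: tall_alive_ge0.
Qed.

Lemma low_prob_le1 n t : 0 <= t -> low_prob n t <= 1.
Proof.
move=> t0; rewrite -subr_ge0 (le_trans _ (tall_alive_le n t0))//.
exact: tall_alive_ge0.
Qed.

Definition tall_prob n t : R := 1 - low_prob n t.

Lemma continuous_tall_prob n : continuous (tall_prob n).
Proof.
by apply: continuousB_; [exact: continuous_cst_|exact: continuous_low_prob].
Qed.

(** As [tall_alive n] is [P] convolved with the density of [tall_prob n], its primitive is [P]
    convolved with [tall_prob n] itself; for [n = 0] the density is a unit mass at 0. *)
Lemma tall_prob_rec n t : 0 <= t ->
  tall_prob n.+1 t = 1 - expR (- (lambda * convol P (tall_prob n) t)).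
Proof.
move=> t0; rewrite /tall_prob; congr (_ - _); rewrite /low_prob/= /empty_prob.
congr (expR (- (lambda * _))).
have c1 := @continuous_cst_ R 1.
case: n => [|n].
  rewrite -convol1l// convolC//; apply: eq_convol => // r _.
  by rewrite subr0.
have cV := @continuous_tall_alive n.
have cVR : continuous (fun r => tall_alive n r * empty_prob lambda (tall_alive n) r).
  by apply: (continuousM_ cV); exact: continuous_empty_prob.
rewrite -convol1l; last exact: (@continuous_tall_alive n.+1).
rewrite /tall_alive -/(tall_alive n) convolZr//; last exact: continuous_convol.
rewrite convolA//.
rewrite (@eq_convol _ _ (convol P (fun=> 1)) _ (fun r => tall_alive n r * empty_prob lambda
  (tall_alive n) r))//; last first.
  by move=> r _; rewrite convolC.
rewrite -convolA// -convolZr//; last exact: continuous_convol.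
apply: eq_convol => // r /andP[r0 _].
by rewrite convol1l// -integral_segZ// empty_prob_int.
Qed.

Lemma tall_prob_nondecreasing n s t : 0 <= s -> s <= t -> tall_prob n s <= tall_prob n t.
Proof.
move=> s0 st; rewrite /tall_prob lerD2l.
case: n => [//|n].
apply: (has_deriv_ge0 (has_derivN (has_deriv_low_prob n)) _ s0 st) => r r0.
by rewrite opprK mulr_ge0 ?(ltW lambda_gt0)// mulr_ge0 ?low_prob_ge0 ?tall_alive_ge0.
Qed.

Lemma tall_prob_unit n t : 0 <= t -> 0 <= tall_prob n t <= 1.
Proof. by move=> t0; rewrite /tall_prob subr_ge0 low_prob_le1// gerBl low_prob_ge0. Qed.

End system.

(** * The backward equation on trees *)

Section tree_combinatorics.

Definition children (A : {fset vertex}) (v : vertex) : {fset vertex} :=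
  [fset w in A | (w != root_vertex) && (parent w == v)]%fset.

Lemma in_children A v w :
  (w \in children A v) = [&& w \in A, w != root_vertex & parent w == v].
Proof. by rewrite /children !inE. Qed.

Lemma size_parent (w : vertex) : size (parent w) = (size w).-1.
Proof. by rewrite /parent size_takel// leq_pred. Qed.

Lemma size_child A v w : w \in children A v -> size w = (size v).+1.
Proof.
by rewrite in_children => /and3P[_ wr /eqP <-]; rewrite size_parent; case: w wr.
Qed.

Lemma prefix_parent (w : vertex) : prefix (parent w) w.
Proof. by rewrite prefixE size_parent /parent. Qed.

Lemma prefix_child A v w : w \in children A v -> prefix v w.
Proof. by rewrite in_children => /and3P[_ _ /eqP <-]; exact: prefix_parent. Qed.

Lemma prefix_size (v w : vertex) : prefix v w -> (size v <= size w)%N.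
Proof. by move=> /prefixP[s ->]; rewrite size_cat leq_addr. Qed.

Lemma prefix_eq (v w : vertex) : prefix v w -> size w = size v -> w = v.
Proof. by rewrite prefixE => /eqP E H; rewrite -[RHS]E -H take_size. Qed.

Lemma tree_take (x : tree) (z : vertex) k : z \in vertices x -> take k z \in vertices x.
Proof.
move=> zx; have [n] := ubnP (size z - k); elim: n z zx => [//|n IH] z zx.
have [zk|kz] := leqP (size z) k; first by rewrite take_oversize.
rewrite ltnS => szk; have px : parent z \in vertices x.
  by have /andP[_ /allP] := treeP x; apply.
have -> : take k z = take k (parent z).
  by rewrite /parent take_takel//; case: (z) kz.
by apply: IH => //; rewrite size_parent; case: (size z) kz szk => // m; rewrite ltnS => km;
  rewrite subSn.
Qed.

Lemma eq_children A B v : (forall z, prefix v z -> (z \in A) = (z \in B)) ->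
  children A v = children B v.
Proof.
move=> AB; apply/fsetP => w; rewrite !in_children.
have [/eqP pw|] := boolP (parent w == v); last by rewrite !andbF.
by rewrite AB// -pw prefix_parent.
Qed.

(** The child of [v] on the path to [z], when [v] is a proper prefix of [z]. *)
Definition child_of (v z : vertex) : vertex := take (size v).+1 z.

Lemma child_of_in (x : tree) v z : z \in vertices x -> prefix v z -> z != v ->
  child_of v z \in children x v.
Proof.
move=> zx vz zv; have sz : (size v < size z)%N.
  rewrite ltn_neqAle prefix_size// andbT; apply: contra zv => /eqP H.
  by apply/eqP; apply: prefix_eq.
rewrite in_children tree_take//= /child_of -size_eq0 size_takel//=.
rewrite /parent size_takel//= take_takel//.
by move: vz; rewrite prefixE.
Qed.

Lemma prefix_child_of v z : prefix (child_of v z) z.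
Proof. exact: prefix_take. Qed.

Lemma child_prefixE (x : tree) v z w : w \in children x v -> prefix w z ->
  w = child_of v z.
Proof.
by move=> wc; rewrite prefixE (size_child wc) => /eqP.
Qed.

Lemma sum_below {R : realType} (x : tree) (v : vertex) (F : vertex -> R) :
  \sum_(z <- enum_fset x | prefix v z && (z != v)) F z =
  \sum_(w <- enum_fset (children x v)) \sum_(z <- enum_fset x | prefix w z) F z.
Proof.
rewrite (exchange_big_dep xpredT)//= big_mkcond/=.
apply: eq_big_seq => z zx; case: ifPn => [/andP[vz zv]|nz].
  rewrite big_mkcond (bigD1_seq (child_of v z) (child_of_in zx vz zv) (fset_uniq _))/=.
  rewrite prefix_child_of big_seq_cond big1 ?addr0// => w /andP[wc wn].
  by case: ifP => // wz; move/eqP: wn; case; exact: child_prefixE wc wz.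
rewrite big_seq_cond big1// => w /andP[wc wz]; exfalso; move/negP: nz; apply.
rewrite (prefix_trans (prefix_child wc) wz)/=; apply: contraL wz => /eqP ->.
by apply/negP => /prefix_size; rewrite (size_child wc) ltnn.
Qed.

Lemma leafE (x : tree) (v : vertex) : is_leaf x v = (children x v == fset0).
Proof.
apply/allP/eqP => [H|H w wx].
  apply/fsetP => w; rewrite in_children in_fset0; apply/negbTE/negP => /and3P[wx wr pw].
  by have := H w wx; rewrite (negbTE wr) pw.
have := in_fset0 w; rewrite -H in_children wx/= => /negbT.
by rewrite negb_and negbK => /orP[->//|->]; rewrite orbT.
Qed.

Lemma leaf_below (x : tree) (v z : vertex) : is_leaf x v -> z \in vertices x ->
  prefix v z -> z = v.
Proof.
rewrite leafE => /eqP H zx vz; apply/eqP; apply: contraT => zv.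
by have := child_of_in zx vz zv; rewrite H in_fset0.
Qed.

Lemma size_le_height (x : tree) v : v \in vertices x -> (size v <= height x)%N.
Proof. by move=> vx; rewrite /height (big_rem v)//= leq_maxl. Qed.

Lemma heightP (x : tree) n : reflect (forall v, v \in vertices x -> (size v <= n)%N) (height x
  <= n)%N.
Proof.
apply: (iffP idP) => [xn v vx|H]; first exact: leq_trans (size_le_height vx) xn.
by rewrite /height; apply/bigmax_leqP_seq => v vx _; exact: H.
Qed.

Lemma root_in (x : tree) : root_vertex \in vertices x.
Proof. by have /andP[] := treeP x. Qed.

End tree_combinatorics.

(** * Products over the vertices of a tree *)

Section tree_functional.
Context {R : realType}.
Variables (lambda mu : R) (P : R -> R).
Hypotheses (lambda_gt0 : 0 < lambda) (mu_ge0 : 0 <= mu).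
Hypotheses (cP : continuous P) (P01 : unit_valued P).
Hypothesis PE : forall t, 0 <= t -> P t + mu * convol (empty_prob lambda P) P t = 1.
Local Notation V := (tall_alive lambda P).
Local Notation L := (low_prob lambda P).
Implicit Types (t : R) (A B : {fset vertex}) (x : tree) (v w z : vertex).

(* The probability that [t] time units after the state [A], the subtree at [v],
   [v] not being deletable, has height less than [n].  [lowdead_from] allows [w]
   to be deleted, and then counts its absence.  The depth of the recursion is
   bounded by the fuel [k], which is irrelevant when large. *)
Fixpoint low_from k n A v t : R := if n is m.+1 then
    L m.+1 t * \prod_(w <- enum_fset (children A v))
      (if k is j.+1 then
         low_from j m A w t + mu * convol (low_from j 1 A w) (V m) t
       else 1)
  else 0.

(** The second term accounts for a deletion before [t]. Let the clock run on an undeletable vertex,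
    and let e be the probability that the deletable one is present and childless: then
    [low_from k 1] is e + mu (e * beta). An undeletable vertex has height at least [n] with
    probability a + mu (e * (1 - L n)), where a is the probability that the deletable one is present
    with that height. Since 1 - L n = V n + mu (beta * V n), it follows that 1 - a is the formula
    given. *)
Definition lowdead_from k n A w t : R :=
  low_from k n A w t + mu * convol (low_from k 1 A w) (V n) t.

Lemma low_fromS k n A v t : low_from k.+1 n.+1 A v t =
  L n.+1 t * \prod_(w <- enum_fset (children A v)) lowdead_from k n A w t.
Proof. by []. Qed.

Lemma low_from_n0 k A v t : low_from k 0 A v t = 0.
Proof. by case: k. Qed.

Lemma low_from_leaf k n A v t : children A v = fset0 -> low_from k n A v t = L n t.
Proof.
by case: n => [|n] Av; case: k => [|k] //=; rewrite Av big1_seq ?mulr1// => w; rewrite in_fset0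
  andbF.
Qed.

Lemma low_from_local k n A B v : (forall z, prefix v z -> (z \in A) = (z \in B)) ->
  low_from k n A v = low_from k n B v.
Proof.
elim: k n v => [|k IH] [|n] v AB; apply/funext => t //=; rewrite (eq_children AB)//.
congr (_ * _); apply: eq_big_seq => w wc.
have ABw z : prefix w z -> (z \in A) = (z \in B).
  by move=> wz; rewrite AB// (prefix_trans _ wz)// (prefix_child wc).
by rewrite !(IH _ w ABw).
Qed.

Lemma lowdead_from_local k n A B v : (forall z, prefix v z -> (z \in A) = (z \in B)) ->
  lowdead_from k n A v = lowdead_from k n B v.
Proof.
by move=> AB; apply/funext => t; rewrite /lowdead_from !(low_from_local _ _ AB).
Qed.

Lemma low_from_fuelS k n A v :
  (forall z, z \in A -> prefix v z -> (size z <= size v + k)%N) ->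
  low_from k.+1 n A v = low_from k n A v.
Proof.
elim: k n v => [|k IH] [|n] v Ak; apply/funext => t //.
  suff C : children A v = fset0 by rewrite !low_from_leaf.
  apply/fsetP => w; rewrite in_fset0.
  apply/negbTE/negP => wc; have := Ak w; rewrite (prefix_child wc) (size_child wc) addn0 ltnn.
  by move: wc; rewrite in_children => /and3P[-> _ _] /(_ isT isT).
rewrite !low_fromS; congr (_ * _); apply: eq_big_seq => w wc; rewrite /lowdead_from.
have Aw z : z \in A -> prefix w z -> (size z <= size w + k)%N.
  move=> zA wz; rewrite (size_child wc) addSnnS Ak//.
  by rewrite (prefix_trans _ wz)// (prefix_child wc).
by rewrite !(IH _ w Aw).
Qed.

Lemma low_from_fuel k k' n A v : (k <= k')%N ->
  (forall z, z \in A -> prefix v z -> (size z <= size v + k)%N) ->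
  low_from k' n A v = low_from k n A v.
Proof.
move=> /subnK <-; elim: (k' - k)%N => [//|i IH] Ak.
rewrite addSn low_from_fuelS ?IH// => z zA vz; rewrite (leq_trans (Ak z zA vz))//.
by rewrite leq_add2l leq_addl.
Qed.

Lemma continuous_prod (I : Type) (s : seq I) (f : I -> R -> R) :
  (forall i, continuous (f i)) -> continuous (fun t => \prod_(i <- s) f i t).
Proof.
move=> cf; elim: s => [|i s IH].
  by under eq_fun do rewrite big_nil; exact: continuous_cst_.
by under eq_fun do rewrite big_cons; exact: continuousM_.
Qed.

Lemma continuous_low_from k n A v : continuous (low_from k n A v).
Proof.
elim: k n v => [|k IH] [|n] v; do ?exact: continuous_cst_.
all: apply: continuousM_; first exact: continuous_low_prob.
all: apply: continuous_prod => w.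
  exact: continuous_cst_.
apply: continuousD_ => //; apply: continuousZ_; apply: continuous_convol => //.
exact: continuous_tall_alive.
Qed.

Lemma continuous_lowdead_from k n A v : continuous (lowdead_from k n A v).
Proof.
apply: continuousD_; first exact: continuous_low_from.
apply: continuousZ_; apply: continuous_convol; first exact: continuous_low_from.
exact: continuous_tall_alive.
Qed.

Lemma prod_unit (I : Type) (s : seq I) (f : I -> R) :
  (forall i, 0 <= f i <= 1) -> 0 <= \prod_(i <- s) f i <= 1.
Proof.
move=> f01; elim: s => [|i s /andP[p0 p1]]; first by rewrite big_nil ler01 lexx.
by rewrite big_cons; have /andP[? ?] := f01 i; rewrite mulr_ge0//= mulr_ile1.
Qed.

(** The upper bound is the value at a leaf: monotonicity in [low_from] reduces it to
    [tall_alive_renewal]. *)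
Lemma lowdead_bounds k n A v :
  (forall m w t, 0 <= t -> 0 <= low_from k m A w t <= L m t) ->
  forall t, 0 <= t -> 0 <= lowdead_from k n A v t <= 1 - V n t.
Proof.
move=> H t t0; have cV := @continuous_tall_alive R lambda P cP n.
apply/andP; split.
  rewrite addr_ge0//; first by case/andP: (H n v t t0).
  rewrite mulr_ge0// convol_ge0// => r /andP[r0 _]; first by case/andP: (H 1%N v r r0).
  exact: tall_alive_ge0.
have -> : 1 - V n t = L n t + mu * convol (L 1) (V n) t.
  by have := tall_alive_renewal cP PE n t0; rewrite /=; lra.
rewrite lerD//; first by case/andP: (H n v t t0).
rewrite ler_wpM2l// le_convol//; [exact: continuous_low_from|exact: continuous_low_prob| |].
- by move=> r /andP[r0 _]; exact: H.
- by move=> r /andP[r0 _]; rewrite lexx tall_alive_ge0.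
Qed.

Lemma low_from_bounds k n A v t : 0 <= t -> 0 <= low_from k n A v t <= L n t.
Proof.
elim: k n v t => [|k IH] [|n] v t t0; rewrite ?low_from_n0 ?lexx//.
  rewrite (_ : low_from 0 n.+1 A v t = L n.+1 t) ?low_prob_ge0 ?lexx//.
  by rewrite /= big1_seq ?mulr1.
rewrite low_fromS.
have L0 : 0 <= L n.+1 t by exact: low_prob_ge0.
have /andP[p0 p1] : 0 <= \prod_(w <- enum_fset (children A v)) lowdead_from k n A w t <= 1.
  apply: prod_unit => w; have /andP[-> /le_trans->//] := lowdead_bounds n w IH t0.
  by rewrite gerBl tall_alive_ge0.
by rewrite mulr_ge0//= ler_piMr.
Qed.

Lemma lowdead_from_bounds k n A v t : 0 <= t -> 0 <= lowdead_from k n A v t <= 1 - V n t.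
Proof. by move=> t0; apply: lowdead_bounds => // m w s; exact: low_from_bounds. Qed.

Lemma lowdead_from_leaf k n A v t : 0 <= t -> children A v = fset0 ->
  lowdead_from k n A v t = 1 - V n t.
Proof.
move=> t0 Av; rewrite /lowdead_from low_from_leaf//.
have := tall_alive_renewal cP PE n t0.
rewrite (@eq_convol _ (low_from k 1 A v) (empty_prob lambda P) _ (V n)); [lra| |by []].
by move=> r _; rewrite low_from_leaf.
Qed.

Lemma low_from_time0 k n x v : v \in vertices x ->
  (forall z, z \in vertices x -> prefix v z -> (size z < size v + k)%N) ->
  low_from k n x v 0 =
  (all (fun z => prefix v z ==> (size z < size v + n)%N) (enum_fset x))%:R.
Proof.
elim: k n v => [|k IH] n v vx xk.
  by have := xk v vx (prefix_refl v); rewrite addn0 ltnn.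
case: n => [|n].
  rewrite (_ : all _ _ = false)//; apply/negbTE/allPn; exists v => //.
  by rewrite prefix_refl/= addn0 ltnn.
rewrite low_fromS low_prob0 mul1r.
have -> : \prod_(w <- enum_fset (children x v)) lowdead_from k n x w 0 =
    \prod_(w <- enum_fset (children x v)) ((all (fun z => prefix w z ==> (size z < size w +
      n)%N) (enum_fset x))%:R : R).
  apply: eq_big_seq => w wc; rewrite /lowdead_from convol_le0// mulr0 addr0 IH//.
    by move: wc; rewrite in_children => /and3P[].
  move=> z zx wz; rewrite (size_child wc) addSnnS xk//.
  by rewrite (prefix_trans (prefix_child wc)).
case: (boolP (all _ _)) => [/allP H|/allPn[z zx]].
  rewrite big1_seq// => w /andP[_ wc]; rewrite (_ : all _ _ = true)//.
  apply/allP => z zx; apply/implyP => wz; rewrite (size_child wc) addSnnS.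
  by have := H z zx; rewrite (prefix_trans (prefix_child wc) wz).
rewrite negb_imply => /andP[vz]; rewrite -leqNgt => sz.
have zv : z != v by apply: contraTneq sz => ->; rewrite -ltnNge addnS ltnS leq_addr.
rewrite (big_rem (child_of v z)) ?child_of_in//= (_ : all _ _ = false) ?mul0r//.
apply/negbTE/allPn; exists z => //; rewrite prefix_child_of/=.
by rewrite (size_child (child_of_in zx vz zv)) addSnnS -leqNgt.
Qed.

(* The part of the generator acting on the subtree at [v], without the deletion
   of [v] itself. *)
Definition gen_below x v (phi : {fset vertex} -> R) : R :=
  \sum_(z <- enum_fset x | prefix v z) lambda * (phi (fresh_child x z |` x)%fset - phi x) +
  \sum_(z <- enum_fset x | [&& prefix v z, z != v & deletable x z]) mu * (phi (x `\ z)%fset -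
    phi x).

Lemma has_deriv_prod (I : eqType) (s : seq I) (f f' : I -> R -> R) : uniq s ->
  (forall i, i \in s -> has_deriv (f i) (f' i)) ->
  has_deriv (fun t => \prod_(i <- s) f i t)
    (fun t => \sum_(i <- s) f' i t * \prod_(j <- s | j != i) f j t).
Proof.
elim: s => [|i s IH].
  move=> _ _; under eq_fun do rewrite big_nil; under [X in has_deriv _ X]eq_fun do rewrite big_nil.
  exact: has_deriv_cst.
move=> /= /andP[ins us] H.
have Hi := H i (mem_head _ _).
have Hs := IH us (fun j js => H j (mem_behead (s := i :: s) js)).
have D := has_derivM Hi Hs.
under eq_fun do rewrite big_cons.
rewrite (_ : (fun t => \sum_(j <- i :: s) f' j t * \prod_(k <- i :: s | k != j) f k t) = (fun t
  => f' i t * \prod_(i <- s) f i t +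
   f i t * (\sum_(i <- s) f' i t * \prod_(j <- s | j != i) f j t)))//.
apply/funext => t; rewrite big_cons big_cons eqxx/=; congr (_ * _ + _).
  rewrite big_seq_cond [RHS]big_seq; apply: eq_bigl => j.
  by have [js|//] := boolP (j \in s); rewrite /=; apply: contraNneq ins => <-.
rewrite mulr_sumr; apply: eq_big_seq => j js.
have ij : i != j by apply: contraNneq ins => ->.
by rewrite big_cons ij; exact: mulrCA.
Qed.

Lemma convol_sum (I : Type) (s : seq I) (Q : pred I) (f : I -> R -> R) g t :
  (forall i, continuous (f i)) -> continuous g ->
  convol (fun r => \sum_(i <- s | Q i) f i r) g t = \sum_(i <- s | Q i) convol (f i) g t.
Proof.
move=> cf cg.
have cs s' : continuous (fun r => \sum_(i <- s' | Q i) f i r).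
  elim: s' => [|i s' IH]; first by under eq_fun do rewrite big_nil; exact: continuous_cst_.
  by under eq_fun do rewrite big_cons; case: (Q i) => //; exact: continuousD_.
elim: s => [|i s IH].
  rewrite big_nil (@eq_convol _ _ (fun r => 0 * g r) _ g); [|by move=> r _; rewrite big_nil
    mul0r|by []].
  by rewrite convolZl// mul0r.
rewrite big_cons.
rewrite (@eq_convol _ _ (fun r => if Q i then f i r + \sum_(i <- s | Q i) f i r else \sum_(i <-
  s | Q i) f i r) _ g);
  [|by move=> r _; rewrite big_cons|by []].
by case: (Q i) => //; rewrite convolDl// IH.
Qed.

Lemma gen_belowD x v phi psi : gen_below x v (fun B => phi B + psi B) =
  gen_below x v phi + gen_below x v psi.
Proof.
rewrite /gen_below addrACA -!big_split/=; congr (_ + _); apply: eq_bigr => z _.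
  by rewrite -mulrDr; congr (_ * _); ring.
by rewrite -mulrDr; congr (_ * _); ring.
Qed.

Lemma gen_belowZ x v c phi : gen_below x v (fun B => c * phi B) = c * gen_below x v phi.
Proof.
by rewrite /gen_below mulrDr !mulr_sumr; congr (_ + _); apply: eq_bigr => z _; ring.
Qed.

Lemma gen_below_convol x v (phi : {fset vertex} -> R -> R) g t :
  (forall B, continuous (phi B)) -> continuous g ->
  convol (fun r => gen_below x v (phi^~ r)) g t = gen_below x v (fun B => convol (phi B) g t).
Proof.
move=> cphi cg; rewrite /gen_below.
have cterm c A B : continuous (fun r => c * (phi A r - phi B r)).
  by apply: continuousZ_; exact: continuousB_.
have csum (c : R) (Q : pred vertex) (F : vertex -> {fset vertex}) :
    continuous (fun r => \sum_(z <- enum_fset x | Q z) c * (phi (F z) r - phi x r)).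
  elim: (enum_fset x) => [|i s IH]; first by under eq_fun do rewrite big_nil; exact:
    continuous_cst_.
  by under eq_fun do rewrite big_cons; case: (Q i) => //; exact: continuousD_.
rewrite convolDl//; try exact: csum.
rewrite !convol_sum//; congr (_ + _); apply: eq_bigr => z _; rewrite convolZl ?convolBl//;
  exact: continuousB_.
Qed.

End tree_functional.

(** * Effect of one jump on the sets of children *)

Section add_del.

Lemma prefix_rcons_inv (w z : vertex) i : prefix w (rcons z i) -> w = rcons z i \/ prefix w z.
Proof.
move=> /prefixP[s]; case/lastP: s => [|s j]; first by rewrite cats0; left.
by rewrite -rcons_cat => /rcons_inj[-> _]; right; exact: prefix_prefix.
Qed.

Lemma fresh_not_below (x : tree) w z : w \in vertices x -> ~~ prefix w z ->
  ~~ prefix w (fresh_child x z).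
Proof.
move=> wx; apply: contra => /prefix_rcons_inv[wE|//].
by have := fresh_childN x z; rewrite /fresh_child -wE wx.
Qed.

Lemma add_below (x : tree) w z y : w \in vertices x -> ~~ prefix w z -> prefix w y ->
  (y \in (fresh_child x z |` x)%fset) = (y \in vertices x).
Proof.
move=> wx wz wy; rewrite in_fset1U; case: eqP => // yE.
by move: (fresh_not_below wx wz); rewrite -yE wy.
Qed.

Lemma del_below (x : tree) w z y : ~~ prefix w z -> prefix w y ->
  (y \in (x `\ z)%fset) = (y \in vertices x).
Proof. by move=> wz wy; rewrite in_fsetD1; case: eqP => // yz; rewrite -yz wy in wz. Qed.

Lemma children_add (x : tree) v z : z != v ->
  children (fresh_child x z |` x)%fset v = children x v.
Proof.
move=> zv; apply/fsetP => w; rewrite !in_children in_fset1U.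
case: eqP => // ->; rewrite (negbTE (fresh_childN _ _)) /= parent_rcons.
by rewrite (negbTE zv) andbF.
Qed.

Lemma children_add_eq (x : tree) v :
  children (fresh_child x v |` x)%fset v = (fresh_child x v |` children x v)%fset.
Proof.
apply/fsetP => w; rewrite in_fset1U !in_children in_fset1U.
case: eqP => // ->; rewrite parent_rcons eqxx andbT.
by rewrite /fresh_child -size_eq0 size_rcons.
Qed.

Lemma children_del (x : tree) v z : parent z != v ->
  children (x `\ z)%fset v = children x v.
Proof.
move=> zv; apply/fsetP => w; rewrite !in_children in_fsetD1.
by case: eqP => // ->; rewrite (negbTE zv) !andbF.
Qed.

Lemma children_del_eq (x : tree) v z : children (x `\ z)%fset v = (children x v `\ z)%fset.
Proof. by apply/fsetP => w; rewrite in_fsetD1 !in_children in_fsetD1 -!andbA. Qed.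

Lemma children_fresh (x : tree) z :
  children (fresh_child x z |` x)%fset (fresh_child x z) = fset0.
Proof.
apply/fsetP => w; rewrite in_fset0; apply/negbTE/negP => wc.
have sw := size_child wc; move: wc; rewrite in_children in_fset1U => /and3P[+ _ /eqP pw].
move=> /orP[/eqP wE|wx]; first by move: sw; rewrite wE => /eqP; rewrite -[X in X == _]addn0
  -addn1 eqn_add2l.
have := fresh_childN x z; rewrite -pw.
by have /andP[_ /allP ->] := treeP x.
Qed.

End add_del.

Lemma bigD1_seq_cond {R : nmodType} (I : eqType) (r : seq I) (Q : pred I) (F : I -> R) j :
  j \in r -> Q j -> uniq r ->
  \sum_(i <- r | Q i) F i = F j + \sum_(i <- r | Q i && (i != j)) F i.
Proof.
move=> jr Qj ur; rewrite -big_filter (bigD1_seq j) ?mem_filter ?Qj ?filter_uniq//=.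
by rewrite big_filter_cond.
Qed.

(** * Time derivative of the products *)

Section derivative.
Context {R : realType}.
Variables (lambda mu : R) (P : R -> R).
Hypotheses (lambda_gt0 : 0 < lambda) (mu_ge0 : 0 <= mu).
Hypotheses (cP : continuous P) (P01 : unit_valued P).
Hypothesis PE : forall t, 0 <= t -> P t + mu * convol (empty_prob lambda P) P t = 1.
Local Notation V := (tall_alive lambda P).
Local Notation L := (low_prob lambda P).
Local Notation Lf := (low_from lambda mu P).
Local Notation Df := (lowdead_from lambda mu P).
Local Notation gB := (gen_below lambda mu).
Implicit Types (t : R) (A B : {fset vertex}) (x : tree) (v w z : vertex).

Lemma continuous_gen_below x v (phi : {fset vertex} -> R -> R) :
  (forall B, continuous (phi B)) -> continuous (fun t => gB x v (phi^~ t)).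
Proof.
move=> cphi; have csum (c : R) (Q : pred vertex) (F : vertex -> {fset vertex}) :
    continuous (fun r => \sum_(z <- enum_fset x | Q z) c * (phi (F z) r - phi x r)).
  elim: (enum_fset x) => [|i s IH]; first by under eq_fun do rewrite big_nil; exact:
    continuous_cst_.
  under eq_fun do rewrite big_cons; case: (Q i) => //; apply: continuousD_ => //.
  by apply: continuousZ_; exact: continuousB_.
by apply: continuousD_; exact: csum.
Qed.

Lemma leaf_time0 k x v : v \in vertices x ->
  (forall z, z \in vertices x -> prefix v z -> (size z < size v + k)%N) ->
  Lf k 1 x v 0 = (is_leaf x v)%:R.
Proof.
move=> vx xk; rewrite low_from_time0//; congr (_ %:R); congr nat_of_bool.
apply/allP/idP => [H|lf z zx]; last first.
  by apply/implyP => vz; rewrite (leaf_below lf zx vz) addn1.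
rewrite leafE; apply/eqP/fsetP => w; rewrite in_fset0; apply/negbTE/negP => wc.
have := H w; rewrite (prefix_child wc) (size_child wc) addn1 ltnn/=.
by move: wc; rewrite in_children => /and3P[wx _ _] /(_ wx).
Qed.

(** The sum [gen_below x w] omits the deletion of [w]. That jump reappears as the boundary term in
    the derivative of the convolution, with coefficient [low_from k 1] at time 0, the indicator that
    [w] is a leaf. *)
Lemma has_deriv_lowdead k n x w : w \in vertices x ->
  (forall z, z \in vertices x -> prefix w z -> (size z < size w + k)%N) ->
  (forall m, has_deriv (Lf k m x w) (fun t => gB x w (fun B => Lf k m B w t))) ->
  has_deriv (Df k n x w) (fun t =>
    gB x w (fun B => Df k n B w t) + mu * ((is_leaf x w)%:R * V n t)).
Proof.
move=> wx xk H.
have cV := @continuous_tall_alive R lambda P cP n.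
have D := has_derivD (H n) (has_derivZ mu (has_deriv_convol (H 1%N) cV)).
apply: (has_deriv_ext' D).
  apply: continuousD_; first by apply: continuous_gen_below => B; exact: continuous_lowdead_from.
  by apply: continuousZ_; exact: continuousZ_.
move=> t t0; rewrite leaf_time0// gen_below_convol//; last by move=> B; exact: continuous_low_from.
by rewrite /lowdead_from gen_belowD gen_belowZ mulrDr addrA [LHS]addrAC.
Qed.

Lemma low_from_prod k n A v t : Lf k.+1 n.+1 A v t =
  L n.+1 t * \prod_(w <- enum_fset (children A v)) Df k n A w t.
Proof. by []. Qed.

(** By locality, a jump below a child [w] changes only the factor of [w], and is matched by the
    derivative of that factor. A birth at [v] adds a factor [1 - V n], which is matched by the
    derivative of the prefactor [L n.+1]. The deletion of a leaf [w] replaces its factor [1 - V n]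
    by 1, which is the extra term of [has_deriv_lowdead]. *)
Lemma has_deriv_low_from k n x v : v \in vertices x ->
  (forall z, z \in vertices x -> prefix v z -> (size z < size v + k)%N) ->
  has_deriv (Lf k n x v) (fun t => gB x v (fun B => Lf k n B v t)).
Proof.
elim: k n v => [|k IH] n v vx xk.
  by have := xk v vx (prefix_refl v); rewrite addn0 ltnn.
case: n => [|n].
  apply: (has_deriv_ext' (has_deriv_cst 0)).
    by apply: continuous_gen_below => B; exact: continuous_low_from.
  move=> t _; rewrite /gen_below !big1 ?addr0//= => z _; by rewrite subrr mulr0.
pose s := enum_fset (children x v).
pose D w t := gB x w (fun B => Df k n B w t) + mu * ((is_leaf x w)%:R * V n t).
have us : uniq s by exact: fset_uniq.
have sx w : w \in s -> w \in vertices x by rewrite /s in_children => /and3P[].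
have dQ w : w \in s -> has_deriv (Df k n x w) (D w).
  move=> wc.
  have xkw z : z \in vertices x -> prefix w z -> (size z < size w + k)%N.
    move=> zx wz; rewrite (size_child wc) addSnnS xk//.
    by rewrite (prefix_trans (prefix_child wc)).
  by apply: has_deriv_lowdead => // [|m]; [exact: sx|apply: IH => //; exact: sx].
have DP := has_derivM (@has_deriv_low_prob R lambda P cP n) (has_deriv_prod us dQ).
apply: (has_deriv_ext' DP).
  by apply: continuous_gen_below => B; exact: continuous_low_from.
move=> t t0.
pose Q w := Df k n x w t.
pose Pi := \prod_(w <- s) Q w.
pose Pw w := \prod_(w' <- s | w' != w) Q w'.
pose l := L n.+1 t.
have PiE w : w \in s -> Pi = Q w * Pw w by move=> ws; rewrite /Pi (bigD1_seq w).
have fE : Lf k.+1 n.+1 x v t = l * Pi by [].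
have swap w B : w \in s -> children B v = children x v ->
    (forall w', w' \in s -> w' != w -> Df k n B w' t = Q w') ->
    Lf k.+1 n.+1 B v t - Lf k.+1 n.+1 x v t =
    l * Pw w * (Df k n B w t - Q w).
  move=> ws cB QB; rewrite fE low_from_prod cB -/s -/l (PiE w ws) (bigD1_seq w ws us)/=.
  rewrite (_ : \prod_(w' <- s | w' != w) _ = Pw w).
    by ring.
  by rewrite /Pw big_seq_cond [RHS]big_seq_cond; apply: eq_bigr => w' /andP[w's w'w]; exact: QB.
have notin w w' z : w \in s -> w' \in s -> w' != w -> prefix w z -> ~~ prefix w' z.
  move=> ws w's w'w wz; apply: contra w'w => w'z.
  by rewrite (child_prefixE ws wz) (child_prefixE w's w'z).
have pv w z : w \in s -> prefix w z -> z != v.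
  move=> ws wz; apply: contraL wz => /eqP ->; apply/negP => /prefix_size.
  by rewrite (size_child ws) ltnn.
have addE w z : w \in s -> prefix w z ->
    Lf k.+1 n.+1 (fresh_child x z |` x)%fset v t - Lf k.+1 n.+1 x v t =
    l * Pw w * (Df k n (fresh_child x z |` x)%fset w t - Q w).
  move=> ws wz; apply: swap => //; first by rewrite children_add// (pv w).
  move=> w' w's w'w; rewrite /Q; congr (_ t); apply: lowdead_from_local => y w'y.
  by rewrite (add_below (sx _ w's) (notin _ _ _ ws w's w'w wz) w'y).
have delE w z : w \in s -> prefix w z -> z != w -> 
    Lf k.+1 n.+1 (x `\ z)%fset v t - Lf k.+1 n.+1 x v t =
    l * Pw w * (Df k n (x `\ z)%fset w t - Q w).
  move=> ws wz zw; apply: swap => //.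
    apply: children_del; apply: contra zw => /eqP pz.
    have vz := prefix_size wz; rewrite (size_child ws) in vz.
    apply/eqP; apply: prefix_eq => //; rewrite (size_child ws) -pz size_parent prednK//.
    exact: leq_ltn_trans (leq0n _) vz.
  move=> w' w's w'w; rewrite /Q; congr (_ t); apply: lowdead_from_local => y w'y.
  by rewrite (del_below _ (notin _ _ _ ws w's w'w wz) w'y).
have delE' w : w \in s -> is_leaf x w ->
    Lf k.+1 n.+1 (x `\ w)%fset v t - Lf k.+1 n.+1 x v t = l * Pw w * V n t.
  move=> ws lw; rewrite fE low_from_prod children_del_eq (PiE w ws) -/l.
  rewrite /Q lowdead_from_leaf ?ltW//; last by apply/eqP; rewrite -leafE.
  rewrite (_ : \prod_(w' <- _) _ = Pw w); first by ring.
  rewrite /Pw -[RHS]big_filter.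
  rewrite (perm_big [seq i <- s | i != w])/=; last first.
    apply: uniq_perm; rewrite ?fset_uniq ?filter_uniq// => y.
    by rewrite mem_filter in_fsetD1.
  rewrite !big_filter big_seq_cond [RHS]big_seq_cond; apply: eq_bigr => y /andP[ys yw].
  rewrite /Q; congr (_ t); apply: lowdead_from_local => u yu.
  by rewrite (del_below _ (notin _ _ _ ws ys yw (prefix_refl _)) yu).
have addv : Lf k.+1 n.+1 (fresh_child x v |` x)%fset v t - Lf k.+1 n.+1 x v t =
    - (V n t * l * Pi).
  rewrite fE low_from_prod children_add_eq -/l.
  rewrite (perm_big (fresh_child x v :: s))/=; last first.
    apply: uniq_perm; rewrite ?fset_uniq//=.
      rewrite us andbT; apply: contra (fresh_childN x v); exact: sx.
    by move=> y; rewrite in_fset1U in_cons.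
  rewrite big_cons lowdead_from_leaf ?children_fresh ?ltW//.
  rewrite (_ : \prod_(j <- s) _ = Pi); first by ring.
  apply: eq_big_seq => w ws; rewrite /Q; congr (_ t); apply: lowdead_from_local => y wy.
  rewrite (add_below (sx _ ws) _ wy)//; apply/negP => /prefix_size.
  by rewrite (size_child ws) ltnn.
rewrite /gen_below.
(* The jumps are sorted: the birth at [v], then for each child [w] the jumps strictly inside its
   subtree and the deletion of [w] itself. *)
rewrite [X in _ = X + _](bigD1_seq_cond _ vx (prefix_refl v) (fset_uniq _)) addv sum_below.
rewrite [X in _ = _ + X](_ : _ = \sum_(w <- s) (\sum_(z <- enum_fset x | [&& prefix w z, z != w
  & deletable x z])
   mu * (Lf k.+1 n.+1 (x `\ z)%fset v t - Lf k.+1 n.+1 x v t) +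
   (is_leaf x w)%:R * (mu * (Lf k.+1 n.+1 (x `\ w)%fset v t - Lf k.+1 n.+1 x v t)))); last first.
  under eq_bigl do rewrite andbA; rewrite big_mkcondr sum_below.
  apply: eq_big_seq => w ws; rewrite (bigD1_seq_cond _ (sx _ ws) (prefix_refl w) (fset_uniq _)).
  rewrite addrC -big_mkcondr; under eq_bigl do rewrite -andbA.
  congr (_ + _); rewrite /deletable sx//= (_ : w != root_vertex)/=; last first.
    by move: ws; rewrite /s in_children => /and3P[].
  by case: ifP; rewrite ?mul1r ?mul0r.
rewrite -addrA; congr (_ + _); first by rewrite -/Pi -/l; ring.
rewrite -/l mulr_sumr -big_split/=.
apply: eq_big_seq => w ws; rewrite -/(Pw w) /D /gen_below.
rewrite (_ : \sum_(z <- enum_fset x | prefix w z) lambda * (Lf k.+1 n.+1 _ v t - _) =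
  l * Pw w * \sum_(z <- enum_fset x | prefix w z) lambda * (Df k n (fresh_child x z |` x)%fset w
    t - Q w)); last first.
  by rewrite mulr_sumr; apply: eq_bigr => z wz; rewrite (addE w)//; ring.
rewrite (_ : \sum_(z <- enum_fset x | _) mu * (Lf k.+1 n.+1 _ v t - _) =
  l * Pw w * \sum_(z <- enum_fset x | [&& prefix w z, z != w & deletable x z]) mu * (Df k n (x
    `\ z)%fset w t - Q w)); last first.
  by rewrite mulr_sumr; apply: eq_bigr => z /and3P[wz zw _]; rewrite (delE w)//; ring.
have -> : (is_leaf x w)%:R * (mu * (Lf k.+1 n.+1 (x `\ w)%fset v t - Lf k.+1 n.+1 x v t)) =
    l * Pw w * (mu * ((is_leaf x w)%:R * V n t)).
  by have [lw|_] := boolP (is_leaf x w); rewrite ?mul0r ?mulr0// delE'//; ring.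
rewrite -/(Q w); set a := \sum_(_ <- _ | _) _; set b := \sum_(_ <- _ | _) _; ring.
Qed.

End derivative.

(** * Jump chains and verification *)

Section density.
Context {R : realType}.
Local Notation leb := (@lebesgue_measure R).
Variables (k : R -> R) (mk : measurable_fun setT k) (k_ge0 : forall x, 0 <= k x).

(* The unused arguments are the hypotheses of the measure instance below. *)
Definition mdensity (_ : measurable_fun setT k) (_ : forall x, 0 <= k x) (A : set R) : \bar R :=
  (\int[leb]_(x in A) (k x)%:E)%E.

Let mdens := mdensity mk k_ge0.

Let mdensity0 : mdens set0 = 0%E.
Proof. by rewrite /mdens /mdensity integral_set0. Qed.

Let mdensity_ge0 A : (0 <= mdens A)%E.
Proof. by apply: integral_ge0 => x _; rewrite lee_fin. Qed.

Let mdensity_sigma_additive : semi_sigma_additive mdens.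
Proof.
move=> /= F mF tF mUF; rewrite /mdens /mdensity; apply: cvg_toP.
  apply: ereal_nondecreasing_is_cvgn => m n mn.
  by apply: lee_sum_nneg_natr => // i _ _; apply: integral_ge0 => x _; rewrite lee_fin.
rewrite ge0_integral_bigcup//=.
- by apply/measurable_funTS/measurableT_comp.
- by move=> x _; rewrite lee_fin.
Qed.

HB.instance Definition _ := isMeasure.Build _ _ _
  mdens mdensity0 mdensity_ge0 mdensity_sigma_additive.

End density.

Section density_integral.
Context {R : realType}.
Local Notation leb := (@lebesgue_measure R).
Variables (k : R -> R) (mk : measurable_fun setT k) (k_ge0 : forall x, 0 <= k x).

Import HBNNSimple.

Lemma integral_mdensity (f : R -> \bar R) : measurable_fun setT f ->
  (forall x, 0 <= f x)%E ->
  (\int[mdensity mk k_ge0]_x f x = \int[leb]_x (f x * (k x)%:E))%E.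
Proof.
move=> mf f0.
have mkE : measurable_fun setT (EFin \o k) by exact/measurable_EFinP.
have indic (E : set R) : measurable E ->
    (\int[mdensity mk k_ge0]_x (\1_E x)%:E = \int[leb]_x ((\1_E x)%:E * (k x)%:E))%E.
  move=> mE; rewrite integral_indic//= setIT /mdensity integral_mkcond.
  apply: eq_integral => x _; rewrite patchE indicE.
  by case: ifP => _; rewrite ?mul1e ?mul0e.
have nns (g : {nnsfun R >-> R}) :
    (\int[mdensity mk k_ge0]_x (g x)%:E = \int[leb]_x ((g x)%:E * (k x)%:E))%E.
  under [LHS]eq_integral do rewrite fimfunE -fsumEFin//.
  rewrite [LHS]ge0_integral_fsum//; last 2 first.
    - by move=> r; exact/measurable_EFinP/measurableT_comp.
    - by move=> n x _; rewrite EFinM nnfun_muleindic_ge0.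
  under [RHS]eq_integral.
    move=> x xD; rewrite fimfunE -fsumEFin// muleC ge0_mule_fsumr; last first.
      by move=> r; rewrite EFinM nnfun_muleindic_ge0.
    over.
  rewrite [RHS]ge0_integral_fsum//; last 2 first.
    - move=> r; apply: emeasurable_funM => //.
      have mg : measurable (g @^-1` [set r]) by rewrite -[X in measurable X]setTI; exact:
        measurable_funP.
      apply/measurable_EFinP; apply: measurable_funM; first exact: measurable_cst.
      exact: measurable_indic.
    - move=> n x _; rewrite mule_ge0//; last by rewrite EFinM nnfun_muleindic_ge0.
      by rewrite lee_fin.
  apply: eq_fsbigr => r _.
  have [r0|r0] := ltP r 0.
    rewrite preimage_nnfun0//.
    under eq_integral do rewrite indic0 mulr0.
    under [RHS]eq_integral do rewrite indic0 mulr0 mule0.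
    by rewrite !integral0.
  under eq_integral do rewrite EFinM.
  have mg : measurable (g @^-1` [set r]) by rewrite -[X in measurable X]setTI; exact:
    measurable_funP.
  have mi : measurable_fun setT (fun x => (\1_(g @^-1` [set r]) x)%:E : \bar R).
    by apply/measurable_EFinP; exact: measurable_indic.
  rewrite ge0_integralZl//.
  rewrite indic//.
  rewrite -ge0_integralZl//; last 2 first.
    - exact: emeasurable_funM.
    - by move=> x _; rewrite mule_ge0// lee_fin.
  by apply: eq_integral => x _; rewrite EFinM muleA [RHS]muleC.
pose f_ := nnsfun_approx measurableT mf.
have mf_ n : measurable_fun setT (fun x => (f_ n x)%:E : \bar R).
  by apply/measurable_EFinP.
transitivity (lim (\int[mdensity mk k_ge0]_x (f_ n x)%:E @[n --> \oo])%E).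
  rewrite -monotone_convergence//=.
  - apply: eq_integral => ? /[!inE] xD; apply/esym/cvg_lim => //=.
    exact: cvg_nnsfun_approx.
  - by move=> n ? _; rewrite lee_fin.
  - by move=> ? _ ? ? mn; rewrite lee_fin; exact/lefP/nd_nnsfun_approx.
under eq_fun do rewrite nns.
rewrite -monotone_convergence//=.
- apply: eq_integral => x _; apply/cvg_lim => //.
  by apply: cvgeZr => //; exact: cvg_nnsfun_approx.
- by move=> n; apply: emeasurable_funM; [exact: mf_|exact: mkE].
- by move=> n x _; rewrite mule_ge0// lee_fin.
- move=> x _ a b ab; apply: lee_wpmul2r; rewrite lee_fin//.
  by have /lefP := nd_nnsfun_approx measurableT mf ab; exact.
Qed.

End density_integral.

(** * Exponential laws *)

Section rays.
Context {R : realType}.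

Lemma rays_unique (m1 m2 : {measure set R -> \bar R}) :
  (m1 setT < +oo)%E -> (forall s : R, m1 `]s, +oo[%classic = m2 `]s, +oo[%classic) ->
  forall A, measurable A -> m1 A = m2 A.
Proof.
move=> m1oo m12 A mA.
pose G := [set A : set R | exists x, A = `]x, +oo[%classic].
apply: (@measure_unique _ R _ G (fun n => `]- n%:R, +oo[%classic)) => //.
- exact: RGenOInfty.measurableE.
- move=> _ _ [x ->] [y ->]; exists (Num.max x y).
  apply/seteqP; split => z /=; rewrite !in_itv/= !andbT.
    by move=> [xz yz]; rewrite gt_max xz.
  by rewrite gt_max => /andP[].
- by move=> i; exists (- i%:R).
- apply/seteqP; split => // x _; exists (Num.truncn `|x|).+1 => //=.
  rewrite in_itv/= andbT ltrNl (le_lt_trans (ler_norm _))// normrN.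
  by have := truncnS_gt `|x|.
- by move=> _ [x ->]; exact: m12.
- move=> i; apply: le_lt_trans m1oo; apply: le_measure; rewrite ?inE//.
Qed.

Definition exp_pdf (q r : R) : R := if 0 < r then q * expR (- (q * r)) else 0.

Lemma measurable_exp_pdf q : measurable_fun setT (exp_pdf q).
Proof.
apply: measurable_fun_ifT.
- exact: measurable_fun_ltr.
- apply: continuous_measurable_fun => x; apply: cvgM; first exact: cvg_cst.
  apply: continuous_comp; last exact: continuous_expR.
  by apply: cvgN; apply: cvgM; [exact: cvg_cst|exact: cvg_id].
- exact: measurable_cst.
Qed.

Lemma exp_pdf_ge0 q : 0 < q -> forall r, 0 <= exp_pdf q r.
Proof. by move=> q0 r; rewrite /exp_pdf; case: ifP => // _; rewrite mulr_ge0 ?expR_ge0 ?ltW. Qed.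

Lemma exp_pdf_tail q s : 0 < q -> 0 <= s ->
  (\int[lebesgue_measure]_(x in `]s, +oo[) (exp_pdf q x)%:E = (expR (- (q * s)))%:E)%E.
Proof.
move=> q0 s0.
have dF (x : R) : is_derive x (1 : R) (fun r : R => - expR (- (q * r))) (q * expR (- (q * x))).
  have H : is_derive x (1 : R) (fun r : R => - (q * r)) (- q).
    have H := is_deriveN (is_deriveZ q (is_derive_id x (1 : R))).
    by apply: (is_derive_eq H); rewrite /GRing.scale/= mulr1.
  have H2 := is_deriveN (@is_derive1_comp R expR (fun r => - (q * r)) x _ _ (is_derive_expR _) H).
  by apply: (is_derive_eq H2); rewrite /GRing.scale/= mulrN opprK mulrC.
have cf : continuous (fun r : R => q * expR (- (q * r))).
  move=> x; apply: cvgM; first exact: cvg_cst.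
  apply: continuous_comp; last exact: continuous_expR.
  by apply: cvgN; apply: cvgM; [exact: cvg_cst|exact: cvg_id].
transitivity (\int[lebesgue_measure]_(x in `]s, +oo[) (q * expR (- (q * x)))%:E)%E.
  by apply: eq_integral => r; rewrite inE/= in_itv/= andbT => sr; rewrite /exp_pdf (le_lt_trans
    s0 sr).
rewrite integral_itv_obnd_cbnd; last first.
  by apply/measurable_EFinP; apply: measurable_funTS; exact: continuous_measurable_fun.
rewrite (@ge0_continuous_FTC2y R _ (fun r => - expR (- (q * r))) s 0).
- by rewrite sub0e -EFinN opprK.
- by move=> x _; rewrite mulr_ge0 ?expR_ge0// ltW.
- exact: continuous_subspaceT.
- rewrite -oppr0; apply: cvgN.
  apply: (@cvg_comp _ _ _ (fun r => q * r) (fun r => expR (- r)) _ +oo); last exact: cvgr_expR.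
  by apply: gt0_cvgMry => //; exact: cvg_id.
- by move=> x _; case: (dF x).
- apply: cvg_at_right_filter; apply: cvgN.
  apply: continuous_comp; last exact: continuous_expR.
  by apply: cvgN; apply: cvgM; [exact: cvg_cst|exact: cvg_id].
- by move=> x _; rewrite derive1E; case: (dF x).
Qed.

End rays.

Section measure_partition.
Context {R : realType} d {Omega : measurableType d}.
Implicit Types (m : {measure set Omega -> \bar R}).

Lemma measurable_fibers (C : countType) (h : Omega -> C) (A : set Omega) :
  (forall c, measurable (A `&` h @^-1` [set c])) -> measurable A.
Proof.
move=> mA.
have -> : A = \bigcup_n (if pickle_inv n is Some c then A `&` h @^-1` [set c] else set0).
  apply/seteqP; split => [w Aw|w [n _]].
    by exists (choice.pickle (h w)) => //; rewrite pickleK_inv.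
  by case: pickle_inv => [c [//]|//].
by apply: bigcupT_measurable => n; case: pickle_inv => [c|//]; exact: mA.
Qed.

Lemma measure_fibers (C : countType) m1 m2 (h : Omega -> C) (A B : set Omega) :
  (forall c, measurable (A `&` h @^-1` [set c])) ->
  (forall c, measurable (B `&` h @^-1` [set c])) ->
  (forall c, m1 (A `&` h @^-1` [set c]) = m2 (B `&` h @^-1` [set c])) ->
  m1 A = m2 B.
Proof.
move=> mA mB AB.
pose F (D : set Omega) n := if pickle_inv n is Some c then D `&` h @^-1` [set c] else set0.
have FE D : D = \bigcup_n F D n.
  apply/seteqP; split => [w Dw|w [n _]].
    by exists (choice.pickle (h w)) => //; rewrite /F pickleK_inv.
  by rewrite /F; case: pickle_inv => [c [//]|//].
have tF D : trivIset setT (F D).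
  apply/trivIsetP => i j _ _ ij; apply/seteqP; split => // w [].
  rewrite /F; case Ei: (@pickle_inv C i) => [c|//]; case Ej: (@pickle_inv C j) => [c'|//].
  move=> -[_ /= hi] [_ /= hj]; move: ij.
  have := @pickle_invK C i; have := @pickle_invK C j; rewrite /ocancel Ei Ej /= -hi -hj => <- <-.
  by rewrite eqxx.
rewrite (FE A) (FE B) !measure_bigcup//; [|by rewrite /F => n _; case: pickle_inv..].
by apply: eq_eseriesr => n _; rewrite /F; case: pickle_inv => [c|]; rewrite ?measure0.
Qed.

End measure_partition.

(** * The past of the jump chain *)

Section jump_law.
Context {R : realType} {T : countType} (q : T -> T -> R) d {Omega : measurableType d}.
Variables (P : probability Omega R) (Y : nat -> Omega -> T) (S : nat -> Omega -> R) (x0 : T).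

(** The part of [is_ctmc] that concerns [Y] and [S], with an arbitrary initial state: it is applied
    to the process itself and to the process seen from its first jump. *)
Definition jump_law : Prop :=
  [/\ forall n y, measurable [set w | Y n w = y],
      forall n, measurable_fun setT (S n),
      forall n w, 0 < S n w &
      forall (n : nat) (y : nat -> T) (s : nat -> R),
        (forall k, 0 <= s k) ->
        P [set w | (forall k, (k <= n)%N -> Y k w = y k) /\
                   (forall k, (k < n)%N -> s k < S k w)]
        = ((y 0%N == x0)%:R *
           \prod_(k < n) (expR (- (exit_rate q (y k) * s k)) *
                          jump_prob q (y k) (y k.+1)))%:E].

Hypothesis law : jump_law.

Let mY n y : measurable [set w | Y n w = y]. Proof. by case: law. Qed.
Let mS n : measurable_fun setT (S n). Proof. by case: law. Qed.
Let S0 n w : 0 < S n w. Proof. by case: law. Qed.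

Definition path_event n (y : nat -> T) (s : nat -> R) : set Omega :=
  [set w | (forall k, (k <= n)%N -> Y k w = y k) /\ (forall k, (k < n)%N -> s k < S k w)].

Lemma measurable_S_gt n s : measurable [set w | s < S n w].
Proof.
rewrite (_ : mkset _ = S n @^-1` `]s, +oo[).
  by rewrite -[X in measurable X]setTI; exact: mS.
by apply/seteqP; split => w /=; rewrite in_itv/= andbT.
Qed.

Lemma measurable_path_event n y s : measurable (path_event n y s).
Proof.
rewrite (_ : path_event n y s =
  \bigcap_k (if (k <= n)%N then [set w | Y k w = y k] else setT) `&`
  \bigcap_k (if (k < n)%N then [set w | s k < S k w] else setT)); last first.
  apply/seteqP; split => w /= [H1 H2]; split => k.
  - by move=> _; case: ifP => // kn; exact: H1.
  - by move=> _; case: ifP => // kn; exact: H2.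
  - by move=> kn; have := H1 k Logic.I; rewrite kn.
  - by move=> kn; have := H2 k Logic.I; rewrite kn.
apply: measurableI; apply: bigcapT_measurable => k; case: ifP => // _.
exact: measurable_S_gt.
Qed.

(** A pi-system for the information in Y 0, ..., Y n and S 0, ..., S (n - 1), the empty set being
    added for closure under intersection. The holding time [S n] is left out, so that its law given
    this past makes sense. *)
Definition past_gen n : set (set Omega) :=
  [set A | A = set0 \/ exists y s, (forall k, 0 <= s k) /\ A = path_event n y s].

Definition past n : set (set Omega) := <<s past_gen n>>.

Lemma past_genI n : setI_closed (past_gen n).
Proof.
move=> A B [->|[y [s [s0 ->]]]]; first by rewrite set0I; left.
move=> [->|[y' [s' [s'0 ->]]]]; first by rewrite setI0; left.
have [yy'|yy'] := pselect (forall k, (k <= n)%N -> y k = y' k); last first.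
  left; apply/seteqP; split => // w [[H1 _] [H2 _]]; apply: yy' => k kn.
  by rewrite -H1// H2.
right; exists y, (fun k => Num.max (s k) (s' k)); split.
  by move=> k; rewrite le_max s0.
apply/seteqP; split => w /=.
  move=> [[H1 H2] [_ H3]]; split=> // k kn; rewrite gt_max H2//= H3//.
move=> [H1 H2]; split; split => // k kn.
- by have := H2 k kn; rewrite gt_max => /andP[].
- by rewrite H1// yy'.
- by have := H2 k kn; rewrite gt_max => /andP[].
Qed.

Lemma past_gen_measurable n : past_gen n `<=` measurable.
Proof. by move=> A [->//|[y [s [_ ->]]]]; exact: measurable_path_event. Qed.

Lemma past_measurable n A : past n A -> measurable A.
Proof.
move=> pA; apply: (smallest_sub _ (@past_gen_measurable n) pA).
exact: sigma_algebra_measurable.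
Qed.

Definition history n w : seq T := [seq Y k w | k <- iota 0 n].

Definition path_of (l : seq T) (k : nat) : T := nth x0 l k.

(** Only finitely many coordinates matter at each level, so countably many paths, namely words
    completed by [x0], cover the sample space. *)
Definition path_code (i : nat) : nat -> T := path_of (odflt [::] (choice.unpickle i)).

Lemma path_codeK l : path_code (choice.pickle l) = path_of l.
Proof. by rewrite /path_code choice.pickleK. Qed.

Lemma history_path n w l : history n.+1 w = l ->
  path_event n (path_of l) (fun=> 0) w.
Proof.
move=> <-; split => // k kn.
by rewrite /path_of /history (nth_map 0%N) ?size_iota// nth_iota.
Qed.

Lemma past_cover n : \bigcup_i (path_event n (path_code i) (fun=> 0)) = setT.
Proof.
apply/seteqP; split => // w _; exists (choice.pickle (history n.+1 w)) => //.
by rewrite path_codeK; exact: history_path.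
Qed.

Let past_path n y s : (forall k, 0 <= s k) -> past n (path_event n y s).
Proof. by move=> s0; apply: sub_sigma_algebra; right; exists y, s. Qed.

Lemma past_Y n k y : (k <= n)%N -> past n [set w | Y k w = y].
Proof.
move=> kn; pose G : ringOfSetsType _ := g_sigma_algebraType (past_gen n).
rewrite (_ : mkset _ = \bigcup_i
   (if path_code i k == y then
      path_event n (path_code i) (fun=> 0) else set0)).
  apply: (@bigcupT_measurable _ (g_sigma_algebraType (past_gen n))) => i.
  by case: ifP => _; [exact: past_path|exact: measurable0].
apply/seteqP; split => w /=.
  move=> Yw; exists (choice.pickle (history n.+1 w)) => //; rewrite path_codeK.
  have H := history_path (erefl (history n.+1 w)).
  by case: ifP => // /eqP; case; case: H => H _; rewrite -H.
by move=> [i _]; case: ifP => // /eqP <- [H _]; exact: H.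
Qed.

Lemma past_S_gt n k s : (k < n)%N -> past n [set w | s < S k w].
Proof.
move=> kn; have [s0|s0] := ltP s 0.
  rewrite (_ : mkset _ = setT); first exact: (@measurableT _ (g_sigma_algebraType (past_gen n))).
  by apply/seteqP; split => // w _ /=; exact: lt_trans (S0 _ _).
rewrite (_ : mkset _ = \bigcup_i (path_event n (path_code i) (fun j => if j == k then s else 0))).
  apply: (@bigcupT_measurable _ (g_sigma_algebraType (past_gen n))) => i.
  by apply: past_path => j; case: ifP.
apply/seteqP; split => w /=.
  move=> sS; exists (choice.pickle (history n.+1 w)) => //; rewrite path_codeK.
  have [H _] := history_path (erefl (history n.+1 w)).
  by split => // j jn; case: eqP => [->//|_].
by move=> [i _ [_ /(_ k kn)]]; rewrite eqxx.
Qed.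

Lemma past_measurable_S n k : (k < n)%N ->
  measurable_fun (setT : set (g_sigma_algebraType (past_gen n))) (S k : g_sigma_algebraType
    (past_gen n) -> R).
Proof.
move=> kn; apply: (@measurability _ _ _ _ _ _ [set A : set R | exists x, A = `]x, +oo[%classic]).
  exact: RGenOInfty.measurableE.
move=> _ [_ [x ->] <-]; rewrite setTI.
rewrite (_ : _ @^-1` _ = [set w | x < S k w]); first exact: past_S_gt.
by apply/seteqP; split => w /=; rewrite in_itv/= andbT.
Qed.

Lemma past_jump_time n k (B : set R) : (k <= n)%N -> measurable B ->
  past n (jump_time S k @^-1` B).
Proof.
move=> kn mB.
have : measurable_fun (setT : set (g_sigma_algebraType (past_gen n))) (jump_time S k :
  g_sigma_algebraType (past_gen n) -> R).
  rewrite /jump_time; elim: k kn => [|k IH] kn.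
    by under eq_fun do rewrite big_ord0; exact: measurable_cst.
  under eq_fun do rewrite big_ord_recr/=.
  by apply: measurable_funD; [apply: IH; exact: ltnW|exact: past_measurable_S].
by move=> /(_ measurableT B mB); rewrite setTI.
Qed.

Lemma measurable_jump_time k : measurable_fun setT (jump_time S k).
Proof. by move=> _ B mB; rewrite setTI; apply: (@past_measurable k); exact: past_jump_time. Qed.

(** Both sides are measures in [A]. On a path event ending at [x] the left side is the probability
    of the path extended by one step, and path events form a pi-system that generates [past]. *)
Lemma past_indep n A x s y : past n A -> 0 <= s ->
  0 <= exit_rate q x -> 0 <= jump_prob q x y ->
  P (A `&` [set w | [/\ Y n w = x, s < S n w & Y n.+1 w = y]]) =
  ((expR (- (exit_rate q x * s)) * jump_prob q x y)%:E * P (A `&` [set w | Y n w = x]))%E.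
Proof.
move=> pA s0 ex0 jp0.
have mB : measurable [set w | [/\ Y n w = x, s < S n w & Y n.+1 w = y]].
  rewrite (_ : mkset _ = [set w | Y n w = x] `&` [set w | s < S n w] `&` [set w | Y n.+1 w = y]).
    by apply: measurableI => //; apply: measurableI => //; exact: measurable_S_gt.
  by apply/seteqP; split => w /= [] => [|[]].
have c0 : 0 <= expR (- (exit_rate q x * s)) * jump_prob q x y by rewrite mulr_ge0 ?expR_ge0.
apply: (@g_sigma_algebra_measure_unique _ R Omega (past_gen n) (@past_gen_measurable n)
  (fun i => path_event n (path_code i) (fun=> 0)) _ (past_cover n)
  (mrestr P mB) (mscale (NngNum c0) (mrestr P (mY n x)))) => //.
- by move=> i; right; exists (path_code i), (fun=> 0).
- exact: past_genI.
- move=> _ [->|[y' [s' [s'0 ->]]]]; first by rewrite !measure0.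
  change (P (path_event n y' s' `&` [set w | [/\ Y n w = x, s < S n w & Y n.+1 w = y]]) =
    ((expR (- (exit_rate q x * s)) * jump_prob q x y)%:E *
     P (path_event n y' s' `&` [set w | Y n w = x]))%E).
  have [xy|xy] := eqVneq (y' n) x; last first.
    rewrite (_ : _ `&` _ = set0); last first.
      by apply/seteqP; split => // w [[H _] [Yx _ _]]; move/eqP: xy; apply; rewrite -H.
    rewrite (_ : _ `&` _ = set0); last first.
      by apply/seteqP; split => // w [[H _] Yx]; move/eqP: xy; apply; rewrite -H.
    by rewrite !measure0 mule0.
  have [_ _ _ lawE] := law.
  rewrite (_ : _ `&` _ = path_event n.+1 (fun k => if (k <= n)%N then y' k else y)
     (fun k => if (k < n)%N then s' k else s)); last first.
    apply/seteqP; split => w /=.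
      move=> [[H1 H2] [Yx sS Yy]]; split => k kn.
        case: (leqP k n) => kn'; first exact: H1.
        by have -> : k = n.+1 by apply/eqP; rewrite eqn_leq kn kn'.
      case: (ltnP k n) => kn'; first exact: H2.
      by have -> : k = n by apply/eqP; rewrite eqn_leq kn' andbT.
    move=> [H1 H2]; split; split.
    - by move=> k kn; rewrite H1 ?kn// leqW.
    - by move=> k kn; have := H2 k (ltnW kn); rewrite kn.
    - by rewrite H1// leqnn.
    - by have := H2 n (leqnn _); rewrite ltnn.
    - by rewrite H1// ltnn.
  rewrite (_ : path_event n y' s' `&` _ = path_event n y' s'); last first.
    by apply/seteqP; split => w /=; [case|move=> H; split => //; case: H => -> //].
  rewrite /path_event !lawE//; last by move=> k; case: ifP.
  rewrite -EFinM big_ord_recr/= leqnn !ltnn xy; congr EFin.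
  rewrite [RHS]mulrC -mulrA; congr (_ * (_ * _)).
  by apply: eq_bigr => k _; rewrite !(ltn_ord k) (ltnW (ltn_ord k)).
- move=> k; rewrite /mrestr.
  by rewrite (le_lt_trans (probability_le1 P _)) ?ltry//; apply: measurableI => //; exact:
    measurable_path_event.
Qed.

End jump_law.

(** * Joint law of a variable of the past and an exponential time *)

Section law_on.
Context {R : realType} d {Omega : measurableType d} d' {T : measurableType d'}.
Variables (P : {finite_measure set Omega -> \bar R}) (D : set Omega) (X : Omega -> T).

Definition law_on (_ : measurable D) (_ : measurable_fun setT X) (B : set T) : \bar R :=
  P (D `&` X @^-1` B).

Hypotheses (mD : measurable D) (mX : measurable_fun setT X).
Let law := law_on mD mX.

Let mXB B : measurable B -> measurable (X @^-1` B).
Proof. by move=> mB; rewrite -[X in measurable X]setTI; exact: mX. Qed.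

Let law0 : law set0 = 0%E.
Proof. by rewrite /law /law_on preimage_set0 setI0 measure0. Qed.

Let law_ge0 A : (0 <= law A)%E.
Proof. exact: measure_ge0. Qed.

Let law_sigma_additive : semi_sigma_additive law.
Proof.
move=> F mF tF mUF; rewrite /law /law_on preimage_bigcup setI_bigcupr.
apply: measure_semi_sigma_additive.
- by move=> n; apply: measurableI => //; exact: mXB.
- apply/trivIsetP => i j _ _ ij; rewrite setIACA setIid -preimage_setI.
  by move/trivIsetP : tF => /(_ _ _ _ _ ij) ->//; rewrite preimage_set0 setI0.
- by rewrite -setI_bigcupr -preimage_bigcup; apply: measurableI => //; exact: mXB.
Qed.

HB.instance Definition _ := isMeasure.Build _ _ _ law law0 law_ge0 law_sigma_additive.

Let law_finite : fin_num_fun law.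
Proof.
move=> A mA; apply: (fin_num_measure P); apply: measurableI => //; exact: mXB.
Qed.

HB.instance Definition _ := Measure_isFinite.Build _ _ _ law law_finite.

End law_on.

Section integral_law_on.
Context {R : realType} d {Omega : measurableType d} d' {T : measurableType d'}.
Variables (P : {finite_measure set Omega -> \bar R}) (D : set Omega) (X : Omega -> T).
Hypotheses (mD : measurable D) (mX : measurable_fun setT X).

Lemma integral_law_on (f : T -> \bar R) : measurable_fun setT f -> (forall x, 0 <= f x)%E ->
  (\int[law_on P mD mX]_x f x = \int[P]_(w in D) f (X w))%E.
Proof.
move=> mf f0.
have mfX : measurable_fun setT (f \o X) by exact: measurableT_comp.
transitivity (\int[pushforward (mrestr P mD) X]_x f x)%E.
  by apply: eq_measure_integral => A mA _; rewrite -[LHS]/(P (D `&` X @^-1` A)) setIC.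
rewrite ge0_integral_pushforward//= preimage_setT.
rewrite (@ge0_negligible_integral _ _ _ (mrestr P mD) setT (~` D))//; last 2 first.
- exact: measurableC.
- by rewrite /= /mrestr setICl measure0.
rewrite setTD setCK.
by apply: eq_measure_integral => A mA AD; rewrite /= /mrestr setIidl.
Qed.

End integral_law_on.

Section finite_density.
Context {R : realType}.
Variables (k : R -> R) (mk : measurable_fun setT k) (k_ge0 : forall x, 0 <= k x).

(** A copy of [mdensity] that carries the finiteness of its mass, on which the finite measure
    instance, and with it the product measure, rests. *)
Definition fdensity (_ : (mdensity mk k_ge0 setT < +oo)%E) := mdensity mk k_ge0.

Hypothesis koo : (mdensity mk k_ge0 setT < +oo)%E.
HB.instance Definition _ := Measure.on (fdensity koo).

Let fdensity_finite : fin_num_fun (fdensity koo).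
Proof.
move=> A mA; rewrite ge0_fin_numE ?measure_ge0//; apply: le_lt_trans koo.
by apply: le_measure => //; rewrite inE.
Qed.

HB.instance Definition _ := Measure_isFinite.Build _ _ _ (fdensity koo) fdensity_finite.

End finite_density.

Section exponential_step.
Context {R : realType} d {Omega : measurableType d}.
Local Notation leb := (@lebesgue_measure R).
Variables (P : {finite_measure set Omega -> \bar R}) (D D' : set Omega) (X Z : Omega -> R) (q c
  : R).
Hypotheses (mD : measurable D) (mD' : measurable D') (mX : measurable_fun setT X)
  (mZ : measurable_fun setT Z) (q_gt0 : 0 < q) (c_ge0 : 0 <= c) (Z_gt0 : forall w, 0 < Z w).
Hypothesis tailE : forall B s, measurable B -> 0 <= s ->
  P (D' `&` X @^-1` B `&` [set w | s < Z w]) = ((c * expR (- (q * s)))%:E * P (D `&` X @^-1` B))%E.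

Let k r := c * exp_pdf q r.
Let mk : measurable_fun setT k.
Proof. by apply: measurable_funM; [exact: measurable_cst|exact: measurable_exp_pdf]. Qed.
Let k_ge0 r : 0 <= k r.
Proof. by rewrite mulr_ge0// exp_pdf_ge0. Qed.

Let mpre (U : Omega -> R) B : measurable_fun setT U -> measurable B -> measurable (U @^-1` B).
Proof. by move=> mU mB; rewrite -[X in measurable X]setTI; exact: mU. Qed.

Let ktail s : 0 <= s -> mdensity mk k_ge0 `]s, +oo[%classic = (c * expR (- (q * s)))%:E.
Proof.
move=> s0; rewrite /mdensity; under eq_integral do rewrite EFinM.
rewrite ge0_integralZl//.
- by rewrite exp_pdf_tail// EFinM.
- by apply/measurable_EFinP; apply: measurable_funTS; exact: measurable_exp_pdf.
- by move=> x _; rewrite lee_fin exp_pdf_ge0.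
Qed.

Let kneg s : s <= 0 -> mdensity mk k_ge0 `]s, +oo[%classic = mdensity mk k_ge0 `]0, +oo[%classic.
Proof.
move=> s0.
rewrite /mdensity [LHS]integral_mkcond [RHS]integral_mkcond; apply: eq_integral => x _.
rewrite !patchE !mem_setE !in_itv/= !andbT /k /exp_pdf.
have [x0|x0] := ltP 0 x; first by rewrite (le_lt_trans s0 x0).
by rewrite mulr0 if_same.
Qed.

Let koo : (mdensity mk k_ge0 setT < +oo)%E.
Proof.
have := ktail (lexx 0); rewrite /mdensity integral_mkcond.
rewrite (_ : integral _ _ _ = \int[leb]_x (k x)%:E)%E; first by move=> ->; rewrite ltry.
apply: eq_integral => x _; rewrite !patchE mem_setE in_itv/= andbT /k /exp_pdf.
by case: (ltP 0 x) => _ //; rewrite mulr0.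
Qed.

Let step_tail B s : measurable B ->
  P (D' `&` X @^-1` B `&` Z @^-1` `]s, +oo[) = (P (D `&` X @^-1` B) * mdensity mk k_ge0 `]s,
    +oo[%classic)%E.
Proof.
move=> mB; rewrite (_ : Z @^-1` _ = [set w | s < Z w]); last first.
  by apply/seteqP; split => w /=; rewrite in_itv/= andbT.
have [s0|s0] := leP 0 s; first by rewrite tailE// ktail// muleC.
rewrite kneg ?ltW// ktail// muleC -tailE//; congr (P (_ `&` _)).
by apply/seteqP; split => w /= _ //; exact: lt_trans (Z_gt0 w).
Qed.

Let step_rect B C : measurable B -> measurable C ->
  P (D' `&` X @^-1` B `&` Z @^-1` C) = (P (D `&` X @^-1` B) * mdensity mk k_ge0 C)%E.
Proof.
move=> mB mC.
have mDB : measurable (D' `&` X @^-1` B) by apply: measurableI => //; exact: mpre.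
have mDB' : measurable (D `&` X @^-1` B) by apply: measurableI => //; exact: mpre.
have fDB : P (D `&` X @^-1` B) \is a fin_num by exact: fin_num_measure.
have dB0 : 0 <= fine (P (D `&` X @^-1` B)) by rewrite fine_ge0.

have := @rays_unique R (law_on P mDB mZ) (mscale (NngNum dB0) (fdensity koo)).
move=> /(_ _ _ C mC) H; rewrite -[LHS]/(law_on P mDB mZ C) H; first by rewrite /= /mscale/= fineK.
- by rewrite /law_on ltey_eq fin_num_measure//= preimage_setT setIT.
- by move=> s; rewrite -[LHS]/(P (D' `&` X @^-1` B `&` Z @^-1` `]s, +oo[)) step_tail//=
  /mscale/= fineK.
Qed.

(** The hypothesis on tails says that on [D'] the pair (X, Z) has as law the product of the law of
    [X] on [D] with [c] times an exponential law. Rays determine the second marginal, rectangles the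
    product, and Tonelli concludes. *)
Lemma integral_exponential_step (f : R * R -> \bar R) : measurable_fun setT f -> (forall x, 0 <=
  f x)%E ->
  (\int[P]_(w in D') f (X w, Z w) =
   \int[P]_(w in D) \int[leb]_r (f (X w, r) * (c * exp_pdf q r)%:E))%E.
Proof.
move=> mf f0.
have mXZ : measurable_fun setT (fun w => (X w, Z w)) by exact: measurable_fun_pair.
rewrite -(integral_law_on P mD' mXZ mf f0).
transitivity (\int[(law_on P mD mX \x fdensity koo)%E]_z f z)%E.
  apply: eq_measure_integral => A mA _; apply/esym.
  apply: (@product_measure_unique _ _ _ _ _ (law_on P mD mX) (fdensity koo) (law_on P mD' mXZ))
    => // B C mB mC.
  rewrite -[RHS]/(P (D `&` X @^-1` B) * mdensity mk k_ge0 C)%E -step_rect//.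
  by congr (P _); apply/seteqP; split => w /= [] => [? []|[]].
rewrite fubini_tonelli1//= integral_law_on//; last 2 first.
- exact: measurable_fun_fubini_tonelli_F.
- by move=> x; exact: integral_ge0.
apply: eq_integral => w _; rewrite /fubini_F.
rewrite -[LHS]/(\int[mdensity mk k_ge0]_y f (X w, y))%E integral_mdensity//.
by apply: measurableT_comp => //; exact: measurable_pair1.
Qed.

End exponential_step.

Section integral_fibers.
Context {R : realType} d {Omega : measurableType d} (m : {measure set Omega -> \bar R}).

Lemma integral_fibers (C : countType) (h : Omega -> C) (A : set Omega) (f : Omega -> \bar R) :
  (forall c, measurable (A `&` h @^-1` [set c])) ->
  measurable_fun A f -> (forall w, A w -> 0 <= f w)%E ->
  (\int[m]_(w in A) f w = \sum_(n <oo)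
    (if pickle_inv n is Some c then \int[m]_(w in A `&` h @^-1` [set c]) f w else 0))%E.
Proof.
move=> mA mf f0.
pose F n := if @pickle_inv C n is Some c then A `&` h @^-1` [set c] else set0.
have FE : A = \bigcup_n F n.
  apply/seteqP; split => [w Dw|w [n _]].
    by exists (choice.pickle (h w)) => //; rewrite /F pickleK_inv.
  by rewrite /F; case: pickle_inv => [c [//]|//].
have tF : trivIset setT F.
  apply/trivIsetP => i j _ _ ij; apply/seteqP; split => // w [].
  rewrite /F; case Ei: (@pickle_inv C i) => [c|//]; case Ej: (@pickle_inv C j) => [c'|//].
  move=> -[_ /= hi] [_ /= hj]; move: ij.
  have := @pickle_invK C i; have := @pickle_invK C j; rewrite /ocancel Ei Ej /= -hi -hj => <- <-.
  by rewrite eqxx.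
rewrite {1}FE ge0_integral_bigcup//; last 3 first.
- by rewrite /F => n; case: pickle_inv.
- by rewrite -FE.
- by rewrite -FE.
by apply: eq_eseriesr => n _; rewrite /F; case: pickle_inv => [c|]; rewrite ?integral_set0.
Qed.

Lemma le_integral_fibers (C : countType) (h h' : Omega -> C) (A B : set Omega) (f g : Omega ->
  \bar R) :
  (forall c, measurable (A `&` h @^-1` [set c])) ->
  (forall c, measurable (B `&` h' @^-1` [set c])) ->
  measurable_fun A f -> (forall w, A w -> 0 <= f w)%E ->
  measurable_fun B g -> (forall w, B w -> 0 <= g w)%E ->
  (forall c, \int[m]_(w in A `&` h @^-1` [set c]) f w <= \int[m]_(w in B `&` h' @^-1` [set c]) g
    w)%E ->
  (\int[m]_(w in A) f w <= \int[m]_(w in B) g w)%E.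
Proof.
move=> mA mB mf f0 mg g0 fg.
rewrite (integral_fibers mA mf f0) (integral_fibers mB mg g0).
apply: lee_nneseries => n _; case: pickle_inv => // c _.
by apply: integral_ge0 => w [Aw _]; exact: f0.
Qed.

Lemma eq_integral_fibers (C : countType) (h h' : Omega -> C) (A B : set Omega) (f g : Omega ->
  \bar R) :
  (forall c, measurable (A `&` h @^-1` [set c])) ->
  (forall c, measurable (B `&` h' @^-1` [set c])) ->
  measurable_fun A f -> (forall w, A w -> 0 <= f w)%E ->
  measurable_fun B g -> (forall w, B w -> 0 <= g w)%E ->
  (forall c, \int[m]_(w in A `&` h @^-1` [set c]) f w = \int[m]_(w in B `&` h' @^-1` [set c]) g
    w)%E ->
  (\int[m]_(w in A) f w = \int[m]_(w in B) g w)%E.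
Proof.
by move=> mA mB mf f0 mg g0 fg; apply/eqP; rewrite eq_le; apply/andP; split;
  [apply: (le_integral_fibers mA mB)|apply: (le_integral_fibers mB mA)] => // c; rewrite fg.
Qed.

Lemma measurable_fun_fibers d' (T : measurableType d') (C : countType) (h : Omega -> C)
    (f : C -> Omega -> T) :
  (forall c, measurable (h @^-1` [set c])) ->
  (forall c, measurable_fun setT (f c)) -> measurable_fun setT (fun w => f (h w) w).
Proof.
move=> mh mf _ B mB; rewrite setTI; apply: (@measurable_fibers _ _ C h) => c.
rewrite (_ : _ `&` _ = h @^-1` [set c] `&` f c @^-1` B).
  by apply: measurableI => //; rewrite -[X in measurable X]setTI; exact: mf.
by apply/seteqP; split => w /= [] => [+ <-|<- ].
Qed.

End integral_fibers.

(** * One step of the chain, and optional stopping *)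

Section jump_step.
Context {R : realType} {T : countType} (q : T -> T -> R) d {Omega : measurableType d}.
Local Notation leb := (@lebesgue_measure R).
Variables (P : probability Omega R) (Y : nat -> Omega -> T) (S : nat -> Omega -> R) (x0 : T).
Variable succ : T -> seq T.
Hypotheses (law : jump_law q P Y S x0)
  (rate_gt0 : forall x, 0 < exit_rate q x)
  (jp_ge0 : forall x y, 0 <= jump_prob q x y)
  (jp_succ : forall x y, y \notin succ x -> jump_prob q x y = 0)
  (succ_uniq : forall x, uniq (succ x)).

Let mY n y : measurable [set w | Y n w = y]. Proof. by case: law. Qed.
Let mS n : measurable_fun setT (S n). Proof. by case: law. Qed.
Let S0 n w : 0 < S n w. Proof. by case: law. Qed.
Let mJ n : measurable_fun setT (jump_time S n). Proof. exact: (measurable_jump_time law). Qed.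

Lemma jump_step1 n A x y (f : R * R -> \bar R) : past Y S n A ->
  measurable_fun setT f -> (forall z, 0 <= f z)%E ->
  (\int[P]_(w in A `&` [set w | Y n w = x] `&` [set w | Y n.+1 w = y]) f (jump_time S n w, S n w) =
   \int[P]_(w in A `&` [set w | Y n w = x])
     \int[leb]_r (f (jump_time S n w, r) * (jump_prob q x y * exp_pdf (exit_rate q x) r)%:E))%E.
Proof.
move=> pA mf f0.
have mA : measurable A by exact: (past_measurable law pA).
apply: integral_exponential_step => //.
- exact: measurableI.
- by apply: measurableI => //; apply: measurableI.
move=> B s mB s0.
have pAB : past Y S n (A `&` jump_time S n @^-1` B).
  apply: (@measurableI _ (g_sigma_algebraType (past_gen Y S n))) => //.
  exact: (past_jump_time law).
have := past_indep law pAB s0 (ltW (rate_gt0 x)) (jp_ge0 x y).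
rewrite (mulrC (jump_prob q x y)) [X in (_ * P X)%E]setIAC => <-.
congr (P _); apply/seteqP; split => w /=; first by move=> [[[[? ?] ?] ?] ?].
by move=> [[? ?] [? ? ?]].
Qed.

Let mAY n A x : past Y S n A -> measurable (A `&` [set w | Y n w = x]).
Proof. by move=> pA; apply: measurableI => //; exact: (past_measurable law pA). Qed.

(** The Markov property at a jump. The finite sum over [succ x] is enough because the event that
    [Y n.+1] takes another value is null. *)
Lemma jump_step n A x (f : T -> R * R -> \bar R) : past Y S n A ->
  (forall y, measurable_fun setT (f y)) -> (forall y z, 0 <= f y z)%E ->
  (\int[P]_(w in A `&` [set w | Y n w = x]) f (Y n.+1 w) (jump_time S n w, S n w) =
   \int[P]_(w in A `&` [set w | Y n w = x])
     \sum_(y <- succ x) \int[leb]_r (f y (jump_time S n w, r) *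
       (jump_prob q x y * exp_pdf (exit_rate q x) r)%:E))%E.
Proof.
move=> pA mf f0.
have mB := mAY x pA.
have mJS : measurable_fun setT (fun w => (jump_time S n w, S n w)) by exact: measurable_fun_pair.
have mfY : measurable_fun setT (fun w => f (Y n.+1 w) (jump_time S n w, S n w)).
  apply: (@measurable_fun_fibers _ _ _ _ _ (Y n.+1) (fun y w => f y (jump_time S n w, S n w))) => y.
    exact: mY.
  by apply: measurableT_comp.
have jE0 y r : (0 <= (jump_prob q x y * exp_pdf (exit_rate q x) r)%:E)%E.
  by rewrite lee_fin mulr_ge0// exp_pdf_ge0.
have mk y : measurable_fun setT (fun z : R * R => f y z * (jump_prob q x y * exp_pdf (exit_rate
  q x) z.2)%:E)%E.
  apply: emeasurable_funM => //; apply/measurable_EFinP; apply: measurable_funM => //.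
  by apply: measurableT_comp; [exact: measurable_exp_pdf|exact: measurable_snd].
have mI y : measurable_fun setT (fun w => \int[leb]_r (f y (jump_time S n w, r) *
       (jump_prob q x y * exp_pdf (exit_rate q x) r)%:E))%E.
  have := @measurable_fun_fubini_tonelli_F _ _ _ _ _ leb _ (mk y).
  move=> H; apply: (measurableT_comp (H _) (mJ n)) => z.
  by rewrite mule_ge0.
rewrite [RHS]ge0_integral_sum//; last 2 first.
- by move=> y; exact: measurable_funTS.
- by move=> y w _; apply: integral_ge0 => r _; rewrite mule_ge0.
pose E y := A `&` [set w | Y n w = x] `&` [set w | Y n.+1 w = y].
have mE y : measurable (E y) by exact: measurableI.
have Enull y : y \notin succ x -> P (E y) = 0%E.
  move=> ys; have := past_indep law pA (lexx 0) (ltW (rate_gt0 x)) (jp_ge0 x y).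
  rewrite jp_succ// mulr0 mul0e => <-; congr (P _).
  by apply/seteqP; split => w /=; [move=> [[? ?] ?]; split => //; split|move=> [? [? ? ?]]].
transitivity (\sum_(y <- succ x) \int[P]_(w in E y) f (Y n.+1 w) (jump_time S n w, S n w))%E;
  last first.
  apply: eq_bigr => y _; rewrite -jump_step1//.
  by apply: eq_integral => w; rewrite inE => -[_ /= ->].
pose D := A `&` [set w | Y n w = x].
pose Z := \big[setU/set0]_(y <- succ x) E y.
have mZ : measurable Z by exact: bigsetU_measurable.
have ZD : Z `<=` D.
  by rewrite /Z big_seq; elim/big_ind: _ => [//|U V UD VD w [/UD|/VD]//|y _ w []].
have PDZ : P (D `\` Z) = 0%E.
  have mN : measurable (D `\` Z) by exact: measurableD.
  rewrite -(measure0 P); apply: (@measure_fibers _ _ _ _ _ P (Y n.+1)) => y.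
    by apply: measurableI => //; exact: mY.
  by rewrite set0I.
  rewrite set0I measure0; have [ys|ys] := boolP (y \in succ x).
    rewrite (_ : _ `&` _ = set0) ?measure0//; apply/seteqP; split => // w [[Dw Zw] Yw].
    by apply: Zw; rewrite /Z (bigD1_seq y)//=; left.
  have mN' : measurable ((D `\` Z) `&` Y n.+1 @^-1` [set y]) by apply: measurableI => //; exact: mY.
  apply/eqP; rewrite eq_le measure_ge0 andbT -(Enull _ ys).
  by apply: le_measure; rewrite ?inE// => w [[Dw _] Yw].
rewrite -[LHS]/(\int[P]_(w in D) f (Y n.+1 w) (jump_time S n w, S n w))%E.
rewrite (ge0_negligible_integral (measurableD mB mZ))//; last exact: measurable_funTS.
rewrite setDD setIC (setIidl ZD) ge0_integral_bigsetU//; last exact: measurable_funTS.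
by move=> y y' _ _ [w [[_ <-] [_ <-]]].
Qed.

Lemma integral_start (g : T -> \bar R) : (forall y, 0 <= g y)%E -> (\int[P]_w g (Y 0%N w) = g x0)%E.
Proof.
move=> g0.
have mg : measurable_fun setT (fun w => g (Y 0%N w)).
  by apply: (@measurable_fun_fibers _ _ _ _ _ (Y 0%N) (fun y _ => g y)) => // y; exact: mY.
have P1 : P [set w | Y 0%N w = x0] = 1%E.
  have [_ _ _ H] := law; have := H 0%N (fun=> x0) (fun=> 0) (fun=> lexx _).
  rewrite eqxx big_ord0 mulr1 => <-; congr (P _); apply/seteqP; split => w /=.
    by move=> Yw; split => // k; rewrite leqn0 => /eqP ->.
  by case=> + _; apply.
have mC : measurable (~` [set w | Y 0%N w = x0]) by exact: measurableC.
have PC : P (~` [set w | Y 0%N w = x0]) = 0%E by rewrite probability_setC// P1 subee.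
rewrite (ge0_negligible_integral mC)// setTD setCK.
rewrite (eq_integral (cst (g x0))); last by move=> w; rewrite inE/= => ->.
rewrite integral_cst; last exact: mY.
by transitivity (g x0 * 1)%E; [congr (_ * _)%E; exact: P1|exact: mule1].
Qed.

Section verification.
Variables (u : R -> T -> R) (t : R).
Hypotheses (u_ge0 : forall s x, 0 <= u s x) (mu : forall x, measurable_fun setT (u ^~ x))
  (t_ge0 : 0 <= t) (jp_sum : forall x, \sum_(y <- succ x) jump_prob q x y = 1).

(* The backward equation integrated up to the first jump. *)
Definition mild (s : R) (x : T) : \bar R :=
  ((expR (- (exit_rate q x * s)) * u 0 x)%:E + \sum_(y <- succ x)
    \int[leb]_(r in `[0%R, s]) (jump_prob q x y * exp_pdf (exit_rate q x) r * u (s - r) y)%:E)%E.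

(** Value after a step begun in [x] at time [z.1] with holding time [z.2] and next state [y]: if the
    jump occurs by [t], the value of [y] for the time that remains; if [t] falls within the holding
    time, [u 0 x]. *)
Definition payoff (x y : T) (z : R * R) : R :=
  if z.1 + z.2 <= t then u (t - (z.1 + z.2)) y else if z.1 <= t then u 0 x else 0.

Let payoff_ge0 x y z : 0 <= payoff x y z.
Proof. by rewrite /payoff; case: ifP => // _; case: ifP. Qed.

Let measurable_payoff x y : measurable_fun setT (payoff x y).
Proof.
have m1 : measurable_fun setT (fun z : R * R => z.1 + z.2).
  by apply: measurable_funD; [exact: measurable_fst|exact: measurable_snd].
rewrite /payoff; apply: measurable_fun_ifT.
- by apply: measurable_fun_ler => //; exact: measurable_cst.
- apply: (measurableT_comp (mu y)); apply: measurable_funB => //; exact: measurable_cst.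
- apply: measurable_fun_ifT; last 2 first.
  + exact: measurable_cst.
  + exact: measurable_cst.
  by apply: measurable_fun_ler; [exact: measurable_fst|exact: measurable_cst].
Qed.

Let payoff_integral x j :
  (\sum_(y <- succ x) \int[leb]_r ((payoff x y (j, r))%:E *
     (jump_prob q x y * exp_pdf (exit_rate q x) r)%:E) =
   if (j <= t)%R then mild (t - j) x else 0)%E.
Proof.
have [jt|jt] := leP j t; last first.
  rewrite big1// => y _; rewrite integral0_eq// => r _.
  rewrite /payoff/= /exp_pdf; have [r0|r0] := ltP 0 r; last by rewrite mulr0 mule0.
  rewrite [j <= t]leNgt jt/= [j + r <= t]leNgt.
  by rewrite (lt_le_trans jt) ?lerDl ?ltW//= mul0e.
have E y : (\int[leb]_r ((payoff x y (j, r))%:E * (jump_prob q x y * exp_pdf (exit_rate q x)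
  r)%:E) =
   \int[leb]_(r in `[0%R, (t - j)%R]) (jump_prob q x y * exp_pdf (exit_rate q x) r * u (t - j -
     r) y)%:E +
   (jump_prob q x y * (expR (- (exit_rate q x * (t - j))) * u 0 x))%:E)%E.
  pose p r := jump_prob q x y * exp_pdf (exit_rate q x) r.
  have p0 r : 0 <= p r by rewrite mulr_ge0// exp_pdf_ge0.
  have mp : measurable_fun setT p.
    by apply: measurable_funM; [exact: measurable_cst|exact: measurable_exp_pdf].
  have mU : measurable_fun setT (fun r => p r * u (t - j - r) y).
    apply: measurable_funM => //; apply: (measurableT_comp (mu y)).
    by apply: measurable_funB; [exact: measurable_cst|exact: measurable_id].
  transitivity (\int[leb]_r ((fun r => (p r * u (t - j - r) y)%:E) \_ `[0%R, (t - j)%R] r +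
     (fun r => (u 0 x)%:E * (p r)%:E) \_ `](t - j)%R, +oo[ r))%E.
    apply: eq_integral => r _; rewrite !patchE !mem_setE !in_itv/= andbT /payoff/=.
    rewrite -lerBrDl; have [r0|r0] := leP 0 r; last first.
      have -> : jump_prob q x y * exp_pdf (exit_rate q x) r = 0.
        by rewrite /exp_pdf ltNge (ltW r0) mulr0.
      rewrite mule0 /= ltNge (le_trans (ltW r0)) ?subr_ge0//=.
      by rewrite adde0.
    have [rt|rt] := leP r (t - j); last by rewrite jt/= add0e.
    by rewrite -EFinM adde0 [in RHS]mulrC opprD addrA.
  rewrite ge0_integralD//; last 4 first.
  - by move=> r _; rewrite erestrict_ge0// => r' _; rewrite lee_fin mulr_ge0.
  - by apply/(measurable_restrictT _ _).1 => //; apply/measurable_EFinP; exact: measurable_funTS.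
  - by move=> r _; rewrite erestrict_ge0// => r' _; rewrite mule_ge0// lee_fin.
  - apply/(measurable_restrictT _ _).1 => //; apply: measurable_funTS.
    by apply: emeasurable_funM; [exact: measurable_cst|exact/measurable_EFinP].
  rewrite -integral_mkcond; congr (_ + _)%E.
  rewrite -integral_mkcond ge0_integralZl//; last 3 first.
  - by apply/measurable_EFinP; exact: measurable_funTS.
  - by move=> r _; rewrite lee_fin.
  - by rewrite lee_fin.
  rewrite /p; under eq_integral do rewrite EFinM.
  rewrite ge0_integralZl//; last 3 first.
  - by apply/measurable_EFinP; apply: measurable_funTS; exact: measurable_exp_pdf.
  - by move=> r _; rewrite lee_fin exp_pdf_ge0.
  - by rewrite lee_fin.
  by rewrite exp_pdf_tail ?subr_ge0// -!EFinM mulrC mulrA.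
rewrite (eq_bigr _ (fun y _ => E y)) big_split/= addeC /mild; congr (_ + _)%E.
by rewrite sumEFin -mulr_suml jp_sum mul1r.
Qed.

Let measurable_mild n x : measurable_fun setT (fun w => if jump_time S n w <= t then mild (t -
  jump_time S n w) x else 0%E).
Proof.
under eq_fun do rewrite -payoff_integral.
apply: emeasurable_sum => y.
pose k (z : R * R) := ((payoff x y z)%:E * (jump_prob q x y * exp_pdf (exit_rate q x) z.2)%:E)%E.
have mk : measurable_fun setT k.
  apply: emeasurable_funM; first exact/measurable_EFinP.
  apply/measurable_EFinP; apply: measurable_funM; first exact: measurable_cst.
  by apply: measurableT_comp; [exact: measurable_exp_pdf|exact: measurable_snd].
have k0 z : (0 <= k z)%E by rewrite mule_ge0// lee_fin// mulr_ge0// exp_pdf_ge0.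
have := @measurable_fun_fubini_tonelli_F _ _ _ _ _ leb _ mk k0 => H.
exact: (measurableT_comp H (mJ n)).
Qed.

Let mild_ge0 s x : 0 <= s -> (0 <= mild s x)%E.
Proof.
move=> s0; apply: adde_ge0; first by rewrite lee_fin mulr_ge0 ?expR_ge0.
apply: sume_ge0 => y _; apply: integral_ge0 => r _.
by rewrite lee_fin mulr_ge0// mulr_ge0// exp_pdf_ge0.
Qed.

Let payoff_at n w := payoff (Y n w) (Y n.+1 w) (jump_time S n w, S n w).

Let measurable_payoff_at n : measurable_fun setT (payoff_at n).
Proof.
apply: (@measurable_fun_fibers _ _ _ _ _ (Y n) (fun x w => payoff x (Y n.+1 w) (jump_time S n w,
  S n w))) => x; first exact: mY.
apply: (@measurable_fun_fibers _ _ _ _ _ (Y n.+1) (fun y w => payoff x y (jump_time S n w, S n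
  w))) => y; first exact: mY.
by apply: measurableT_comp => //; exact: measurable_fun_pair.
Qed.

Lemma payoff_step n A : past Y S n A ->
  (\int[P]_(w in A) (payoff_at n w)%:E =
   \int[P]_(w in A) (if (jump_time S n w <= t)%R then mild (t - jump_time S n w) (Y n w) else 0))%E.
Proof.
move=> pA; have mA := past_measurable law pA.
apply: (@eq_integral_fibers _ _ _ P T (Y n) (Y n)).
- by move=> y; apply: measurableI => //; exact: mY.
- by move=> y; apply: measurableI => //; exact: mY.
- by apply/measurable_EFinP; exact: measurable_funTS.
- by move=> w _; rewrite lee_fin payoff_ge0.
- apply: measurable_funTS.
  apply: (@measurable_fun_fibers _ _ _ _ _ (Y n) (fun x w => if jump_time S n w <= t then mild
    (t - jump_time S n w) x else 0%E)) => x; last exact: measurable_mild.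
  exact: mY.
- by move=> w _; case: ifPn => // jt; rewrite mild_ge0// subr_ge0.
move=> x.
transitivity (\int[P]_(w in A `&` [set w | Y n w = x]) (payoff x (Y n.+1 w) (jump_time S n w, S
  n w))%:E)%E.
  by apply: eq_integral => w; rewrite inE => -[_ /= Yx]; rewrite /payoff_at Yx.
rewrite (@jump_step n A x (fun y z => (payoff x y z)%:E))//.
- by apply: eq_integral => w; rewrite inE => -[_ /= Yx]; rewrite payoff_integral Yx.
- by move=> y; exact/measurable_EFinP.
- by move=> y z; rewrite lee_fin.
Qed.

(* The set of remaining times at which a state belongs to the domain of the
   equation. *)
Variable D : T -> set R.
Hypothesis mD : forall x, measurable (D x).

Definition stays n : set Omega :=
  [set w | forall k, (k < n)%N -> D (Y k w) (t - jump_time S k w)].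

Let past_stay1 n k : (k <= n)%N -> past Y S n [set w | D (Y k w) (t - jump_time S k w)].
Proof.
move=> kn; apply: (@measurable_fibers _ (g_sigma_algebraType (past_gen Y S n)) T (Y k)) => x.
rewrite (_ : _ `&` _ = [set w | Y k w = x] `&` jump_time S k @^-1` [set s | D x (t - s)]).
  apply: (@measurableI _ (g_sigma_algebraType (past_gen Y S n))); first exact: (past_Y law).
  apply: (past_jump_time law) => //.
  have : measurable_fun setT (fun s : R => t - s).
    by apply: measurable_funB; [exact: measurable_cst|exact: measurable_id].
  by move=> /(_ measurableT _ (mD x)); rewrite setTI.
by apply/seteqP; split => w /= [] => [+ <-|<-].
Qed.

Lemma past_stays n k : (k <= n.+1)%N -> past Y S n (stays k).
Proof.
elim: k => [_|k IH kn].
  rewrite (_ : stays 0 = setT); first exact: (@measurableT _ (g_sigma_algebraType (past_gen Y S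
    n))).
  by apply/seteqP; split.
have kn' : (k <= n)%N by [].
rewrite (_ : stays k.+1 = stays k `&` [set w | D (Y k w) (t - jump_time S k w)]).
  apply: (@measurableI _ (g_sigma_algebraType (past_gen Y S n))); first by apply: IH; exact: ltnW.
  exact: past_stay1.
apply/seteqP; split => w /= H; first by split; [move=> j jk; apply: H; exact: ltnW|exact: H].
move=> j; rewrite ltnS leq_eqVlt => /orP[/eqP ->|jk]; first exact: H.2.
exact: H.1.
Qed.

Definition exits n : set Omega := stays n `&` [set w | ~ D (Y n w) (t - jump_time S n w)].

Lemma measurable_exits n : measurable (exits n).
Proof.
apply: measurableI; first by apply: (past_measurable law); exact: (@past_stays n).
by apply: measurableC; apply: (past_measurable law); exact: (@past_stay1 n).
Qed.

(** Expected value of [u] at the n-th jump, on the event that [D] was left at no earlier jump and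
    [t] is not yet passed. What disappears at step [n] is collected in [exit_value], when [D] is
    left, and in [final_value], when [t] falls in the n-th holding time. *)
Definition running n : \bar R :=
  (\int[P]_(w in stays n) (if jump_time S n w <= t then u (t - jump_time S n w) (Y n w) else
    0)%:E)%E.
Definition exit_value n : \bar R :=
  (\int[P]_(w in exits n) (if jump_time S n w <= t then u (t - jump_time S n w) (Y n w) else
    0)%:E)%E.
Definition final_value n : \bar R :=
  (\int[P]_(w in stays n.+1) (if jump_time S n w <= t < jump_time S n.+1 w then u 0 (Y n w) else
    0)%:E)%E.

Let mJle n : measurable_fun setT (fun w => jump_time S n w <= t).
Proof. by apply: measurable_fun_ler => //; exact: measurable_cst. Qed.

Let mrun n : measurable_fun setT (fun w => (if jump_time S n w <= t then u (t - jump_time S n w)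
  (Y n w) else 0)%:E).
Proof.
apply/measurable_EFinP; apply: measurable_fun_ifT => //.
apply: (@measurable_fun_fibers _ _ _ _ _ (Y n) (fun x w => u (t - jump_time S n w) x)) => x;
  first exact: mY.
by apply: (measurableT_comp (mu x)); apply: measurable_funB.
Qed.

Let mfin n : measurable_fun setT (fun w => (if jump_time S n w <= t < jump_time S n.+1 w then u
  0 (Y n w) else 0)%:E).
Proof.
apply/measurable_EFinP; apply: measurable_fun_ifT => //.
  apply: measurable_and => //; apply: measurable_fun_ltr => //; exact: measurable_cst.
apply: (@measurable_fun_fibers _ _ _ _ _ (Y n) (fun x w => u 0 x)) => // x; exact: mY.
Qed.

Let run_ge0 n w : (0 <= (if jump_time S n w <= t then u (t - jump_time S n w) (Y n w) else 0)%:E)%E.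
Proof. by rewrite lee_fin; case: ifP. Qed.

Lemma running_split n : running n = (exit_value n +
  \int[P]_(w in stays n.+1) (if jump_time S n w <= t then u (t - jump_time S n w) (Y n w) else
    0)%:E)%E.
Proof.
have mS1 : measurable (stays n.+1) by apply: (past_measurable law); exact: (@past_stays n).
have -> : running n = (\int[P]_(w in exits n `|` stays n.+1)
    (if jump_time S n w <= t then u (t - jump_time S n w) (Y n w) else 0)%:E)%E.
  congr integral; apply/seteqP; split => w.
    move=> sw; have [Dw|Dw] := pselect (D (Y n w) (t - jump_time S n w)); last by left.
    by right=> j; rewrite ltnS leq_eqVlt => /orP[/eqP ->//|]; exact: sw.
  by case=> [[]//|sw] j jn; apply: sw; exact: ltnW.
rewrite ge0_integral_setU//.
- exact: measurable_exits.
- exact: measurable_funTS.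
- by apply/disj_setPS => w [[_ /= nD] /(_ n (leqnn _))].
Qed.

Lemma payoff_split n : (\int[P]_(w in stays n.+1) (payoff_at n w)%:E =
  final_value n + running n.+1)%E.
Proof.
have mS1 : measurable (stays n.+1) by apply: (past_measurable law); exact: (@past_stays n).
rewrite -ge0_integralD//.
- apply: eq_integral => w _; rewrite -EFinD; congr EFin.
  have JE : jump_time S n.+1 w = jump_time S n w + S n w by rewrite /jump_time big_ord_recr.
  rewrite /payoff_at /payoff/= -JE.
  have [J1|J1] := leP (jump_time S n.+1 w) t; first by rewrite andbF add0r.
  by rewrite andbT addr0.
- by move=> w _; rewrite lee_fin; case: ifP.
- exact: measurable_funTS.
- exact: measurable_funTS.
Qed.

Lemma running0 : running 0 = (u t x0)%:E.
Proof.
rewrite -(@integral_start (fun y => (u t y)%:E)); last by move=> y; rewrite lee_fin.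
rewrite /running (_ : stays 0 = setT); last by apply/seteqP; split.
by apply: eq_integral => w _; rewrite /jump_time big_ord0 t_ge0 subr0.
Qed.

(** A supersolution is a supermartingale along the jumps: [payoff_step] turns the value after one
    step into [mild]. *)
Lemma running_le : (forall x s, D x s -> 0 <= s <= t -> (mild s x <= (u s x)%:E)%E) ->
  forall n, (exit_value n + final_value n + running n.+1 <= running n)%E.
Proof.
move=> umild n; rewrite (running_split n) -addeA -payoff_split; apply: leeD => //.
have pS1 := past_stays (leqnn n.+1).
have mS1 := past_measurable law pS1.
rewrite (payoff_step pS1); apply: ge0_le_integral => //.
- by move=> w _; case: ifPn => // jt; rewrite mild_ge0// subr_ge0.
- apply: measurable_funTS.
  apply: (@measurable_fun_fibers _ _ _ _ _ (Y n) (fun x w => if jump_time S n w <= t then mild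
    (t - jump_time S n w) x else 0%E)) => x; last exact: measurable_mild.
  exact: mY.
- exact: measurable_funTS.
- move=> w sw; case: ifPn => // jt; apply: umild; first exact: sw.
  rewrite subr_ge0 jt/= gerBl.
  by rewrite /jump_time sumr_ge0// => k _; exact: ltW.
Qed.

Lemma running_eq : (forall x s, D x s -> 0 <= s <= t -> mild s x = (u s x)%:E) ->
  forall n, (exit_value n + final_value n + running n.+1 = running n)%E.
Proof.
move=> umild n; rewrite (running_split n) -addeA -payoff_split; congr (_ + _)%E.
have pS1 := past_stays (leqnn n.+1).
rewrite (payoff_step pS1); apply: eq_integral => w; rewrite inE => sw.
case: ifPn => // jt; apply: umild; first exact: sw.
rewrite subr_ge0 jt/= gerBl.
by rewrite /jump_time sumr_ge0// => k _; exact: ltW.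
Qed.

Let exit_value_ge0 n : (0 <= exit_value n)%E. Proof. exact: integral_ge0. Qed.
Let final_value_ge0 n : (0 <= final_value n)%E.
Proof. by apply: integral_ge0 => w _; rewrite lee_fin; case: ifP. Qed.

(** Telescopes [running_le]; the remainder [running N] is nonnegative. *)
Lemma supersolution_bound :
  (forall x s, D x s -> 0 <= s <= t -> (mild s x <= (u s x)%:E)%E) ->
  (\sum_(n <oo) (exit_value n + final_value n) <= (u t x0)%:E)%E.
Proof.
move=> umild; have H N : (\sum_(0 <= n < N) (exit_value n + final_value n) + running N <=
  running 0)%E.
  elim: N => [|N IH]; first by rewrite big_geq// add0e.
  by apply: le_trans IH; rewrite big_nat_recr//= -addeA leeD2l// running_le.
rewrite -running0; apply: lime_le.
  by apply: is_cvg_nneseries => n _ _; rewrite adde_ge0.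
apply: nearW => N; apply: le_trans (H N); apply: leeDl.
exact: integral_ge0.
Qed.

Lemma jump_time_mono w m n : (m <= n)%N -> jump_time S m w <= jump_time S n w.
Proof.
elim: n => [|n IH]; first by rewrite leqn0 => /eqP ->.
rewrite leq_eqVlt => /orP[/eqP ->//|]; rewrite ltnS => /IH mn.
by apply: le_trans mn _; rewrite {2}/jump_time big_ord_recr/= lerDl ltW.
Qed.

Definition final_event (E : pred T) n : set Omega :=
  stays n.+1 `&` [set w | jump_time S n w <= t < jump_time S n.+1 w] `&` [set w | E (Y n w)].

Let mE (E : pred T) n : measurable [set w | E (Y n w)].
Proof.
rewrite (_ : mkset _ = \bigcup_i (if @pickle_inv T i is Some c then if E c then [set w | Y n w =
  c] else set0 else set0)).
  by apply: bigcupT_measurable => i; case: pickle_inv => // c; case: ifP => // _; exact: mY.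
apply/seteqP; split => w /=; last by move=> [i _]; case: pickle_inv => // c; case: ifP => // Ec
  /= ->.
by move=> Ew; exists (choice.pickle (Y n w)) => //; rewrite pickleK_inv Ew.
Qed.

Lemma measurable_final_event E n : measurable (final_event E n).
Proof.
rewrite /final_event; apply: measurableI; last exact: mE.
apply: measurableI; first by apply: (past_measurable law); exact: (@past_stays n).
have : measurable_fun setT (fun w => jump_time S n w <= t < jump_time S n.+1 w).
  by apply: measurable_and => //; apply: measurable_fun_ltr => //; exact: measurable_cst.
by move=> /(_ measurableT [set true]) ; rewrite setTI; apply.
Qed.

Lemma trivIset_final_event E : trivIset setT (final_event E).
Proof.
apply/trivIsetP => i j _ _ ij; apply/seteqP; split => // w [[[_ /= /andP[i1 i2]] _] [[_ /=
  /andP[j1 j2]] _]].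
have [lij|lji] := ltnP i j.
  by have := jump_time_mono w lij; rewrite leNgt (le_lt_trans j1 i2).
have {}lji : (j < i)%N by rewrite ltn_neqAle eq_sym ij.
by have := jump_time_mono w lji; rewrite leNgt (le_lt_trans i1 j2).
Qed.

(** Telescopes [running_eq]. Nothing is collected on leaving [D], since [u] vanishes there, and the
    indicator of [E] is collected at time [t]; the remainder is at most the probability of [n] jumps
    before [t], and tends to 0. *)
Lemma solution_prob (E : pred T) :
  (forall x s, D x s -> 0 <= s <= t -> mild s x = (u s x)%:E) ->
  (forall x s, ~ D x s -> u s x = 0) -> (forall x, D x 0 -> u 0 x = (E x)%:R) ->
  (forall x s, u s x <= 1) ->
  (forall x s, D x 0 = D x s) ->
  P [set w | jump_time S n w <= t] @[n --> \oo] --> 0%E ->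
  P (\bigcup_n final_event E n) = (u t x0)%:E.
Proof.
move=> umild uD u0 u1 Dc Jt.
have ex0 n : exit_value n = 0%E.
  by apply: integral0_eq => w [_ /= nD]; rewrite uD//; case: ifP.
have fin n : final_value n = P (final_event E n).
  rewrite -(setIidl (subsetT (final_event E n))) -integral_indic//; last exact:
    measurable_final_event.
  have mS1 : measurable (stays n.+1) by apply: (past_measurable law); exact: (@past_stays n).
  rewrite /final_value [LHS]integral_mkcond; apply: eq_integral => w _.
  rewrite patchE indicE; case: ifPn => [|/negP nw].
    rewrite inE => sw; congr EFin; case: ifPn => Jw; last first.
      rewrite (_ : (w \in _) = false)//; apply/negP; rewrite inE => -[[_ /=]].
      by rewrite (negbTE Jw).
    rewrite u0; last by rewrite (Dc _ (t - jump_time S n w)); exact: sw.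
    congr ((nat_of_bool _)%:R); apply/idP/idP => [Ew|]; first by rewrite inE; split => //.
    by rewrite inE => -[].
  rewrite (_ : (w \in _) = false)//; apply/negP; rewrite inE => -[[sw _] _]; apply: nw.
  by rewrite inE.
have run0 : running n @[n --> \oo] --> 0%E.
  apply: (@squeeze_cvge _ _ _ _ (cst 0%E) _ (fun n => P [set w | jump_time S n w <= t])) => //;
    last exact: cvg_cst.
  apply: nearW => n; apply/andP; split; first exact: integral_ge0.
  have mJ' : measurable [set w | jump_time S n w <= t].
    by have := @mJle n measurableT [set true]; rewrite setTI; apply.
  have mSn : measurable (stays n) by apply: (past_measurable law); exact: (@past_stays n).
  rewrite -(setIidl (subsetT [set w | jump_time S n w <= t])) -integral_indic//.
  rewrite /running [leLHS]integral_mkcond; apply: ge0_le_integral => //.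
  - by move=> w _; rewrite erestrict_ge0.
  - apply/(measurable_restrictT _ _).1 => //; exact: measurable_funTS.
  - by apply/measurable_EFinP; exact: measurable_indic.
  move=> w _; rewrite patchE indicE; case: ifPn => _; last by rewrite lee_fin.
  rewrite lee_fin; case: ifPn => Jw; last by rewrite ler0n.
  by rewrite mem_set.
have sumE N : (\sum_(0 <= n < N) P (final_event E n) + running N = (u t x0)%:E)%E.
  rewrite -running0; elim: N => [|N IH]; first by rewrite big_geq// add0e.
  rewrite -IH big_nat_recr//= -addeA; congr (_ + _)%E.
  by rewrite -(running_eq umild N) ex0 add0e fin.
have cvs : (\sum_(0 <= n < N) P (final_event E n))%E @[N --> \oo] --> P (\bigcup_n final_event E n).
  apply: measure_semi_sigma_additive.
  - by move=> n; exact: measurable_final_event.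
  - exact: trivIset_final_event.
  - by apply: bigcupT_measurable => n; exact: measurable_final_event.
have : ((\sum_(0 <= n < N) P (final_event E n) + running N)%E @[N --> \oo] --> P (\bigcup_n
  final_event E n) + 0)%E.
  by apply: cvgeD => //; rewrite ?fin_num_adde_defl.
rewrite adde0; under eq_fun do rewrite sumE.
by move=> H; apply: (cvg_unique (@ereal_hausdorff R) H); exact: cvg_cst.
Qed.

(** A maximal inequality: whenever [D] is left by time [t], a value of at least 1 is collected. *)
Lemma exit_prob : 
  (forall x s, D x s -> 0 <= s <= t -> (mild s x <= (u s x)%:E)%E) ->
  (forall x s, ~ D x s -> 0 <= s <= t -> 1 <= u s x) ->
  (P (\bigcup_n (exits n `&` [set w | (jump_time S n w <= t)%R])) <= (u t x0)%:E)%E.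
Proof.
move=> umild u1; apply: le_trans (supersolution_bound umild).
have mJ' n : measurable [set w | jump_time S n w <= t].
  by have := @mJle n measurableT [set true]; rewrite setTI; apply.
have mX n : measurable (exits n `&` [set w | jump_time S n w <= t]).
  by apply: measurableI => //; exact: measurable_exits.
rewrite measure_bigcup//; last first.
  apply/trivIsetP => i j _ _ ij; apply/seteqP; split => // w [[[si /= ni] _] [[sj /= nj] _]].
  have [lij|lji] := ltnP i j; first exact/ni/sj.
  by apply: nj; apply: si; rewrite ltn_neqAle eq_sym ij.
rewrite (@eq_eseriesl _ _ xpredT); last by move=> n; rewrite in_setT.
apply: lee_nneseries => // n _.
apply: (@le_trans _ _ (exit_value n)); last by rewrite leeDl.
rewrite -(setIidl (subsetT (exits n `&` _))) -integral_indic//.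
rewrite /exit_value [leRHS]integral_mkcond; apply: ge0_le_integral => //.
- by apply/measurable_EFinP; exact: measurable_indic.
- by apply/(measurable_restrictT _ _).1; [exact: measurable_exits|exact: measurable_funTS].
move=> w _; rewrite patchE indicE.
have [wE|wE] := boolP (w \in exits n); last first.
  rewrite (_ : (w \in _) = false)//; apply/negP; rewrite inE => -[ew _].
  by move/negP: wE; apply; rewrite inE.
have [Jw|Jw] := leP (jump_time S n w) t; last first.
  rewrite (_ : (w \in _) = false)//; apply/negP; rewrite inE => -[_ /=].
  by rewrite leNgt Jw.
rewrite lee_fin (@le_trans _ _ 1)//; first by case: (w \in _).
apply: u1; first by move: wE; rewrite inE => -[].
by rewrite subr_ge0 Jw/= gerBl /jump_time sumr_ge0// => k _; exact: ltW.
Qed.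

End verification.
End jump_step.

(** * From differential equations to the mild form *)

Section ode_mild.
Context {R : realType} {T : countType} (q : T -> T -> R) (succ : T -> seq T).
Local Notation leb := (@lebesgue_measure R).

Lemma integral_exp_convol (c k s : R) (g : R -> R) : continuous g ->
  (\int[leb]_(r in `[0%R, s]) (c * exp_pdf k r * g (s - r))%:E =
   (c * convol (fun r => k * expR (- (k * r))) g s)%:E)%E.
Proof.
move=> cg; pose e := fun r : R => k * expR (- (k * r)).
have ce : continuous e by apply: continuousZ_; apply: continuous_expR_; apply: continuousN_;
  apply: continuousZ_; exact: continuous_id_.
have cb : continuous (fun r => e r * g (s - r)) by exact: continuous_convol_body.
have mb : measurable_fun setT (fun r => (c * exp_pdf k r * g (s - r))%:E : \bar R).
  apply/measurable_EFinP; apply: measurable_funM; last first.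
    by apply: measurable_continuous; exact: continuous_refl_.
  by apply: measurable_funM; [exact: measurable_cst|exact: measurable_exp_pdf].
rewrite -/e /convol -integral_segZ// integral_segE; last exact: continuousZ_.
rewrite -[LHS]integral_itv_obnd_cbnd; last exact: measurable_funTS.
rewrite -[RHS]integral_itv_obnd_cbnd; last first.
  by apply/measurable_EFinP; apply: measurable_funTS; apply: measurable_continuous; exact:
    continuousZ_.
apply: eq_integral => r; rewrite inE/= in_itv/= => /andP[r0 _].
by rewrite /exp_pdf r0 /e !mulrA.
Qed.

Variable u : R -> T -> R.
Hypothesis cu : forall y, continuous (u^~ y).
Hypothesis rate_gt0 : forall x, 0 < exit_rate q x.

Lemma mildE s x : mild q succ u s x =
  (expR (- (exit_rate q x * s)) * u 0 x +
   convol (fun r => expR (- (exit_rate q x * r)))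
     (fun r => \sum_(y <- succ x) exit_rate q x * jump_prob q x y * u r y) s)%:E.
Proof.
have ce : continuous (fun r => expR (- (exit_rate q x * r))).
  by apply: continuous_expR_; apply: continuousN_; apply: continuousZ_; exact: continuous_id_.
have csum (l : seq T) (c : T -> R) : continuous (fun r => \sum_(y <- l) c y * u r y).
  elim: l => [|y l IH]; first by under eq_fun do rewrite big_nil; exact: continuous_cst_.
  by under eq_fun do rewrite big_cons; apply: continuousD_ => //; exact: continuousZ_.
rewrite /mild EFinD; congr (_ + _)%E.
transitivity (\sum_(y <- succ x) (exit_rate q x * jump_prob q x y * convol (fun r => expR (-
  (exit_rate q x * r))) (u^~ y) s)%:E)%E.
  apply: eq_bigr => y _; rewrite (@integral_exp_convol _ _ s (u^~ y) (@cu y)) convolZl//.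
  by congr EFin; rewrite mulrA [jump_prob _ _ _ * _]mulrC.
rewrite sumEFin; congr EFin.
elim: (succ x) => [|y l IH].
  rewrite big_nil; under eq_convol => [r _|r _]; [over|rewrite big_nil; over|].
  by rewrite convolC//; [rewrite -(mul0r 1) convolZl ?mul0r//; exact: continuous_cst_|exact:
    continuous_cst_].
rewrite big_cons IH -convolZr//.
rewrite -convolDr//; last exact: continuousZ_.
by apply: eq_convol => r _ //; rewrite big_cons.
Qed.

(** The convolution of [f] with the exponential is differentiated in two ways, once on each factor,
    and the results are equated. *)
Lemma variation_of_constants (k : R) (f f' : R -> R) s : has_deriv f f' -> 0 <= s ->
  f s = expR (- (k * s)) * f 0 + convol (fun r => expR (- (k * r))) (fun r => f' r + k * f r) s.
Proof.
move=> df; have [cf cf' _] := df; pose e := fun r : R => expR (- (k * r)).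
have He : has_deriv e (fun r => - k * e r).
  exact: (has_deriv_expN k).
have [ce ce' _] := He.
rewrite le_eqVlt => /predU1P[<-|s0].
  by rewrite convol_le0// mulr0 oppr0 expR0 mul1r addr0.
have [_ _ /(_ s s0) d1] := has_deriv_convol df ce.
have [_ _ /(_ s s0) d2] := has_deriv_convol He cf.
have E : convol f e = convol e f by apply/funext => t; rewrite convolC.
rewrite E in d1.
have := @derive_val _ _ _ _ _ _ _ d1; rewrite (@derive_val _ _ _ _ _ _ _ d2).
rewrite {1}/e mulr0 oppr0 expR0 mul1r -/e convolZl// mulNr => H.
rewrite convolDr//; last exact: continuousZ_.
rewrite convolZr// (convolC s ce cf').
rewrite -/(e s) addrA [e s * _]mulrC -H; ring.
Qed.

Lemma mild_solution x h s : has_deriv (u^~ x) h -> 0 <= s ->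
  (forall r, 0 <= r -> h r = \sum_(y <- succ x) exit_rate q x * jump_prob q x y * u r y -
    exit_rate q x * u r x) ->
  mild q succ u s x = (u s x)%:E.
Proof.
move=> dh s0 hE; rewrite mildE; congr EFin.
rewrite [RHS](variation_of_constants (exit_rate q x) dh s0); congr (_ + _).
by apply: eq_convol => r /andP[r0 _] //; rewrite hE// subrK.
Qed.

Lemma mild_supersolution x h s : has_deriv (u^~ x) h -> 0 <= s ->
  (forall r, 0 <= r -> \sum_(y <- succ x) exit_rate q x * jump_prob q x y * u r y - exit_rate q
    x * u r x <= h r) ->
  (mild q succ u s x <= (u s x)%:E)%E.
Proof.
move=> dh s0 hE; rewrite mildE lee_fin.
rewrite [leRHS](variation_of_constants (exit_rate q x) dh s0) lerD2l.
have [cf ch _] := dh.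
have ce : continuous (fun r => expR (- (exit_rate q x * r))).
  by apply: continuous_expR_; apply: continuousN_; apply: continuousZ_; exact: continuous_id_.
have csum : continuous (fun r => \sum_(y <- succ x) exit_rate q x * jump_prob q x y * u r y).
  elim: (succ x) => [|y l IH]; first by under eq_fun do rewrite big_nil; exact: continuous_cst_.
  by under eq_fun do rewrite big_cons; apply: continuousD_ => //; exact: continuousZ_.
have ch' : continuous (fun r => h r + exit_rate q x * u r x) by apply: continuousD_ => //;
  exact: continuousZ_.
rewrite -subr_ge0 -convolBr//; apply: convol_ge0 => r /andP[r0 _]; first exact: expR_ge0.
by rewrite subr_ge0 -lerBlDr hE.
Qed.

Lemma mild_ext (u' : R -> T -> R) s x : 0 <= s -> (forall r y, 0 <= r <= s -> u r y = u' r y) ->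
  mild q succ u s x = mild q succ u' s x.
Proof.
move=> s0 uu'; rewrite /mild uu' ?lexx//; congr (_ + _)%E.
apply: eq_bigr => y _; apply: eq_integral => r; rewrite inE/= in_itv/= => /andP[r0 rs].
by rewrite uu'// subr_ge0 rs gerBl.
Qed.

End ode_mild.

(** * Comparison and gluing of supersolutions *)

Section mild_comparison.
Context {R : realType} {T : countType} (q : T -> T -> R) (succ : T -> seq T).
Local Notation leb := (@lebesgue_measure R).
Hypothesis rate_gt0 : forall x, 0 < exit_rate q x.
Hypothesis jp_ge0 : forall x y, 0 <= jump_prob q x y.
Implicit Types u v g F : R -> T -> R.

Let mbody v x y s : measurable_fun setT (v^~ y) ->
  measurable_fun setT (fun r => (jump_prob q x y * exp_pdf (exit_rate q x) r * v (s - r) y)%:E :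
    \bar R).
Proof.
move=> mv; apply/measurable_EFinP; apply: measurable_funM; last first.
  by apply: (measurableT_comp mv); apply: measurable_funB; [exact: measurable_cst|exact:
    measurable_id].
by apply: measurable_funM; [exact: measurable_cst|exact: measurable_exp_pdf].
Qed.

Let body_ge0 v x y s r : (forall s y, 0 <= v s y) ->
  (0 <= (jump_prob q x y * exp_pdf (exit_rate q x) r * v (s - r) y)%:E)%E.
Proof. by move=> v0; rewrite lee_fin mulr_ge0// mulr_ge0// exp_pdf_ge0. Qed.

Lemma le_mild u v s x : 0 <= s -> (forall r y, 0 <= u r y) ->
  (forall y, measurable_fun setT (u^~ y)) -> (forall y, measurable_fun setT (v^~ y)) ->
  (forall r y, 0 <= r <= s -> u r y <= v r y) -> (mild q succ u s x <= mild q succ v s x)%E.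
Proof.
move=> s0 u0 mu mv uv; apply: leeD.
  by rewrite lee_fin ler_wpM2l ?expR_ge0// uv// lexx.
apply: lee_sum => y _; apply: ge0_le_integral => //.
- by move=> r _; exact: body_ge0.
- by apply: measurable_funTS; exact: mbody.
- by apply: measurable_funTS; exact: mbody.
move=> r /=; rewrite in_itv/= => /andP[r0 rs].
rewrite lee_fin ler_wpM2l// ?mulr_ge0// ?exp_pdf_ge0// uv//.
by rewrite subr_ge0 rs gerBl.
Qed.

Definition concat g F (s : R) (x : T) : R := if s <= 1 then g s x else F (s - 1) x.

Lemma measurable_concat g F x : continuous (g^~ x) -> continuous (F^~ x) -> measurable_fun setT
  (concat g F ^~ x).
Proof.
move=> cg cF; apply: measurable_fun_ifT.
- by apply: measurable_fun_ler; [exact: measurable_id|exact: measurable_cst].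
- exact: measurable_continuous.
- apply: (measurableT_comp (measurable_continuous cF)).
  by apply: measurable_funB; [exact: measurable_id|exact: measurable_cst].
Qed.

(* Gluing at time 1 is the semigroup property. *)
Lemma mild_concat g F s x :
  (forall y, continuous (g^~ y)) -> (forall y, continuous (F^~ y)) ->
  (forall r y, 0 <= g r y) -> (forall r y, 0 <= F r y) ->
  (forall r, 0 <= r <= 1 -> (mild q succ g r x <= (g r x)%:E)%E) ->
  (forall r, 0 <= r -> (mild q succ F r x <= (F r x)%:E)%E) ->
  g 1 x <= F 0 x -> 0 <= s ->
  (mild q succ (concat g F) s x <= (concat g F s x)%:E)%E.
Proof.
move=> cg cF g0 F0 gm Fm gF s0; have [s1|s1] := leP s 1.
  have -> : mild q succ (concat g F) s x = mild q succ g s x.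
    by apply: mild_ext => // r y /andP[_ rs]; rewrite /concat (le_trans rs).
  by rewrite /concat s1; apply: gm; rewrite s0.
have c0 r y : 0 <= concat g F r y by rewrite /concat; case: ifP.
have mc y : measurable_fun setT (concat g F ^~ y) by exact: measurable_concat.
have s10 : 0 <= s - 1 by rewrite subr_ge0 ltW.
pose e (r : R) := expR (- (exit_rate q x * r)).
have ce : continuous e by apply: continuous_expR_; apply: continuousN_; apply: continuousZ_;
  exact: continuous_id_.
pose c y := exit_rate q x * jump_prob q x y.
(* The first jump falls either in the first [s - 1] units of time, where [F] is in force, or in the
   last unit, where the integrand is the one for [g] delayed by [s - 1]. *)
have piece y : (\int[leb]_(r in `[0%R, s]) (jump_prob q x y * exp_pdf (exit_rate q x) r * concat
  g F (s - r) y)%:E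
   <= (c y * convol e (F^~ y) (s - 1) + e (s - 1) * (c y * convol e (g^~ y) 1))%:E)%E.
  rewrite (_ : [set` `[0%R, s]] = `[0, s - 1[%classic `|` `[s - 1, s]%classic); last first.
    apply/seteqP; split => r /=; rewrite !in_itv/=.
      by move=> /andP[r0 rs]; have [?|?] := ltP r (s - 1); [left; rewrite r0|right; rewrite rs].
    by move=> [/andP[-> rs]|/andP[rs ->]]; [rewrite (le_trans (ltW rs)) ?gerBl|rewrite (le_trans
      s10)].
  rewrite ge0_integral_setU//; last 3 first.
  - by apply: measurable_funTS; exact: mbody.
  - by move=> r _; exact: body_ge0.
  - by apply/disj_setPS => r [/=]; rewrite !in_itv/= => /andP[_ rs] /andP[]; rewrite leNgt rs.
  rewrite EFinD; apply: leeD.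
    have -> : (c y * convol e (F^~ y) (s - 1))%:E = (\int[leb]_(r in `[0%R, (s - 1)%R])
        (jump_prob q x y * exp_pdf (exit_rate q x) r * F (s - 1 - r) y)%:E)%E.
      rewrite (@integral_exp_convol R _ _ (s - 1) (F^~ y))// convolZl// /c; congr EFin.
      by rewrite mulrA [jump_prob _ _ _ * _]mulrC.
    apply: (@le_trans _ _ (\int[leb]_(r in `[0%R, (s - 1)%R[) (jump_prob q x y * exp_pdf
      (exit_rate q x) r * F (s - 1 - r) y)%:E)%E).
      rewrite le_eqVlt; apply/orP; left; apply/eqP/eq_integral => r; rewrite inE/= in_itv/= =>
        /andP[r0 rs]; rewrite /concat.
      by rewrite leNgt ltrBrDl -ltrBrDr rs/= addrAC.
    apply: ge0_subset_integral => //.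
    - by apply: measurable_funTS; apply: (mbody (v := F)); exact: measurable_continuous.
    - by move=> r _; rewrite lee_fin mulr_ge0// mulr_ge0// exp_pdf_ge0.
    - by apply: subset_itv => //; rewrite bnd_simp.
  pose f r := e (s - 1) * (c y * (e r * g (1 - r) y)).
  have cf : continuous f.
    by do 2 apply: continuousZ_; exact: (continuous_convol_body (t := 1) ce (cg y)).
  have -> : e (s - 1) * (c y * convol e (g^~ y) 1) = integral_seg f 0 1.
    rewrite /f integral_segZ; last by apply: continuousZ_; exact: (continuous_convol_body (t :=
      1) ce (cg y)).
    by rewrite integral_segZ//; exact: (continuous_convol_body (t := 1) ce (cg y)).
  have -> : integral_seg f 0 1 = integral_seg (fun r => f (r - (s - 1))) (s - 1) s.
    rewrite integral_seg_shift ?gerBl// subrr; congr (integral_seg f 0 _); ring.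
  rewrite integral_segE; last first.
    apply: (@continuous_comp_ R f (fun r => r - (s - 1))) => //.
    by apply: continuousB_; [exact: continuous_id_|exact: continuous_cst_].
  rewrite le_eqVlt; apply/orP; left; apply/eqP/eq_integral => r; rewrite inE/= in_itv/= =>
    /andP[rs rs'].
  have r0 : 0 < r by rewrite (lt_le_trans _ rs)// subr_gt0.
  congr EFin; rewrite /concat lerBlDr -lerBlDl rs /exp_pdf r0 /f /c.
  rewrite (_ : 1 - (r - (s - 1)) = s - r); last by ring.
  have -> : expR (- (exit_rate q x * r)) = e (s - 1) * e (r - (s - 1)).
    by rewrite /e -expRD; congr expR; ring.
  by ring.
apply: (@le_trans _ _ ((e s * g 0 x)%:E + \sum_(y <- succ x) (c y * convol e (F^~ y) (s - 1) + e
  (s - 1) * (c y * convol e (g^~ y) 1))%:E)%E).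
  apply: leeD; first by rewrite /concat ler01.
  by apply: lee_sum => y _; exact: piece.
have := gm 1; rewrite lexx ler01 => /(_ isT); have := Fm _ s10.
have conv_sum v t : (forall y, continuous (v^~ y)) -> \sum_(y <- succ x) c y * convol e (v^~ y) t =
    convol e (fun r => \sum_(y <- succ x) c y * v r y) t.
  move=> cv.
  have csum (l : seq T) : continuous (fun r => \sum_(y <- l) c y * v r y).
    elim: l => [|y l IH]; first by under eq_fun do rewrite big_nil; exact: continuous_cst_.
    by under eq_fun do rewrite big_cons; apply: continuousD_ => //; exact: continuousZ_.
  elim: (succ x) => [|y l IH].
    rewrite big_nil; under eq_convol => [r _|r _]; [over|rewrite big_nil; over|].
    by rewrite convolC//; [rewrite -(mul0r 1) convolZl ?mul0r//; exact: continuous_cst_|exact: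
      continuous_cst_].
  rewrite big_cons IH -convolZr// -convolDr//; last exact: continuousZ_.
  by apply: eq_convol => r _ //; rewrite big_cons.
rewrite !mildE// sumEFin big_split/= -mulr_sumr !conv_sum// -EFinD !lee_fin -/(e _) -/(e _).
set KF := convol _ _ (s - 1); set Kg := convol _ _ 1 => Fm1 gm1.
have -> : concat g F s x = F (s - 1) x by rewrite /concat leNgt s1.
have eE : e s = e (s - 1) * e 1 by rewrite /e -expRD; congr expR; ring.
have e0 : 0 <= e (s - 1) by exact: expR_ge0.
have H1 : e (s - 1) * (e 1 * g 0 x + Kg) <= e (s - 1) * F 0 x.
  by rewrite ler_wpM2l// (le_trans gm1).
apply: le_trans Fm1; move: H1; rewrite eE -/KF -/Kg mulrDr mulrA /e; lra.
Qed.

End mild_comparison.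

(** * The tree process *)

Section tree_chain.
Context {R : realType}.
Variables (lambda mu : R).
Hypotheses (lambda_gt0 : 0 < lambda) (mu_ge0 : 0 <= mu).
Local Notation Q := (tree_rate lambda mu).

Definition succ_tree (x : tree) : seq tree :=
  undup ([seq add_leaf x v | v <- enum_fset x] ++
    [seq del_leaf x v | v <- enum_fset x & deletable x v]).

Lemma add_leaf_succ (x : tree) v : v \in enum_fset x -> add_leaf x v \in succ_tree x.
Proof. by move=> vx; rewrite mem_undup mem_cat map_f. Qed.

Lemma del_leaf_succ (x : tree) v : v \in enum_fset x -> deletable x v -> del_leaf x v \in
  succ_tree x.
Proof. by move=> vx dv; rewrite mem_undup mem_cat map_f ?orbT// mem_filter dv. Qed.

Lemma succ_tree_neq (x y : tree) : y \in succ_tree x -> y != x.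
Proof.
rewrite mem_undup mem_cat => /orP[|] /mapP[v].
  by move=> vx ->; exact: add_leaf_neq.
by rewrite mem_filter => /andP[dv _] ->; exact: del_leaf_neq.
Qed.

Lemma tree_rate_succ (x y : tree) : y \notin succ_tree x -> Q x y = 0.
Proof.
move=> yx; rewrite /tree_rate !big1_seq ?addr0//.
  move=> v /andP[dv vx]; case: eqP => [yE|]; last by rewrite mulr0.
  by move: yx; rewrite yE del_leaf_succ.
move=> v /andP[_ vx]; case: eqP => [yE|]; last by rewrite mulr0.
by move: yx; rewrite yE add_leaf_succ.
Qed.

Lemma exit_rate_gt0 (x : tree) : 0 < exit_rate Q x.
Proof.
rewrite exit_rate_tree ltr_pwDl ?mulrn_wge0// pmulrn_lgt0// cardfs_gt0.
by apply/fset0Pn; exists root_vertex; exact: root_in.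
Qed.

Lemma tree_rate_ge0 (x y : tree) : 0 <= Q x y.
Proof.
rewrite addr_ge0// sumr_ge0// => v _; rewrite mulr_ge0 ?ler0n// ltW//.
Qed.

Lemma tree_jump_ge0 (x y : tree) : 0 <= jump_prob Q x y.
Proof. by rewrite /jump_prob; case: ifP => // _; rewrite divr_ge0 ?tree_rate_ge0// ltW//
  exit_rate_gt0. Qed.

Lemma tree_jump_succ (x y : tree) : y \notin succ_tree x -> jump_prob Q x y = 0.
Proof. by move=> yx; rewrite /jump_prob tree_rate_succ// mul0r if_same. Qed.

Lemma rate_jump (x y : tree) : y \in succ_tree x -> exit_rate Q x * jump_prob Q x y = Q x y.
Proof.
move=> yx; rewrite /jump_prob (negbTE (succ_tree_neq yx)) mulrC divfK//.
by rewrite gt_eqF// exit_rate_gt0.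
Qed.

Lemma sum_indic (I : Type) (T : eqType) (r : seq I) (K : pred I) (s : seq T)
    (f : I -> T) (c : R) (phi : T -> R) : uniq s -> (forall i, K i -> f i \in s) ->
  \sum_(y <- s) (\sum_(i <- r | K i) c * (y == f i)%:R) * phi y = \sum_(i <- r | K i) c * phi (f i).
Proof.
move=> us fs; under eq_bigr do rewrite mulr_suml.
rewrite exchange_big; apply: eq_bigr => i Ki.
rewrite (bigD1_seq (f i)) ?fs//= eqxx mulr1 big1 ?addr0// => y /negbTE ->.
by rewrite mulr0 mul0r.
Qed.

Lemma tree_sum (x : tree) (phi : tree -> R) :
  \sum_(y <- succ_tree x) exit_rate Q x * jump_prob Q x y * phi y =
  \sum_(v <- enum_fset x) lambda * phi (add_leaf x v) +
  \sum_(v <- enum_fset x | deletable x v) mu * phi (del_leaf x v).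
Proof.
rewrite big_seq; under eq_bigr => y yx do rewrite rate_jump// /tree_rate mulrDl.
rewrite -big_seq big_split/=; congr (_ + _).
  rewrite big_seq [RHS]big_seq; under eq_bigr do rewrite [\sum_(v <- _) _]big_seq.
  rewrite -big_seq sum_indic//; first exact: undup_uniq.
  by move=> v vx; exact: add_leaf_succ.
under eq_bigr do rewrite big_seq_cond.
rewrite sum_indic -?big_seq_cond//; first exact: undup_uniq.
by move=> v /andP[vx dv]; exact: del_leaf_succ.
Qed.

Lemma tree_exit_sum (x : tree) :
  exit_rate Q x = \sum_(v <- enum_fset x) lambda + \sum_(v <- enum_fset x | deletable x v) mu.
Proof.
by rewrite exit_rate_tree !big_const_seq count_predT !iter_addr_0.
Qed.

Lemma tree_generator (x : tree) (phi : tree -> R) :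
  \sum_(y <- succ_tree x) exit_rate Q x * jump_prob Q x y * phi y - exit_rate Q x * phi x =
  \sum_(v <- enum_fset x) lambda * (phi (add_leaf x v) - phi x) +
  \sum_(v <- enum_fset x | deletable x v) mu * (phi (del_leaf x v) - phi x).
Proof.
rewrite tree_sum tree_exit_sum mulrDl !mulr_suml opprD addrACA.
by congr (_ + _); rewrite -sumrB; apply: eq_bigr => v _; rewrite mulrBr.
Qed.

Lemma tree_jump_sum (x : tree) : \sum_(y <- succ_tree x) jump_prob Q x y = 1.
Proof.
have := tree_generator x (fun=> 1).
rewrite [RHS](_ : _ = 0); last by rewrite !big1 ?addr0// => v _; rewrite subrr mulr0.
move=> /eqP; rewrite subr_eq0 mulr1 => /eqP H.
apply: (@mulfI _ (exit_rate Q x)); first by rewrite gt_eqF// exit_rate_gt0.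
by rewrite mulr1 -{2}H mulr_sumr; apply: eq_bigr => y _; rewrite mulr1.
Qed.

End tree_chain.

Section heights.
Implicit Types (x : tree) (v : vertex).

Lemma height_add_leaf x v : v \in vertices x ->
  height (add_leaf x v) = maxn (height x) (size v).+1.
Proof.
move=> vx; apply/eqP; rewrite eqn_leq; apply/andP; split.
  apply/heightP => w; rewrite vertices_add_leaf// in_fset1U => /orP[/eqP ->|wx].
    by rewrite /fresh_child size_rcons leq_maxr.
  by rewrite leq_max size_le_height.
rewrite geq_max; apply/andP; split.
  by apply/heightP => w wx; apply: size_le_height; rewrite vertices_add_leaf// in_fset1U wx orbT.
rewrite -[(size v).+1](size_rcons v (fresh_index x v)); apply: size_le_height.
by rewrite vertices_add_leaf// in_fset1U eqxx.
Qed.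

Lemma height_add_leafS x v : v \in vertices x -> (height (add_leaf x v) <= (height x).+1)%N.
Proof. by move=> vx; rewrite height_add_leaf// geq_max leqnSn ltnS size_le_height. Qed.

Lemma height_del_leaf x v : deletable x v -> (height (del_leaf x v) <= height x)%N.
Proof.
move=> dv; apply/heightP => w; rewrite vertices_del_leaf// in_fsetD1 => /andP[_ wx].
exact: size_le_height.
Qed.

Lemma height_del_leaf_ge x v : deletable x v -> (height x <= (height (del_leaf x v)).+1)%N.
Proof.
move=> dv; have [vx vr _] := and3P dv; apply/heightP => w wx.
have [->|wv] := eqVneq w v; last first.
  by rewrite leqW//; apply: size_le_height; rewrite vertices_del_leaf// in_fsetD1 wv.
have pv : parent v \in vertices (del_leaf x v).
  rewrite vertices_del_leaf// in_fsetD1; have /andP[_ /allP px] := treeP x.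
  rewrite px// andbT; apply/eqP => /(congr1 size); rewrite size_parent.
  by case: v vr {dv vx wx w} => // a v _ /= /eqP; rewrite -[X in X == _]addn0 -addn1 eqn_add2l.
by have := size_le_height pv; rewrite size_parent; case: (size v).
Qed.

Lemma height_del_leaf_lt x v : deletable x v -> (height (del_leaf x v) < height x)%N ->
  forall w, w \in vertices x -> size w = height x -> w = v.
Proof.
move=> dv lt w wx sw; apply/eqP; apply: contraT => wv.
have : w \in vertices (del_leaf x v) by rewrite vertices_del_leaf// in_fsetD1 wv.
by move=> /size_le_height; rewrite sw leqNgt lt.
Qed.

Lemma height_root_tree : height root_tree = 0%N.
Proof.
apply/eqP; rewrite -leqn0; apply/heightP => v; rewrite in_fset1 => /eqP ->//.
Qed.

Lemma vertex_top x : exists2 v, v \in vertices x & size v = height x.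
Proof.
rewrite /height; have : enum_fset x != [::].
  by apply/eqP => E; have := root_in x; rewrite -[_ \in _]/(_ \in enum_fset x) E.
change (enum_fset x != [::] -> exists2 v, v \in enum_fset x & size v = \max_(v0 <- enum_fset x)
  size v0).
elim: (enum_fset x) => [//|a s IH _]; rewrite big_cons.
have [->|/IH[v vs sv]] := eqVneq s [::].
  by exists a; rewrite ?mem_head// big_nil maxn0.
have [le|lt] := leqP (size a) (\max_(j <- s) size j).
  by exists v; rewrite ?in_cons ?vs ?orbT// sv.
by exists a; rewrite ?mem_head.
Qed.

End heights.

Section clamp.
Context {R : realType}.
Implicit Types f : R -> R.

(* Extends a solution by a constant to negative times, to have functions that
   are continuous on the whole line. *)
Definition clamp f (s : R) : R := f (Num.max s 0).

Lemma clampE f s : 0 <= s -> clamp f s = f s.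
Proof. by move=> s0; rewrite /clamp; case: (leP s 0) => // s0'; congr f; apply/eqP; rewrite
  eq_le s0. Qed.

Lemma continuous_clamp f : continuous f -> continuous (clamp f).
Proof.
move=> cf; apply: (@continuous_comp_ R f (fun s => Num.max s 0)) => // s.
by apply: (@continuous_max _ _ (fun x => x) (fun=> 0)); [exact: cvg_id|exact: cvg_cst].
Qed.

Lemma has_deriv_clamp f f' : has_deriv f f' -> has_deriv (clamp f) (clamp f').
Proof.
move=> df; have [cf cf' _] := df.
apply: has_deriv_ext' (has_deriv_ext df _ _) _ _; try exact: continuous_clamp.
  by move=> t t0; rewrite clampE.
by move=> t t0; rewrite clampE// ltW.
Qed.

Lemma clamp_ge0 f s : (forall r, 0 <= r -> 0 <= f r) -> 0 <= clamp f s.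
Proof. by move=> f0; apply: f0; rewrite le_max lexx orbT. Qed.

Lemma clamp_le f c s : (forall r, 0 <= r -> f r <= c) -> clamp f s <= c.
Proof. by move=> f0; apply: f0; rewrite le_max lexx orbT. Qed.

End clamp.

(** * Solutions of the backward equation on trees *)

Section tree_solutions.
Context {R : realType}.
Variables (lambda mu : R) (Pb : R -> R).
Hypotheses (lambda_gt0 : 0 < lambda) (mu_ge0 : 0 <= mu).
Hypotheses (cP : continuous Pb) (P01 : unit_valued Pb).
Hypothesis PE : forall t, 0 <= t -> Pb t + mu * convol (empty_prob lambda Pb) Pb t = 1.
Local Notation Q := (tree_rate lambda mu).
Local Notation Lf := (low_from lambda mu Pb).
Local Notation Df := (lowdead_from lambda mu Pb).
Implicit Types (x y : tree) (v w : vertex).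

(** The fuel exceeds the height of [x], so that [low_fromE] can exchange it for a larger one common
    to [x] and its successors. *)
Definition low_tree n (s : R) x : R := clamp (Lf (height x).+1 n x [::]) s.

Lemma low_fromE k n x : (height x <= k)%N -> Lf k n x [::] = Lf (height x).+1 n x [::].
Proof.
move=> xk; have H z : z \in vertices x -> prefix [::] z -> (size z <= size ([::] : vertex) +
  height x)%N.
  by move=> zx _; rewrite add0n size_le_height.
by rewrite (low_from_fuel _ _ _ _ xk H) (low_from_fuel _ _ _ _ (leqnSn _) H).
Qed.

Lemma continuous_low_tree n x : continuous (low_tree n ^~ x).
Proof. by apply: continuous_clamp; exact: continuous_low_from. Qed.

Lemma low_tree_ge0 n s x : 0 <= low_tree n s x.
Proof. by apply: clamp_ge0 => r r0; have /andP[] := low_from_bounds lambda_gt0 mu_ge0 cP P01 PE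
  (height x).+1 n x [::] r0. Qed.

Lemma low_tree_le1 n s x : low_tree n s x <= 1.
Proof.
apply: clamp_le => r r0; have /andP[_ H] := low_from_bounds lambda_gt0 mu_ge0 cP P01 PE (height
  x).+1 n x [::] r0.
exact: (le_trans H (low_prob_le1 lambda_gt0 mu_ge0 cP P01 PE _ r0)).
Qed.

Lemma has_deriv_low_tree n x : has_deriv (low_tree n ^~ x)
  (fun r => \sum_(y <- succ_tree x) exit_rate Q x * jump_prob Q x y * low_tree n r y - exit_rate
    Q x * low_tree n r x).
Proof.
have H : has_deriv (Lf (height x).+2 n x [::]) (fun t => gen_below lambda mu x [::] (fun B => Lf
  (height x).+2 n B [::] t)).
  apply: has_deriv_low_from => //; first exact: root_in.
  by move=> z zx _; rewrite add0n ltnW// !ltnS size_le_height.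
have E y : (height y <= (height x).+2)%N -> low_tree n ^~ y = clamp (Lf (height x).+2 n y [::]).
  by move=> yx; rewrite /low_tree low_fromE.
rewrite E; last by rewrite leqW.
apply: (has_deriv_ext' (has_deriv_clamp H)).
  have csum (l : seq tree) (c : tree -> R) : continuous (fun r => \sum_(y <- l) c y * low_tree n
    r y).
    elim: l => [|y l IH]; first by under eq_fun do rewrite big_nil; exact: continuous_cst_.
    by under eq_fun do rewrite big_cons; apply: continuousD_ => //; apply: continuousZ_; exact:
      continuous_low_tree.
  by apply: continuousB_ => //; apply: continuousZ_; exact: continuous_low_tree.
move=> t t0; rewrite tree_generator// clampE ?(ltW t0)// /gen_below.
have Et y : (height y <= (height x).+2)%N -> low_tree n t y = Lf (height x).+2 n y [::] t.
  by move=> yx; rewrite -[LHS]/((low_tree n ^~ y) t) E// clampE// ltW.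
congr (_ + _).
  rewrite big_seq_cond [RHS]big_seq; apply: eq_big => [z|z /andP[zx _]].
    by rewrite prefix0s andbT.
  rewrite !Et ?vertices_add_leaf//; first by rewrite leqW.
  by rewrite (leq_trans (height_add_leafS zx))// ltnW.
rewrite big_seq_cond [RHS]big_seq_cond; apply: eq_big => [z|z /andP[zx /and3P[_ zr dz]]].
  by rewrite prefix0s /= /deletable; case: (z == [::]); rewrite ?andbT ?andbF.
rewrite !Et ?vertices_del_leaf//; first by rewrite leqW.
by rewrite (leq_trans (height_del_leaf dz))// leqW.
Qed.

Lemma low_tree_mild n x s : 0 <= s -> mild Q succ_tree (low_tree n) s x = (low_tree n s x)%:E.
Proof.
move=> s0; apply: (mild_solution _ (has_deriv_low_tree n x) s0) => //.
  by move=> y; exact: continuous_low_tree.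
Qed.

Lemma low_tree0 n x : low_tree n 0 x = (height x < n)%:R.
Proof.
rewrite /low_tree clampE// low_from_time0//; last 2 first.
- exact: root_in.
- by move=> z zx _; rewrite add0n ltnS size_le_height.
congr (nat_of_bool _)%:R; case: n => [|n].
  apply/negbTE/allPn; exists root_vertex; first exact: root_in.
  by [].
rewrite ltnS; apply/allP/heightP => [H v vx|H v vx].
  by have := H v vx; rewrite prefix0s /= add0n ltnS.
by rewrite prefix0s /= add0n ltnS H.
Qed.

Lemma low_tree_root n s : 0 <= s -> low_tree n s root_tree = low_prob lambda Pb n s.
Proof.
move=> s0; rewrite /low_tree clampE// low_from_leaf//.
apply/fsetP => w; rewrite in_fset0 in_children in_fset1.
by case: eqP.
Qed.

(** With [n = 0] the functional counts only absence. The value 0 on trees without [w] stops the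
    process at the deletion of [w], before its name can be used again. *)
Definition alive_tree w (s : R) x : R :=
  if w \in vertices x then clamp (fun r => 1 - Df (height x).+1 0 x w r) s else 0.

Lemma lowdead_fromE k n x w : (height x <= k)%N ->
  Df k n x w = Df (height x).+1 n x w.
Proof.
move=> xk; have H z : z \in vertices x -> prefix w z -> (size z <= size w + height x)%N.
  by move=> zx _; rewrite (leq_trans (size_le_height zx))// leq_addl.
have E m : Lf k m x w = Lf (height x).+1 m x w.
  by rewrite (low_from_fuel _ _ _ _ xk H) (low_from_fuel _ _ _ _ (leqnSn _) H).
by rewrite /lowdead_from !E.
Qed.

Lemma continuous_alive_tree w x : continuous (alive_tree w ^~ x).
Proof.
rewrite /alive_tree; case: (w \in vertices x); last exact: continuous_cst_.
have c1 := @continuousB_ R (fun=> 1) _ (@continuous_cst_ R 1) (@continuous_lowdead_from R lambda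
  mu Pb cP (height x).+1 0 x w).
exact: (continuous_clamp c1).

Qed.

Let V0 t : 0 <= t -> 0 <= Pb t. Proof. by move=> /P01 /andP[]. Qed.

Lemma alive_tree_ge0 w s x : 0 <= alive_tree w s x.
Proof.
rewrite /alive_tree; case: ifP => // _; apply: clamp_ge0 => r r0; rewrite subr_ge0.
have /andP[_ H] := lowdead_from_bounds lambda_gt0 mu_ge0 cP P01 PE (height x).+1 0 x w r0.
by rewrite (le_trans H)// gerBl V0.
Qed.

Lemma alive_tree_le1 w s x : alive_tree w s x <= 1.
Proof.
rewrite /alive_tree; case: ifP => // _; apply: clamp_le => r r0; rewrite gerBl.
by have /andP[] := lowdead_from_bounds lambda_gt0 mu_ge0 cP P01 PE (height x).+1 0 x w r0.
Qed.

Let subC1 (c a b : R) : c * (1 - a - (1 - b)) = - (c * (a - b)).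
Proof. by ring. Qed.

Lemma has_deriv_alive_tree w x : w != root_vertex -> w \in vertices x ->
  has_deriv (alive_tree w ^~ x)
  (fun r => \sum_(y <- succ_tree x) exit_rate Q x * jump_prob Q x y * alive_tree w r y -
    exit_rate Q x * alive_tree w r x).
Proof.
move=> wr wx; set k := (height x).+2.
have xk z : z \in vertices x -> prefix w z -> (size z < size w + k)%N.
  by move=> zx _; rewrite (leq_ltn_trans (size_le_height zx))// ltn_addl// /k.
have H0 m : has_deriv (Lf k m x w) (fun t => gen_below lambda mu x w (fun B => Lf k m B w t)).
  exact: has_deriv_low_from.
have H := has_deriv_lowdead cP 0 wx xk H0.
have {}H := has_deriv_clamp (has_derivB (@has_deriv_cst R 1) H).
have E y : (height y <= k)%N -> w \in vertices y -> alive_tree w ^~ y = clamp (fun r => 1 - Df k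
  0 y w r).
  by move=> yx wy; apply/funext => r; rewrite /alive_tree wy (lowdead_fromE _ _ yx).
rewrite E//; last by rewrite /k leqW.
apply: (has_deriv_ext' H).
  have csum (l : seq tree) (c : tree -> R) : continuous (fun r => \sum_(y <- l) c y * alive_tree
    w r y).
    elim: l => [|y l IH]; first by under eq_fun do rewrite big_nil; exact: continuous_cst_.
    by under eq_fun do rewrite big_cons; apply: continuousD_ => //; apply: continuousZ_; exact:
      continuous_alive_tree.
  by apply: continuousB_ => //; apply: continuousZ_; exact: continuous_alive_tree.
move=> t t0; have t0' := ltW t0; rewrite tree_generator// clampE//.
have Et y : (height y <= k)%N -> w \in vertices y -> alive_tree w t y = 1 - Df k 0 y w t.
  by move=> yx wy; rewrite -[LHS]/((alive_tree w ^~ y) t) E// clampE.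
have Ex : alive_tree w t x = 1 - Df k 0 x w t by rewrite Et// /k leqW.
rewrite sub0r /gen_below -addrA opprD; congr (_ + _).
  rewrite -sumrN big_mkcond big_seq [RHS]big_seq; apply: eq_bigr => z zx.
  have zk : (height (add_leaf x z) <= k)%N by rewrite (leq_trans (height_add_leafS zx))// /k ltnW.
  rewrite Ex Et//; last by rewrite vertices_add_leaf// in_fset1U wx orbT.
  rewrite vertices_add_leaf// subC1; case: ifPn => wz //.
  rewrite (@lowdead_from_local _ lambda mu Pb k 0 (fresh_child x z |` x)%fset x w).
    by rewrite subrr mulr0 oppr0.
  by move=> y wy; exact: (add_below wx wz wy).
have delw z : z \in vertices x -> deletable x z -> z != w ->
    mu * (alive_tree w t (del_leaf x z) - alive_tree w t x) =
    if prefix w z then - (mu * (Df k 0 (x `\ z)%fset w t - Df k 0 x w t)) else 0.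
  move=> zx dz zw.
  have zk : (height (del_leaf x z) <= k)%N by rewrite (leq_trans (height_del_leaf dz))// /k leqW.
  rewrite Ex Et//; last by rewrite vertices_del_leaf// in_fsetD1 eq_sym zw.
  rewrite vertices_del_leaf// subC1; case: ifPn => wz //.
  rewrite (@lowdead_from_local _ lambda mu Pb k 0 (x `\ z)%fset x w).
    by rewrite subrr mulr0 oppr0.
  by move=> y wy; exact: (del_below x wz wy).
have rest : \sum_(v <- enum_fset x | deletable x v && (v != w)) mu * (alive_tree w t (del_leaf x
  v) - alive_tree w t x) =
  - \sum_(z <- enum_fset x | [&& prefix w z, z != w & deletable x z]) mu * (Df k 0 (x `\ z)%fset
    w t - Df k 0 x w t).
  rewrite -sumrN big_mkcond [RHS]big_mkcond big_seq [RHS]big_seq; apply: eq_bigr => z zx.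
  case dz: (deletable x z) => /=; last by rewrite !andbF.
  by case zw: (z != w) => /=; rewrite ?andbF// andbT delw.
(* When [w] is a leaf, its deletion is a jump to the value 0, which accounts for the extra term of
   [has_deriv_lowdead]. *)
have [lw|lw] := boolP (is_leaf x w); last first.
  rewrite mul0r mulr0 addr0 -rest; apply: eq_bigl => z; rewrite andb_idr// => dz.
  by apply: contra lw => /eqP <-; case/and3P: dz.
have dw : deletable x w by rewrite /deletable wx wr.
rewrite [RHS](bigD1_seq_cond _ (j := w))//; last exact: fset_uniq.
rewrite rest opprD addrC; congr (_ + _).
rewrite Ex {1}/alive_tree vertices_del_leaf// in_fsetD1 eqxx/= lowdead_from_leaf//; last first.
  by apply/eqP; rewrite -leafE.
by rewrite -[tall_alive lambda Pb 0 t]/(Pb t); ring.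
Qed.

Lemma alive_tree_mild w x s : w != root_vertex -> w \in vertices x -> 0 <= s ->
  mild Q succ_tree (alive_tree w) s x = (alive_tree w s x)%:E.
Proof.
move=> wr wx s0; apply: (mild_solution _ (has_deriv_alive_tree wr wx) s0) => //.
by move=> y; exact: continuous_alive_tree.
Qed.

Lemma alive_tree0 w x : w \in vertices x -> alive_tree w 0 x = 1.
Proof.
move=> wx; rewrite /alive_tree wx clampE// /lowdead_from low_from_n0 convol_le0//.
by rewrite mulr0 addr0 subr0.
Qed.

Lemma alive_tree_leaf w x s : w \in vertices x -> is_leaf x w -> 0 <= s -> alive_tree w s x = Pb s.
Proof.
move=> wx; rewrite leafE => /eqP lw s0; rewrite /alive_tree wx clampE// lowdead_from_leaf//.
by rewrite subKr.
Qed.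

End tree_solutions.

(** * Supersolutions on a unit time interval *)

Section tree_supersolutions.
Context {R : realType}.
Variables (lambda mu : R) (Pb : R -> R).
Hypotheses (lambda_gt0 : 0 < lambda) (mu_ge0 : 0 <= mu).
Hypotheses (cP : continuous Pb) (P01 : unit_valued Pb).
Hypothesis PE : forall t, 0 <= t -> Pb t + mu * convol (empty_prob lambda Pb) Pb t = 1.
Hypothesis Pmin : forall t, 0 <= t -> expR (- (mu * t)) <= Pb t.
Local Notation Q := (tree_rate lambda mu).
Local Notation V := (tall_alive lambda Pb).
Local Notation L := (low_prob lambda Pb).
Local Notation Lf := (low_from lambda mu Pb).
Local Notation Df := (lowdead_from lambda mu Pb).
Local Notation Lt := (low_tree lambda mu Pb).
Implicit Types (x y : tree) (v w z : vertex).

Let gen (phi : tree -> R) x :=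
  \sum_(y <- succ_tree x) exit_rate Q x * jump_prob Q x y * phi y - exit_rate Q x * phi x.

Lemma generator_affine (a b : R) phi x : gen (fun y => a + b * phi y) x = b * gen phi x.
Proof.
rewrite /gen !tree_generator// mulrDr !mulr_sumr.
by congr (_ + _); apply: eq_bigr => v _; rewrite opprD addrACA subrr add0r -mulrBr mulrCA.
Qed.

Let prod_le_factor x k n v c t : c \in children x v -> 0 <= t ->
  0 <= \prod_(w <- enum_fset (children x v)) Df k n x w t <= Df k n x c t.
Proof.
move=> cv t0.
have b01 w : 0 <= Df k n x w t <= 1.
  have /andP[-> H] := lowdead_from_bounds lambda_gt0 mu_ge0 cP P01 PE k n x w t0.
  rewrite (le_trans H)// gerBl; exact: (tall_alive_ge0 lambda_gt0 P01).
have /andP[p0 _] := prod_unit (enum_fset (children x v)) b01; rewrite p0/=.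
rewrite (bigD1_seq c)//=.
rewrite -[leRHS]mulr1 ler_wpM2l//; first by case/andP: (b01 c).
by rewrite -big_filter; have /andP[] := prod_unit [seq i <- enum_fset (children x v) | i != c] b01.
Qed.

(** A vertex is deleted at rate at most mu, so [z], and with it the path from [v] to [z], persists
    with probability at least exp (- mu t). On the functional this is an induction along the path,
    closed by L + mu (beta * V) = 1 - V at level [n.+1]. *)
Lemma lowdead_below k n x v z t : z \in vertices x -> prefix v z ->
  (size z <= size v + k)%N -> (size v + n <= size z)%N -> 0 <= t ->
  Df k n x v t <= 1 - expR (- (mu * t)).
Proof.
elim: k n v t => [|k IH] n v t zx vz zk nz t0.
  have -> : n = 0%N.
    by apply/eqP; rewrite -leqn0 -(leq_add2l (size v)) (leq_trans nz).
  have /andP[_ H] := lowdead_from_bounds lambda_gt0 mu_ge0 cP P01 PE 0 0 x v t0.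
  by rewrite (le_trans H)// lerD2l lerN2 Pmin.
case: n nz => [|n] nz.
  have /andP[_ H] := lowdead_from_bounds lambda_gt0 mu_ge0 cP P01 PE k.+1 0 x v t0.
  by rewrite (le_trans H)// lerD2l lerN2 Pmin.
have zv : z != v.
  by apply/eqP => E; move: nz; rewrite E addnS ltnNge leq_addr.
have cv := child_of_in zx vz zv; set c := child_of v z in cv.
have cz : prefix c z := prefix_child_of v z.
have sc := size_child cv.
have IH' m r : (size v + m.+1 <= size z)%N -> 0 <= r -> Df k m x c r <= 1 - expR (- (mu * r)).
  by move=> mz r0; apply: IH => //; rewrite sc ?addSn -addnS.
pose D r := 1 - expR (- (mu * r)).
have D0 r : 0 <= r -> 0 <= D r.
  by move=> r0; rewrite subr_ge0 -expR0 ler_expR oppr_le0 mulr_ge0.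
have low_le m r : (size v + m.+1 <= size z)%N -> 0 <= r -> Lf k.+1 m.+1 x v r <= L m.+1 r * D r.
  move=> mz r0; rewrite low_fromS ler_wpM2l ?low_prob_ge0//.
  have /andP[_ H] := prod_le_factor k m cv r0.
  by rewrite (le_trans H)// IH'.
rewrite /lowdead_from; have nz1 : (size v + 1 <= size z)%N by rewrite (leq_trans _ nz)// leq_add2l.
have cV := @continuous_tall_alive R lambda Pb cP n.+1.
have cb : continuous (empty_prob lambda Pb) by exact: continuous_empty_prob.
have conv_le : convol (Lf k.+1 1 x v) (V n.+1) t <= D t * convol (empty_prob lambda Pb) (V n.+1) t.
  rewrite -convolZl//; apply: le_convol => //.
  - exact: continuous_low_from.
  - exact: continuousZ_.
  - move=> r /andP[r0 rt].
    have /andP[-> _] := low_from_bounds lambda_gt0 mu_ge0 cP P01 PE k.+1 1 x v r0.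
    rewrite (le_trans (low_le 0%N r nz1 r0))// mulrC ler_wpM2r ?expR_ge0//.
    by rewrite lerD2l lerN2 ler_expR lerN2 ler_wpM2l.
  - by move=> r /andP[r0 _]; rewrite lexx andbT (tall_alive_ge0 lambda_gt0 P01).
have ren := tall_alive_renewal cP PE n.+1 t0.
have V0 := tall_alive_ge0 lambda_gt0 P01 n.+1 t0.
have l1 := low_le n t nz t0.
have l2 := ler_wpM2l mu_ge0 conv_le.
rewrite -/(D t); apply: le_trans (lerD l1 l2) _.
rewrite mulrCA [L _ _ * _]mulrC -mulrDr ler_piMr ?D0//.
by move: ren V0; rewrite -/(L n.+1 t); lra.
Qed.

(* Once height [n] is reached, it is still reached after a time [s <= 1] with
   probability at least [expR (- mu)]. *)
Definition tall_tree n (s : R) x : R := expR mu * (1 - Lt n s x).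

Lemma continuous_tall_tree n x : continuous (tall_tree n ^~ x).
Proof.
by apply: continuousZ_; apply: continuousB_; [exact: continuous_cst_|exact: continuous_low_tree].
Qed.

Lemma tall_tree_ge0 n s x : 0 <= tall_tree n s x.
Proof. by rewrite mulr_ge0 ?expR_ge0// subr_ge0 low_tree_le1. Qed.

Lemma tall_tree_mild n x s : 0 <= s -> (mild Q succ_tree (tall_tree n) s x <= (tall_tree n s
  x)%:E)%E.
Proof.
move=> s0; have H := has_deriv_low_tree lambda_gt0 mu_ge0 cP PE n x.
have {}H := has_derivZ (expR mu) (has_derivB (@has_deriv_cst R 1) H).
apply: (mild_supersolution _ H s0) => //.
  by move=> y; exact: continuous_tall_tree.
move=> r r0; rewrite -/(gen (Lt n r) x) le_eqVlt; apply/orP; left; apply/eqP.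
have -> : expR mu * (0 - gen (Lt n r) x) = (- expR mu) * gen (Lt n r) x by rewrite sub0r mulrN
  mulNr.
rewrite -(generator_affine (expR mu)) /gen.
have E y : tall_tree n r y = expR mu + - expR mu * Lt n r y by rewrite /tall_tree mulrBr mulr1
  mulNr.
by rewrite E; congr (_ - _); apply: eq_bigr => y _; rewrite E.
Qed.

Lemma tall_tree_exit n x s : 0 <= s <= 1 -> (n <= height x)%N -> 1 <= tall_tree n s x.
Proof.
move=> /andP[s0 s1] nx.
have H : Lt n s x <= 1 - expR (- (mu * s)).
  rewrite /low_tree clampE//; case: n nx => [|n] nx.
    by rewrite low_from_n0 subr_ge0 -expR0 ler_expR oppr_le0 mulr_ge0.
  have [z zx sz] := vertex_top x.
  have zv : z != [::] by rewrite -size_eq0 sz; case: (height x) nx.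
  have cv := child_of_in zx (prefix0s z) zv.
  rewrite low_fromS; have /andP[p0 pc] := prod_le_factor (height x) n cv s0.
  apply: (@le_trans _ _ (Df (height x) n x (child_of [::] z) s)).
    apply: le_trans pc; rewrite ler_piMl//.
    exact: (low_prob_le1 lambda_gt0 mu_ge0 cP P01 PE).
  apply: (lowdead_below (z := z)) => //.
  - exact: prefix_child_of.
  - by rewrite (size_child cv) sz addSn ltnW// ltnS.
  - by rewrite (size_child cv) sz add1n.
rewrite /tall_tree (@le_trans _ _ (expR mu * expR (- (mu * s))))//.
  by rewrite -expRD -[leLHS]expR0 ler_expR subr_ge0 ler_piMr.
by rewrite ler_wpM2l ?expR_ge0// -lerBlDl -opprB lerNl opprK.
Qed.

(* The weight doubles when the height decreases, which happens at rate at most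
   [mu]. *)
Definition drop_weight n x : R := 2 ^+ n / 2 ^+ height x.
Definition drop_tree n (s : R) x : R := Num.min 1 (expR (mu * s) * drop_weight n x).
(** Value at the start of the last unit of time for falling below height [n]: either the height is
    then below [m], or it has to drop from [m], which the first term bounds through [drop_tree] at
    time 1. *)
Definition after_tree n m (s : R) x : R := expR mu * (2 ^+ n / 2 ^+ m) + Lt m s x.

Let two_pos n : 0 < (2 : R) ^+ n. Proof. by rewrite exprn_gt0. Qed.

Lemma drop_weight_ge0 n x : 0 <= drop_weight n x.
Proof. by rewrite divr_ge0// ltW. Qed.

Lemma drop_weight_le n x y : (height x <= height y)%N -> drop_weight n y <= drop_weight n x.
Proof.
move=> xy; rewrite /drop_weight ler_wpM2l ?(ltW (two_pos _))// lef_pV2 ?posrE//.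
by rewrite ler_weXn2l// ler1n.
Qed.

Lemma drop_weight_le2 n x y : (height x <= (height y).+1)%N -> drop_weight n y <= 2 *
  drop_weight n x.
Proof.
move=> xy; rewrite /drop_weight mulrCA ler_wpM2l ?(ltW (two_pos _))//.
rewrite ler_pdivlMr// mulrC ler_pdivrMr// -exprS.
by rewrite ler_weXn2l// ler1n.
Qed.

(** A deletion lowers the height only if the deleted vertex is the unique one at maximal distance.
    At most one term is therefore positive, and there the weight at most doubles. *)
Lemma drop_weight_gen n x : gen (drop_weight n) x <= mu * drop_weight n x.
Proof.
rewrite /gen tree_generator//.
have adds : \sum_(v <- enum_fset x) lambda * (drop_weight n (add_leaf x v) - drop_weight n x) <= 0.
  rewrite big_seq sumr_le0// => v vx; rewrite mulr_ge0_le0 ?(ltW lambda_gt0)// subr_le0.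
  by apply: drop_weight_le; rewrite height_add_leaf// leq_maxl.
have w0 := drop_weight_ge0 n x.
suff dels : \sum_(v <- enum_fset x | deletable x v) mu * (drop_weight n (del_leaf x v) -
  drop_weight n x) <= mu * drop_weight n x.
  by rewrite (le_trans (lerD adds dels))// add0r.
have [w wx sw] := vertex_top x.
have term v : deletable x v -> v != w -> mu * (drop_weight n (del_leaf x v) - drop_weight n x) <= 0.
  move=> dv vw; rewrite mulr_ge0_le0// subr_le0; apply: drop_weight_le.
  rewrite leqNgt; apply/negP => lt; move/eqP: vw; apply.
  by rewrite (height_del_leaf_lt dv lt wx sw).
have rest : \sum_(v <- enum_fset x | deletable x v && (v != w)) mu * (drop_weight n (del_leaf x
  v) - drop_weight n x) <= 0.
  by rewrite sumr_le0// => v /andP[]; exact: term.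
have [dw|dw] := boolP (deletable x w); last first.
  rewrite (le_trans _ (mulr_ge0 mu_ge0 w0))// (le_trans _ rest)//.
  rewrite le_eqVlt; apply/orP; left; apply/eqP; apply: eq_bigl => v.
  by rewrite andb_idr// => dv; apply: contra dw => /eqP <-.
rewrite (bigD1_seq_cond _ (j := w))//.
rewrite -[leRHS]addr0 lerD// ler_wpM2l// lerBlDr.
rewrite (le_trans (drop_weight_le2 n (height_del_leaf_ge dw)))//.
by rewrite mulr_natl mulr2n.
Qed.

Lemma continuous_drop_tree n x : continuous (drop_tree n ^~ x).
Proof.
move=> s; apply: (@continuous_min _ _ (fun=> 1) (fun s => expR (mu * s) * drop_weight n x));
  first exact: cvg_cst.
apply: cvgM; last exact: cvg_cst.
by apply: (@continuous_expR_ R (fun s => mu * s)); apply: continuousZ_; exact: continuous_id_.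
Qed.

Lemma drop_tree_ge0 n s x : 0 <= drop_tree n s x.
Proof. by rewrite le_min ler01 mulr_ge0 ?expR_ge0// drop_weight_ge0. Qed.

(** A minimum of two supersolutions is one, by monotonicity of [mild]. The cap at 1 is what makes
    [drop_after] hold on trees of height below [m]. *)
Lemma drop_tree_mild n x s : 0 <= s -> (mild Q succ_tree (drop_tree n) s x <= (drop_tree n s
  x)%:E)%E.
Proof.
move=> s0; pose g (s : R) x := expR (mu * s) * drop_weight n x.
have ce : continuous (fun r : R => expR (mu * r)).
  by apply: continuous_expR_; apply: continuousZ_; exact: continuous_id_.
have cg y : continuous (g ^~ y) by apply: continuousM_ => //; exact: continuous_cst_.
have rate := exit_rate_gt0 lambda_gt0 mu_ge0.
have md y : measurable_fun setT (drop_tree n ^~ y).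
  by apply: measurable_continuous; exact: continuous_drop_tree.
rewrite /drop_tree EFin_min le_min; apply/andP; split.
  apply: (@le_trans _ _ (mild Q succ_tree (fun _ _ => 1) s x)).
    apply: le_mild => //.
    - by move=> u v; exact: tree_jump_ge0.
    - by move=> r y; exact: drop_tree_ge0.
    - by move=> r y _; rewrite ge_min lexx.
  rewrite le_eqVlt; apply/orP; left; apply/eqP.
  apply: (mild_solution _ (has_deriv_cst 1) s0) => //.
    by move=> y; exact: continuous_cst_.
  move=> r _; rewrite -[LHS](mul0r (gen (fun=> 0) x)) -(generator_affine 1) /gen.
  by rewrite !mul0r !addr0.
apply: (@le_trans _ _ (mild Q succ_tree g s x)).
  apply: le_mild => //.
  - by move=> u v; exact: tree_jump_ge0.
  - by move=> r y; exact: drop_tree_ge0.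
  - by move=> y; exact: measurable_continuous.
  - by move=> r y _; rewrite ge_min lexx orbT.
have He : has_deriv (g ^~ x) (fun r => mu * g r x).
  have H := has_derivM (has_deriv_exp (has_derivZ mu (@has_deriv_id R))) (@has_deriv_cst R
    (drop_weight n x)).
  apply: (has_deriv_ext' H); first exact: continuousZ_.
  by move=> r _; rewrite mulr0 addr0 mulr1 /g mulrA.
apply: (mild_supersolution _ He) => //.
move=> r r0; rewrite -/(gen (g r) x).
have -> : gen (g r) x = expR (mu * r) * gen (drop_weight n) x.
  rewrite -(generator_affine 0) /gen add0r; congr (_ - _).
  by apply: eq_bigr => y _; rewrite add0r.
rewrite mulrCA ler_wpM2l ?expR_ge0//.
exact: drop_weight_gen.
Qed.

Lemma continuous_after_tree n m x : continuous (after_tree n m ^~ x).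
Proof. by apply: continuousD_; [exact: continuous_cst_|exact: continuous_low_tree]. Qed.

Lemma after_tree_ge0 n m s x : 0 <= after_tree n m s x.
Proof.
rewrite addr_ge0 ?low_tree_ge0// mulr_ge0 ?expR_ge0// divr_ge0// ltW//.
Qed.

Lemma after_tree_mild n m x s : 0 <= s -> (mild Q succ_tree (after_tree n m) s x <= (after_tree
  n m s x)%:E)%E.
Proof.
move=> s0; set c := expR mu * (2 ^+ n / 2 ^+ m).
have H := has_derivD (@has_deriv_cst R c) (has_deriv_low_tree lambda_gt0 mu_ge0 cP PE m x).
apply: (mild_supersolution _ H) => //.
  by move=> y; exact: continuous_after_tree.
move=> r r0; rewrite add0r -/(gen (Lt m r) x).
rewrite -[leRHS]mul1r -(generator_affine c) /gen /after_tree -/c mul1r lerD2r.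
by apply: ler_sum => y _; rewrite mul1r.
Qed.

Lemma drop_after n m x : drop_tree n 1 x <= after_tree n m 0 x.
Proof.
rewrite /after_tree low_tree0; case: ltnP => xm.
  by rewrite /drop_tree ge_min lerDr mulr_ge0 ?expR_ge0// divr_ge0// ltW.
rewrite addr0 /drop_tree ge_min mulr1; apply/orP; right.
rewrite /drop_weight ler_wpM2l ?expR_ge0// ler_wpM2l ?(ltW (two_pos _))// lef_pV2 ?posrE//.
by rewrite ler_weXn2l// ler1n.
Qed.

Lemma drop_tree_exit n x s : 0 <= s -> (height x < n)%N -> 1 <= drop_tree n s x.
Proof.
move=> s0 xn; rewrite le_min lexx/= -[leLHS]mulr1 ler_pM//.
  by rewrite -expR0 ler_expR mulr_ge0.
by rewrite ler_pdivlMr// mul1r ler_weXn2l ?ler1n// ltnW.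
Qed.

End tree_supersolutions.

(** * A supersolution for the time to reach the root alone *)

Section idle.
Context {R : realType}.
Variables (lambda mu : R) (Pb : R -> R).
Hypotheses (lambda_gt0 : 0 < lambda) (mu_ge0 : 0 <= mu).
Hypotheses (cP : continuous Pb) (P01 : unit_valued Pb).
Hypothesis PE : forall t, 0 <= t -> Pb t + mu * convol (empty_prob lambda Pb) Pb t = 1.
Local Notation Q := (tree_rate lambda mu).
Local Notation Lt := (low_tree lambda mu Pb).
Local Notation beta := (empty_prob lambda Pb).
Implicit Types (x y : tree).

(* [missed s x] is the integral over [0, s] of the difference between the
   probabilities that the tree is reduced to its root, started from the root
   alone and started from [x]; up to a linear term it bounds the time to reach
   the root alone. *)
Definition missed (s : R) x : R := clamp (integral_seg (fun r => beta r - Lt 1 r x) 0) s.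
Definition idle_tree (c t : R) (s : R) x : R := missed s x + c * Num.max (t - s) 0.

Let cbeta : continuous beta. Proof. exact: continuous_empty_prob. Qed.
Let cdiff x : continuous (fun r => beta r - Lt 1 r x).
Proof. by apply: continuousB_ => //; exact: continuous_low_tree. Qed.

Lemma continuous_missed x : continuous (missed ^~ x).
Proof. by apply: continuous_clamp; exact: continuous_integral_seg. Qed.

Lemma missed_ge0 s x : 0 <= missed s x.
Proof.
apply: clamp_ge0 => r r0; apply: integral_seg_ge0 => q /andP[q0 _]; rewrite subr_ge0.
rewrite /low_tree clampE//.
by have /andP[_] := low_from_bounds lambda_gt0 mu_ge0 cP P01 PE (height x).+1 1 x [::] q0.
Qed.

Lemma missed_root s : missed s root_tree = 0.
Proof.
rewrite /missed /clamp (@eq_integral_seg _ _ (fun=> 0)); last first.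
  by move=> r /andP[r0 _]; rewrite low_tree_root// subrr.
by rewrite integral_seg_cst ?mul0r// le_max lexx orbT.
Qed.

Lemma missed0 x : missed 0 x = 0.
Proof. by rewrite /missed clampE// integral_seg_xx. Qed.

Lemma idle_tree_ge0 c t s x : 0 <= c -> 0 <= idle_tree c t s x.
Proof. by move=> c0; rewrite addr_ge0 ?missed_ge0// mulr_ge0// le_max lexx orbT. Qed.

Lemma continuous_idle_tree c t x : continuous (idle_tree c t ^~ x).
Proof.
apply: continuousD_; first exact: continuous_missed.
apply: continuousZ_ => s; apply: (@continuous_max _ _ (fun s => t - s) (fun=> 0)); last exact:
  cvg_cst.
by apply: cvgB; [exact: cvg_cst|exact: cvg_id].
Qed.

(** The generator commutes with the time integral, and the integral of the generator of [low_tree 1]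
    is the increment of that function, which starts from 0 because [x] has positive height. *)
Lemma missed_gen x t : 0 <= t -> (0 < height x)%N ->
  \sum_(y <- succ_tree x) exit_rate Q x * jump_prob Q x y * missed t y - exit_rate Q x * missed
    t x =
  - Lt 1 t x.
Proof.
move=> t0 xh.
have mE y : missed t y = integral_seg beta 0 t - integral_seg (Lt 1 ^~ y) 0 t.
  rewrite /missed clampE// -(mulN1r (integral_seg _ 0 t)) -integral_segZ; last exact:
    continuous_low_tree.
  rewrite -integral_segD//; last by apply: continuousZ_; exact: continuous_low_tree.
  by apply: eq_integral_seg => r _; rewrite mulN1r.
have := @generator_affine _ _ _ lambda_gt0 mu_ge0 (integral_seg beta 0 t) (-1) (fun y =>
  integral_seg (Lt 1 ^~ y) 0 t) x.
under eq_bigr do rewrite mulN1r -mE.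
rewrite mulN1r -mE => ->; rewrite mulN1r; congr (- _).
have H := has_deriv_low_tree lambda_gt0 mu_ge0 cP PE 1 x.
have := has_deriv_int H t0; rewrite low_tree0 ltnNge xh add0r => ->.
have cl y := @continuous_low_tree R lambda mu Pb cP 1 y.
have csum (l : seq tree) (c : tree -> R) : continuous (fun r => \sum_(y <- l) c y * Lt 1 r y).
  elim: l => [|y l IH]; first by under eq_fun do rewrite big_nil; exact: continuous_cst_.
  by under eq_fun do rewrite big_cons; apply: continuousD_ => //; exact: continuousZ_.
transitivity (integral_seg (fun r => \sum_(y <- succ_tree x) exit_rate Q x * jump_prob Q x y *
  Lt 1 r y) 0 t
  + integral_seg (fun r => - exit_rate Q x * Lt 1 r x) 0 t); last first.
  rewrite -integral_segD//; last exact: continuousZ_.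
  by apply: eq_integral_seg => r _; rewrite mulNr.
rewrite integral_segZ// mulNr; congr (_ - _).
elim: (succ_tree x) => [|y l IH].
  rewrite big_nil; under eq_integral_seg do rewrite big_nil.
  by rewrite integral_seg_cst// mul0r.
under eq_integral_seg do rewrite big_cons.
by rewrite big_cons IH integral_segD//; [rewrite integral_segZ|exact: continuousZ_].
Qed.

(** The time derivative is beta - low_tree 1 - c and the generator gives - low_tree 1, so the
    supersolution inequality amounts to c <= beta. *)
Lemma idle_tree_mild c t x s : 0 <= c -> (forall r, 0 <= r -> c <= beta r) ->
  0 <= s <= t -> (0 < height x)%N ->
  (mild Q succ_tree (idle_tree c t) s x <= (idle_tree c t s x)%:E)%E.
Proof.
move=> c0 cb /andP[s0 st] xh; pose u' (r : R) y := missed r y + c * (t - r).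
have -> : mild Q succ_tree (idle_tree c t) s x = mild Q succ_tree u' s x.
  apply: mild_ext => // r y /andP[_ rs]; rewrite /idle_tree /u'.
  by rewrite (max_idPl _)// subr_ge0 (le_trans rs).
have -> : idle_tree c t s x = u' s x.
  by rewrite /idle_tree /u' (max_idPl _)// subr_ge0.
have H1 : has_deriv (missed ^~ x) (clamp (fun r => beta r - Lt 1 r x)).
  by apply: has_deriv_clamp; exact: has_deriv_integral.
have H := has_derivD H1 (has_derivZ c (has_derivB (@has_deriv_cst R t) (@has_deriv_id R))).
apply: (mild_supersolution _ H s0) => //.
  move=> y; apply: continuousD_; first exact: continuous_missed.
  by apply: continuousZ_; apply: continuousB_; [exact: continuous_cst_|exact: continuous_id_].
move=> r r0; rewrite clampE//.
have uE y : u' r y = c * (t - r) + 1 * missed r y by rewrite /u' mul1r addrC.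
rewrite -[X in _ - _ * X <= _]/(u' r x) uE.
rewrite (eq_bigr (fun y => exit_rate Q x * jump_prob Q x y * (c * (t - r) + 1 * missed r y)));
  last first.
  by move=> y _; rewrite -[X in _ * X = _]/(u' r y) uE.
rewrite generator_affine// mul1r missed_gen// sub0r mulrN1.
by have := cb r r0; rewrite addrAC lerDr subr_ge0.
Qed.

End idle.

(** * Non-explosion *)

Section nonexplosion.
Context {R : realType} d {Omega : measurableType d}.
Variables (lambda mu : R).
Hypotheses (lambda_gt0 : 0 < lambda) (mu_ge0 : 0 <= mu).
Local Notation Q := (tree_rate lambda mu).
Local Notation leb := (@lebesgue_measure R).
Variables (P : probability Omega R) (Y : nat -> Omega -> tree) (S : nat -> Omega -> R) (x0 : tree).
Hypothesis law : jump_law Q P Y S x0.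

Let mY n y : measurable [set w | Y n w = y]. Proof. by case: law. Qed.
Let mJ n : measurable_fun setT (jump_time S n). Proof. exact: (measurable_jump_time law). Qed.
Let rate := exit_rate_gt0 lambda_gt0 mu_ge0.
Let jp0 := tree_jump_ge0 lambda_gt0 mu_ge0.
Let jps := @tree_jump_succ R lambda mu.
Let us (x : tree) : uniq (succ_tree x). Proof. exact: undup_uniq. Qed.

Lemma card_succ (x y : tree) : y \in succ_tree x -> (#|` y| <= (#|` x|).+1)%N.
Proof.
rewrite mem_undup mem_cat => /orP[|] /mapP[v].
  by move=> vx ->; rewrite vertices_add_leaf// cardfsU1; case: (_ \notin _).
rewrite mem_filter => /andP[dv _] ->; rewrite vertices_del_leaf//.
by rewrite (cardfsD1 v (vertices x)) leqW// leq_addl.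
Qed.

Lemma past_setT n : past Y S n setT.
Proof. exact: (@measurableT _ (g_sigma_algebraType (past_gen Y S n))). Qed.

Lemma card_bound n (y : tree) : (n + #|` x0| < #|` y|)%N -> P [set w | Y n w = y] = 0%E.
Proof.
elim: n y => [|n IH] y ny.
  have [_ _ _ H] := law; have := H 0%N (fun=> y) (fun=> 0) (fun=> lexx _).
  rewrite (_ : y == x0 = false); last by apply/negbTE/eqP => E; move: ny; rewrite E add0n ltnn.
  rewrite mul0r => E; rewrite -[RHS]/(0%:E) -E; congr (P _); apply/seteqP; split => w /=.
    by move=> Yw; split => // k; rewrite leqn0 => /eqP ->.
  by case=> + _; apply.
rewrite -(measure0 P); apply: (@measure_fibers _ _ _ _ _ P (Y n)) => x.
- by apply: measurableI; exact: mY.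
- by rewrite set0I.
rewrite set0I measure0.
have := past_indep law (@past_setT n) (lexx 0) (ltW (rate x)) (jp0 x y).
rewrite !setTI (_ : [set w | _] = [set w | Y n.+1 w = y] `&` Y n @^-1` [set x]); last first.
  apply/seteqP; split => w /=; first by move=> [? ? ?].
  by move=> [? ?]; split => //; case: law => _ _ + _; apply.
move=> E; apply: (eq_trans E); have [yx|yx] := boolP (y \in succ_tree x); last by rewrite jps//
  mulr0 mul0e.
rewrite [X in (_ * X)%E]IH ?mule0//.
by have := leq_trans ny (card_succ yx); rewrite addSn.
Qed.

(** Chosen so that a tree with at most n more vertices than [x0] has an exit rate which, increased
    by 1, is at most n + 1 times [growth]. *)
Definition growth : R := 1 + (lambda + mu) * (#|` x0|)%:R.

Lemma rate_bound (n : nat) (x : tree) : (#|` x| <= n + #|` x0|)%N ->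
  exit_rate Q x / (exit_rate Q x + 1) <= expR (- ((n.+1)%:R * growth)^-1).
Proof.
move=> xn; have q0 := rate x.
have c1 : (1 <= #|` x0|)%N.
  by rewrite cardfs_gt0; apply/fset0Pn; exists root_vertex; exact: root_in.
have g0 : 0 < growth by rewrite ltr_pwDl// mulr_ge0// addr_ge0// ltW.
have qle : exit_rate Q x + 1 <= n.+1%:R * growth.
  apply: (@le_trans _ _ (1 + (lambda + mu) * (n + #|` x0|)%:R)).
    rewrite addrC lerD2l exit_rate_tree mulrDl !mulr_natr lerD//.
      by rewrite ler_wpMn2l// ltW.
    by rewrite ler_wpMn2l// (leq_trans (count_size _ _)).
  rewrite /growth mulrDr mulr1 lerD//; first by rewrite ler1n.
  rewrite mulrCA ler_wpM2l ?addr_ge0// ?(ltW lambda_gt0)// -natrM ler_nat mulSn addnC leq_add2l.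
  by rewrite leq_pmulr.
have E : exit_rate Q x / (exit_rate Q x + 1) = 1 - (exit_rate Q x + 1)^-1.
  by field; rewrite gt_eqF// addr_gt0.
rewrite E (le_trans (expR_ge1Dx _))// ler_expR lerN2 lef_pV2 ?posrE ?addr_gt0//.
by rewrite mulr_gt0.
Qed.

Definition discount n : \bar R := (\int[P]_w (expR (- jump_time S n w))%:E)%E.

Let mdisc n : measurable_fun setT (fun w => (expR (- jump_time S n w))%:E : \bar R).
Proof. by apply/measurable_EFinP; apply: (measurableT_comp (@measurable_expR R)); exact:
  measurable_funN. Qed.

(** Given the past, a holding time of rate q multiplies exp (- J) by q / (q + 1) on average, and q
    grows at most linearly with the number of jumps. The divergence of the harmonic series then
    sends the product to 0. *)
Lemma discountS n : (discount n.+1 <= (expR (- ((n.+1)%:R * growth)^-1))%:E * discount n)%E.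
Proof.
rewrite /discount -ge0_integralZl//.
apply: (@le_integral_fibers _ _ _ P _ (Y n) (Y n)) => //.
- by move=> x; rewrite setTI; exact: mY.
- by move=> x; rewrite setTI; exact: mY.
- by apply: emeasurable_funM => //; exact: measurable_cst.
move=> x; rewrite setTI.
have mE : measurable (Y n @^-1` [set x]) by exact: mY.
have [xn|xn] := leqP #|` x| (n + #|` x0|); last first.
  have N0 : P (Y n @^-1` [set x]) = 0%E by exact: card_bound.
  rewrite null_set_integral//; last exact: measurable_funTS.
  by apply: integral_ge0 => w _; rewrite mule_ge0// lee_fin expR_ge0.
pose f (y : tree) (z : R * R) := (expR (- (z.1 + z.2)))%:E : \bar R.
have mf y : measurable_fun setT (f y).
  apply/measurable_EFinP; apply: (measurableT_comp (@measurable_expR R)); apply: measurable_funN.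
  by apply: measurable_funD; [exact: measurable_fst|exact: measurable_snd].
have f0 y z : (0 <= f y z)%E by rewrite lee_fin expR_ge0.
have := jump_step law rate jp0 jps us x (@past_setT n) mf f0; rewrite setTI.
rewrite (_ : [set w | Y n w = x] = Y n @^-1` [set x])// => H.
rewrite (eq_integral (fun w => f (Y n.+1 w) (jump_time S n w, S n w))); last first.
  by move=> w _; rewrite /f/= /jump_time big_ord_recr.
rewrite H {H}; set qx := exit_rate Q x.
have q0 : 0 < qx := rate x.
have q10 : 0 < qx + 1 by rewrite addr_gt0.
have inner y j : (\int[leb]_r (f y (j, r) * (jump_prob Q x y * exp_pdf qx r)%:E) =
    (jump_prob Q x y * (qx / (qx + 1) * expR (- j)))%:E)%E.
  transitivity (\int[leb]_r ((jump_prob Q x y * (qx / (qx + 1) * expR (- j)))%:E * (exp_pdf (qx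
    + 1) r)%:E))%E.
    apply: eq_integral => r _; rewrite -!EFinM; congr EFin; rewrite /exp_pdf; case: ifP => _;
      last by rewrite !mulr0.
    rewrite /= opprD expRD (_ : - ((qx + 1) * r) = - (qx * r) + - r); last by ring.
    rewrite expRD; move: (expR _) (expR _) (expR _) => a b c; field.
    by rewrite gt_eqF.
  rewrite ge0_integralZl//; last 3 first.
  - by apply/measurable_EFinP; exact: measurable_exp_pdf.
  - by move=> r _; rewrite lee_fin exp_pdf_ge0.
  - by rewrite lee_fin mulr_ge0// mulr_ge0 ?expR_ge0// divr_ge0// ltW.
  rewrite (_ : integral _ _ _ = 1%E) ?mule1//.
  have := exp_pdf_tail q10 (lexx 0); rewrite mulr0 oppr0 expR0 => <-.
  rewrite [RHS]integral_mkcond; apply: eq_integral => r _.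
  rewrite patchE mem_setE in_itv/= andbT /exp_pdf.
  by case: (ltP 0 r).
apply: ge0_le_integral => //.
- by move=> w _; apply: sume_ge0 => y _; rewrite inner lee_fin mulr_ge0// mulr_ge0 ?expR_ge0//
  divr_ge0// ltW.
- apply: emeasurable_sum => y; under eq_fun do rewrite inner.
  apply/measurable_EFinP; apply: measurable_funM; first exact: measurable_cst.
  apply: measurable_funM; first exact: measurable_cst.
  by apply: measurable_funTS; apply/measurable_EFinP; exact: mdisc.
- apply: measurable_funTS; apply: emeasurable_funM => //; exact: measurable_cst.
move=> w _; under eq_bigr do rewrite inner.
rewrite sumEFin -mulr_suml tree_jump_sum// mul1r -EFinM lee_fin ler_wpM2r ?expR_ge0//.
exact: rate_bound.
Qed.

Let growth_gt0 : 0 < growth.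
Proof. by rewrite ltr_pwDl// mulr_ge0// addr_ge0// ltW. Qed.

Lemma discount_le n : (discount n <= (expR (- (growth^-1 * series harmonic n)))%:E)%E.
Proof.
elim: n => [|n IH].
  rewrite /discount seriesEnat/= big_geq// mulr0 oppr0 expR0.
  under eq_integral do rewrite /jump_time big_ord0 oppr0 expR0.
  by rewrite integral_cst// mul1e; exact: probability_le1.
apply: (le_trans (discountS n)); apply: (le_trans (lee_wpmul2l _ IH)); first by rewrite lee_fin
  expR_ge0.
have E : growth^-1 * series harmonic n.+1 = growth^-1 * series harmonic n + (n.+1%:R * growth)^-1.
  by rewrite seriesSr mulrDr invfM [growth^-1 * harmonic n]mulrC.
by rewrite -EFinM lee_fin -expRD ler_expR E opprD addrC.
Qed.

Lemma nonexplosion t : P [set w | jump_time S n w <= t] @[n --> \oo] --> 0%E.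
Proof.
have mA n : measurable [set w | jump_time S n w <= t].
  have : measurable_fun setT (fun w => jump_time S n w <= t) by apply: measurable_fun_ler => //;
    exact: measurable_cst.
  by move=> /(_ measurableT [set true]); rewrite setTI; apply.
have bound n : (P [set w | (jump_time S n w <= t)%R] <= (expR t * expR (- (growth^-1 * series
  harmonic n)))%:E)%E.
  rewrite EFinM; apply: le_trans (lee_wpmul2l _ (discount_le n)); last by rewrite lee_fin expR_ge0.
  rewrite /discount -ge0_integralZl//.
  rewrite -(setIidl (subsetT [set w | jump_time S n w <= t])) -integral_indic//.
  apply: ge0_le_integral => //.
  - by apply/measurable_EFinP; exact: measurable_indic.
  - by apply: emeasurable_funM => //; exact: measurable_cst.
  move=> w _; rewrite indicE -EFinM lee_fin -expRD.
  have [wA|wA] := boolP (w \in _); last by rewrite expR_ge0.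
  by rewrite -expR0 ler_expR subr_ge0; move: wA; rewrite inE.
apply: (@squeeze_cvge _ _ _ _ (cst 0%E) _ (fun n => (expR t * expR (- (growth^-1 * series
  harmonic n)))%:E)).
- by apply: nearW => n; rewrite measure_ge0/= bound.
- exact: cvg_cst.
apply: cvg_EFin; first exact: nearW.
rewrite -[X in _ --> X](mulr0 (expR t)); apply: cvgMr.
apply: (@cvg_comp _ _ _ (fun n => growth^-1 * series (@harmonic R) n) (fun r => expR (- r)) _
  +oo); last exact: cvgr_expR.
have g1 : 0 < growth^-1 by rewrite invr_gt0.
have dH : series (@harmonic R) n @[n --> \oo] --> +oo.
  apply: nondecreasing_dvgn_lt; last exact: dvg_harmonic.
  by apply/nondecreasing_seqP => n; rewrite seriesSr lerDl harmonic_ge0.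
apply/cvgryPge => A; move/cvgryPge: dH => /(_ (A / growth^-1)).
by apply: filterS => n; rewrite ler_pdivrMr// mulrC.
Qed.

End nonexplosion.

(** * Events of the tree process *)

Section tree_process.
Context {R : realType} d {Omega : measurableType d}.
Variables (lambda mu : R) (Pb : R -> R).
Hypotheses (lambda_gt0 : 0 < lambda) (mu_ge0 : 0 <= mu).
Hypotheses (cP : continuous Pb) (P01 : unit_valued Pb).
Hypothesis PE : forall t, 0 <= t -> Pb t + mu * convol (empty_prob lambda Pb) Pb t = 1.
Hypothesis Pmin : forall t, 0 <= t -> expR (- (mu * t)) <= Pb t.
Local Notation Q := (tree_rate lambda mu).
Variables (P : probability Omega R) (Y : nat -> Omega -> tree) (S : nat -> Omega -> R) (x0 : tree).
Hypothesis law : jump_law Q P Y S x0.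

Let mJ n : measurable_fun setT (jump_time S n). Proof. exact: (measurable_jump_time law). Qed.

Let rate := exit_rate_gt0 lambda_gt0 mu_ge0.
Let jp0 := tree_jump_ge0 lambda_gt0 mu_ge0.
Let jps := @tree_jump_succ R lambda mu.
Let us (x : tree) : uniq (succ_tree x). Proof. exact: undup_uniq. Qed.
Let jsum := tree_jump_sum lambda_gt0 mu_ge0.

Definition explosive : set Omega :=
  \bigcup_k \bigcap_n [set w | jump_time S n w <= k%:R].

Let mJle t n : measurable [set w | jump_time S n w <= t].
Proof.
have : measurable_fun setT (fun w => jump_time S n w <= t) by apply: measurable_fun_ler => //;
  exact: measurable_cst.
by move=> /(_ measurableT [set true]); rewrite setTI; apply.
Qed.

Lemma measurable_explosive : measurable explosive.
Proof. by apply: bigcupT_measurable => k; apply: bigcapT_measurable => n. Qed.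

Lemma explosive0 : P explosive = 0%E.
Proof.
apply/eqP; rewrite eq_le measure_ge0 andbT.
have mI (k : nat) : measurable (\bigcap_n [set w | jump_time S n w <= k%:R]) by exact:
  bigcapT_measurable.
have I0 (k : nat) : P (\bigcap_n [set w | jump_time S n w <= k%:R]) = 0%E.
  apply/eqP; rewrite eq_le measure_ge0 andbT.
  have H := nonexplosion lambda_gt0 mu_ge0 law (k%:R : R).
  rewrite -(cvg_lim _ H)//; apply: lime_ge; first by apply/cvg_ex; exists 0%E.
  apply: nearW => n; apply: le_measure; rewrite ?inE//.
  by move=> w /(_ n Logic.I).
have [N [mN PN N0]] : P.-negligible explosive.
  by apply: negligible_bigcup => k; apply/negligibleP; [exact: mI|exact: I0].
by rewrite -PN; apply: le_measure; rewrite ?inE//; exact: measurable_explosive.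
Qed.

Lemma nonexplosiveP w t : ~ explosive w -> exists n, t < jump_time S n w.
Proof.
move=> nw; apply: contrapT => H; apply: nw; exists (Num.truncn `|t|).+1 => // n _ /=.
have tn := truncnS_gt `|t|; apply: le_trans (ltW tn).
apply: le_trans (ler_norm t); rewrite leNgt; apply/negP => tJ.
by apply: H; exists n.
Qed.

Lemma locate w t : ~ explosive w -> 0 <= t -> exists n, jump_time S n w <= t < jump_time S n.+1 w.
Proof.
move=> nw t0; have ex : exists n, t < jump_time S n w := nonexplosiveP t nw.
case: (ex_minnP ex) => -[|n] tn nmin; first by move: tn; rewrite /jump_time big_ord0 ltNge t0.
exists n; rewrite tn andbT leNgt; apply/negP => /nmin; by rewrite ltnn.
Qed.

Definition low_event m t : set Omega :=
  \bigcup_n final_event Y S t (fun=> setT) (fun x : tree => (height x < m)%N) n.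

Lemma measurable_low_event m t : measurable (low_event m t).
Proof. by apply: bigcupT_measurable => n; exact: (measurable_final_event law). Qed.

Lemma low_event_prob m t : 0 <= t -> P (low_event m t) = (low_tree lambda mu Pb m t x0)%:E.
Proof.
move=> t0; apply: (solution_prob law rate jp0 jps us) => //.
- by move=> s x; exact: low_tree_ge0.
- by move=> x; apply: measurable_continuous; exact: continuous_low_tree.
- by move=> x s _ /andP[s0 _]; exact: low_tree_mild.
- by move=> x s /(_ Logic.I).
- by move=> x _; rewrite low_tree0.
- by move=> x s; exact: low_tree_le1.
- exact: (nonexplosion lambda_gt0 mu_ge0 law).
Qed.

Lemma low_eventP m t n w : jump_time S n w <= t < jump_time S n.+1 w -> (height (Y n w) < m)%N ->
  low_event m t w.
Proof. by move=> nt hn; exists n => //; split => //; split. Qed.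

Let measurable_const v (x : tree) : measurable ([set _ | v \in vertices x] : set R).
Proof.
case vx: (v \in vertices x); first by rewrite (_ : mkset _ = setT)//; apply/seteqP; split.
by rewrite (_ : mkset _ = set0)//; apply/seteqP; split.
Qed.

Definition alive_event v t : set Omega :=
  \bigcup_n final_event Y S t (fun x : tree => [set _ | v \in vertices x]) xpredT n.

Lemma alive_event_prob v t : v != root_vertex -> 0 <= t ->
  P (alive_event v t) = (alive_tree lambda mu Pb v t x0)%:E.
Proof.
move=> vr t0; apply: (solution_prob law rate jp0 jps us) => //.
- by move=> s x; exact: alive_tree_ge0.
- by move=> x; apply: measurable_continuous; exact: continuous_alive_tree.
- by move=> x s /= vx /andP[s0 _]; exact: alive_tree_mild.
- by move=> x s /= /negP vx; rewrite /alive_tree (negbTE vx).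
- by move=> x vx; rewrite alive_tree0.
- by move=> x s; exact: alive_tree_le1.
- exact: (nonexplosion lambda_gt0 mu_ge0 law).
Qed.

Lemma measurable_alive_event v t : measurable (alive_event v t).
Proof.
by apply: bigcupT_measurable => n; apply: (measurable_final_event law); exact: measurable_const.
Qed.

(** A constraint on the last unit of time only: at remaining times above 1 every state is
    admissible. *)
Let late (b : tree -> bool) (x : tree) : set R := [set s | 1 < s \/ b x].

Let mlate b x : measurable (late b x).
Proof.
case bx: (b x); first by rewrite (_ : late _ _ = setT)//; apply/seteqP; split => // s _; right.
rewrite (_ : late _ _ = `]1, +oo[%classic)//; apply/seteqP; split => s /=; rewrite in_itv/= andbT.
  by case=> //; rewrite bx.
by left.
Qed.

Definition late_exit (b : tree -> bool) t : set Omega :=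
  \bigcup_n (exits Y S t (late b) n `&` [set w | jump_time S n w <= t]).

Lemma measurable_late_exit b t : measurable (late_exit b t).
Proof.
apply: bigcupT_measurable => n; apply: measurableI => //.
by apply: (measurable_exits law) => x; exact: mlate.
Qed.

(** The exit takes place at the first violation, all earlier states being admissible by
    minimality. *)
Lemma late_exitP b t n w : t - 1 <= jump_time S n w <= t -> ~~ b (Y n w) -> late_exit b t w.
Proof.
move=> /andP[Jt tJ] bn.
pose bad k := ~~ (1 < t - jump_time S k w) && ~~ b (Y k w).
have ex : exists k, bad k by exists n; rewrite /bad bn andbT -leNgt lerBlDl -lerBlDr.
case: (ex_minnP ex) => k /andP[k1 kb] kmin; exists k => //; split; last first.
  rewrite /=; apply: le_trans tJ; apply: (jump_time_mono law); apply: kmin.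
  by rewrite /bad bn andbT -leNgt lerBlDl -lerBlDr.
split => /=; last by rewrite /late/=; case => [/(negP k1)|/(negP kb)].
move=> j jk; rewrite /late/=; case J1: (1 < t - jump_time S j w); first by left.
right; apply: contraT => jb; have : bad j by rewrite /bad J1 jb.
by move=> /kmin; rewrite leqNgt jk.
Qed.

Lemma tall_exit_prob m t : 0 <= t ->
  (P (late_exit (fun x => (height x < m)%N) t) <= (tall_tree lambda mu Pb m t x0)%:E)%E.
Proof.
move=> t0; apply: (exit_prob law rate jp0 jps us) => //.
- by move=> s x; exact: tall_tree_ge0.
- by move=> x; apply: measurable_continuous; exact: continuous_tall_tree.
- by move=> x s _ /andP[s0 _]; exact: tall_tree_mild.
- move=> x s; rewrite /late/= => nD /andP[s0 _]; apply: tall_tree_exit => //.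
    by rewrite s0 leNgt; apply/negP => s1; apply: nD; left.
  by rewrite leqNgt; apply/negP => h; apply: nD; right.
Qed.

Lemma low_exit_prob m M t : 1 < t ->
  (P (late_exit (fun x => (m <= height x)%N) t) <= (after_tree lambda mu Pb m M (t - 1) x0)%:E)%E.
Proof.
(* The argument is the remaining time: [drop_tree] governs the last unit and [after_tree] what
   precedes it. *)
move=> t1; pose u := concat (drop_tree mu m) (after_tree lambda mu Pb m M).
have -> : after_tree lambda mu Pb m M (t - 1) x0 = u t x0 by rewrite /u /concat leNgt t1.
apply: (exit_prob law rate jp0 jps us) => //.
- by move=> s x; rewrite /u /concat; case: ifP => _; [exact: drop_tree_ge0|exact: after_tree_ge0].
- by move=> x; apply: measurable_concat; [exact: continuous_drop_tree|exact: continuous_after_tree].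
- by rewrite ltW// (lt_trans _ t1).
- move=> x s _ /andP[s0 _]; apply: mild_concat => //.
  + by move=> y; exact: continuous_drop_tree.
  + by move=> y; exact: continuous_after_tree.
  + by move=> r y; exact: drop_tree_ge0.
  + by move=> r y; exact: after_tree_ge0.
  + by move=> r /andP[r0 _]; exact: drop_tree_mild.
  + by move=> r r0; exact: after_tree_mild.
  + exact: drop_after.
- move=> x s; rewrite /late/= => nD /andP[s0 _].
  have s1 : s <= 1 by rewrite leNgt; apply/negP => s1; apply: nD; left.
  rewrite /u /concat s1; apply: drop_tree_exit => //.
  by rewrite ltnNge; apply/negP => h; apply: nD; right.
Qed.

End tree_process.

(** * Mean time to reach the root alone *)

Section hitting.
Context {R : realType} d {Omega : measurableType d}.
Variables (lambda mu : R) (Pb : R -> R).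
Hypotheses (lambda_gt0 : 0 < lambda) (mu_ge0 : 0 <= mu).
Hypotheses (cP : continuous Pb) (P01 : unit_valued Pb).
Hypothesis PE : forall t, 0 <= t -> Pb t + mu * convol (empty_prob lambda Pb) Pb t = 1.
Local Notation Q := (tree_rate lambda mu).
Variables (P : probability Omega R) (Y : nat -> Omega -> tree) (S : nat -> Omega -> R) (x0 : tree).
Hypothesis law : jump_law Q P Y S x0.

Let mY n y : measurable [set w | Y n w = y]. Proof. by case: law. Qed.
Let mJ n : measurable_fun setT (jump_time S n). Proof. exact: (measurable_jump_time law). Qed.
Let S0 n w : 0 < S n w. Proof. by case: law. Qed.
Let rate := exit_rate_gt0 lambda_gt0 mu_ge0.
Let jp0 := tree_jump_ge0 lambda_gt0 mu_ge0.
Let jps := @tree_jump_succ R lambda mu.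
Let us (x : tree) : uniq (succ_tree x). Proof. exact: undup_uniq. Qed.
Let jsum := tree_jump_sum lambda_gt0 mu_ge0.

Lemma height_eq0 (x : tree) : height x = 0%N -> x = root_tree.
Proof.
move=> hx; apply/val_inj/fsetP => v; rewrite /= in_fset1; apply/idP/eqP => [vx|->]; last exact:
  root_in.
by apply/eqP; rewrite -size_eq0 -leqn0 -hx size_le_height.
Qed.

Definition hitting_time (w : Omega) : \bar R :=
  ereal_inf (range (fun n => if Y n w == root_tree then (jump_time S n w)%:E else +oo%E)).

Lemma jump_time_ge0 n w : 0 <= jump_time S n w.
Proof. by rewrite /jump_time sumr_ge0// => k _; exact: ltW. Qed.

Lemma hitting_time_ge0 w : (0 <= hitting_time w)%E.
Proof.
apply: le_ereal_inf_tmp => _ [n _ <-]; by case: ifP => _; rewrite ?lee_fin ?jump_time_ge0 ?leey.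
Qed.

Lemma measurable_hitting_time : measurable_fun setT hitting_time.
Proof.
pose u n w := if Y n w == root_tree then (jump_time S n w)%:E else +oo%E.
rewrite (_ : hitting_time = fun w => einfs (u ^~ w) 0).
  apply: measurable_fun_einfs => n.
  apply: (@measurable_fun_fibers _ _ _ _ _ (Y n) (fun x w => if x == root_tree then (jump_time S
    n w)%:E else +oo%E)) => x; first exact: mY.
  by case: (x == root_tree); [exact/measurable_EFinP|exact: measurable_cst].
apply/funext => w; rewrite /hitting_time /einfs/= /sdrop; congr ereal_inf.
by apply/seteqP; split => _ [n _ <-]; exists n.
Qed.

Variable c : R.
Hypotheses (c_gt0 : 0 < c) (c_le : forall r, 0 <= r -> c <= empty_prob lambda Pb r).
Local Notation idle := (idle_tree lambda mu Pb c).
Let D (x : tree) : set R := [set _ | (0 < height x)%N].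

Let mD x : measurable (D x).
Proof.
case hx: (0 < height x)%N; first by rewrite (_ : D x = setT)//; apply/seteqP; split.
by rewrite (_ : D x = set0)//; apply/seteqP; split => // s; rewrite /D/= hx.
Qed.

Lemma idle_bound t : 0 <= t ->
  (\sum_(n <oo) (exit_value P Y S (idle t) t D n + final_value P Y S (idle t) t D n)
   <= (idle t t x0)%:E)%E.
Proof.
move=> t0; apply: (supersolution_bound law rate jp0 jps us) => //.
- by move=> s x; apply: idle_tree_ge0 => //; exact: ltW.
- by move=> x; apply: measurable_continuous; exact: continuous_idle_tree.
- by move=> x s /= hx st; apply: idle_tree_mild => //; exact: ltW.
Qed.

(** Along almost every path a single term of the series already dominates: if the root alone is
    reached at time J <= t, the exit value of [idle] is c J, and otherwise the final value at time
    [t] is c t. *)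
Lemma hitting_time_min t : 0 <= t ->
  (\int[P]_w (c%:E * mine (hitting_time w) t%:E) <= (idle t t x0)%:E)%E.
Proof.
move=> t0; apply: le_trans (idle_bound t0).
pose e n := (fun w => (if jump_time S n w <= t then idle t (t - jump_time S n w) (Y n w) else
  0)%:E : \bar R) \_ (exits Y S t D n).
pose f n := (fun w => (if jump_time S n w <= t < jump_time S n.+1 w then idle t 0 (Y n w) else
  0)%:E : \bar R) \_ (stays Y S t D n.+1).
have i0 s x : 0 <= idle t s x by apply: idle_tree_ge0 => //; exact: ltW.
have mi x : measurable_fun setT (idle t ^~ x) by apply: measurable_continuous; exact:
  continuous_idle_tree.
have e0 n w : (0 <= e n w)%E by rewrite erestrict_ge0// => w' _; rewrite lee_fin; case: ifP.
have f0 n w : (0 <= f n w)%E by rewrite erestrict_ge0// => w' _; rewrite lee_fin; case: ifP.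
have mJle n : measurable_fun setT (fun w => jump_time S n w <= t).
  by apply: measurable_fun_ler => //; exact: measurable_cst.
have me n : measurable_fun setT (e n).
  apply/(measurable_restrictT _ _).1; first by apply: (measurable_exits law).
  apply: measurable_funTS; apply/measurable_EFinP; apply: measurable_fun_ifT => //.
  apply: (@measurable_fun_fibers _ _ _ _ _ (Y n) (fun x w => idle t (t - jump_time S n w) x)) =>
    x; first exact: mY.
  by apply: (measurableT_comp (mi x)); apply: measurable_funB.
have mf n : measurable_fun setT (f n).
  apply/(measurable_restrictT _ _).1.
    by apply: (past_measurable law); apply: (@past_stays _ _ _ _ _ _ _ _ _ law t D mD n).
  apply: measurable_funTS; apply/measurable_EFinP; apply: measurable_fun_ifT => //.
    by apply: measurable_and => //; apply: measurable_fun_ltr => //; exact: measurable_cst.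
  by apply: (@measurable_fun_fibers _ _ _ _ _ (Y n) (fun x w => idle t 0 x)) => // x; exact: mY.
have E : (\sum_(n <oo) (exit_value P Y S (idle t) t D n + final_value P Y S (idle t) t D n)
    = \int[P]_w \sum_(n <oo) (e n w + f n w))%E.
  rewrite integral_nneseries//; last 2 first.
  - by move=> n; exact: emeasurable_funD.
  - by move=> n w _; rewrite adde_ge0.
  apply: eq_eseriesr => n _; rewrite ge0_integralD//.
  by rewrite /exit_value /final_value -!integral_mkcond.
rewrite E.
have mhit : measurable_fun setT (fun w => c%:E * mine (hitting_time w) t%:E)%E.
  apply: emeasurable_funM; first exact: measurable_cst.
  apply: measurable_mine; first exact: measurable_hitting_time.
  exact: measurable_cst.
have hit0 w : (0 <= c%:E * mine (hitting_time w) t%:E)%E.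
  by rewrite mule_ge0 ?lee_fin ?(ltW c_gt0)// le_min hitting_time_ge0 lee_fin.
have mE := measurable_explosive law.
have pE : P (explosive S) = 0%E := explosive0 lambda_gt0 mu_ge0 law.
rewrite (ge0_negligible_integral mE)//.
have ef0 w : (0 <= \sum_(n <oo) (e n w + f n w))%E by apply: nneseries_ge0 => n _ _; rewrite
  adde_ge0.
have mef : measurable_fun setT (fun w => \sum_(n <oo) (e n w + f n w))%E.
  apply: ge0_emeasurable_sum => [n w _ _|n _]; first by rewrite adde_ge0.
  exact: emeasurable_funD.
rewrite [leRHS](ge0_negligible_integral mE)//.
apply: ge0_le_integral => //.
- exact: measurableD.
- exact: measurable_funTS.
- exact: measurable_funTS.
move=> w [_ nw].
have pick n : (e n w + f n w <= \sum_(n <oo) (e n w + f n w))%E.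
  apply: le_trans (nneseries_lim_ge n.+1 _); last by move=> k _ _; rewrite adde_ge0.
  by rewrite big_nat_recr//= leeDr// sume_ge0// => k _; rewrite adde_ge0.
have [[n /andP[Jn hn]]|no] := pselect (exists n, (jump_time S n w <= t) && (height (Y n w) == 0%N)).
  have ex : exists n, (jump_time S n w <= t) && (height (Y n w) == 0%N) by exists n; rewrite Jn.
  case: (ex_minnP ex) => k /andP[Jk /eqP hk] kmin.
  apply: le_trans (pick k); apply: (@le_trans _ _ (e k w)); last by rewrite leeDl.
  have wk : w \in exits Y S t D k.
    rewrite inE; split; last by rewrite /D/= hk.
    move=> j jk; rewrite /D/= lt0n; apply/negP => hj.
    have Jj : jump_time S j w <= t by apply: le_trans Jk; apply: (jump_time_mono law); exact: ltnW.
    by have := kmin j; rewrite Jj hj => /(_ isT); rewrite leqNgt jk.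
  rewrite /e patchE wk Jk (height_eq0 hk) /idle_tree missed_root//.
  rewrite add0r EFinM lee_pmul2l// (_ : Num.max _ _ = jump_time S k w); last first.
    by rewrite opprB addrCA subrr addr0; apply/max_idPl; exact: jump_time_ge0.
  rewrite ge_min; apply/orP; left; apply: ereal_inf_lbound; exists k => //.
  by rewrite (height_eq0 hk) eqxx.
have [n /andP[Jn Jn1]] := locate nw t0.
apply: le_trans (pick n); apply: (@le_trans _ _ (f n w)); last by rewrite leeDr.
have wn : w \in stays Y S t D n.+1.
  rewrite inE => j jn; rewrite /D/= lt0n; apply/negP => hj; apply: no; exists j; rewrite hj andbT.
  by apply: le_trans Jn; apply: (jump_time_mono law).
rewrite /f patchE wn Jn Jn1 /= /idle_tree missed0 add0r subr0 (max_idPl t0) EFinM lee_pmul2l//.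
by rewrite ge_min lexx orbT.
Qed.

(** Fatou's lemma as the horizon tends to infinity. *)
Lemma hitting_time_integral K : (forall t, 0 <= t -> idle t t x0 <= K) ->
  (c%:E * \int[P]_w hitting_time w <= K%:E)%E.
Proof.
move=> HK.
rewrite -ge0_integralZl//; [|exact: measurable_hitting_time|by move=> w _; exact:
  hitting_time_ge0|by rewrite lee_fin ltW].
pose g (k : nat) w := (c%:E * mine (hitting_time w) k%:R%:E)%E.
have mg k : measurable_fun setT (g k).
  apply: emeasurable_funM; first exact: measurable_cst.
  apply: measurable_mine; first exact: measurable_hitting_time.
  exact: measurable_cst.
have g0 k w : setT w -> (0 <= g k w)%E.
  by move=> _; rewrite mule_ge0 ?lee_fin ?(ltW c_gt0)// le_min hitting_time_ge0 lee_fin/=.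
have gcv w : g k w @[k --> \oo] --> (c%:E * hitting_time w)%E.
  apply: cvgeZl => //; have := hitting_time_ge0 w; case: (hitting_time w) => [r|_|//]; last first.
    rewrite (_ : (fun k => _) = (fun k : nat => k%:R%:E)); last by apply/funext => k; rewrite
      minEle leye_eq.
    by apply/cvgeryP; exact: cvgr_idn.
  move=> r0; apply: cvg_near_cst; exists (Num.truncn r).+1 => // k /= rk.
  apply/min_idPl; rewrite lee_fin (le_trans (ltW (truncnS_gt r)))// ler_nat//.
rewrite (eq_integral (fun w => limn_einf (g ^~ w))); last first.
  by move=> w _; rewrite (cvg_limn_einf_sup (gcv w)).
have FT := @fatou _ _ _ P _ measurableT g mg g0; apply: (le_trans FT).
rewrite limn_einf_lim; apply: lime_le; first exact: is_cvg_einfs.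
apply: nearW => n; apply: (@le_trans _ _ (\int[P]_w g n w)%E).
  by apply: ereal_inf_lbound; exists n => //=.
by apply: le_trans (hitting_time_min (ler0n _ n)) _; rewrite lee_fin HK.
Qed.

End hitting.

Lemma measure_eq_off_null {R : realType} d {T : measurableType d} (m : {measure set T -> \bar
  R}) (N A B : set T) :
  measurable N -> measurable A -> measurable B -> m N = 0%E ->
  (forall w, ~ N w -> A w <-> B w) -> m A = m B.
Proof.
move=> mN mA mB N0 AB.
have half (C : set T) : measurable C -> m C = m (C `\` N).
  move=> mC; transitivity (m (C `\` N) + m (C `&` N))%E; first exact: measureDI.
  suff -> : m (C `&` N) = 0%E by rewrite adde0.
  apply/eqP; rewrite eq_le measure_ge0 andbT -N0; apply: le_measure; rewrite ?inE//; exact: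
    measurableI.
rewrite (half A)// (half B)//; congr (m _); apply/seteqP; split => w [Cw nw]; split => //; exact/AB.
Qed.

Lemma start_null {R : realType} {T : countType} (q : T -> T -> R) d {Omega : measurableType d}
    (P : probability Omega R) Y S (x0 : T) : jump_law q P Y S x0 -> P (~` [set w | Y 0%N w =
      x0]) = 0%E.
Proof.
move=> [mY _ _ H]; rewrite probability_setC//.
have := H 0%N (fun=> x0) (fun=> 0) (fun=> lexx _).
rewrite eqxx big_ord0 mulr1 => E; rewrite (_ : P [set w | Y 0%N w = x0] = 1%E) ?subee//.
rewrite -E; congr (P _); apply/seteqP; split => w /=.
  by move=> Yw; split => // k; rewrite leqn0 => /eqP ->.
by case=> + _; apply.
Qed.

(** * The process after the first jump, and the lifetime law *)

Section shift.
Context {R : realType} d {Omega : measurableType d}.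
Variables (lambda mu : R).
Hypotheses (lambda_gt0 : 0 < lambda) (mu_ge0 : 0 <= mu).
Local Notation Q := (tree_rate lambda mu).
Variables (P : probability Omega R) (Y : nat -> Omega -> tree) (S : nat -> Omega -> R).
Hypothesis law : jump_law Q P Y S root_tree.

Let mY n y : measurable [set w | Y n w = y]. Proof. by case: law. Qed.
Let S0 n w : 0 < S n w. Proof. by case: law. Qed.
Let rate := exit_rate_gt0 lambda_gt0 mu_ge0.

Definition first_child : vertex := fresh_child root_tree root_vertex.
Definition first_tree : tree := add_leaf root_tree root_vertex.

Lemma vertices_first_tree : vertices first_tree = (first_child |` root_tree)%fset.
Proof. by rewrite vertices_add_leaf// root_in. Qed.

Lemma first_child_in : first_child \in vertices first_tree.
Proof. by rewrite vertices_first_tree in_fset1U eqxx. Qed.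

Lemma first_child_root : first_child != root_vertex.
Proof. by rewrite -size_eq0 size_rcons. Qed.

Lemma first_child_leaf : is_leaf first_tree first_child.
Proof. by rewrite leafE vertices_first_tree; apply/eqP; exact: children_fresh. Qed.

Lemma first_tree_neq : first_tree != root_tree.
Proof. by rewrite add_leaf_neq// root_in. Qed.

Lemma root_succ y : (y \in succ_tree root_tree) = (y == first_tree).
Proof.
apply/idP/eqP => [|->]; last exact: (@add_leaf_succ root_tree root_vertex (root_in _)).
rewrite mem_undup mem_cat => /orP[|] /mapP[v].
  by move=> vx ->; have : v \in vertices root_tree := vx; rewrite in_fset1 => /eqP ->.
rewrite mem_filter => /andP[/and3P[vx vr _] _] _.
by move: vx; rewrite in_fset1 (negbTE vr).
Qed.

Lemma root_jump y : jump_prob Q root_tree y = (y == first_tree)%:R.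
Proof.
have [->|yx] := eqVneq y first_tree; last by rewrite tree_jump_succ// root_succ.
have := tree_jump_sum lambda_gt0 mu_ge0 root_tree.
rewrite (bigD1_seq first_tree) ?root_succ//=; last exact: undup_uniq.
by rewrite big1_seq ?addr0// => z /andP[zx]; rewrite root_succ (negbTE zx).
Qed.

(** From the root alone the chain jumps to [first_tree] with probability 1. A path event of the
    shifted process is, off the null set where [Y 0] is not the root alone, a path event with one
    more step. *)
Lemma shifted_law : jump_law Q P (fun n => Y n.+1) (fun n => S n.+1) first_tree.
Proof.
have [_ mS _ H] := law; split => //.
move=> n y s s0; pose y' k := if k is k'.+1 then y k' else root_tree.
pose s' k := if k is k'.+1 then s k' else 0.
have s'0 k : 0 <= s' k by case: k.
have := H n.+1 y' s' s'0; rewrite eqxx mul1r big_ord_recl /= mulr0 oppr0 expR0 mul1r root_jump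
  => <-.
apply: (measure_eq_off_null (measurableC (mY 0 root_tree)) _ _ (start_null law)).
- apply: (@measurable_fibers _ _ _ (Y 0%N)) => x.
  pose yx k := if k is k'.+1 then y k' else x.
  rewrite (_ : _ `&` _ = path_event Y S n.+1 yx s'); first exact: (@measurable_path_event _ _ _
    _ _ _ _ _ _ law n.+1).
  apply/seteqP; split => w /=.
    move=> [[H1 H2] Yx]; split; first by case=> [|k] // kn; exact: H1.
    by case=> [|k] // kn; exact: H2.
  move=> [H1 H2]; split; last exact: (H1 0%N).
  by split => k kn; [exact: (H1 k.+1)|exact: (H2 k.+1)].
- exact: (@measurable_path_event _ _ _ _ _ _ _ _ _ law n.+1 y' s').
move=> w /contrapT /= Y0; split => [[H1 H2]|[H1 H2]]; split.
- by case=> [|k] // kn; exact: H1.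
- by case=> [|k] // kn; exact: H2.
- by move=> k kn; exact: (H1 k.+1).
- by move=> k kn; exact: (H2 k.+1).
Qed.

Lemma jump_time_shift n w : jump_time S n.+1 w = S 0%N w + jump_time (fun n => S n.+1) n w.
Proof. by rewrite /jump_time big_ord_recl; congr (_ + _); apply: eq_bigr. Qed.

(** A null set outside which the chain begins with the birth of the first child and does not
    explode; pathwise statements are made off this set. *)
Definition bad_set : set Omega :=
  ~` [set w | Y 0%N w = root_tree] `|` (~` [set w | Y 1%N w = first_tree] `|` explosive (fun n
    => S n.+1)).

Lemma measurable_bad_set : measurable bad_set.
Proof.
apply: measurableU; first by apply: measurableC; exact: mY.
apply: measurableU; first by apply: measurableC; exact: mY.
exact: (measurable_explosive shifted_law).
Qed.

Lemma bad_set0 : P bad_set = 0%E.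
Proof.
have mC y n : measurable (~` [set w | Y n w = y]) by apply: measurableC; exact: mY.
have m1 := measurable_explosive shifted_law.
have n0 := start_null law; have n1 := start_null shifted_law.
have n2 := explosive0 lambda_gt0 mu_ge0 shifted_law.
have U0 (A B : set Omega) : measurable A -> measurable B -> P A = 0%E -> P B = 0%E -> P (A `|`
  B) = 0%E.
  by move=> mA mB A0 B0; transitivity (P A); [exact: measureU0|exact: A0].
by apply: (U0) => //; [exact: measurableU|exact: U0].
Qed.

Lemma not_bad w : ~ bad_set w ->
  [/\ Y 0%N w = root_tree, Y 1%N w = first_tree, ~ explosive (fun n => S n.+1) w & ~ explosive S w].
Proof.
move=> nb; have Y0 : Y 0%N w = root_tree by apply: contrapT => H; apply: nb; left.
have Y1 : Y 1%N w = first_tree by apply: contrapT => H; apply: nb; right; left.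
have ne : ~ explosive (fun n => S n.+1) w by move=> H; apply: nb; right; right.
split => // -[k _ Jk]; apply: ne; exists k => // n _ /=.
have := Jk n.+1 Logic.I; rewrite /= jump_time_shift; apply: le_trans.
by rewrite lerDr ltW.
Qed.

Variable Pb : R -> R.
Hypotheses (cP : continuous Pb) (P01 : unit_valued Pb).
Hypothesis PE : forall t, 0 <= t -> Pb t + mu * convol (empty_prob lambda Pb) Pb t = 1.
Hypothesis Pmin : forall t, 0 <= t -> expR (- (mu * t)) <= Pb t.

Let alive t := alive_event (fun n => Y n.+1) (fun n => S n.+1) first_child t.

Lemma alive_prob t : 0 <= t -> P (alive t) = (Pb t)%:E.
Proof.
move=> t0; rewrite (alive_event_prob lambda_gt0 mu_ge0 cP P01 PE shifted_law first_child_root t0).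
by rewrite alive_tree_leaf// ?first_child_in// first_child_leaf.
Qed.

Let mJ n : measurable_fun setT (jump_time S n). Proof. exact: (measurable_jump_time law). Qed.

Lemma measurable_lifetime v n : measurable_fun setT (lifetime Y S v n).
Proof.
pose u m w := if (n.+1 < m)%N && (v \notin vertices (Y m w)) then (jump_time S m w - jump_time S
  n.+1 w)%:E else +oo%E.
rewrite (_ : lifetime Y S v n = fun w => einfs (u ^~ w) 0).
  apply: measurable_fun_einfs => m.
  apply: (@measurable_fun_fibers _ _ _ _ _ (Y m) (fun x w => if (n.+1 < m)%N && (v \notin
    vertices x) then (jump_time S m w - jump_time S n.+1 w)%:E else +oo%E)) => x; first exact: mY.
  case: (_ && _); last exact: measurable_cst.
  by apply/measurable_EFinP; apply: measurable_funB.
apply/funext => w; rewrite /lifetime /einfs/= /sdrop; apply/eqP; rewrite eq_le; apply/andP; split.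
  apply: le_ereal_inf_tmp => _ [m _ <-]; rewrite /u; case: ifP => [/andP[nm vm]|_]; last by
    rewrite leey.
  by apply: ereal_inf_lbound; exists m.
apply: le_ereal_inf_tmp => _ [m [nm vm] <-]; apply: ereal_inf_lbound; exists m => //.
by rewrite /u nm vm.
Qed.

Lemma aliveP t w : ~ bad_set w -> 0 <= t -> alive t w <-> (t%:E < lifetime Y S first_child 0 w)%E.
Proof.
move=> /not_bad[Y0 Y1 ne _] t0; have [n Jn] := locate ne t0.
have Jshift m : jump_time S m.+1 w - jump_time S 1 w = jump_time (fun n => S n.+1) m w.
  have J0 : jump_time (fun n => S n.+1) 0 w = 0 by rewrite /jump_time big_ord0.
  by rewrite !jump_time_shift J0 addr0 addrC addKr.
have mono := @jump_time_mono _ _ _ _ _ _ _ _ _ shifted_law w.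
split => [[m _ [[sm /= Jm] _]]|tl].
  have /andP[Jm1 Jm2] := Jm.
  apply: (@lt_le_trans _ _ (jump_time (fun n => S n.+1) m.+1 w)%:E); first by rewrite lte_fin.
  apply: le_ereal_inf_tmp => _ [i [i1 vi] <-]; case: i i1 vi => [//|k] k1 vk; rewrite Jshift
    lee_fin; apply: mono.
  rewrite ltnNge; apply/negP => km; have := sm k; rewrite ltnS => /(_ km) /=.
  by rewrite (negbTE vk).
exists n => //; split => //; split => // k kn /=; apply: contraT => vk.
have k0 : (0 < k)%N by case: k vk {kn} => //; rewrite Y1 first_child_in.
have : (lifetime Y S first_child 0 w <= t%:E)%E.
  apply: (@le_trans _ _ (jump_time (fun n => S n.+1) k w)%:E).
    by apply: ereal_inf_lbound; exists k.+1; [split|rewrite Jshift].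
  by rewrite lee_fin; case/andP: Jn => Jn _; apply: le_trans Jn; exact: mono.
by rewrite leNgt tl.
Qed.

Lemma measurable_born v n : measurable (born Y v n).
Proof.
have mE (E : pred tree) m : measurable [set w | E (Y m w)].
  apply: (@measurable_fibers _ _ _ (Y m)) => x.
  case Ex: (E x); last first.
    by rewrite (_ : _ `&` _ = set0)//; apply/seteqP; split => // w [/= + Yx]; rewrite Yx Ex.
  rewrite (_ : _ `&` _ = [set w | Y m w = x])//.
  by apply/seteqP; split => w /=; [case|move=> Yx; rewrite Yx].
by apply: (measurableI _ _ (mE (fun x => v \notin vertices x) n) (mE (fun x => v \in vertices x)
  n.+1)).
Qed.

(** The hypothesis is tested on the child born at the first jump, which is a leaf of [first_tree]
    and is alive at age [t] with probability [Pb t]. *)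
Lemma lifetime_survival p t : lifetime_distribution Y S P p -> 0 <= t -> p t = 1 - Pb t.
Proof.
move=> pl t0; have := pl first_child 0%N t.
have bornw w : ~ bad_set w -> born Y first_child 0 w.
  move=> /not_bad[Y0 Y1 _ _]; rewrite /born/= Y0 Y1 first_child_in; split => //.
  exact: fresh_childN.
have mb := measurable_bad_set; have b0 := bad_set0.
have mL : measurable [set w | (lifetime Y S first_child 0 w <= t%:E)%E].
  by have := emeasurable_fun_infty_c measurableT (measurable_lifetime first_child 0) t%:E;
    rewrite setTI.
have -> : P (born Y first_child 0) = 1%E.
  rewrite -(@probability_setT _ _ _ P); apply: (measure_eq_off_null mb _ measurableT b0) => [|w
    /bornw//].
  exact: measurable_born.
have mA : measurable (alive t) by exact: (measurable_alive_event shifted_law).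
have -> : P (born Y first_child 0 `&` [set w | (lifetime Y S first_child 0 w <= t%:E)%E]) = P
  (~` alive t).
  apply: (measure_eq_off_null mb _ _ b0); [|exact: measurableC|].
    by apply: measurableI => //; exact: measurable_born.
  move=> w nw; have := aliveP nw t0; rewrite /= leNgt => aw.
  by split => [[_ /negP lw] /aw//|nal]; split; [exact: bornw|apply/negP => /aw].
by rewrite probability_setC// alive_prob// mul1e -EFinB => -[].
Qed.

(** Monotonicity is read off the process and not off the renewal equation: presence at age [t]
    implies presence at age [s]. *)
Lemma survival_nonincreasing s t : 0 <= s -> s <= t -> Pb t <= Pb s.
Proof.
move=> s0 st; have t0 := le_trans s0 st; rewrite -lee_fin -!alive_prob//.
have mb := measurable_bad_set; have b0 := bad_set0.
have mA r : measurable (alive r) by exact: (measurable_alive_event shifted_law).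
have -> : P (alive t) = P (alive t `&` alive s).
  apply: (measure_eq_off_null mb _ _ b0) => //; first exact: measurableI.
  move=> w nw; split => [tw|[]//]; split => //; apply/aliveP => //.
  by move/(aliveP nw t0): tw; apply: le_lt_trans; rewrite lee_fin.
by apply: le_measure; rewrite ?inE//; exact: measurableI.
Qed.

Lemma measurable_return_time : measurable_fun setT (return_time Y S).
Proof.
pose u m w := if (0 < m)%N && (Y m w == Y 0%N w) then (jump_time S m w)%:E else +oo%E.
rewrite (_ : return_time Y S = fun w => einfs (u ^~ w) 0).
  apply: measurable_fun_einfs => m.
  apply: (@measurable_fun_fibers _ _ _ _ _ (Y m) (fun x w => if (0 < m)%N && (x == Y 0%N w) then
    (jump_time S m w)%:E else +oo%E)) => x; first exact: mY.
  apply: (@measurable_fun_fibers _ _ _ _ _ (Y 0%N) (fun y w => if (0 < m)%N && (x == y) then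
    (jump_time S m w)%:E else +oo%E)) => y; first exact: mY.
  case: (_ && _); last exact: measurable_cst.
  exact/measurable_EFinP.
apply/funext => w; rewrite /return_time /einfs/= /sdrop; apply/eqP; rewrite eq_le; apply/andP;
  split.
  apply: le_ereal_inf_tmp => _ [m _ <-]; rewrite /u; case: ifP => [/andP[nm /eqP vm]|_]; last by
    rewrite leey.
  by apply: ereal_inf_lbound; exists m.
apply: le_ereal_inf_tmp => _ [m [nm vm] <-]; apply: ereal_inf_lbound; exists m => //.
by rewrite /u nm vm eqxx.
Qed.

Lemma return_time_ge0 w : (0 <= return_time Y S w)%E.
Proof.
by apply: le_ereal_inf_tmp => _ [m _ <-]; rewrite lee_fin /jump_time sumr_ge0// => k _; exact: ltW.
Qed.

(** The root is not alone again before the first child has been deleted. *)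
Lemma return_lifetime w : ~ bad_set w -> (lifetime Y S first_child 0 w <= return_time Y S w)%E.
Proof.
move=> /not_bad[Y0 Y1 _ _]; apply: le_ereal_inf_tmp => _ [m [m0 Ym] <-].
have m1 : (1 < m)%N.
  case: m m0 Ym => [//|[|//]] _; rewrite Y0 Y1 => /eqP.
  by rewrite (negbTE first_tree_neq).
apply: (@le_trans _ _ (jump_time S m w - jump_time S 1 w)%:E).
  apply: ereal_inf_lbound; exists m => //; split => //.
  by rewrite Ym Y0 in_fset1 (negbTE first_child_root).
rewrite lee_fin gerBl /jump_time sumr_ge0// => k _; exact: ltW.
Qed.

Let count_le (x : \bar R) N : (0 <= x)%E ->
  (\sum_(0 <= k < N) ((k%:R : R)%:E < x)%E%:R <= (N%:R : R))%R /\
  ((\sum_(0 <= k < N) ((k%:R : R)%:E < x)%E%:R)%:E <= x + 1)%E.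
Proof.
move=> x0; elim: N => [|N [IH1 IH2]].
  by rewrite big_geq//; split => //; rewrite adde_ge0.
rewrite big_nat_recr//=; split.
  by rewrite -natr1 lerD//; case: (_ < _)%E; rewrite ?lexx// ler01.
case Nx : (_ < _)%E; last by rewrite addr0.
rewrite EFinD; apply: leeD => //; apply: le_trans (ltW Nx); rewrite lee_fin//.
Qed.

(** The integral of a nonincreasing function is at most the sum of its values at the integers. Here
    that sum is the mean number of integers below the lifetime, at most the mean return time plus
    1. *)
Lemma survival_integral_le K t : (\int[P]_w return_time Y S w <= K%:E)%E -> 0 <= t ->
  integral_seg Pb 0 t <= K + 1.
Proof.
move=> RK t0; pose N := (Num.truncn t).+1.
have tN : t <= N%:R by rewrite ltW// truncnS_gt.
have mA r : measurable (alive r) by exact: (measurable_alive_event shifted_law).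
have step n : integral_seg Pb 0 n%:R <= \sum_(0 <= k < n) Pb k%:R.
  elim: n => [|n IH]; first by rewrite big_geq// integral_seg_xx.
  rewrite big_nat_recr//= (integral_seg_split (b := n%:R))//; last by rewrite ler_nat.
  rewrite lerD// (le_trans (le_integral_seg (g := fun=> Pb n%:R) cP _ _))//.
  - exact: continuous_cst_.
  - by move=> r /andP[nr _]; apply: survival_nonincreasing.
  - by rewrite integral_seg_cst ?ler_nat// -natr1 addrC addKr mulr1.
apply: (@le_trans _ _ (integral_seg Pb 0 N%:R)).
  rewrite (integral_seg_split cP t0 tN) lerDl integral_seg_ge0// => r /andP[tr _].
  by case/andP: (P01 (le_trans t0 tr)).
apply: le_trans (step N) _; rewrite -lee_fin -sumEFin.
have mb := measurable_bad_set; have b0 := bad_set0.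
have E k : (Pb k%:R)%:E = (\int[P]_w (\1_(alive k%:R) w)%:E)%E.
  by transitivity (P (alive k%:R)); [rewrite alive_prob|rewrite integral_indic// setIT].
under eq_bigr do rewrite E.
rewrite -ge0_integral_sum//; last by move=> k; apply/measurable_EFinP; exact: measurable_indic.
rewrite EFinD -[1%:E](mul1e 1%E).
have -> : (K%:E + 1 * 1 = K%:E + 1)%E by rewrite mul1e.
apply: (@le_trans _ _ (\int[P]_w (return_time Y S w + 1))%E); last first.
  rewrite ge0_integralD//; last 2 first.
  - by move=> w _; exact: return_time_ge0.
  - exact: measurable_return_time.
  by apply: leeD => //; rewrite integral_cst// mul1e; exact: probability_le1.
have mR1 : measurable_fun setT (fun w => return_time Y S w + 1)%E.
  by apply: emeasurable_funD; [exact: measurable_return_time|exact: measurable_cst].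
have mI : measurable_fun setT (fun w => \sum_(0 <= k < N) (\1_(alive k%:R) w)%:E : \bar R)%E.
  by apply: emeasurable_sum => k; apply/measurable_EFinP; exact: measurable_indic.
rewrite (ge0_negligible_integral mb)//; last by move=> w _; apply: sume_ge0 => k _; rewrite lee_fin.
rewrite [leRHS](ge0_negligible_integral mb)//; last by move=> w _; rewrite adde_ge0//
  return_time_ge0.
apply: ge0_le_integral => //.
- exact: measurableD.
- by move=> w _; apply: sume_ge0 => k _; rewrite lee_fin.
- exact: measurable_funTS.
- exact: measurable_funTS.
move=> w [_ nw]; have [_] := count_le N (return_time_ge0 w); apply: le_trans.
rewrite sumEFin lee_fin; apply: ler_sum => k _; rewrite indicE ler_nat.
have [|//] := boolP (w \in alive k%:R); rewrite inE => /(aliveP nw (ler0n _ k)) lk.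
by rewrite (lt_le_trans lk (return_lifetime nw)).
Qed.

Lemma low_tree_first r : 0 <= r ->
  low_tree lambda mu Pb 1 r first_tree = empty_prob lambda Pb r * (1 - Pb r).
Proof.
move=> r0; rewrite /low_tree clampE// low_fromS; congr (_ * _).
have h1 : height first_tree = 1%N.
  by rewrite height_add_leaf ?root_in// height_root_tree.
have ch : children first_tree [::] = [fset first_child]%fset.
  rewrite vertices_first_tree children_add_eq; apply/fsetP => w.
  rewrite in_fset1U in_children !in_fset1 -/first_child.
  by case: (w == [::]); rewrite ?andbF ?orbF.
rewrite ch big_seq_fset1 h1 lowdead_from_leaf//.
by apply/eqP; rewrite -leafE first_child_leaf.
Qed.

(** Deduced from the exponential moment of order half the rate k, which is 2, through s <= (2 / k)
    exp (k s / 2). *)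
Lemma first_holding_time : (\int[P]_w (S 0%N w)%:E < +oo)%E.
Proof.
set k := exit_rate Q root_tree; have k0 : 0 < k := rate root_tree.
have k20 : 0 < k / 2 by rewrite divr_gt0.
have mS : measurable_fun setT (S 0%N) by case: law.
pose f (y : tree) (z : R * R) := (expR (k / 2 * z.2))%:E : \bar R.
have mf y : measurable_fun setT (f y).
  apply/measurable_EFinP; apply: (measurableT_comp (@measurable_expR R)).
  by apply: measurable_funM; [exact: measurable_cst|exact: measurable_snd].
have f0 y z : (0 <= f y z)%E by rewrite lee_fin expR_ge0.
have jp0 := tree_jump_ge0 lambda_gt0 mu_ge0.
have us (x : tree) : uniq (succ_tree x) by exact: undup_uniq.
have pT : past Y S 0 setT by exact: past_setT.
have := jump_step law rate jp0 (@tree_jump_succ R lambda mu) us root_tree pT mf f0.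
(* The integrand does not depend on the jump time, so an arbitrary sample point stands for it. *)
have inner y : (\int[lebesgue_measure]_r (f y (jump_time S 0 (point : Omega), r) * (jump_prob Q
  root_tree y * exp_pdf k r)%:E) =
    (jump_prob Q root_tree y * 2)%:E)%E.
  transitivity (\int[lebesgue_measure]_r ((jump_prob Q root_tree y * 2)%:E * (exp_pdf (k / 2)
    r)%:E))%E.
    apply: eq_integral => r _; rewrite /f/= -!EFinM; congr EFin; rewrite /exp_pdf; case: ifP =>
      _; last by rewrite !mulr0.
    rewrite (_ : - (k / 2 * r) = k / 2 * r + - (k * r)); last by field.
    by rewrite expRD; move: (expR _) (expR _) => a b; field.
  rewrite ge0_integralZl//; last 3 first.
  - by apply/measurable_EFinP; exact: measurable_exp_pdf.
  - by move=> r _; rewrite lee_fin exp_pdf_ge0.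
  - by rewrite lee_fin mulr_ge0.
  rewrite [X in (_ * X)%E](_ : _ = 1%E) ?mule1//.
  have := exp_pdf_tail k20 (lexx 0); rewrite mulr0 oppr0 expR0 => <-.
  rewrite [RHS]integral_mkcond; apply: eq_integral => r _.
  rewrite patchE mem_setE in_itv/= andbT /exp_pdf.
  by case: (ltP 0 r).
rewrite setTI => H.
have mD : measurable [set w | Y 0%N w = root_tree] by exact: mY.
apply: (@le_lt_trans _ _ (\int[P]_(w in [set w | Y 0%N w = root_tree]) ((2 / k)%:E * f (Y 1%N w)
  (jump_time S 0 w, S 0%N w)))%E).
  rewrite (ge0_negligible_integral (measurableC mD))//; last 3 first.
  - exact/measurable_EFinP.
  - by move=> w _; rewrite lee_fin ltW.
  - exact: start_null law.
  rewrite setTD setCK; apply: ge0_le_integral => //.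
  - by move=> w _; rewrite lee_fin ltW.
  - by apply/measurable_EFinP; exact: measurable_funTS.
  - apply: measurable_funTS; apply: emeasurable_funM; first exact: measurable_cst.
    apply/measurable_EFinP; apply: (measurableT_comp (@measurable_expR R)).
    by apply: measurable_funM => //; exact: measurable_cst.
  move=> w _; rewrite -EFinM lee_fin -ler_pdivrMl ?divr_gt0// invf_div.
  by rewrite (le_trans _ (expR_ge1Dx _))// lerDr.
rewrite ge0_integralZl//; last 2 first.
- apply: measurable_funTS.
  apply/measurable_EFinP; apply: (measurableT_comp (@measurable_expR R)).
  by apply: measurable_funM => //; exact: measurable_cst.
- by rewrite lee_fin divr_ge0// ltW.
rewrite H; under eq_integral => w _.
  under eq_bigr => y _ do rewrite inner.
  over.
rewrite integral_cst//; apply: lte_mul_pinfty; [by rewrite lee_fin divr_ge0// ltW|by []|].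
rewrite sumEFin; apply: lte_mul_pinfty => //; last by rewrite (le_lt_trans (probability_le1 P
  mD))// ltry.
by rewrite lee_fin sumr_ge0// => y _; rewrite mulr_ge0.
Qed.

(** The bound [K] gives beta >= exp (- lambda K), which serves as the slope of [idle_tree]. From
    [first_tree] the missed mass is the integral of beta Pb, at most [K] at every horizon. *)
Lemma positive_recurrent_of_bounded K : (forall t, 0 <= t -> integral_seg Pb 0 t <= K) ->
  positive_recurrent Y S P.
Proof.
move=> HK; pose c := expR (- (lambda * K)).
have c0 : 0 < c by exact: expR_gt0.
have c_le r : 0 <= r -> c <= empty_prob lambda Pb r.
  by move=> r0; rewrite ler_expR lerN2 ler_wpM2l ?(ltW lambda_gt0)// HK.
have idleK t : 0 <= t -> idle_tree lambda mu Pb c t t first_tree <= K.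
  move=> t0; rewrite /idle_tree subrr maxxx mulr0 addr0 /missed clampE//.
  apply: le_trans (HK t t0); apply: le_integral_seg => //.
    apply: continuousB_; first exact: continuous_empty_prob.
    exact: continuous_low_tree.
  move=> r /andP[r0 _]; rewrite low_tree_first// mulrBr mulr1 opprB addrCA subrr addr0.
  have /andP[p0 p1] := P01 r0.
  rewrite ler_piMl//.
  by have /andP[] := empty_prob_unit lambda_gt0 P01 r0.
have HI := hitting_time_integral lambda_gt0 mu_ge0 cP P01 PE shifted_law c0 c_le idleK.
have mb := measurable_bad_set; have b0 := bad_set0.
pose hit := hitting_time (fun n => Y n.+1) (fun n => S n.+1).
have mhit : measurable_fun setT hit := measurable_hitting_time shifted_law.
have hit0 w : (0 <= hit w)%E := hitting_time_ge0 shifted_law w.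
have mS : measurable_fun setT (fun w => (S 0%N w)%:E : \bar R) by apply/measurable_EFinP; case: law.
apply: (@le_lt_trans _ _ (\int[P]_w ((S 0%N w)%:E + hit w))%E); last first.
  rewrite ge0_integralD//; last by move=> w _; rewrite lee_fin ltW.
  apply: lte_add_pinfty; first exact: first_holding_time.
  have : (\int[P]_w hit w <= c^-1%:E * K%:E)%E.
    by rewrite lee_pdivlMl.
  by move=> /le_lt_trans; apply; rewrite -EFinM ltry.
have mT : measurable_fun setT (fun w => (S 0%N w)%:E + hit w)%E by exact: emeasurable_funD.
rewrite (ge0_negligible_integral mb measurableT measurable_return_time)//; last by move=> w _;
  exact: return_time_ge0.
rewrite [leRHS](ge0_negligible_integral mb)//; last by move=> w _; rewrite adde_ge0// lee_fin ltW.
apply: ge0_le_integral => //.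
- exact: measurableD.
- by move=> w _; exact: return_time_ge0.
- by apply: measurable_funTS; exact: measurable_return_time.
- exact: measurable_funTS.
move=> w [_ nw]; have [Y0 _ _ _] := not_bad nw.
rewrite -leeBlDl//; apply: le_ereal_inf_tmp => _ [n _ <-]; case: ifP => [/eqP Yn|_]; last by
  rewrite leey.
rewrite leeBlDl// -EFinD -jump_time_shift; apply: ereal_inf_lbound; exists n.+1 => //.
by split => //; rewrite Yn Y0.
Qed.

End shift.

(** * The height over unit time intervals *)

Section height_events.
Context {R : realType} d {Omega : measurableType d}.
Variables (lambda mu : R) (Pb : R -> R).
Hypotheses (lambda_gt0 : 0 < lambda) (mu_ge0 : 0 <= mu).
Hypotheses (cP : continuous Pb) (P01 : unit_valued Pb).
Hypothesis PE : forall t, 0 <= t -> Pb t + mu * convol (empty_prob lambda Pb) Pb t = 1.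
Hypothesis Pmin : forall t, 0 <= t -> expR (- (mu * t)) <= Pb t.
Local Notation Q := (tree_rate lambda mu).
Variables (P : probability Omega R) (Y : nat -> Omega -> tree) (S : nat -> Omega -> R) (G : R ->
  Omega -> tree).
Hypothesis G_ctmc : is_ctmc Q Y S P root_tree G.

Let law : jump_law Q P Y S root_tree. Proof. by case: G_ctmc. Qed.

Lemma height_eventP (b : pred tree) k w t : ~ explosive S w -> k%:R <= t <= k.+1%:R -> ~~ b (G t
  w) ->
  (exists n, jump_time S n w <= k%:R < jump_time S n.+1 w /\ ~~ b (Y n w)) \/
  late_exit Y S b k.+1%:R w.
Proof.
move=> nw /andP[kt tk] bG; have t0 : 0 <= t by rewrite (le_trans _ kt).
have [n Jn] := locate nw t0; have [_ _ _ _ GE] := G_ctmc.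
rewrite (GE n t w Jn) in bG; case/andP: Jn => Jt tJ.
have [Jk|kJ] := ltP k%:R (jump_time S n w); last first.
  by left; exists n; rewrite kJ (le_lt_trans kt tJ).
right; apply: (late_exitP law _ bG); rewrite (le_trans Jt tk) andbT.
by rewrite -natr1 addrK ltW.
Qed.

(** Covers the event that the height is at least [m] at some time between k and k + 1: either it is
    so at time k, or such a state is entered during the unit of time before k + 1. *)
Definition tall_bad m k : set Omega :=
  ~` low_event Y S m k%:R `|` late_exit Y S (fun x : tree => (height x < m)%N) k.+1%:R.

(** The margin between [m] and [M] makes it unlikely that the height falls from [M] to below [m]
    within a unit of time. *)
Definition low_bad m M k : set Omega :=
  low_event Y S M k%:R `|` late_exit Y S (fun x : tree => (m <= height x)%N) k.+1%:R.

Lemma measurable_tall_bad m k : measurable (tall_bad m k).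
Proof.
apply: measurableU; last exact: (measurable_late_exit law).
by apply: measurableC; exact: (measurable_low_event law).
Qed.

Lemma measurable_low_bad m M k : measurable (low_bad m M k).
Proof.
by apply: measurableU; [exact: (measurable_low_event law)|exact: (measurable_late_exit law)].
Qed.

Lemma tall_bad_prob m k :
  (P (tall_bad m k) <= ((1 + expR mu) * tall_prob lambda Pb m k.+1%:R)%:E)%E.
Proof.
have k0 : 0 <= (k%:R : R) := ler0n _ k; have k10 : 0 <= (k.+1%:R : R) := ler0n _ k.+1.
have m1 : measurable (~` low_event Y S m k%:R) by apply: measurableC; exact:
  (measurable_low_event law).
have m2 := measurable_late_exit law (fun x : tree => (height x < m)%N) (k.+1%:R).
apply: (@le_trans _ _ (P (~` low_event Y S m k%:R) + P (late_exit Y S (fun x : tree => (height x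
  < m)%N) k.+1%:R))%E).
  exact: measureU2.
rewrite mulrDl mul1r EFinD; apply: leeD.
  rewrite probability_setC; last exact: (measurable_low_event law).
  rewrite (low_event_prob lambda_gt0 mu_ge0 cP P01 PE law)// low_tree_root// -EFinB lee_fin.
  apply: tall_prob_nondecreasing => //; by rewrite ler_nat.
apply: le_trans (tall_exit_prob lambda_gt0 mu_ge0 cP P01 PE Pmin law m k10) _.
by rewrite /tall_tree low_tree_root.
Qed.

Lemma low_bad_prob m M k : (0 < k)%N ->
  (P (low_bad m M k) <= (2 * low_prob lambda Pb M k%:R + expR mu * (2 ^+ m / 2 ^+ M))%:E)%E.
Proof.
move=> k0; have kR : 0 <= (k%:R : R) := ler0n _ k.
have k1 : 1 < (k.+1%:R : R) by rewrite ltr1n.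
have m1 : measurable (low_event Y S M k%:R) by exact: (measurable_low_event law).
have m2 := measurable_late_exit law (fun x : tree => (m <= height x)%N) (k.+1%:R).
apply: (@le_trans _ _ (P (low_event Y S M k%:R) + P (late_exit Y S (fun x : tree => (m <= height
  x)%N) k.+1%:R))%E).
  exact: measureU2.
rewrite mulrDl mul1r -addrA EFinD; apply: leeD.
  by rewrite (low_event_prob lambda_gt0 mu_ge0 cP P01 PE law)// low_tree_root.
apply: le_trans (low_exit_prob lambda_gt0 mu_ge0 cP P01 PE law m M k1) _.
have -> : k.+1%:R - 1 = k%:R :> R by rewrite -natr1 addrK.
by rewrite /after_tree low_tree_root// addrC.
Qed.

Lemma not_tall_bad m k w t : ~ explosive S w -> ~ tall_bad m k w -> k%:R <= t <= k.+1%:R ->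
  (height (G t w) < m)%N.
Proof.
move=> nw nb kt; apply: contraT => h.
have [[n [Jn bn]]|le] := height_eventP (b := fun x : tree => (height x < m)%N) nw kt h; exfalso;
  apply: nb.
  left => -[j _ [[_ /= Jj] hj]].
  suff jn : j = n by move: bn; rewrite -jn hj.
  case/andP: Jn => n1 n2; case/andP: Jj => j1 j2; apply/eqP; rewrite eqn_leq; apply/andP; split.
    by rewrite leqNgt; apply/negP => nj; have := jump_time_mono law w nj; rewrite leNgt
      (le_lt_trans j1 n2).
  by rewrite leqNgt; apply/negP => jn; have := jump_time_mono law w jn; rewrite leNgt
    (le_lt_trans n1 j2).
by right.
Qed.

Lemma not_low_bad m M k w t : (m <= M)%N -> ~ explosive S w -> ~ low_bad m M k w -> k%:R <= t <=
  k.+1%:R ->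
  (m <= height (G t w))%N.
Proof.
move=> mM nw nb kt; apply: contraT => h.
have [[n [Jn bn]]|le] := height_eventP (b := fun x : tree => (m <= height x)%N) nw kt h;
  exfalso; apply: nb.
  by left; apply: low_eventP Jn _; rewrite (leq_trans _ mM)// ltnNge.
by right.
Qed.

End height_events.

(** * The transform of the survival function *)

Section half_line.
Context {R : realType}.
Local Notation leb := (@lebesgue_measure R).
Implicit Types (f g : R -> R).

Definition half_integral f : R := \int[leb]_(t in `[0%R, +oo[) f t.

(** A class stable under sums, bounded continuous factors and multiplication by t, whose integrals
    over the half line are limits of integrals over segments. *)
Definition exp_small f := continuous f /\
  exists C a, [/\ 0 <= C, 0 < a & forall t, 0 <= t -> `|f t| <= C * expR (- (a * t))].

Lemma continuous_decay (a : R) : continuous (fun t : R => expR (- (a * t))).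
Proof. by apply: continuous_expR_; apply: continuousN_; apply: continuousZ_; exact:
  continuous_id_. Qed.

Lemma integral_decay_tail (a T : R) : 0 < a -> 0 <= T ->
  (\int[leb]_(t in `]T, +oo[) (expR (- (a * t)))%:E = (expR (- (a * T)) / a)%:E)%E.
Proof.
move=> a0 T0; have := exp_pdf_tail a0 T0.
transitivity (\int[leb]_(t in `]T, +oo[) (a^-1%:E * (exp_pdf a t)%:E))%E.
  apply: eq_integral => t; rewrite inE/= in_itv/= andbT => Tt.
  by rewrite /exp_pdf (le_lt_trans T0 Tt) -EFinM mulrA mulVf ?gt_eqF// mul1r.
rewrite ge0_integralZl//; last 3 first.
- by apply/measurable_EFinP; apply: measurable_funTS; exact: measurable_exp_pdf.
- by move=> t _; rewrite lee_fin exp_pdf_ge0// ltW.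
- by rewrite lee_fin invr_ge0 ltW.
by rewrite H -EFinM mulrC.
Qed.

Lemma integrable_decay (a : R) : 0 < a ->
  leb.-integrable `[0, +oo[ (EFin \o (fun t => expR (- (a * t)))).
Proof.
move=> a0; apply/integrableP; split.
  apply/measurable_EFinP; apply: measurable_funTS.
  exact: measurable_continuous (@continuous_decay a).
rewrite -integral_itv_obnd_cbnd; last first.
  apply: measurableT_comp => //; apply/measurable_EFinP; apply: measurable_funTS.
  exact: measurable_continuous (@continuous_decay a).
have -> : (\int[leb]_(x in `]0%R, +oo[) `|(expR (- (a * x)))%:E|
   = \int[leb]_(x in `]0%R, +oo[) (expR (- (a * x)))%:E)%E.
  by apply: eq_integral => x _; rewrite /= ger0_norm ?expR_ge0.
by rewrite integral_decay_tail// ltry.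
Qed.

Lemma exp_small_integrable f : exp_small f -> leb.-integrable `[0, +oo[ (EFin \o f).
Proof.
move=> [cf [C [a [C0 a0 fC]]]].
apply: (@le_integrable _ _ _ leb _ _ _ (EFin \o (fun t => C * expR (- (a * t))))) => //.
- by apply/measurable_EFinP; apply: measurable_funTS; exact: measurable_continuous.
- move=> t /=; rewrite in_itv/= andbT => t0; rewrite lee_fin.
  by apply: (le_trans (fC _ t0)); rewrite ler_norm.
- have -> : EFin \o (fun t => C * expR (- (a * t))) =
      (fun t => C%:E * (EFin \o (fun t => expR (- (a * t)))) t)%E by apply/funext => t; rewrite
        /= EFinM.
  by apply: integrableZl => //; exact: integrable_decay.
Qed.

Lemma half_integralD f g : exp_small f -> exp_small g ->
  half_integral (fun t => f t + g t) = half_integral f + half_integral g.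
Proof. by move=> sf sg; apply: RintegralD => //; exact: exp_small_integrable. Qed.

Lemma half_integralZ k f : exp_small f ->
  half_integral (fun t => k * f t) = k * half_integral f.
Proof. by move=> sf; apply: RintegralZl => //; exact: exp_small_integrable. Qed.

Lemma le_half_integral f g : exp_small f -> exp_small g ->
  (forall t, 0 <= t -> f t <= g t) -> half_integral f <= half_integral g.
Proof.
move=> sf sg fg; apply: le_Rintegral => //; try exact: exp_small_integrable.
by move=> t /=; rewrite in_itv/= andbT; exact: fg.
Qed.

Lemma eq_half_integral f g : (forall t, 0 <= t -> f t = g t) ->
  half_integral f = half_integral g.
Proof.
by move=> fg; apply: eq_Rintegral => t; rewrite inE/= in_itv/= andbT; exact: fg.
Qed.

Lemma half_integral_ge0 f : (forall t, 0 <= t -> 0 <= f t) -> 0 <= half_integral f.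
Proof. by move=> f0; apply: Rintegral_ge0 => t /=; rewrite in_itv/= andbT; exact: f0. Qed.

Lemma half_integral_tail f (C a T : R) : continuous f -> 0 <= C -> 0 < a -> 0 <= T ->
  (forall t, 0 <= t -> `|f t| <= C * expR (- (a * t))) ->
  `|half_integral f - integral_seg f 0 T| <= C / a * expR (- (a * T)).
Proof.
move=> cf C0 a0 T0 fC.
have If := exp_small_integrable (conj cf (ex_intro _ C (ex_intro _ a (And3 C0 a0 fC)))).
rewrite /half_integral /integral_seg Rintegral_itvB//.
have sub : [set` `]T, +oo[] `<=` [set` `[0, +oo[].
  by move=> t /=; rewrite !in_itv/= !andbT => /ltW; exact: le_trans.
have IfT : leb.-integrable `]T, +oo[ (EFin \o f) by apply: integrableS If => //.
apply: (le_trans (le_normr_Rintegral _ IfT)) => //.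
have Ic : leb.-integrable `]T, +oo[ (EFin \o (fun t => C * expR (- (a * t)))).
  have -> : EFin \o (fun t => C * expR (- (a * t))) =
      (fun t => C%:E * (EFin \o (fun t => expR (- (a * t)))) t)%E by apply/funext => t; rewrite
        /= EFinM.
  by apply: integrableZl => //; apply: integrableS (integrable_decay a0) => //.
apply: (@le_trans _ _ (\int[leb]_(t in `]T, +oo[) (C * expR (- (a * t))))).
  apply: le_Rintegral => //.
    have := integrable_norm IfT; apply => //.
  by move=> t Tt; apply: fC; have := sub _ Tt; rewrite /= in_itv/= andbT.
rewrite RintegralZl//; last by apply: integrableS (integrable_decay a0) => //.
by rewrite /Rintegral integral_decay_tail//= mulrA mulrAC.
Qed.

Lemma half_integral_approx f (e : R) : exp_small f -> 0 < e ->
  exists T0, 0 <= T0 /\ forall T, T0 <= T -> `|half_integral f - integral_seg f 0 T| <= e.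
Proof.
move=> [cf [C [a [C0 a0 fC]]]] e0.
(* From exp (a T) >= a T, the tail is at most C / (a^2 T). *)
exists (C / (a * a * e)).
have T0 : 0 <= C / (a * a * e) by rewrite divr_ge0// ltW// !mulr_gt0.
split=> // T TT; have T1 : 0 <= T by exact: le_trans TT.
apply: (le_trans (half_integral_tail cf C0 a0 T1 fC)).
have := expR_ge1Dx (a * T) => H.
have X0 : 0 < expR (a * T) by exact: expR_gt0.
rewrite expRN ler_pdivrMr// ler_pdivrMr//.
have : C <= T * (a * a * e) by rewrite -ler_pdivrMr// !mulr_gt0.
have : 0 < a * e by rewrite mulr_gt0.
nra.
Qed.

Lemma integral_seg_le_half f T : exp_small f -> (forall t, 0 <= t -> 0 <= f t) ->
  integral_seg f 0 T <= half_integral f.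
Proof.
move=> sf f0; apply/ler_addgt0Pr => e e0.
have [T0 [T00 /(_ (Num.max T0 T))]] := half_integral_approx sf e0.
rewrite le_max lexx => /(_ isT); rewrite ler_norml => /andP[+ _].
rewrite lerBrDl => H; apply: (le_trans _ (y := integral_seg f 0 (Num.max T0 T))); last by lra.
have [T1|T1] := leP T 0.
  rewrite integral_seg_le0//; apply: integral_seg_ge0 => r /andP[r0 _]; exact: f0.
rewrite (@integral_seg_split _ f 0 T (Num.max T0 T)) ?(ltW T1) ?le_max ?lexx ?orbT//; last by
  case: sf.
rewrite lerDl; apply: integral_seg_ge0 => r /andP[r0 _]; apply: f0.
exact: le_trans (ltW T1) r0.
Qed.

Lemma half_integral_decay (a : R) : 0 < a -> half_integral (fun t => expR (- (a * t))) = a^-1.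
Proof.
move=> a0; rewrite /half_integral -Rintegral_itv_obnd_cbnd; last first.
  apply: integrableS (integrable_decay a0) => //.
  by move=> t /=; rewrite !in_itv/= !andbT => /ltW.
by rewrite /Rintegral integral_decay_tail//= mulr0 oppr0 expR0 mul1r.
Qed.

Lemma exp_smallD f g : exp_small f -> exp_small g -> exp_small (fun t => f t + g t).
Proof.
move=> [cf [C [a [C0 a0 fC]]]] [cg [D [b [D0 b0 gD]]]]; split.
  exact: continuousD_.
exists (C + D), (Num.min a b); split; [exact: addr_ge0|by rewrite lt_min a0|].
move=> t t0; apply: (le_trans (ler_normD _ _)); rewrite mulrDl; apply: lerD.
  apply: (le_trans (fC _ t0)); rewrite ler_wpM2l// ler_expR lerN2 ler_wpM2r//.
  by rewrite ge_min lexx.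
apply: (le_trans (gD _ t0)); rewrite ler_wpM2l// ler_expR lerN2 ler_wpM2r//.
by rewrite ge_min lexx orbT.
Qed.

Lemma exp_smallM f g (M : R) : exp_small f -> continuous g ->
  (forall t, 0 <= t -> `|g t| <= M) -> exp_small (fun t => f t * g t).
Proof.
move=> [cf [C [a [C0 a0 fC]]]] cg gM; split; first exact: continuousM_.
have M0 : 0 <= M by apply: le_trans (gM 0 _).
exists (C * M), a; split => //; first exact: mulr_ge0.
by move=> t t0; rewrite normrM mulrAC; apply: ler_pM => //; [exact: fC|exact: gM].
Qed.

Lemma exp_smallZ k f : exp_small f -> exp_small (fun t => k * f t).
Proof.
move=> sf; have := exp_smallM sf (@continuous_cst_ R k) (fun t _ => lexx `|k|).
by under eq_fun do rewrite mulrC.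
Qed.

Lemma exp_small_decay (a : R) : 0 < a -> exp_small (fun t => expR (- (a * t))).
Proof.
move=> a0; split; first exact: continuous_decay.
by exists 1, a; split => // t t0; rewrite mul1r ger0_norm ?expR_ge0.
Qed.

Lemma exp_small_linear f : exp_small f -> exp_small (fun t => t * f t).
Proof.
move=> [cf [C [a [C0 a0 fC]]]]; split; first by apply: continuousM_ => //; exact: continuous_id_.
exists (2 / a * C), (a / 2); split; rewrite ?divr_gt0//.
  by rewrite mulr_ge0// divr_ge0// ltW.
move=> t t0; rewrite normrM (ger0_norm t0).
have E : expR (- (a * t)) = expR (- (a / 2 * t)) * expR (- (a / 2 * t)) by rewrite -expRD; congr
  expR; field.
have H := expR_ge1Dx (a / 2 * t).
have X0 : 0 < expR (a / 2 * t) by exact: expR_gt0.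
apply: (@le_trans _ _ (t * (C * expR (- (a * t))))); first by rewrite ler_wpM2l// fC.
rewrite E !mulrA ler_wpM2r ?expR_ge0// expRN ler_pdivrMr//.
have -> : 2 / a * C * expR (a / 2 * t) = C * (2 / a * expR (a / 2 * t)) by ring.
rewrite mulrC ler_wpM2l// mulrAC ler_pdivlMr//.
by move: H; rewrite mulrAC; lra.
Qed.

End half_line.

(** * Estimates on the transform *)

Section transform.
Context {R : realType}.
Variables (lambda mu : R).
Hypotheses (lambda_gt0 : 0 < lambda) (mu_ge0 : 0 <= mu).
Variable P : R -> R.
Hypotheses (cP : continuous P) (P01 : unit_valued P).
Hypothesis PE : forall t, 0 <= t -> P t + mu * convol (empty_prob lambda P) P t = 1.
Hypothesis Pmin : forall t, 0 <= t -> expN mu t <= P t.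

Definition laplace_body (s t : R) : R := expR (- (s * t)) * P t.
(* In the notation of the paper, [lambda (1 - s p^*(s)) / s]. *)
Definition child_transform (s : R) : R := lambda * half_integral (laplace_body s).
Definition child_moment (s : R) : R := lambda * half_integral (fun t => t * laplace_body s t).
Local Notation m := child_transform.
Local Notation D := child_moment.

Lemma laplace_body_small s : 0 < s -> exp_small (laplace_body s).
Proof.
move=> s0; apply: (exp_smallM (exp_small_decay s0) cP (M := 1)) => t t0.
by have /andP[p0 p1] := P01 t0; rewrite ger0_norm.
Qed.

Lemma laplace_body_ge0 s t : 0 <= t -> 0 <= laplace_body s t.
Proof. by move=> t0; rewrite mulr_ge0 ?expR_ge0//; case/andP: (P01 t0). Qed.

Lemma child_transform_le s : 0 < s -> m s <= lambda / s.
Proof.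
move=> s0; rewrite /child_transform ler_wpM2l ?(ltW lambda_gt0)// -half_integral_decay//.
apply: le_half_integral; [exact: laplace_body_small|exact: exp_small_decay|].
by move=> t t0; rewrite /laplace_body ler_piMr ?expR_ge0//; case/andP: (P01 t0).
Qed.

Lemma child_transform_ge s : 0 < s -> lambda / (s + mu) <= m s.
Proof.
move=> s0; have smu : 0 < s + mu by rewrite ltr_wpDr.
rewrite /child_transform ler_wpM2l ?(ltW lambda_gt0)// -half_integral_decay//.
apply: le_half_integral; [exact: exp_small_decay|exact: laplace_body_small|].
move=> t t0; rewrite mulrDl opprD expRD ler_wpM2l ?expR_ge0//; exact: Pmin.
Qed.

Lemma child_transform_gt0 s : 0 < s -> 0 < m s.
Proof.
move=> s0; apply: lt_le_trans (child_transform_ge s0).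
by rewrite divr_gt0// ltr_wpDr.
Qed.

Lemma laplace_child_transform (p : R -> R) s : 0 < s -> (forall t, 0 <= t -> p t = 1 - P t) ->
  lambda * (1 - s * laplace p s) / s = m s.
Proof.
move=> s0 pE; have -> : laplace p s = s^-1 - half_integral (laplace_body s).
  rewrite -half_integral_decay// -[X in _ + X]mulN1r -half_integralZ; last exact:
    laplace_body_small.
  rewrite -half_integralD; [|exact: exp_small_decay|exact/exp_smallZ/laplace_body_small].
  by apply: eq_half_integral => t t0; rewrite pE// /laplace_body; ring.
by rewrite /child_transform; field; rewrite gt_eqF.
Qed.

Lemma expR_taylor1 (x : R) : `|expR x - 1 - x| <= x ^+ 2 * expR `|x|.
Proof.
have H1 := expR_ge1Dx x; have H2 := expR_ge1Dx (- x).
have X0 : 0 < expR x by exact: expR_gt0.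
have H3 : expR x - 1 <= x * expR x.
  by have : expR x * (1 - x) <= expR x * expR (- x) by [rewrite ler_wpM2l// ltW|]; rewrite
    -expRD subrr expR0; lra.
rewrite ger0_norm; last lra.
have [x0|x0] := leP 0 x; first by rewrite ger0_norm//; nra.
rewrite ltr0_norm//; have : 1 <= expR (- x) by rewrite -expR0 ler_expR; lra.
by nra.
Qed.

(** Expansion to first order under the integral sign. The remainder carries a factor exp (|h| t),
    which is absorbed by passing from s to s / 2. *)
Lemma child_transform_taylor s : 0 < s -> exists C, 0 <= C /\
  forall h, `|h| <= s / 2 -> `|m (s + h) - m s + h * D s| <= C * h ^+ 2.
Proof.
move=> s0; have s20 : 0 < s / 2 by rewrite divr_gt0.
have sm2 := exp_small_linear (exp_small_linear (laplace_body_small s20)).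
exists (lambda * half_integral (fun t => t * (t * laplace_body (s / 2) t))); split.
  rewrite mulr_ge0 ?(ltW lambda_gt0)//; apply: half_integral_ge0 => t t0.
  by apply: mulr_ge0 => //; apply: mulr_ge0 => //; exact: laplace_body_ge0.
move=> h hs; have sh0 : 0 < s + h by move: hs; rewrite ler_norml; lra.
have S1 := laplace_body_small sh0; have S2 := laplace_body_small s0.
have S3 := exp_small_linear S2.
have S4 := exp_smallD (exp_smallD S1 (exp_smallZ (-1) S2)) (exp_smallZ h S3).
have -> : m (s + h) - m s + h * D s = lambda * half_integral (fun t =>
    laplace_body (s + h) t + -1 * laplace_body s t + h * (t * laplace_body s t)).
  rewrite half_integralD; [|exact: (exp_smallD S1 (exp_smallZ (-1) S2))|exact: exp_smallZ].
  rewrite half_integralD; [|exact: S1|exact: exp_smallZ].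
  rewrite (half_integralZ (-1) S2) (half_integralZ h S3) /child_transform /child_moment; ring.
have B t : 0 <= t -> `|laplace_body (s + h) t + -1 * laplace_body s t + h * (t * laplace_body s t)|
    <= h ^+ 2 * (t * (t * laplace_body (s / 2) t)).
  move=> t0; have /andP[p0 p1] := P01 t0.
  have -> : laplace_body (s + h) t + -1 * laplace_body s t + h * (t * laplace_body s t) =
    laplace_body s t * (expR (- (h * t)) - 1 - - (h * t)).
    rewrite /laplace_body mulrDl opprD expRD; ring.
  rewrite normrM (ger0_norm (laplace_body_ge0 _ t0)).
  apply: (le_trans (ler_wpM2l (laplace_body_ge0 _ t0) (expR_taylor1 _))).
  rewrite sqrrN exprMn normrN normrM (ger0_norm t0).
  have -> : laplace_body s t * (h ^+ 2 * t ^+ 2 * expR (`|h| * t)) =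
    h ^+ 2 * (t * (t * (expR (- (s * t)) * expR (`|h| * t) * P t))) by rewrite /laplace_body; ring.
  rewrite !ler_wpM2l ?sqr_ge0// /laplace_body ler_wpM2r// -expRD ler_expR.
  by nra.
rewrite normrM (gtr0_norm lambda_gt0) -mulrA ler_wpM2l ?(ltW lambda_gt0)//.
have -> : half_integral (fun t : R => t * (t * laplace_body (s / 2) t)) * h ^+ 2 =
    half_integral (fun t => h ^+ 2 * (t * (t * laplace_body (s / 2) t))) by rewrite
      (half_integralZ _ sm2) mulrC.
set F := fun t : R => h ^+ 2 * _; set E := fun t : R => laplace_body (s + h) t + _ + _.
have SF : exp_small F by exact: exp_smallZ.
rewrite ler_norml; apply/andP; split.
  have -> : - half_integral F = half_integral (fun t => -1 * F t) by rewrite (half_integralZ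
    (-1) SF) mulN1r.
  apply: le_half_integral => //; first exact: exp_smallZ.
  by move=> t t0; rewrite mulN1r; have := B _ t0; rewrite ler_norml => /andP[].
apply: le_half_integral => // t t0.
by have := B _ t0; rewrite ler_norml => /andP[].
Qed.

(* [expR (- (u - s) t)] lies above its tangent at the mean [D s / m s]. *)
Lemma child_transform_tangent s u : 0 < s -> 0 < u ->
  m s * expR (- ((u - s) * (D s / m s))) <= m u.
Proof.
move=> s0 u0; have ms := child_transform_gt0 s0.
set t0 := D s / m s; set X := expR _.
have S1 := laplace_body_small u0; have S2 := laplace_body_small s0.
have S3 := exp_small_linear S2.
have : lambda * half_integral (fun t => (X * (1 + (u - s) * t0)) * laplace_body s t +
    - (X * (u - s)) * (t * laplace_body s t)) <= m u.
  rewrite /child_transform ler_wpM2l ?(ltW lambda_gt0)//.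
  apply: le_half_integral => //; first by apply: exp_smallD; exact: exp_smallZ.
  move=> t tt0; have /andP[p0 p1] := P01 tt0.
  have -> : laplace_body u t = X * (expR (- ((u - s) * (t - t0))) * laplace_body s t).
    have E : expR (- (u * t)) = X * (expR (- ((u - s) * (t - t0))) * expR (- (s * t))).
      by rewrite /X -!expRD; congr expR; move: (t0) => y; ring.
    by rewrite /laplace_body E; move: (expR _) => y; move: (X) => x; rewrite -!mulrA.
  have -> : X * (1 + (u - s) * t0) * laplace_body s t + - (X * (u - s)) * (t * laplace_body s t)
     = X * ((1 + - ((u - s) * (t - t0))) * laplace_body s t) by ring.
  rewrite ler_wpM2l ?expR_ge0// ler_wpM2r ?laplace_body_ge0//; exact: expR_ge1Dx.
rewrite half_integralD; [|exact: exp_smallZ..].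
rewrite (half_integralZ (X * (1 + (u - s) * t0)) S2) (half_integralZ (- (X * (u - s))) S3);
  apply: le_trans.
rewrite le_eqVlt; apply/orP; left; apply/eqP.
have Dm : D s = t0 * m s by rewrite /t0 divfK ?gt_eqF.
have -> : lambda * (X * (1 + (u - s) * t0) * half_integral (laplace_body s) +
  - (X * (u - s)) * half_integral (fun t => t * laplace_body s t)) =
  X * (1 + (u - s) * t0) * m s - X * (u - s) * D s by rewrite /child_transform /child_moment; ring.
rewrite Dm; ring.
Qed.

(** By 1 - exp (- x) <= x, [tall_prob_rec] becomes a linear convolution inequality, along which each
    generation contributes a factor [m s]. *)
Lemma tall_prob_le n s t : 0 < s -> 0 <= t ->
  tall_prob lambda P n t <= expR (s * t) * m s ^+ n.
Proof.
move=> s0; elim: n t => [|n IH] t t0.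
  rewrite expr0 mulr1 (le_trans (y := 1))//; first by case/andP: (tall_prob_unit lambda_gt0
    mu_ge0 cP P01 PE 0 t0).
  by rewrite -expR0 ler_expR mulr_ge0// ltW.
rewrite tall_prob_rec// lerBlDl -lerBlDr.
apply: le_trans (expR_ge1Dx _).
rewrite lerD2l lerN2.
have cb := (laplace_body_small s0).1.
apply: (@le_trans _ _ (lambda * (expR (s * t) * m s ^+ n * integral_seg (laplace_body s) 0 t))).
  rewrite ler_wpM2l ?(ltW lambda_gt0)// -integral_segZ// /convol.
  apply: le_integral_seg.
  - by apply: continuous_convol_body => //; exact: continuous_tall_prob.
  - exact: continuousZ_.
  move=> r /andP[r0 rt]; have tr : 0 <= t - r by rewrite subr_ge0.
  have /andP[p0 p1] := P01 r0.
  apply: (le_trans (ler_wpM2l p0 (IH _ tr))).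
  have -> : s * (t - r) = s * t + - (s * r) by ring.
  by rewrite expRD /laplace_body le_eqVlt; apply/orP; left; apply/eqP; ring.
rewrite exprSr [m s as X in _ <= _ * (_ * X)]/child_transform.
have -> : expR (s * t) * (m s ^+ n * (lambda * half_integral (laplace_body s))) =
  lambda * (expR (s * t) * m s ^+ n * half_integral (laplace_body s)) by ring.
rewrite !ler_wpM2l ?(ltW lambda_gt0)//.
  by rewrite mulr_ge0 ?expR_ge0// exprn_ge0// ltW// child_transform_gt0.
apply: integral_seg_le_half; first exact: laplace_body_small.
by move=> r r0; exact: laplace_body_ge0.
Qed.

End transform.

Section calculus.
Context {R : realType}.
Implicit Types (f : R -> R).

Lemma quadratic_is_derive f (s r D C : R) : 0 < r ->
  (forall h, `|h| <= r -> `|f (s + h) - f s - h * D| <= C * h ^+ 2) ->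
  is_derive s (1 : R) f D.
Proof.
move=> r0 fC.
have H : (fun h : R => h^-1 *: ((f \o shift s) (h *: (1 : R)) - f s)) @ 0^' --> D.
  apply/cvgrPdist_le => e e0.
  have B0 : 0 < `|C| + 1 by rewrite ltr_wpDl.
  near=> h.
  have h0 : h != 0 by near: h; exact: nbhs_dnbhs_neq.
  have hr : `|h| < Num.min r (e / (`|C| + 1)).
    near: h; apply: dnbhs0_lt; by rewrite lt_min r0 divr_gt0.
  move: hr; rewrite lt_min => /andP[hr he].
  rewrite /shift/= /GRing.scale/= mulr1 [h + s]addrC.
  have -> : D - h^-1 * (f (s + h) - f s) = - (h^-1 * (f (s + h) - f s - h * D)) by field.
  rewrite normrN normrM normfV ler_pdivrMl ?normr_gt0//.
  apply: (le_trans (fC _ (ltW hr))).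
  have CC := ler_norm C; rewrite -[h ^+ 2]ger0_norm ?sqr_ge0// normrX.
  have N0 : 0 < `|h| by rewrite normr_gt0.
  have : `|h| * (`|C| + 1) <= e by rewrite -ler_pdivlMr// ltW.
  nra.
apply: DeriveDef; first by apply/cvg_ex; exists D.
exact: cvg_lim.
Unshelve. all: by end_near. Qed.

Lemma half_line_min f (a x0 b : R) : 0 < a -> a <= x0 -> x0 <= b ->
  (forall u, 0 < u -> {for u, continuous f}) ->
  (forall u, 0 < u -> u <= a -> f x0 <= f u) -> (forall u, b <= u -> f x0 <= f u) ->
  exists s, 0 < s /\ forall u, 0 < u -> f s <= f u.
Proof.
move=> a0 ax xb cf fa fb.
have ab : a <= b by exact: le_trans xb.
have cw : {within `[a, b], continuous f}.
  apply: continuous_in_subspaceT => u; rewrite inE/= in_itv/= => /andP[au _].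
  exact: cf (lt_le_trans a0 au).
have [s sab fs] := EVT_min ab cw.
have s0 : 0 < s by move: sab; rewrite in_itv/= => /andP[/(lt_le_trans a0)].
have sx : f s <= f x0 by apply: fs; rewrite in_itv/= ax.
exists s; split => // u u0.
have [ua|au] := leP u a; first exact: le_trans (fa _ u0 ua).
have [bu|ub] := leP b u; first exact: le_trans (fb _ bu).
by apply: fs; rewrite in_itv/= !ltW.
Qed.

Lemma expR_ge_sqr (x : R) : 0 <= x -> x ^+ 2 / 4 <= expR x.
Proof.
move=> x0; have -> : expR x = expR (x / 2) ^+ 2 by rewrite expr2 -expRD; congr expR; field.
have -> : x ^+ 2 / 4 = (x / 2) ^+ 2 by field.
rewrite lerXn2r ?nnegrE ?expR_ge0 ?divr_ge0//.
by have := expR_ge1Dx (x / 2); lra.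
Qed.

End calculus.

(** * The logarithm of the transform and the solutions of the system *)

Section log_transform.
Context {R : realType}.
Variables (lambda mu : R).
Hypotheses (lambda_gt0 : 0 < lambda) (mu_ge0 : 0 <= mu).
Variable P : R -> R.
Hypotheses (cP : continuous P) (P01 : unit_valued P).
Hypothesis Pmin : forall t, 0 <= t -> expN mu t <= P t.
Local Notation m := (child_transform lambda P).

Definition log_transform (s : R) : R := ln (m s).
(* The mean of the distribution proportional to [expR (- s * r) * P r], which is
   also minus the derivative of [L]. *)
Definition mean_age (s : R) : R := child_moment lambda P s / m s.
Local Notation L := log_transform.

Lemma log_transformK s : 0 < s -> expR (L s) = m s.
Proof. by move=> s0; rewrite lnK// posrE (child_transform_gt0 lambda_gt0 mu_ge0 cP P01 Pmin). Qed.

Lemma is_derive_log_transform (s : R) : 0 < s -> is_derive s (1 : R) L (- mean_age s).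
Proof.
move=> s0; have ms := child_transform_gt0 lambda_gt0 mu_ge0 cP P01 Pmin s0.
have [C [C0 mC]] := child_transform_taylor lambda_gt0 cP P01 s0.
have dm : is_derive s (1 : R) m (- child_moment lambda P s).
  apply: (@quadratic_is_derive _ _ _ (s / 2) _ C); first by rewrite divr_gt0.
  by move=> h hs; rewrite mulrN opprK; exact: mC.
have H := @is_derive1_comp R (@ln R) m s _ _ (is_derive1_ln ms) dm.
by apply: (is_derive_eq H); rewrite mulrC mulNr.
Qed.

Lemma continuous_log_transform s : 0 < s -> {for s, continuous L}.
Proof.
move=> s0; have [d _] := is_derive_log_transform s0.
exact: differentiable_continuous ((derivable1_diffP _ _).1 d).
Qed.

Lemma log_transform_tangent s u : 0 < s -> 0 < u ->
  L s - (u - s) * mean_age s <= L u.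
Proof.
move=> s0 u0; rewrite -ler_expR; have := log_transformK s0; have := log_transformK u0.
move: (L s) (L u) => x y Ey Ex; rewrite expRD Ex Ey.
exact: (child_transform_tangent lambda_gt0 mu_ge0 cP P01 Pmin).
Qed.

(** Once u >= mu, the transform is at least lambda / (2 u), whereas exp (u g) >= (u g)^2 / 4; the
    threshold 8 exp M / (lambda g^2) solves the resulting inequality. *)
Lemma log_transform_dominates (g M : R) : 0 < g -> exists b, 0 < b /\
  forall u, b <= u -> M <= u * g + L u.
Proof.
move=> g0.
have B0 : 0 < expR M * 8 / (lambda * g ^+ 2) by rewrite divr_gt0 ?mulr_gt0 ?expR_gt0// exprn_gt0.
exists (Num.max (expR M * 8 / (lambda * g ^+ 2)) mu); split; first by rewrite lt_max B0.
move=> u; rewrite ge_max => /andP[u1 u2]; have u0 := lt_le_trans B0 u1.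
rewrite -ler_expR expRD log_transformK//.
have H1 : lambda / (2 * u) <= m u.
  apply: le_trans (child_transform_ge lambda_gt0 mu_ge0 cP P01 Pmin u0).
  by rewrite ler_pM2l// lef_pV2 ?posrE ?mulr_gt0 ?ltr_wpDr//; lra.
have H2 : (u * g) ^+ 2 / 4 <= expR (u * g) by apply: expR_ge_sqr; rewrite mulr_ge0 ?ltW.
apply: le_trans (ler_pM _ _ H2 H1).
- have -> : (u * g) ^+ 2 / 4 * (lambda / (2 * u)) = u * (lambda * g ^+ 2) / 8 by field; rewrite
  gt_eqF.
  by rewrite ler_pdivlMr// -ler_pdivrMr ?mulr_gt0 ?exprn_gt0.
- by rewrite divr_ge0// sqr_ge0.
- by rewrite divr_ge0 ?mulr_ge0 ?(ltW lambda_gt0)// ltW.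
Qed.

Lemma log_transform_stationary (s g : R) : 0 < s ->
  (forall u, 0 < u -> s * g + L s <= u * g + L u) -> mean_age s = g.
Proof.
move=> s0 smin.
have dphi (u : R) : 0 < u -> is_derive u (1 : R) (fun x : R => x * g + L x) (g - mean_age u).
  move=> u0; have H := is_deriveD (is_deriveZ g (is_derive_id u (1 : R)))
    (is_derive_log_transform u0).
  rewrite (_ : (fun x : R => x * g + L x) = (g \*: id) + L); last first.
    by apply/funext => x; rewrite /= /GRing.scale/= mulrC.
  by apply: (is_derive_eq H); rewrite /GRing.scale/= mulr1.
have s2 : s < s + 1 by rewrite ltrDl.
have H : is_derive s (1 : R) (fun x : R => x * g + L x) 0.
  apply: (@derive1_at_min _ _ 0 (s + 1)).
  - by rewrite addr_ge0// ltW.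
  - move=> t; rewrite in_itv/= => /andP[t0 _]; by have [] := dphi _ t0.
  - by rewrite in_itv/= s0 s2.
  - by move=> t; rewrite in_itv/= => /andP[t0 _]; exact: smin.
have [_ E1] := H; have [_ E2] := dphi _ s0.
by move: E2; rewrite E1 => /eqP; rewrite eq_sym subr_eq0 => /eqP.
Qed.

Lemma solves_bP (p : R -> R) s c : (forall t, 0 <= t -> p t = 1 - P t) ->
  solves_b lambda p s c <->
  [/\ 0 < s, 0 < c, s / c + L s = 0 & mean_age s = c^-1].
Proof.
move=> pE.
have bE u : 0 < u -> b_fun lambda p u c = u / c + L u.
  by move=> u0; rewrite /b_fun (laplace_child_transform lambda cP P01 u0 pE).
have db (u : R) : 0 < u -> is_derive u (1 : R) (fun x : R => b_fun lambda p x c : R) (c^-1 -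
  mean_age u).
  move=> u0; apply: (@near_eq_is_derive _ _ _ (fun x : R => x * c^-1 + L x)).
  - near=> x; rewrite bE//; near: x; exact: lt_nbhsr.
  - have H := is_deriveD (is_deriveZ c^-1 (is_derive_id u (1 : R))) (is_derive_log_transform u0).
    rewrite (_ : (fun x : R => x * c^-1 + L x) = (c^-1 \*: id) + L); last first.
      by apply/funext => x; rewrite /= /GRing.scale/= mulrC.
    by apply: (is_derive_eq H); rewrite /GRing.scale/= mulr1.
split.
- move=> [s0 c0 b0 [_ d0]]; split => //; first by rewrite -bE.
  have [_ E] := db _ s0; apply/eqP; rewrite eq_sym -subr_eq0 -E; apply/eqP; exact: d0.
- move=> [s0 c0 b0 E]; split => //; first by rewrite bE.
  by apply: (is_derive_eq (db _ s0)); rewrite E subrr.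
Unshelve. all: by end_near. Qed.

(* A solution is a tangent of [L] through the origin, and [L] is convex. *)
Lemma solves_b_tangent (p : R -> R) s c u : (forall t, 0 <= t -> p t = 1 - P t) ->
  solves_b lambda p s c -> 0 < u -> 0 <= u / c + L u.
Proof.
move=> pE /(solves_bP _ _ pE)[s0 c0 b0 E] u0.
have := log_transform_tangent s0 u0; rewrite E mulrBl => H.
by move: b0 H; move: (L s) (L u) (s / c) (u / c) => x y z w; lra.
Qed.

(** The tangent inequality of one solution, taken at the point of the other, compares the two
    speeds; by symmetry they agree. *)
Lemma solves_b_uniq (p : R -> R) s c s' c' : (forall t, 0 <= t -> p t = 1 - P t) ->
  solves_b lambda p s c -> solves_b lambda p s' c' -> c = c'.
Proof.
move=> pE; have H a x b y : solves_b lambda p a x -> solves_b lambda p b y -> x <= y.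
  move=> ax by_; have /(solves_bP _ _ pE)[b0 y0 e _] := by_.
  have [x0 a0] : 0 < x /\ 0 < a by case: ax.
  have := solves_b_tangent pE ax b0.
  rewrite -(lerD2r (- L b)) addrK add0r.
  have -> : - L b = b / y by lra.
  by rewrite ler_pM2l// lef_pV2.
by move=> h1 h2; apply/eqP; rewrite eq_le; apply/andP; split; [exact: H h1 h2|exact: H h2 h1].
Qed.

Section persistent.
Variable kappa : R.
Hypotheses (kappa_gt0 : 0 < kappa) (kappaP : forall t, 0 <= t -> kappa <= P t).

Lemma child_transform_ge_kappa s : 0 < s -> lambda * kappa / s <= m s.
Proof.
move=> s0; rewrite -mulrA /child_transform ler_wpM2l ?(ltW lambda_gt0)//.
rewrite -half_integral_decay// -half_integralZ; last exact: exp_small_decay.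
apply: le_half_integral; [exact/exp_smallZ/exp_small_decay|exact: laplace_body_small|].
by move=> t t0; rewrite mulrC ler_wpM2l ?expR_ge0//; exact: kappaP.
Qed.

Lemma log_transform_min g : 0 < g -> exists s, 0 < s /\
  forall u, 0 < u -> s * g + L s <= u * g + L u.
Proof.
move=> g0; set M := 1 * g + L 1.
have [b [b0 bM]] := log_transform_dominates M g0.
have lk : 0 < lambda * kappa by rewrite mulr_gt0.
have lM : 0 < lambda * kappa / expR M by rewrite divr_gt0 ?expR_gt0.
apply: (@half_line_min _ _ (Num.min 1 (lambda * kappa / expR M)) 1 (Num.max 1 b)).
- by rewrite lt_min ltr01.
- by rewrite ge_min lexx.
- by rewrite le_max lexx.
- move=> u u0; apply: continuousD; last exact: continuous_log_transform.
  by apply: cvgM; [exact: cvg_id|exact: cvg_cst].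
- move=> u u0; rewrite le_min => /andP[_ uM]; rewrite -/M.
  apply: (@le_trans _ _ (L u)); last by rewrite lerDr mulr_ge0 ?ltW.
  rewrite -ler_expR log_transformK//; apply: le_trans (child_transform_ge_kappa u0).
  by rewrite ler_pdivlMr// mulrC -ler_pdivlMr ?expR_gt0.
- by move=> u; rewrite ge_max => /andP[_]; exact: bM.
Qed.

(** The number [g] is minus the minimum of L u / u. The ratio is negative at 2 lambda, where m <=
    1/2. It is nonnegative for u <= lambda kappa, where m >= 1, and at least its value at 2 lambda
    for u large, so the minimum is attained. *)
Lemma speed_exists : exists g s, [/\ 0 < g, 0 < s, s * g + L s = 0 &
  forall u, 0 < u -> 0 <= u * g + L u].
Proof.
have kappa1 : kappa <= 1 by apply: (le_trans (kappaP (lexx 0))); case/andP: (P01 (lexx 0)).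
have lk : 0 < lambda * kappa by rewrite mulr_gt0.
pose f u := L u / u.
have l20 : 0 < 2 * lambda by rewrite mulr_gt0.
have f20 : f (2 * lambda) < 0.
  rewrite /f ltr_pdivrMr// mul0r -ltr_expR log_transformK// expR0.
  apply: (le_lt_trans (child_transform_le lambda_gt0 cP P01 l20)).
  by rewrite ltr_pdivrMr// mul1r ltr_pMl// ltr1n.
have [b [b0 bM]] := @log_transform_dominates (- f (2 * lambda)) 0 ltac:(by rewrite oppr_gt0).
have [s [s0 sm]] : exists s, 0 < s /\ forall u, 0 < u -> f s <= f u.
  apply: (@half_line_min _ _ (lambda * kappa) (2 * lambda) (Num.max (2 * lambda) b)) => //.
  - by nra.
  - by rewrite le_max lexx.
  - move=> u u0; apply: continuousM; first exact: continuous_log_transform.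
    by apply: continuousV; [rewrite gt_eqF|exact: cvg_id].
  - move=> u u0 uk; apply: (le_trans (ltW f20)); rewrite /f divr_ge0 ?(ltW u0)//.
    rewrite -ler_expR log_transformK// expR0; apply: le_trans (child_transform_ge_kappa u0).
    by rewrite ler_pdivlMr// mul1r.
  - move=> u; rewrite ge_max => /andP[_ bu]; have u0 := lt_le_trans b0 bu.
    rewrite {2}/f ler_pdivlMr//; have := bM _ bu; rewrite mulrN; lra.
exists (- f s), s; split => //.
- by rewrite oppr_gt0; apply: le_lt_trans f20; exact: sm.
- by rewrite /f mulrN mulrC divfK ?gt_eqF// addrC subrr.
- move=> u u0; have := sm _ u0; rewrite {2}/f ler_pdivlMr// => H.
  by rewrite mulrN -lerBlDl opprK add0r mulrC.
Qed.

End persistent.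
End log_transform.

(** * Mass of convolutions on segments *)

Section convolution_mass.
Context {R : realType}.
Implicit Types (f g : R -> R).

Lemma integral_convol f g T : continuous f -> continuous g ->
  integral_seg (convol f g) 0 T = convol g (integral_seg f 0) T.
Proof.
move=> cf cg; have cc := continuous_convol cf cg; have c1 := @continuous_cst_ R 1.
rewrite -(convol1l T cc) (convolA T c1 cf cg) (convolC T (continuous_convol c1 cf) cg).
by apply: eq_convol => // r _; rewrite convol1l.
Qed.

(** The mass of a convolution on a segment is that of a product over a triangle. The triangle of
    side 2 T contains the square of side T; [integral_convol_le] rests on the reverse inclusion for
    the triangle of side T. *)
Lemma integral_convol_ge f g T : continuous f -> continuous g -> 0 <= T ->
  (forall t, 0 <= t -> 0 <= f t) -> (forall t, 0 <= t -> 0 <= g t) ->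
  integral_seg f 0 T * integral_seg g 0 T <= integral_seg (convol f g) 0 (2 * T).
Proof.
move=> cf cg T0 f0 g0; have cF := continuous_integral_seg cf.
rewrite integral_convol// /convol -integral_segZ//.
have T2 : T <= 2 * T by lra.
have cb : continuous (fun r => g r * integral_seg f 0 (2 * T - r)) by exact: continuous_convol_body.
rewrite (integral_seg_split cb T0 T2).
apply: le_trans (_ : _ <= integral_seg (fun r => g r * integral_seg f 0 (2 * T - r)) 0 T) _.
  apply: le_integral_seg => //; first exact: continuousZ_.
  move=> r /andP[r0 rT]; rewrite mulrC ler_wpM2l ?g0//.
  rewrite (@integral_seg_split _ f 0 T (2 * T - r)) ?lerDl//; last by lra.
  by apply: integral_seg_ge0 => x /andP[Tx _]; apply: f0; exact: le_trans Tx.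
rewrite lerDl; apply: integral_seg_ge0 => r /andP[Tr rT].
apply: mulr_ge0; first by apply: g0; exact: le_trans Tr.
by apply: integral_seg_ge0 => x /andP[x0 _]; exact: f0.
Qed.

Lemma integral_convol_le f g T : continuous f -> continuous g -> 0 <= T ->
  (forall t, 0 <= t -> 0 <= f t) -> (forall t, 0 <= t -> 0 <= g t) ->
  integral_seg (convol f g) 0 T <= integral_seg f 0 T * integral_seg g 0 T.
Proof.
move=> cf cg T0 f0 g0; have cF := continuous_integral_seg cf.
rewrite integral_convol// /convol -integral_segZ//.
apply: le_integral_seg; [exact: continuous_convol_body|exact: continuousZ_|].
move=> r /andP[r0 rT]; rewrite mulrC ler_wpM2r ?g0//.
rewrite (@integral_seg_split _ f 0 (T - r) T) ?lerDl ?subr_ge0//; last by lra.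
by apply: integral_seg_ge0 => x /andP[Tx _]; apply: f0; apply: le_trans Tx; rewrite subr_ge0.
Qed.

Lemma convol_laplace_body (s : R) g h (t : R) : continuous g -> continuous h ->
  convol (laplace_body g s) (laplace_body h s) t = expR (- (s * t)) * convol g h t.
Proof.
move=> cg ch; rewrite /convol -integral_segZ//; last exact: continuous_convol_body.
apply: eq_integral_seg => r _; rewrite /laplace_body.
have -> : - (s * t) = - (s * r) + - (s * (t - r)) by ring.
by rewrite expRD; ring.
Qed.

End convolution_mass.

(** * Consequences of the renewal equation for a nonincreasing survival function *)

Section renewal.
Context {R : realType}.
Variables (lambda mu : R).
Hypotheses (lambda_gt0 : 0 < lambda) (mu_ge0 : 0 <= mu).
Variable P : R -> R.
Hypotheses (cP : continuous P) (P01 : unit_valued P).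
Hypothesis PE : forall t, 0 <= t -> P t + mu * convol (empty_prob lambda P) P t = 1.
Hypothesis Pdecr : forall s t, 0 <= s -> s <= t -> P t <= P s.
Local Notation beta := (empty_prob lambda P).

Let cbeta : continuous beta. Proof. exact: continuous_empty_prob. Qed.
Let P0 t : 0 <= t -> 0 <= P t. Proof. by move=> /P01/andP[]. Qed.

Lemma empty_prob_decr s t : 0 <= s -> s <= t -> beta t <= beta s.
Proof.
move=> s0 st; rewrite /empty_prob ler_expR lerN2 ler_wpM2l ?(ltW lambda_gt0)//.
rewrite (@integral_seg_split _ P 0 s t)// lerDl.
by apply: integral_seg_ge0 => r /andP[sr _]; apply: P0; exact: le_trans sr.
Qed.

(** The convolution on [0, 2 u] is cut at the middle. On the half where the argument of [beta] is at
    least [u], that nonincreasing function is replaced by [beta u]. *)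
Lemma renewal_split u : 0 <= u -> 1 - P (2 * u) <=
  mu * (beta u * integral_seg P 0 u + integral_seg (fun r => P r * beta (2 * u - r)) u (2 * u)).
Proof.
move=> u0; have u20 : 0 <= 2 * u by rewrite mulr_ge0.
have -> : 1 - P (2 * u) = mu * convol beta P (2 * u) by have := PE u20; lra.
rewrite ler_wpM2l// convolC// /convol.
rewrite (@integral_seg_split _ _ 0 u)//; last by lra.
  rewrite lerD2r -integral_segZ//; apply: le_integral_seg.
  - exact: continuous_convol_body.
  - exact: continuousZ_.
  - move=> r /andP[r0 ru]; rewrite mulrC ler_wpM2r ?P0//; apply: empty_prob_decr => //; lra.
exact: continuous_convol_body.
Qed.

Lemma mul_expRN_le (x : R) : x * expR (- x) <= expR (- 1).
Proof.
have := expR_ge1Dx (x - 1); rewrite addrC subrK expRD => H.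
have X : 0 < expR x by exact: expR_gt0.
by rewrite expRN ler_pdivrMr// mulrC.
Qed.

(** * Finite integral of the survival function *)

Section finite_mass.
Variable K : R.
Hypothesis PK : forall t, 0 <= t -> integral_seg P 0 t <= K.
Hypothesis Pmin : forall t, 0 <= t -> expN mu t <= P t.
Local Notation m := (child_transform lambda P).

Let K0 : 0 <= K. Proof. by have := PK (lexx 0); rewrite integral_seg_xx. Qed.

(** The dyadic blocks are disjoint, so fewer than K / e + 1 of them can have mass above [e]. *)
Lemma small_dyadic_mass (e N : R) : 0 < e -> 0 < N ->
  exists u, N <= u /\ integral_seg P u (2 * u) <= e.
Proof.
move=> e0 N0; apply: contrapT => H.
have step u : N <= u -> e < integral_seg P u (2 * u).
  by move=> Nu; rewrite ltNge; apply/negP => He; apply: H; exists u.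
have big n : n%:R * e <= integral_seg P 0 (2 ^+ n * N).
  elim: n => [|n IH].
    by rewrite mul0r; apply: integral_seg_ge0 => r /andP[r0 _]; exact: P0.
  have n1 : N <= 2 ^+ n * N by rewrite ler_peMl ?(ltW N0)// exprn_ege1// ler1n.
  rewrite exprS -mulrA (@integral_seg_split _ P 0 (2 ^+ n * N))//; last 2 first.
  - by rewrite mulr_ge0 ?exprn_ge0 ?(ltW N0).
  - by rewrite ler_peMl ?ler1n// mulr_ge0 ?exprn_ge0 ?(ltW N0).
  by rewrite -natr1 mulrDl mul1r; apply: lerD => //; exact/ltW/step.
have := big (Num.truncn (K / e)).+1; apply/negP; rewrite -ltNge.
apply: (@le_lt_trans _ _ K); first by apply: PK; rewrite mulr_ge0 ?exprn_ge0 ?(ltW N0).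
rewrite -ltr_pdivrMr//; exact: truncnS_gt.
Qed.

(** Along the times of [small_dyadic_mass], and up to arbitrarily small errors, [renewal_split]
    leaves 1 <= mu F exp (- lambda F), where F is the integral of [P] up to [u]; and x exp (- x) <=
    exp (- 1). *)
Lemma death_rate_large : lambda * expR 1 <= mu.
Proof.
have E1 : 0 < expR (- 1) :> R by exact: expR_gt0.
suff : lambda <= mu * expR (- 1) by rewrite expRN ler_pdivlMr ?expR_gt0.
apply/ler_addgt0Pr => e e0.
pose d := e / (lambda + lambda * mu).
have lm : 0 < lambda + lambda * mu by rewrite ltr_wpDr// mulr_ge0// ltW.
have d0 : 0 < d by rewrite divr_gt0.
have [u [uN ud]] := @small_dyadic_mass d (K / d + 1) d0 ltac:(by rewrite ltr_wpDl// divr_ge0// ltW).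
have u0 : 0 < u by apply: lt_le_trans uN; rewrite ltr_wpDl// divr_ge0// ltW.
have Pu : P (2 * u) <= d.
  have : P (2 * u) * u <= K.
    apply: le_trans (PK (ltW u0)); have -> : P (2 * u) * u = integral_seg (fun=> P (2 * u)) 0 u.
      by rewrite integral_seg_cst ?subr0// ltW.
    apply: le_integral_seg => //; first exact: continuous_cst_.
    by move=> r /andP[r0 ru]; apply: Pdecr => //; lra.
  move=> H; have : K <= d * u by rewrite mulrC -ler_pdivrMr//; lra.
  by move=> H2; rewrite -(ler_pM2r u0); exact: le_trans H2.
have H := renewal_split (ltW u0).
have H1 : lambda * (beta u * integral_seg P 0 u) <= expR (- 1).
  have := mul_expRN_le (lambda * integral_seg P 0 u); apply: le_trans.
  by rewrite /empty_prob le_eqVlt; apply/orP; left; apply/eqP; ring.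
have H2 : integral_seg (fun r => P r * beta (2 * u - r)) u (2 * u) <= d.
  apply: le_trans ud; apply: le_integral_seg => //; first exact: continuous_convol_body.
  move=> r /andP[ur ru]; rewrite ler_piMr// ?P0//; first exact: le_trans (ltW u0) ur.
  by have /andP[] := empty_prob_unit lambda_gt0 P01 (t := 2 * u - r) ltac:(by lra).
have : lambda * (1 - d) <= mu * (expR (- 1) + lambda * d).
  apply: (@le_trans _ _ (lambda * (1 - P (2 * u)))).
    by rewrite ler_wpM2l ?(ltW lambda_gt0)//; lra.
  apply: (le_trans (ler_wpM2l (ltW lambda_gt0) H)).
  rewrite mulrCA ler_wpM2l// mulrDr lerD// ler_wpM2l// ltW//.
have -> : e = d * (lambda + lambda * mu) by rewrite /d divfK ?gt_eqF.
move: (expR (-1)) => x; lra.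
Qed.

(** The renewal equation is multiplied by exp (- s t) and integrated up to 2 T. The convolution term
    is bounded below by a product of integrals up to T, and T is then taken large. *)
Lemma renewal_transform s : 0 < s ->
  half_integral (laplace_body P s) + mu * (half_integral (laplace_body beta s) * half_integral
    (laplace_body P s))
  <= s^-1.
Proof.
move=> s0; have b01 := empty_prob_unit lambda_gt0 P01.
have Sg := laplace_body_small cP P01 s0; have Sf := laplace_body_small cbeta b01 s0.
have g0 := laplace_body_ge0 P01 s; have f0 := laplace_body_ge0 b01 s.
have gh0 := half_integral_ge0 g0; have fh0 := half_integral_ge0 f0.
have IE T := integral_seg_le_half T (exp_small_decay s0) (fun t _ => expR_ge0 _).
move: IE; rewrite half_integral_decay// => IE.
set gh := half_integral _; set fh := half_integral _.
have c0 : 0 < 1 + mu * (fh + gh) by rewrite ltr_wpDr// mulr_ge0// addr_ge0.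
apply/ler_addgt0Pr => e e0; pose d := e / (1 + mu * (fh + gh)).
have d0 : 0 < d by rewrite divr_gt0.
have [T1 [T10 H1]] := half_integral_approx Sg d0; have [T2 [T20 H2]] := half_integral_approx Sf d0.
pose T := Num.max T1 T2; have T0 : 0 <= T by rewrite le_max T10.
have gT : gh - d <= integral_seg (laplace_body P s) 0 T.
  by have := H1 T; rewrite le_max lexx => /(_ isT); rewrite ler_norml -/gh; lra.
have g2T : gh - d <= integral_seg (laplace_body P s) 0 (2 * T).
  have := H1 (2 * T); have : T1 <= 2 * T by have : T1 <= T by [rewrite le_max lexx|]; lra.
  by move=> -> /(_ isT); rewrite ler_norml -/gh; lra.
have fT : fh - d <= integral_seg (laplace_body beta s) 0 T.
  by have := H2 T; rewrite le_max lexx orbT => /(_ isT); rewrite ler_norml -/fh; lra.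
have fT0 : 0 <= integral_seg (laplace_body beta s) 0 T by apply: integral_seg_ge0 => r /andP[r0
  _]; exact: f0.
have fTle := integral_seg_le_half T Sf f0.
have [cg _] := Sg; have [cf _] := Sf.
have conv := integral_convol_ge cf cg T0 f0 g0.
have tot : integral_seg (laplace_body P s) 0 (2 * T) +
    mu * integral_seg (convol (laplace_body beta s) (laplace_body P s)) 0 (2 * T) <= s^-1.
  apply: le_trans (IE (2 * T)).
  have cc := continuous_convol cf cg.
  rewrite -integral_segZ// -integral_segD//; last exact: continuousZ_.
  rewrite le_eqVlt; apply/orP; left; apply/eqP; apply: eq_integral_seg => r /andP[r0 _].
  by rewrite convol_laplace_body// -[RHS]mulr1 -(PE r0) /laplace_body; ring.
have : (gh - d) + mu * (fh * gh - d * (fh + gh)) <= s^-1.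
  apply: le_trans tot; apply: lerD => //; rewrite ler_wpM2l//; apply: le_trans conv.
  move: gT fT fT0 fTle gh0 fh0; rewrite -/gh -/fh.
  move: (integral_seg _ 0 T) (integral_seg _ 0 T) => x y; nra.
have -> : e = d * (1 + mu * (fh + gh)) by rewrite /d divfK ?gt_eqF.
by move: (s^-1) => x; lra.
Qed.

(* Jensen: [exp (- F) >= exp (- A) (1 + A - F)] for [F t = lambda int_0^t P] and
   [A = m s], the mean of [F] under [s exp (- s t) dt]. *)
Lemma empty_transform_ge s : 0 < s -> expR (- m s) <= s * half_integral (laplace_body beta s).
Proof.
move=> s0; have b01 := empty_prob_unit lambda_gt0 P01.
have Sg := laplace_body_small cP P01 s0; have Sf := laplace_body_small cbeta b01 s0.
have Se := exp_small_decay s0.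
have cI := continuous_integral_seg cP.
have I0 t : 0 <= t -> 0 <= integral_seg P 0 t.
  by move=> t0; apply: integral_seg_ge0 => r /andP[r0 _]; exact: P0.
have SI : exp_small (laplace_body (integral_seg P 0) s).
  by apply: (exp_smallM Se cI (M := K)) => t t0; rewrite ger0_norm ?I0 ?PK.
have HI : half_integral (laplace_body (integral_seg P 0) s) <= s^-1 * half_integral
  (laplace_body P s).
  apply/ler_addgt0Pr => e e0; have [T [T0 /(_ _ (lexx T))]] := half_integral_approx SI e0.
  rewrite ler_norml => /andP[_ H].
  have : integral_seg (laplace_body (integral_seg P 0) s) 0 T <= s^-1 * half_integral
    (laplace_body P s).
    have g0 := laplace_body_ge0 P01 s.
    have e0' t : 0 <= t -> 0 <= expR (- (s * t)) by move=> _; exact: expR_ge0.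
    have H1 := integral_seg_le_half T Se e0'.
    have H2 := integral_seg_le_half T Sg g0.
    rewrite half_integral_decay// in H1.
    apply: (@le_trans _ _ (integral_seg (fun t => expR (- (s * t))) 0 T * integral_seg
      (laplace_body P s) 0 T)).
      apply: le_trans (integral_convol_le Se.1 Sg.1 T0 e0' g0).
      rewrite le_eqVlt; apply/orP; left; apply/eqP; apply: eq_integral_seg => r _.
      rewrite /laplace_body -convol1l// -convol_laplace_body//; last exact: continuous_cst_.
      by apply: eq_convol => // x _; rewrite /laplace_body mulr1.
    by apply: ler_pM => //; apply: integral_seg_ge0 => r /andP[r0 _]; [exact: e0'|exact: g0].
  by move: H; set X := half_integral _; set Y := integral_seg _ 0 T; lra.
pose A := m s; rewrite -/A.
have : half_integral (fun t => (expR (- A) * (1 + A)) * expR (- (s * t)) +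
    - (expR (- A) * lambda) * laplace_body (integral_seg P 0) s t) <= half_integral
      (laplace_body beta s).
  apply: le_half_integral => //; first by apply: exp_smallD; exact: exp_smallZ.
  move=> t t0; rewrite /laplace_body /empty_prob.
  have H := expR_ge1Dx (A - lambda * integral_seg P 0 t).
  have -> : expR (- (lambda * integral_seg P 0 t)) = expR (- A) * expR (A - lambda *
    integral_seg P 0 t).
    by rewrite -expRD; congr expR; ring.
  have X0 : 0 <= expR (- (s * t)) * expR (- A) by rewrite mulr_ge0 ?expR_ge0.
  apply: le_trans (_ : expR (- (s * t)) * expR (- A) * (1 + (A - lambda * integral_seg P 0 t))
    <= _).
    by rewrite le_eqVlt; apply/orP; left; apply/eqP; ring.
  by rewrite mulrA ler_wpM2l.
rewrite (half_integralD (exp_smallZ _ Se) (exp_smallZ _ SI)) (half_integralZ _ Se)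
  (half_integralZ _ SI).
rewrite half_integral_decay// => H.
rewrite mulrC -ler_pdivrMr//; apply: le_trans H.
have EA : 0 < expR (- A) by exact: expR_gt0.
have -> : expR (- A) / s = expR (- A) * (1 + A) * s^-1 + - (expR (- A) * lambda) * (s^-1 *
  half_integral (laplace_body P s)).
  by rewrite /A /child_transform; ring.
rewrite lerD2l mulNr mulNr lerN2 ler_wpM2l// mulr_ge0 ?(ltW lambda_gt0)// ltW//.
Qed.

(** [renewal_transform], [empty_transform_ge] and mu >= lambda e combine into s m / lambda + m exp
    (1 - m) <= 1, and exp (1 - m) >= 2 - m completes the square. *)
Lemma child_transform_sqr s : 0 < s -> s * m s / lambda <= (1 - m s) ^+ 2.
Proof.
move=> s0; have H1 := renewal_transform s0; have H2 := empty_transform_ge s0.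
have m0 := child_transform_gt0 lambda_gt0 mu_ge0 cP P01 Pmin s0.
have mu0 : 0 < mu by apply: lt_le_trans death_rate_large; rewrite mulr_gt0 ?expR_gt0.
have gE : half_integral (laplace_body P s) = m s / lambda by rewrite /child_transform [RHS]mulrC
  mulKf ?gt_eqF.
move: H1; rewrite gE; move: H2; set fh := half_integral (laplace_body beta s) => H2 H1.
have H3 : s * m s / lambda + (mu / lambda) * (m s * (s * fh)) <= 1.
  have : s * (m s / lambda + mu * (fh * (m s / lambda))) <= s * s^-1 by rewrite ler_wpM2l// ltW.
  rewrite mulfV ?gt_eqF//; apply: le_trans; rewrite le_eqVlt; apply/orP; left; apply/eqP; ring.
have H4 : expR 1 * (m s * expR (- m s)) <= (mu / lambda) * (m s * (s * fh)).
  apply: ler_pM.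
  - exact: expR_ge0.
  - by rewrite mulr_ge0 ?expR_ge0// ltW.
  - by rewrite ler_pdivlMr// mulrC death_rate_large.
  - by rewrite ler_wpM2l// ltW.
have H5 : m s * (1 + (1 - m s)) <= expR 1 * (m s * expR (- m s)).
  by rewrite mulrCA -expRD ler_wpM2l ?(ltW m0)//; exact: expR_ge1Dx.
move: H3 H4 H5; move: (_ / lambda) (expR 1 * _) (mu / lambda * _) => x y z; nra.
Qed.

(* [m] is continuous, less than [1] for [s] large, and does not take the value
   [1] by [child_transform_sqr]. *)
Lemma child_transform_le1 s : 0 < s -> m s <= 1.
Proof.
move=> s0; rewrite leNgt; apply/negP => ms1.
have l2 : 0 < 2 * lambda by rewrite mulr_gt0.
have m2 : m (2 * lambda) <= 1 / 2.
  apply: (le_trans (child_transform_le lambda_gt0 cP P01 l2)).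
  by rewrite le_eqVlt; apply/orP; left; apply/eqP; field; rewrite gt_eqF.
have cm u : 0 < u -> {for u, continuous (fun x : R => expR (log_transform lambda P x))}.
  move=> u0; apply: continuous_comp; last exact: continuous_expR.
  exact: (continuous_log_transform lambda_gt0 mu_ge0 cP P01 Pmin).
have mE u : 0 < u -> expR (log_transform lambda P u) = m u.
  exact: (log_transformK lambda_gt0 mu_ge0 cP P01 Pmin).
have no u : 0 < u -> m u <> 1.
  move=> u0 mu1; have := child_transform_sqr u0; rewrite mu1 subrr expr0n/= mulr1.
  by rewrite leNgt divr_gt0.
have s2 : s <= 2 * lambda.
  rewrite leNgt; apply/negP => ls.
  have := child_transform_le lambda_gt0 cP P01 s0; rewrite leNgt => /negP; apply.
  by apply: lt_trans ms1; rewrite ltr_pdivrMr// mul1r; apply: lt_trans ls; rewrite ltr_pMl// ltr1n.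
have cw : {within `[s, 2 * lambda], continuous (fun x : R => expR (log_transform lambda P x))}.
  apply: continuous_in_subspaceT => u; rewrite inE/= in_itv/= => /andP[su _].
  exact: cm (lt_le_trans s0 su).
have [|u] := IVT s2 cw (v := 1).
  rewrite (mE _ s0) (mE _ l2); move: ms1 m2; move: (m s) (m (2 * lambda)) => x y x1 y1.
  by rewrite ge_min le_max (ltW x1)/= andbT; apply/orP; right; lra.
rewrite in_itv/= => /andP[su _]; have u0 := lt_le_trans s0 su.
rewrite mE//; exact: no.
Qed.

(** For s <= mu the transform is at least lambda / (2 mu), so (1 - m)^2 >= s / (2 mu) by
    [child_transform_sqr]. Hence 1 - m exceeds s / c once s <= c^2 / (4 mu), and ln m <= m - 1. *)
Lemma speed_zero c : 0 < c -> exists s, 0 < s /\ s / c + log_transform lambda P s < 0.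
Proof.
move=> c0; have mu0 : 0 < mu by apply: lt_le_trans death_rate_large; rewrite mulr_gt0 ?expR_gt0.
pose s := Num.min mu (c ^+ 2 / (4 * mu)).
have s0 : 0 < s by rewrite lt_min mu0 divr_gt0 ?exprn_gt0// mulr_gt0.
exists s; split => //.
have sm : s <= mu by rewrite ge_min lexx.
have sc : 4 * mu * s <= c ^+ 2 by rewrite mulrC -ler_pdivlMr ?mulr_gt0// ge_min lexx orbT.
have m0 := child_transform_gt0 lambda_gt0 mu_ge0 cP P01 Pmin s0.
have m1 := child_transform_le1 s0.
have Q := child_transform_sqr s0.
have ml : lambda <= m s * (2 * mu).
  rewrite -ler_pdivrMr ?mulr_gt0//; apply: le_trans (child_transform_ge lambda_gt0 mu_ge0 cP P01
    Pmin s0).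
  by rewrite ler_pM2l// lef_pV2 ?posrE ?mulr_gt0 ?addr_gt0//; lra.
have Q2 : s <= 2 * mu * (1 - m s) ^+ 2.
  have : s / (2 * mu) <= (1 - m s) ^+ 2.
    apply: le_trans Q; rewrite -mulrA ler_pM2l// ler_pdivlMr// mulrC ler_pdivrMr ?mulr_gt0//.
  by rewrite ler_pdivrMr ?mulr_gt0// mulrC.
have Ll : log_transform lambda P s <= m s - 1.
  rewrite /log_transform; have -> : ln (m s) = ln (1 + (m s - 1)) by congr ln; ring.
  by apply: le_ln1Dx; lra.
suff : s / c < 1 - m s by lra.
rewrite ltr_pdivrMr//; rewrite ltNge; apply/negP => H.
have : ((1 - m s) * c) ^+ 2 <= s ^+ 2 by rewrite lerXn2r ?nnegrE ?mulr_ge0 ?subr_ge0 ?(ltW s0)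
  ?(ltW c0).
rewrite exprMn => H3.
have : (1 - m s) ^+ 2 * (4 * mu * s) <= s ^+ 2.
  by apply: le_trans H3; rewrite ler_wpM2l// sqr_ge0.
have : s * s <= 2 * mu * (1 - m s) ^+ 2 * s by rewrite ler_wpM2r// ltW.
move: ((1 - m s) ^+ 2) => x; rewrite expr2 => h1 h2.
have : 0 < s * s by rewrite mulr_gt0.
lra.
Qed.

End finite_mass.
End renewal.

Lemma integral_seg_reflect2 (R : realType) (g : R -> R) (u : R) : continuous g -> 0 <= u ->
  integral_seg (fun r => g (2 * u - r)) u (2 * u) = integral_seg g 0 u.
Proof.
move=> cg u0; have uu : u <= 2 * u by lra.
have u20 : 0 <= 2 * u by lra.
have c2 : continuous (fun r => g (2 * u - r)) by exact: continuous_refl_.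
have E1 := integral_seg_split c2 u0 uu.
have E2 := integral_seg_split cg u0 uu.
have E3 := integral_seg_reflect cg u20.
suff E4 : integral_seg (fun r => g (2 * u - r)) 0 u = integral_seg g u (2 * u).
  move: E1 E2 E3 E4; move: (integral_seg _ _ _) (integral_seg _ _ _) (integral_seg _ _ _) => x y z.
  by lra.
rewrite -(integral_seg_reflect c2 u0).
have := integral_seg_shift (- u) cg u0.
have -> : 0 - - u = u by ring.
have -> : u - - u = 2 * u by ring.
move=> <-; by apply: eq_integral_seg => r _; congr g; ring.
Qed.

(** * Infinite integral of the survival function *)

Section infinite_mass.
Context {R : realType}.
Variables (lambda mu : R).
Hypotheses (lambda_gt0 : 0 < lambda) (mu_ge0 : 0 <= mu).
Variable P : R -> R.
Hypotheses (cP : continuous P) (P01 : unit_valued P).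
Hypothesis PE : forall t, 0 <= t -> P t + mu * convol (empty_prob lambda P) P t = 1.
Hypothesis Pdecr : forall s t, 0 <= s -> s <= t -> P t <= P s.
Local Notation beta := (empty_prob lambda P).
Local Notation B := (integral_seg beta 0).

Let cbeta : continuous beta. Proof. exact: continuous_empty_prob. Qed.
Let P0 t : 0 <= t -> 0 <= P t. Proof. by move=> /P01/andP[]. Qed.
Let beta0 t : 0 <= beta t. Proof. exact: expR_ge0. Qed.

Lemma empty_integral_gt0 u : 0 < u -> 0 < B u.
Proof.
move=> u0; apply: (@lt_le_trans _ _ (beta u * (u - 0))).
  by rewrite subr0 mulr_gt0// expR_gt0.
rewrite -(@integral_seg_cst R (beta u) 0 u (ltW u0)).
apply: le_integral_seg; [exact: continuous_cst_|exact: cbeta|].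
by move=> r /andP[r0 ru]; exact: (empty_prob_decr lambda_gt0 cP P01).
Qed.

Lemma empty_integral_le s t : 0 <= s -> s <= t -> B s <= B t.
Proof.
move=> s0 st; rewrite (@integral_seg_split _ beta 0 s t)// lerDl.
by apply: integral_seg_ge0 => r _.
Qed.

(* Each doubling of [B] costs [beta] a fixed amount, since
   [- beta' = lambda P beta >= r B' / B]. *)
Lemma empty_integral_doubling (r U : R) n t : 0 < r -> 0 < U ->
  (forall u, U <= u -> r <= lambda * P u * B u) -> U <= t -> 2 ^+ n * B U <= B t ->
  n%:R * (r / 2) <= beta U - beta t.
Proof.
move=> r0 U0 rPB; elim: n t => [|n IH] t Ut.
  by move=> _; rewrite mul0r subr_ge0; apply: (empty_prob_decr lambda_gt0 cP P01) => //; exact: ltW.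
rewrite exprS -mulrA => H; have BU := empty_integral_gt0 U0.
have n1 : B U <= 2 ^+ n * B U by rewrite ler_peMl ?(ltW BU)// exprn_ege1// ler1n.
have cw : {within `[U, t], continuous B}.
  by apply: continuous_subspaceT; exact: continuous_integral_seg.
have [|u] := IVT Ut cw (v := B t / 2).
  have Bt : B U <= B t by exact: empty_integral_le (ltW U0) Ut.
  by rewrite ge_min le_max; apply/andP; split; apply/orP; [left|right]; lra.
rewrite in_itv/= => /andP[Uu ut] Bu.
have := IH u Uu ltac:(by rewrite Bu; lra).
suff : r / 2 <= beta u - beta t by rewrite -[n.+1%:R]natr1 mulrDl mul1r => X Y; move: X Y; move:
  (n%:R * _) (beta u) (beta t) (beta U) => x1 x2 x3 x4; lra.
have u0 : 0 <= u by exact: le_trans (ltW U0) Uu.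
have cb : continuous (fun x => lambda * (P x * beta x)) by apply: continuousZ_; exact: continuousM_.
have -> : beta u - beta t = integral_seg (fun x => lambda * (P x * beta x)) u t.
  have := empty_prob_int lambda cP u0; have := empty_prob_int lambda cP (le_trans u0 ut).
  rewrite (integral_seg_split cb u0 ut); move: (integral_seg _ 0 u) (integral_seg _ u t) => x y.
  by move: (beta u) (beta t) => a b; lra.
have Bt0 : 0 < B t by apply: empty_integral_gt0; exact: lt_le_trans U0 Ut.
have -> : r / 2 = integral_seg (fun x => (r / B t) * beta x) u t.
  rewrite integral_segZ//; have : B t = B u + integral_seg beta u t by exact: integral_seg_split.
  rewrite Bu => E; have -> : integral_seg beta u t = B t / 2 by lra.
  by field; rewrite gt_eqF.
apply: le_integral_seg => //; first exact: continuousZ_.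
move=> x /andP[ux xt]; rewrite mulrA ler_wpM2r// ler_pdivrMr//.
apply: (le_trans (rPB x (le_trans Uu ux))).
by rewrite ler_wpM2l ?mulr_ge0 ?(ltW lambda_gt0) ?P0 ?(le_trans u0 ux)// empty_integral_le//
  (le_trans u0 ux).
Qed.

(** If [P] tended to 0, [renewal_split] would give mu P B >= 1/2 at large times, where B is the
    integral of beta. Since beta <= 1, [empty_integral_doubling] allows only finitely many doublings
    of B, which is then bounded, and the product tends to 0. *)
Lemma survival_bounded_below : ~ (exists K, forall t, 0 <= t -> integral_seg P 0 t <= K) ->
  exists kappa, 0 < kappa /\ forall t, 0 <= t -> kappa <= P t.
Proof.
move=> noK; apply: contrapT => nok.
have small (e : R) : 0 < e -> exists T, 0 < T /\ forall t, T <= t -> P t < e.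
  move=> e0; apply: contrapT => H; apply: nok; exists e; split => // t t0.
  rewrite leNgt; apply/negP => Pt; apply: H; exists (t + 1); split; first by rewrite ltr_wpDl.
  by move=> x tx; apply: le_lt_trans Pt; apply: Pdecr => //; lra.
have large (M : R) : exists T, 0 < T /\ forall t, T <= t -> M < integral_seg P 0 t.
  apply: contrapT => H; apply: noK; exists M => t t0.
  rewrite leNgt; apply/negP => Pt; apply: H; exists (t + 1); split; first by rewrite ltr_wpDl.
  move=> x tx; apply: (lt_le_trans Pt); rewrite (@integral_seg_split _ P 0 t x)//; last by lra.
  by rewrite lerDl; apply: integral_seg_ge0 => r /andP[tr _]; apply: P0; exact: le_trans tr.
have [T1 [T10 H1]] := small (1 / 4) ltac:(by []).
(* With F the integral of [P], exp (lambda F) >= (lambda F)^2 / 4, so mu F exp (- lambda F) <= 1/4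
   once F >= 16 mu / lambda^2. *)
have [T2 [T20 H2]] := large (16 * (mu + 1) / lambda ^+ 2 + 1).
have mu1 : 0 < mu + 1 by rewrite ltr_wpDl.
pose U := Num.max T1 T2; have U0 : 0 < U by rewrite lt_max T10.
have half u : U <= u -> 1 / 2 <= mu * (P u * B u).
  rewrite ge_max => /andP[u1 u2]; have u0 : 0 < u by exact: lt_le_trans u1.
  have := renewal_split lambda_gt0 mu_ge0 cP P01 PE (ltW u0).
  have P2 : P (2 * u) < 1 / 4 by apply: H1; lra.
  have tail : integral_seg (fun r => P r * beta (2 * u - r)) u (2 * u) <= P u * B u.
    have uu : u <= 2 * u by lra.
    apply: (@le_trans _ _ (integral_seg (fun r => P u * beta (2 * u - r)) u (2 * u))).
      apply: le_integral_seg.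
      - exact: continuous_convol_body.
      - by apply: continuousZ_; exact: continuous_refl_.
      - by move=> r /andP[ur ru]; rewrite ler_wpM2r//; exact: Pdecr (ltW u0) ur.
    rewrite integral_segZ; last exact: continuous_refl_.
    apply: ler_wpM2l; first exact: P0 (ltW u0).
    by rewrite (integral_seg_reflect2 cbeta (ltW u0)).
  have head : mu * (beta u * integral_seg P 0 u) <= 1 / 4.
    have F0 : 0 < integral_seg P 0 u.
      apply: lt_trans (H2 u u2); rewrite ltr_wpDl// divr_ge0 ?sqr_ge0// mulr_ge0// ltW//.
    have LF0 : 0 < lambda * integral_seg P 0 u by rewrite mulr_gt0.
    have HE := expR_ge_sqr (ltW LF0).
    rewrite /empty_prob expRN mulrA -ler_pdivlMr// mulrC ler_pdivrMl ?expR_gt0//.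
    have HF := H2 u u2.
    have HF2 : 16 * (mu + 1) <= integral_seg P 0 u * lambda ^+ 2.
      by rewrite -ler_pdivrMr ?exprn_gt0//; lra.
    rewrite mulrC mulrC -ler_pdivrMr// ?divr_gt0//.
    apply: le_trans HE; rewrite exprMn ler_pdivrMr ?divr_gt0//.
    have -> : lambda ^+ 2 * integral_seg P 0 u ^+ 2 / 4 * (1 / 4 / integral_seg P 0 u) =
       integral_seg P 0 u * lambda ^+ 2 / 16 by field; rewrite gt_eqF.
    by lra.
  move=> H; have := ler_wpM2l mu_ge0 tail; move: head H; rewrite mulrDr.
  move: P2; move: (mu * (beta u * _)) (mu * (P u * _)) (mu * integral_seg _ _ _) (P (2 * u)) =>
    x z y p.
  by lra.
have mu0 : 0 < mu.
  rewrite lt_neqAle mu_ge0 andbT eq_sym; apply/negP => /eqP m0.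
  by have := half U (lexx U); rewrite m0 mul0r; lra.
have r0 : 0 < lambda / (2 * mu) by rewrite divr_gt0// mulr_gt0.
have rPB u : U <= u -> lambda / (2 * mu) <= lambda * P u * B u.
  move=> /half; rewrite -mulrA ler_pM2l// invfM; move: (P u * B u) => x.
  by rewrite -ler_pdivrMl//; lra.
(* So many doublings would lower beta by more than 1. *)
pose n := (Num.truncn (2 / (lambda / (2 * mu)))).+1.
have Bn t : U <= t -> B t <= 2 ^+ n * B U.
  move=> Ut; rewrite leNgt; apply/negP => /ltW BB.
  have := empty_integral_doubling r0 U0 rPB Ut BB.
  apply/negP; rewrite -ltNge.
  apply: (@le_lt_trans _ _ 1).
    have := beta0 t; have /andP[_] := empty_prob_unit lambda_gt0 P01 (ltW U0).
    by move: (beta t) (beta U) => x y; lra.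
  rewrite mulrA ltr_pdivlMr// mul1r -ltr_pdivrMr//; exact: truncnS_gt.
have BU := empty_integral_gt0 U0.
have M0 : 0 < 2 ^+ n * B U by rewrite mulr_gt0// exprn_gt0.
have [T3 [T30 H3]] := small (1 / (4 * mu * (2 ^+ n * B U))) ltac:(by rewrite divr_gt0// !mulr_gt0).
pose t := Num.max T3 U.
have Ut : U <= t by rewrite le_max lexx orbT.
have t0 : 0 <= t by exact: le_trans (ltW U0) Ut.
have := half t Ut; apply/negP; rewrite -ltNge.
have := H3 t; rewrite le_max lexx => /(_ isT); rewrite ltr_pdivlMr ?mulr_gt0// => H.
apply: (@le_lt_trans _ _ (mu * (P t * (2 ^+ n * B U)))).
  by rewrite ler_wpM2l// ler_wpM2l ?P0// Bn.
by move: H; move: (2 ^+ n * B U) (P t) => x y; lra.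
Qed.

End infinite_mass.

Lemma quarters_bound (R : realType) (x A y1 y2 y3 : R) : 0 < x -> 0 <= A ->
  y3 <= x / 4 -> y2 <= x / 4 -> y1 <= x / 4 -> x <= y1 + y2 * A + y3 -> 2 <= A.
Proof.
move=> x0 A0 h3 h2 h1 h.
have : x <= x / 4 + x / 4 * A + x / 4.
  by apply: (le_trans h); apply: lerD => //; apply: lerD => //; exact: ler_wpM2r.
have -> : x / 4 * A = x * A / 4 by ring.
by move=> H; rewrite -(ler_pM2l x0); move: (x * A) H => z; lra.
Qed.

Lemma taylor_step (R : realType) (x y C h g T : R) : 0 < h -> h * (C + 1) <= y * (g - T) ->
  `|x - y - h * (T * y)| <= C * h ^+ 2 -> x < y * (1 + h * g).
Proof.
move=> h0 H; rewrite ler_norml expr2 => /andP[_ H2].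
have := ler_wpM2l (ltW h0) H; have := mulr_gt0 h0 h0; lra.
Qed.

(** * The lower bound for the speed *)

Section lower_bound.
Context {R : realType}.
Variables (lambda mu : R).
Hypotheses (lambda_gt0 : 0 < lambda) (mu_ge0 : 0 <= mu).
Variable P : R -> R.
Hypotheses (cP : continuous P) (P01 : unit_valued P).
Hypothesis PE : forall t, 0 <= t -> P t + mu * convol (empty_prob lambda P) P t = 1.
Hypothesis Pmin : forall t, 0 <= t -> expN mu t <= P t.
Local Notation m := (child_transform lambda P).
Local Notation L := (log_transform lambda P).

Definition birth_rate (r : R) : R := lambda * P r.

(** The convolution power of order n + 1: the index starts at [birth_rate], as the unit of
    convolution is not a function. *)
Fixpoint birth_power n : R -> R :=
  if n is k.+1 then convol birth_rate (birth_power k) else birth_rate.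

(** Iterates, on the constant 1, of the linear part of [tall_prob_rec]. *)
Fixpoint mean_births n : R -> R :=
  if n is k.+1 then convol birth_rate (mean_births k) else fun=> 1.

Let cb : continuous birth_rate. Proof. exact: continuousZ_. Qed.
Let b0 t : 0 <= t -> 0 <= birth_rate t.
Proof. by move=> t0; rewrite mulr_ge0 ?(ltW lambda_gt0)//; case/andP: (P01 t0). Qed.

Lemma continuous_birth_power n : continuous (birth_power n).
Proof. by elim: n => [|n IH] //; exact: continuous_convol. Qed.

Lemma continuous_mean_births n : continuous (mean_births n).
Proof. by elim: n => [|n IH]; [exact: continuous_cst_|exact: continuous_convol]. Qed.

Lemma birth_power_ge0 n t : 0 <= t -> 0 <= birth_power n t.
Proof.
elim: n t => [|n IH] t t0; first exact: b0.
by apply: convol_ge0 => r /andP[r0 rt]; [exact: b0|exact: IH].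
Qed.

(* Split the transform of the [n.+1]-st convolution power at [n.+1 * g1] and
   [n.+1 * g2], and use the transforms at [s + h] and [s - h] for the tails. *)
Lemma mean_births_ge0 n t : 0 <= t -> 0 <= mean_births n t.
Proof.
elim: n t => [|n IH] t t0; first by [].
by apply: convol_ge0 => r /andP[r0 rt]; [exact: b0|exact: IH].
Qed.

Lemma mean_births_integral n t : mean_births n.+1 t = integral_seg (birth_power n) 0 t.
Proof.
have c1 := @continuous_cst_ R 1.
elim: n t => [|n IH] t /=; first by rewrite (convolC t cb c1) convol1l.
have cn := @continuous_birth_power n; have cc := continuous_convol cb cn.
rewrite -(convol1l t cc) (convolC t c1 cc) -(convolA t cb cn c1).
apply: eq_convol => // r _; rewrite -/(mean_births n.+1 r) IH.
by rewrite (convolC r cn c1) convol1l.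
Qed.

Lemma mean_births_le n S t : 0 <= t -> t <= S -> mean_births n t <= (1 + lambda * S) ^+ n.
Proof.
elim: n t => [|n IH] t t0 tS //=.
have S0 : 0 <= S by exact: le_trans tS.
have B0 : 0 <= 1 + lambda * S by rewrite addr_ge0// mulr_ge0// ltW.
apply: (@le_trans _ _ (integral_seg (fun=> lambda * (1 + lambda * S) ^+ n) 0 t)).
  apply: le_integral_seg.
  - by apply: continuous_convol_body => //; exact: continuous_mean_births.
  - exact: continuous_cst_.
  - move=> r /andP[r0 rt]; apply: ler_pM.
    + exact: b0.
    + by apply: mean_births_ge0; rewrite subr_ge0.
    + by rewrite /birth_rate ler_piMr ?(ltW lambda_gt0)//; case/andP: (P01 r0).
    + by apply: IH; rewrite ?subr_ge0//; lra.
rewrite integral_seg_cst// subr0 exprS mulrAC ler_wpM2r ?exprn_ge0//.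
have : lambda * t <= lambda * S by rewrite ler_wpM2l ?(ltW lambda_gt0).
lra.
Qed.

Lemma laplace_birth_rate s r : laplace_body birth_rate s r = lambda * laplace_body P s r.
Proof. by rewrite /laplace_body /birth_rate mulrCA. Qed.

Lemma continuous_laplace_body (f : R -> R) s : continuous f -> continuous (laplace_body f s).
Proof. by move=> cf; apply: continuousM_ => //; exact: continuous_decay. Qed.

Lemma integral_birth_rate s T : integral_seg (laplace_body birth_rate s) 0 T =
  lambda * integral_seg (laplace_body P s) 0 T.
Proof.
have H := @integral_segZ _ (laplace_body P s) lambda 0 T (continuous_laplace_body (s:=s) cP).
by rewrite -H; apply: eq_integral_seg => r _; exact: laplace_birth_rate.
Qed.

Let lb0 n s t : 0 <= t -> 0 <= laplace_body (birth_power n) s t.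
Proof. by move=> t0; rewrite mulr_ge0 ?expR_ge0// birth_power_ge0. Qed.

Let lb_convol n s T : integral_seg (laplace_body (birth_power n.+1) s) 0 T =
  integral_seg (convol (laplace_body birth_rate s) (laplace_body (birth_power n) s)) 0 T.
Proof.
apply: eq_integral_seg => r _.
by rewrite (convol_laplace_body s r cb (@continuous_birth_power n)).
Qed.

Lemma birth_power_transform_le n s T : 0 < s -> 0 <= T ->
  integral_seg (laplace_body (birth_power n) s) 0 T <= m s ^+ n.+1.
Proof.
move=> s0 T0.
have base : integral_seg (laplace_body birth_rate s) 0 T <= m s.
  rewrite integral_birth_rate /child_transform; apply: ler_wpM2l; first exact: ltW.
  apply: integral_seg_le_half; first exact: laplace_body_small.
  by move=> r r0; exact: laplace_body_ge0.
elim: n => [|n IH]; first by rewrite expr1.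
have c1 := continuous_laplace_body (s:=s) cb.
have c2 := continuous_laplace_body (s:=s) (@continuous_birth_power n).
rewrite lb_convol; apply: (le_trans (integral_convol_le c1 c2 T0 (lb0 0 s) (lb0 n s))).
rewrite exprS; apply: ler_pM => //; apply: integral_seg_ge0 => r /andP[r0 _].
  exact: (lb0 0).
exact: lb0.
Qed.

(** A mass q found on [0, T] yields a mass q^(n+1) on [0, 2^n T], since each convolution doubles the
    segment. *)
Lemma birth_power_transform_ge n s T q : 0 <= T -> 0 <= q ->
  (forall T', T <= T' -> q <= integral_seg (laplace_body birth_rate s) 0 T') ->
  exists T1, forall T2, T1 <= T2 -> q ^+ n.+1 <= integral_seg (laplace_body (birth_power n) s) 0 T2.
Proof.
move=> T0 q0 qT; suff H : q ^+ n.+1 <= integral_seg (laplace_body (birth_power n) s) 0 (2 ^+ n * T).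
  have P2 : 0 <= 2 ^+ n * T by rewrite mulr_ge0 ?exprn_ge0.
  exists (2 ^+ n * T) => T2 T12; apply: (le_trans H).
  have c2 := continuous_laplace_body (s:=s) (@continuous_birth_power n).
  rewrite (integral_seg_split c2 P2 T12) lerDl; apply: integral_seg_ge0 => r /andP[r0 _].
  by apply: lb0; exact: le_trans r0.
elim: n => [|n IH]; first by rewrite expr1 mul1r; exact: qT.
have c1 := continuous_laplace_body (s:=s) cb.
have c2 := continuous_laplace_body (s:=s) (@continuous_birth_power n).
have P2 : 0 <= 2 ^+ n * T by rewrite mulr_ge0 ?exprn_ge0.
rewrite lb_convol [2 ^+ n.+1]exprS -mulrA.
apply: le_trans (integral_convol_ge c1 c2 P2 (lb0 0 s) (lb0 n s)).
rewrite exprS; apply: ler_pM => //; first by rewrite exprn_ge0.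
by apply: qT; rewrite ler_peMl// exprn_ege1// ler1n.
Qed.

(** On the middle part exp (- s r) is at most its value at (n + 1) g1, which brings in the untilted
    mass; the two outer parts are Chernoff bounds. *)
Lemma mean_births_ge n s h g1 g2 q T : 0 < s -> 0 < h -> h < s -> 0 <= T -> 0 <= q ->
  0 <= g1 -> g1 <= g2 ->
  (forall T', T <= T' -> q <= integral_seg (laplace_body birth_rate s) 0 T') ->
  q ^+ n.+1 <= (expR (h * g1) * m (s + h)) ^+ n.+1 +
    expR (- (s * (n.+1%:R * g1))) * mean_births n.+1 (n.+1%:R * g2) +
    (expR (- (h * g2)) * m (s - h)) ^+ n.+1.
Proof.
move=> s0 h0 hs T0 q0 g10 g12 qT.
have [T1 /(_ (Num.max T1 (n.+1%:R * g2)))] := birth_power_transform_ge n T0 q0 qT.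
rewrite le_max lexx => /(_ isT) H; apply: (le_trans H) => {H}.
set T2 := Num.max _ _.
pose t1 := n.+1%:R * g1; pose t2 := n.+1%:R * g2.
have t10 : 0 <= t1 by rewrite mulr_ge0.
have t12 : t1 <= t2 by rewrite ler_wpM2l.
have t2T : t2 <= T2 by rewrite le_max lexx orbT.
have cl := continuous_laplace_body (s:=s) (@continuous_birth_power n).
rewrite (integral_seg_split cl (le_trans t10 t12) t2T) (integral_seg_split cl t10 t12).
apply: lerD; first apply: lerD.
- rewrite exprMn -expRM_natl mulrCA.
  apply: le_trans (ler_wpM2l (expR_ge0 _) (birth_power_transform_le n (addr_gt0 s0 h0) t10)).
  have cl' := continuous_laplace_body (s:=(s + h)) (@continuous_birth_power n).
  rewrite -(@integral_segZ _ _ (expR (h * t1)) 0 t1 cl').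
  apply: le_integral_seg => //; first exact: continuousZ_.
  move=> r /andP[r0 rt]; rewrite /laplace_body mulrA ler_wpM2r ?birth_power_ge0//.
  by rewrite -expRD ler_expR; nra.
- rewrite mean_births_integral.
  have cn := @continuous_birth_power n.
  apply: (@le_trans _ _ (integral_seg (fun r => expR (- (s * t1)) * birth_power n r) t1 t2)).
    apply: le_integral_seg => //; first exact: continuousZ_.
    move=> r /andP[r0 rt]; rewrite /laplace_body ler_wpM2r ?birth_power_ge0 ?(le_trans t10)//.
    by rewrite ler_expR; nra.
  rewrite (integral_segZ _ _ _ cn); apply: ler_wpM2l; first exact: expR_ge0.
  rewrite (integral_seg_split cn t10 t12) lerDr.
  by apply: integral_seg_ge0 => r /andP[r0 _]; exact: birth_power_ge0.
- have sh : 0 < s - h by rewrite subr_gt0.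
  rewrite exprMn -expRM_natl mulrN mulrCA.
  have T20 : 0 <= T2 by exact: le_trans (le_trans t10 t12) t2T.
  apply: le_trans (ler_wpM2l (expR_ge0 _) (birth_power_transform_le n sh T20)).
  have cl' := continuous_laplace_body (s:=(s - h)) (@continuous_birth_power n).
  rewrite -(@integral_segZ _ _ (expR (- (h * t2))) 0 T2 cl').
  have cz : continuous (fun r => expR (- (h * t2)) * laplace_body (birth_power n) (s - h) r) by
    exact: continuousZ_.
  rewrite (integral_seg_split cz (le_trans t10 t12) t2T).
  apply: (@le_trans _ _ (integral_seg (fun r => expR (- (h * t2)) * laplace_body (birth_power n)
    (s - h) r) t2 T2)).
    apply: le_integral_seg => //.
    move=> r /andP[r0 rt]; have r1 : 0 <= r by exact: le_trans (le_trans t10 t12) r0.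
    rewrite /laplace_body mulrA ler_wpM2r ?birth_power_ge0//.
    by rewrite -expRD ler_expR; nra.
  rewrite lerDr; apply: integral_seg_ge0 => r /andP[r0 _].
  by rewrite mulr_ge0 ?expR_ge0// lb0.
Qed.

Lemma exprn_small (x e : R) : 0 <= x -> x < 1 -> 0 < e ->
  exists N, forall n, (N <= n)%N -> x ^+ n <= e.
Proof.
move=> x0 x1 e0.
have /cvgrPdist_le/(_ _ e0)[N _ H] : (fun n => x ^+ n : R) @ \oo --> (0 : R).
  by apply: cvg_expr; rewrite ger0_norm.
exists N => n Nn; have := H n Nn; rewrite sub0r normrN; apply: le_trans; exact: ler_norm.
Qed.

(** With T the mean age, g1 is taken below T with exp (- s g1) < m s; by the expansion at s, a small
    h brings both outer factors below m s too. All three are then less than some q < m s. For n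
    large their powers are at most a quarter of q^(n+1), which forces [mean_births] to be at least
    2. *)
Lemma mean_births_supercritical s g : 0 < s -> 0 < mean_age lambda P s ->
  0 < s * mean_age lambda P s + L s ->
  mean_age lambda P s < g -> exists N, 2 <= mean_births N.+1 (N.+1%:R * g).
Proof.
move=> s0; have ms := child_transform_gt0 lambda_gt0 mu_ge0 cP P01 Pmin s0.
have [C [C0 taylor]] := child_transform_taylor lambda_gt0 cP P01 s0.
have LE : expR (L s) = m s by exact: (log_transformK lambda_gt0 mu_ge0 cP P01 Pmin).
have DT : child_moment lambda P s = mean_age lambda P s * m s by rewrite /mean_age divfK// gt_eqF.
move: DT; set T := mean_age _ _ _ => DT Tp sT Tg.
(* Half of the margin s T + L s is kept; the bound by T keeps g1 nonnegative. *)
pose e := Num.min T ((s * T + L s) / (2 * s)).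
have e0 : 0 < e by rewrite lt_min Tp divr_gt0// mulr_gt0.
have eT : e <= T by rewrite ge_min lexx.
have es : s * e <= (s * T + L s) / 2.
  have : e <= (s * T + L s) / (2 * s) by rewrite ge_min lexx orbT.
  rewrite ler_pdivlMr ?mulr_gt0//; move: (L s) (s * T) => l x; lra.
pose g1 := T - e.
have g10 : 0 <= g1 by rewrite subr_ge0.
have g1T : g1 < T by rewrite ltrBlDr ltrDl.
have sg1 : expR (- (s * g1)) < m s.
  rewrite -LE ltr_expR; move: es sT; rewrite /g1 mulrBr.
  by move: (L s) (s * T) (s * e) => x y z; lra.
have C1 : 0 < C + 1 by rewrite ltr_wpDl.
(* Small enough for the expansion to apply and for its remainder C h^2 to be less than the
   first-order gain on either side. *)
pose h := Num.min (s / 2) (Num.min (m s * (T - g1) / (C + 1)) (m s * (g - T) / (C + 1))).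
have h0 : 0 < h.
  by rewrite !lt_min divr_gt0//= !divr_gt0// mulr_gt0// subr_gt0.
have hs : h <= s / 2 by rewrite ge_min lexx.
have h1 : h * (C + 1) <= m s * (T - g1) by rewrite -ler_pdivlMr// ge_min ge_min lexx orbT.
have h2 : h * (C + 1) <= m s * (g - T) by rewrite -ler_pdivlMr// ge_min ge_min lexx !orbT.
have hs' : h < s by apply: (le_lt_trans hs); rewrite ltr_pdivrMr// ltr_pMr// ltr1n.
have sh0 : 0 < s - h by rewrite subr_gt0.
clearbody h g1.
have x1 : expR (h * g1) * m (s + h) < m s.
  rewrite mulrC -ltr_pdivlMr ?expR_gt0// -expRN.
  apply: lt_le_trans (ler_wpM2l (ltW ms) (expR_ge1Dx _)).
  have := taylor h; rewrite gtr0_norm// => /(_ hs); rewrite DT ler_norml => /andP[_].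
  have := ler_wpM2l (ltW h0) h1; have := mulr_gt0 h0 h0.
  by move: (m (s + h)) (m s) => x y; rewrite expr2; lra.
have x3 : expR (- (h * g)) * m (s - h) < m s.
  rewrite expRN mulrC ltr_pdivrMr ?expR_gt0//.
  apply: lt_le_trans (ler_wpM2l (ltW ms) (expR_ge1Dx _)).
  apply: (taylor_step h0 h2).
  have := taylor (- h); rewrite normrN gtr0_norm// => /(_ hs).
  by rewrite DT sqrrN mulNr.
have p1 : 0 < expR (h * g1) * m (s + h).
  apply: mulr_gt0; first exact: expR_gt0.
  exact: (child_transform_gt0 lambda_gt0 mu_ge0 cP P01 Pmin (addr_gt0 s0 h0)).
have p3 : 0 < expR (- (h * g)) * m (s - h).
  apply: mulr_gt0; first exact: expR_gt0.
  exact: (child_transform_gt0 lambda_gt0 mu_ge0 cP P01 Pmin sh0).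
have p2 : 0 < expR (- (s * g1)) by exact: expR_gt0.
have := fun n q T => @mean_births_ge n s h g1 g q T s0 h0 hs'.
move: x1 x3 sg1 p1 p2 p3.
move: (_ * m (s + h)) (_ * m (s - h)) => a1 a3.
move=> x1 x3 x2 p1 p2 p3 H.
have {}H n q T' : 0 <= T' -> 0 <= q ->
  (forall T'', T' <= T'' -> q <= integral_seg (laplace_body birth_rate s) 0 T'') ->
  q ^+ n.+1 <= a1 ^+ n.+1 + expR (- (s * g1)) ^+ n.+1 * mean_births n.+1 (n.+1%:R * g) + a3 ^+ n.+1.
  move=> T'0 q0 qT; have -> : expR (- (s * g1)) ^+ n.+1 = expR (- (s * (n.+1%:R * g1))).
    by rewrite -expRM_natl; congr expR; ring.
  by apply: (H n q T') => //; exact: (le_trans (ltW g1T) (ltW Tg)).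
move: x2 p2 H; move: (expR (- (s * g1))) => a2 x2 p2 H.
pose q := (Num.max a1 (Num.max a2 a3) + m s) / 2.
have M : Num.max a1 (Num.max a2 a3) < m s by rewrite !gt_max x1 x2.
have qm : q < m s by rewrite /q; lra.
have [q1 q2 q3] : [/\ a1 < q, a2 < q & a3 < q].
  by split; (apply: (@le_lt_trans _ _ (Num.max a1 (Num.max a2 a3))); [rewrite !le_max lexx
    ?orbT|rewrite /q; lra]).
have q0 : 0 < q by exact: lt_trans q1.
have Sg := laplace_body_small cP P01 s0.
have [T' [T'0 HT]] := half_integral_approx Sg (e := (m s - q) / lambda) ltac:(by rewrite
  divr_gt0// subr_gt0).
have qT T'' : T' <= T'' -> q <= integral_seg (laplace_body birth_rate s) 0 T''.
  move=> /HT; rewrite ler_norml => /andP[_]; rewrite ler_pdivlMr// integral_birth_rate mulrBl.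
  rewrite [half_integral _ * _]mulrC -/(m s) [_ * lambda]mulrC.
  by move: (lambda * _) (m s) => x y; lra.
have small a : 0 < a -> a < q -> exists N, forall n, (N <= n)%N -> a ^+ n <= q ^+ n / 4.
  move=> a0 aq; have aq0 : 0 <= a / q by rewrite divr_ge0// ltW.
  have aq1 : a / q < 1 by rewrite ltr_pdivrMr// mul1r.
  have [N HN] := exprn_small aq0 aq1 (e := 1 / 4) ltac:(by []).
  exists N => n /HN; rewrite expr_div_n ler_pdivrMr ?exprn_gt0//; move: (q ^+ n) => x; lra.
have [N1 HN1] := small _ p1 q1; have [N2 HN2] := small _ p2 q2; have [N3 HN3] := small _ p3 q3.
exists (maxn N1 (maxn N2 N3)); set n := maxn _ _.
have l1 : (N1 <= n.+1)%N by rewrite leqW// leq_max leqnn.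
have l2 : (N2 <= n.+1)%N by rewrite leqW// !leq_max leqnn orbT.
have l3 : (N3 <= n.+1)%N by rewrite leqW// !leq_max leqnn !orbT.
have := H n q T' T'0 (ltW q0) qT; have := HN1 _ l1; have := HN2 _ l2; have := HN3 _ l3.
have Q : 0 < q ^+ n.+1 by rewrite exprn_gt0.
have A0 : 0 <= mean_births n.+1 (n.+1%:R * g).
  by apply: mean_births_ge0; rewrite mulr_ge0// (le_trans g10)// (le_trans (ltW g1T) (ltW Tg)).
exact: (quarters_bound Q A0).
Qed.

End lower_bound.

(** * From mean numbers of births to probabilities *)

Section spread.
Context {R : realType}.
Variables (lambda mu : R).
Hypotheses (lambda_gt0 : 0 < lambda) (mu_ge0 : 0 <= mu).
Variable P : R -> R.
Hypotheses (cP : continuous P) (P01 : unit_valued P).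
Hypothesis PE : forall t, 0 <= t -> P t + mu * convol (empty_prob lambda P) P t = 1.
Hypothesis Pmin : forall t, 0 <= t -> expN mu t <= P t.
Local Notation f := (tall_prob lambda P).
Local Notation L := (log_transform lambda P).
Local Notation a := (mean_births lambda P).

Let f01 n t : 0 <= t -> 0 <= f n t <= 1.
Proof. exact: (tall_prob_unit lambda_gt0 mu_ge0 cP P01 PE). Qed.
Let fmono n s t : 0 <= s -> s <= t -> f n s <= f n t.
Proof. exact: (tall_prob_nondecreasing lambda_gt0 cP P01). Qed.
Let frec n t : 0 <= t -> f n.+1 t = 1 - expR (- (lambda * convol P (f n) t)).
Proof. exact: tall_prob_rec. Qed.
Let cf n : continuous (f n).
Proof. exact: continuous_tall_prob. Qed.
Let P0 t : 0 <= t -> 0 <= P t. Proof. by move=> /P01/andP[]. Qed.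

Lemma one_sub_expRN_ge (z h : R) : 0 <= z -> z <= h -> z / (1 + h) <= 1 - expR (- z).
Proof.
move=> z0 zh; have H := expR_ge1Dx z; have z1 : 0 < 1 + z by rewrite ltr_wpDr.
have h1 : 0 < 1 + h by apply: lt_le_trans z1 _; rewrite lerD2l.
have H1 : expR (- z) <= (1 + z)^-1 by rewrite expRN lef_pV2 ?posrE ?expR_gt0.
apply: (@le_trans _ _ (z / (1 + z))).
  by rewrite ler_wpM2l// lef_pV2 ?posrE// lerD2l.
have -> : z / (1 + z) = 1 - (1 + z)^-1 by field; rewrite gt_eqF.
by rewrite lerD2l lerN2.
Qed.

(* The births occurring within [S] of the time [tau] are thinned by a factor at most
   [1 + h M] in each generation, [M] bounding the expected numbers of births. *)
Lemma tall_prob_block n h tau S M i N r : 0 <= h -> 0 <= tau ->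
  (forall t, tau <= t -> h <= f n t) ->
  (forall j x, (j <= N)%N -> 0 <= x -> x <= S -> a j x <= M) ->
  (i <= N)%N -> 0 <= r -> r <= S ->
  h * a i r / (1 + h * M) ^+ i <= f (n + i)%N (tau + r).
Proof.
move=> h0 tau0 fh aM; elim: i r => [|i IH] r iN r0 rS.
  by rewrite addn0 expr0 divr1 mulr1; apply: fh; rewrite lerDl.
have M0 : 0 <= M.
  by apply: le_trans (aM 0%N r _ r0 rS).
have D0 : 0 < 1 + h * M by rewrite ltr_wpDr// mulr_ge0.
have Di : 0 < (1 + h * M) ^+ i by rewrite exprn_gt0.
have tr0 : 0 <= tau + r by rewrite addr_ge0.
rewrite addnS frec//.
set z := h * a i.+1 r / (1 + h * M) ^+ i.
have a0 : 0 <= a i.+1 r by exact: mean_births_ge0.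
have z0 : 0 <= z by rewrite divr_ge0 ?mulr_ge0// ltW.
have zh : z <= h * M.
  rewrite ler_pdivrMr//; apply: (@le_trans _ _ (h * M)).
    by apply: ler_wpM2l => //; exact: aM.
  rewrite ler_peMr ?mulr_ge0//; apply: exprn_ege1; by rewrite lerDl mulr_ge0.
have -> : h * a i.+1 r / (1 + h * M) ^+ i.+1 = z / (1 + h * M).
  by rewrite /z exprSr invfM mulrA.
apply: (le_trans (one_sub_expRN_ge z0 zh)).
rewrite lerD2l lerN2 ler_expR lerN2.
have cc : continuous (fun x => P x * f (n + i)%N (tau + r - x)) by exact: continuous_convol_body.
have rt : r <= tau + r by rewrite lerDr.
have ca := @continuous_mean_births R lambda P cP i.
have cb : continuous (fun x => birth_rate lambda P x * a i (r - x)).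
  by apply: continuous_convol_body => //; exact: continuousZ_.
have cb' : continuous (fun x => h / (1 + h * M) ^+ i * (birth_rate lambda P x * a i (r - x))).
  exact: continuousZ_.
apply: (@le_trans _ _ (integral_seg (fun x => lambda * (P x * f (n + i)%N (tau + r - x))) 0 r)).
  have -> : z = integral_seg (fun x => h / (1 + h * M) ^+ i * (birth_rate lambda P x * a i (r -
    x))) 0 r.
    by rewrite (integral_segZ _ _ _ cb) /z mulrAC.
  apply: le_integral_seg => //; first exact: continuousZ_.
  move=> x /andP[x0 xr].
  have rx0 : 0 <= r - x by rewrite subr_ge0.
  have rxS : r - x <= S by apply: le_trans rS; rewrite gerBl.
  have := IH _ (ltnW iN) rx0 rxS; rewrite addrA => H.
  have -> : h / (1 + h * M) ^+ i * (birth_rate lambda P x * a i (r - x)) =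
    lambda * (P x * (h * a i (r - x) / (1 + h * M) ^+ i)) by rewrite /birth_rate; ring.
  by rewrite ler_pM2l// ler_wpM2l// P0.
rewrite (integral_segZ _ _ _ cc) ler_pM2l// /convol (integral_seg_split cc r0 rt) lerDl.
apply: integral_seg_ge0 => x /andP[rx xr].
have x0 : 0 <= x by exact: le_trans rx.
have y0 : 0 <= tau + r - x by rewrite subr_ge0.
by rewrite mulr_ge0 ?P0//; case/andP: (f01 (n + i) y0).
Qed.

(** The constant [h] is such that (1 + h M)^N <= exp (1/2) <= 2. A block of [N] generations, with
    mean at least 2, thus reproduces the lower bound [h]. *)
Lemma tall_prob_spread N S : 0 <= S -> 2 <= a N S -> exists h, 0 < h /\
  forall j t, j%:R * S <= t -> h <= f (j * N)%N t.
Proof.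
move=> S0 aN.
pose M := (1 + lambda * S) ^+ N.
have l1 : 1 <= 1 + lambda * S by rewrite lerDl mulr_ge0// ltW.
have M1 : 1 <= M by exact: exprn_ege1.
have aM j x : (j <= N)%N -> 0 <= x -> x <= S -> a j x <= M.
  move=> jN x0 xS; apply: (le_trans (mean_births_le lambda_gt0 cP P01 j x0 xS)).
  exact: ler_weXn2l.
have M0 : 0 < M by exact: lt_le_trans M1.
have N1 : 0 < (N.+1%:R : R) by rewrite ltr0n.
pose h := (2 * N.+1%:R * M)^-1; have h0 : 0 < h by rewrite invr_gt0 !mulr_gt0.
have h1 : h <= 1.
  rewrite invf_le1 ?mulr_gt0//; apply: (@le_trans _ _ (2 * 1 * 1)); first by rewrite !mulr1 ler1n.
  by apply: ler_pM => //; apply: ler_pM => //; rewrite ler1n.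
have hN : (1 + h * M) ^+ N <= 2.
  apply: (@le_trans _ _ (expR (h * M) ^+ N)).
    by rewrite lerXn2r ?nnegrE ?expR_ge0// ?addr_ge0// ?mulr_ge0 ?(ltW h0) ?(ltW M0)// expR_ge1Dx.
  rewrite -expRM_natl.
  have : N%:R * (h * M) <= 2^-1.
    rewrite /h -[N.+1%:R]natr1; have : 0 <= (N%:R : R) by [].
    move=> n0; have -> : N%:R * ((2 * (N%:R + 1) * M)^-1 * M) = N%:R / (2 * (N%:R + 1)) :> R.
      by field; rewrite !gt_eqF// ltr_wpDl.
    rewrite ler_pdivrMr ?mulr_gt0// ?ltr_wpDl//; lra.
  rewrite -ler_expR => /le_trans; apply.
  have := expR_ge1Dx (- (2^-1) : R); rewrite expRN.
  have E0 : 0 < expR (2^-1) :> R by exact: expR_gt0.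
  rewrite -(ler_pM2r E0) mulVf ?gt_eqF//; move: (expR _) => x; lra.
exists h; split => //; elim => [|j IH] t.
  by rewrite mul0r mul0n => t0; rewrite (le_trans h1)// /tall_prob /low_prob subr0.
rewrite -natr1 mulrDl mul1r => jt.
have jS : 0 <= j%:R * S by rewrite mulr_ge0.
have := @tall_prob_block _ h _ S M N N S (ltW h0) jS IH aM (leqnn N) S0 (lexx S).
rewrite addnC -mulSn => H.
apply: le_trans (fmono _ _ jt); last by rewrite addr_ge0.
apply: le_trans H.
rewrite ler_pdivlMr ?exprn_gt0//; last by rewrite ltr_wpDr// mulr_ge0// ltW.
by rewrite ler_pM2l// (le_trans hN).
Qed.

Lemma low_prob_nondecreasing n t : 0 <= t -> low_prob lambda P n t <= low_prob lambda P n.+1 t.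
Proof.
move=> t0; suff : f n.+1 t <= f n t by rewrite /tall_prob lerD2l lerN2.
elim: n t t0 => [|n IH] t t0.
  by have /andP[_] := f01 1 t0; rewrite {3}/tall_prob /low_prob subr0.
rewrite !frec// lerD2l lerN2 ler_expR lerN2 ler_pM2l//.
apply: le_integral_seg; [exact: continuous_convol_body|exact: continuous_convol_body|].
by move=> r /andP[r0 rt]; rewrite ler_wpM2l ?P0// IH// subr_ge0.
Qed.

Lemma low_prob_homo n n' t : 0 <= t -> (n <= n')%N -> low_prob lambda P n t <= low_prob lambda P
  n' t.
Proof.
move=> t0 /subnKC <-; elim: (n' - n)%N => [|k IH]; first by rewrite addn0.
by rewrite addnS (le_trans IH)// low_prob_nondecreasing.
Qed.

(** In the recursion the convolution of [P] with [f n] is at least kappa h (t - tau): [P] is bounded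
    below by kappa, and [f n] by [h] on a duration t - tau. *)
Lemma low_prob_boost kappa n h tau t : 0 <= kappa -> (forall t, 0 <= t -> kappa <= P t) ->
  0 <= tau -> 0 <= h -> (forall t, tau <= t -> h <= f n t) -> tau <= t ->
  low_prob lambda P n.+1 t <= expR (- (lambda * kappa * h * (t - tau))).
Proof.
move=> k0 kP tau0 h0 fh tt; have t0 : 0 <= t by exact: le_trans tt.
have -> : low_prob lambda P n.+1 t = 1 - f n.+1 t by rewrite /tall_prob subKr.
rewrite frec// subKr ler_expR lerN2 -!mulrA ler_pM2l//.
have ts : 0 <= t - tau by rewrite subr_ge0.
have ts' : t - tau <= t by rewrite gerBl.
have cc : continuous (fun x => P x * f n (t - x)) by exact: continuous_convol_body.
have -> : kappa * (h * (t - tau)) = integral_seg (fun=> kappa * h) 0 (t - tau).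
  by rewrite (integral_seg_cst _ ts) subr0 mulrA.
rewrite /convol (integral_seg_split cc ts ts'); apply: ler_wpDr.
  apply: integral_seg_ge0 => x /andP[rx xr]; have tx : 0 <= t - x by rewrite subr_ge0.
  by have /andP[fx _] := f01 n tx; rewrite mulr_ge0// P0// (le_trans ts).
apply: le_integral_seg => //; first exact: continuous_cst_.
move=> r /andP[r0 rt]; apply: ler_pM => //; first exact: kP.
by apply: fh; rewrite lerBrDr addrC -lerBrDr.
Qed.

(** For g1 strictly between g0 and g, the minimiser s of u g1 + L u has mean age g1, and s g1 + L s
    > s g0 + L s >= 0: [mean_births_supercritical] applies with g. *)
Lemma low_prob_linear kappa g0 g : 0 < kappa -> (forall t, 0 <= t -> kappa <= P t) ->
  0 < g0 -> g0 < g -> (forall u, 0 < u -> 0 <= u * g0 + L u) ->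
  exists al C, [/\ 0 < al, 0 <= C & forall n t, 0 <= t ->
    low_prob lambda P n t <= expR (- (al * (t - n%:R * g - C)))].
Proof.
move=> k0 kP g00 gg L0.
pose g1 := (g0 + g) / 2.
have g01 : g0 < g1 by rewrite /g1; lra.
have g1g : g1 < g by rewrite /g1; lra.
have g10 : 0 < g1 by exact: lt_trans g01.
have [s [s0 smin]] := log_transform_min lambda_gt0 mu_ge0 cP P01 Pmin k0 kP g10.
have age := log_transform_stationary lambda_gt0 mu_ge0 cP P01 Pmin s0 smin.
have pos : 0 < s * mean_age lambda P s + L s.
  rewrite age; have := L0 s s0; have : s * g0 < s * g1 by rewrite ltr_pM2l.
  by move: (L s) (s * g0) (s * g1) => x y z; lra.
have age0 : 0 < mean_age lambda P s by rewrite age.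
have ageg : mean_age lambda P s < g by rewrite age.
have [N aN] := mean_births_supercritical lambda_gt0 mu_ge0 cP P01 Pmin s0 age0 pos ageg.
have gp : 0 < g by exact: lt_trans g1g.
have S0 : 0 <= N.+1%:R * g by rewrite mulr_ge0// ltW.
have [h [h0 fh]] := tall_prob_spread S0 aN.
exists (lambda * kappa * h), (N.+1%:R * g); split; rewrite ?mulr_gt0//.
move=> n t t0.
have lkh : 0 < lambda * kappa * h by rewrite !mulr_gt0.
have [tn|nt] := leP (t - n%:R * g - N.+1%:R * g) 0.
  apply: (@le_trans _ _ (expR 0)); last by rewrite ler_expR oppr_ge0 mulr_ge0_le0// ltW.
  rewrite expR0; exact: (low_prob_le1 lambda_gt0 mu_ge0 cP P01 PE).
(* Blocks reach a multiple of [N.+1] just above [n]; the rounding costs the constant N.+1 g. *)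
pose j := (n %/ N.+1).+1.
have nj : (n <= (j * N.+1).+1)%N by rewrite leqW// ltnW// ltn_ceil.
have jS : j%:R * (N.+1%:R * g) <= n%:R * g + N.+1%:R * g.
  rewrite -mulrDl mulrA ler_wpM2r ?(ltW gp)// -natrM -natrD ler_nat /j mulSn addnC leq_add2r.
  exact: leq_trunc_div.
have jS0 : 0 <= j%:R * (N.+1%:R * g) by rewrite mulr_ge0.
have jt : j%:R * (N.+1%:R * g) <= t by move: jS nt; move: (j%:R * _) (n%:R * g) => x y; lra.
apply: (le_trans (low_prob_homo t0 nj)).
apply: (le_trans (low_prob_boost (ltW k0) kP jS0 (ltW h0) (fh j) jt)).
rewrite ler_expR lerN2 ler_pM2l//; move: jS; move: (j%:R * _) (n%:R * g) => x y; lra.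
Qed.

End spread.

(** * Almost sure convergence *)

Section almost_sure.
Context {R : realType} d {Omega : measurableType d} (P : probability Omega R).

(** Borel-Cantelli. The bound is asked from index 1 on, as [low_bad_prob] concerns positive
    times. *)
Lemma ae_eventually_not (A : nat -> set Omega) (C q : R) : 0 <= q -> q < 1 ->
  (forall k, measurable (A k)) -> (forall k, (P (A k.+1) <= (C * q ^+ k)%:E)%E) ->
  {ae P, forall w, exists K, forall k, (K <= k)%N -> ~ A k w}.
Proof.
move=> q0 q1 mA PA; have q10 : 0 < 1 - q by rewrite subr_gt0.
have C0 : 0 <= C by have := le_trans (measure_ge0 P _) (PA 0%N); rewrite lee_fin expr0 mulr1.
have part n : (\sum_(0 <= i < n) P (A i.+1) <= (C * (1 - q ^+ n) / (1 - q))%:E)%E.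
  elim: n => [|n IH]; first by rewrite big_geq// expr0 subrr mulr0 mul0r.
  rewrite big_nat_recr//=; apply: (le_trans (leeD IH (PA n))).
  rewrite -EFinD lee_fin le_eqVlt; apply/orP; left; apply/eqP.
  by rewrite exprS; field; rewrite gt_eqF.
have sum_fin : (\sum_(n <oo) P (A n.+1) < +oo)%E.
  apply: (@le_lt_trans _ _ (C / (1 - q))%:E); last exact: ltry.
  apply: lime_le; first by apply: is_cvg_nneseries => n _ _; exact: measure_ge0.
  apply: nearW => n; apply: (le_trans (part n)).
  rewrite lee_fin ler_wpM2r ?invr_ge0 ?(ltW q10)// ler_piMr// gerBl exprn_ge0//.
have mA' k : measurable (A k.+1) by exact: mA.
have lim0 := lim_sup_set_cvg0 mA' sum_fin.
have mlim : measurable (lim_sup_set (fun k => A k.+1)).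
  by apply: bigcap_measurable => // k _; apply: bigcup_measurable => j _; exact: mA.
exists (lim_sup_set (fun k => A k.+1)); split => // w /= nK n _.
apply: contrapT => nA; apply: nK; exists n.+1 => -[//|k] nk Ak; apply: nA.
by exists k.
Qed.

Lemma ratio_limit (h : R -> nat) (delta : R) : 0 <= delta ->
  (forall j, exists K, forall k t, (K <= k)%N -> k%:R <= t <= k.+1%:R ->
     (h t)%:R <= (delta + j.+1%:R^-1) * k%:R) ->
  (forall j, 0 < delta - j.+1%:R^-1 -> exists K, forall k t, (K <= k)%N -> k%:R <= t <= k.+1%:R ->
     (delta - j.+1%:R^-1) * k%:R - 1 <= (h t)%:R) ->
  (h t)%:R / t @[t --> +oo] --> delta.
Proof.
move=> d0 up lo; apply/cvgrPdist_le => e e0.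
have [j je] : exists j, (j.+1%:R : R)^-1 <= e / 2.
  exists (Num.truncn (2 / e)); rewrite -[e / 2]invrK lef_pV2 ?posrE ?ltr0n ?invr_gt0 ?divr_gt0//.
  by rewrite invf_div ltW// truncnS_gt.
have j0 : 0 < (j.+1%:R : R)^-1 by rewrite invr_gt0 ltr0n.
move: (up j) (lo j); move: (j.+1%:R^-1) j0 je => c c0 ce [K1 H1] lo'.
have {lo'}[K2 H2] : exists K, forall k t, (K <= k)%N -> k%:R <= t <= k.+1%:R ->
    (delta - c) * k%:R - 1 <= (h t)%:R.
  have [/lo'//|dc] := ltP 0 (delta - c).
  exists 0%N => k t _ _; apply: (@le_trans _ _ 0) => //.
  by rewrite subr_le0 (le_trans (y := 0))// mulr_le0_ge0.
near=> t.
have t0 : 0 < t by near: t; exact: nbhs_pinfty_gt.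
have tK : (maxn K1 K2)%:R <= t by near: t; apply: nbhs_pinfty_ge; rewrite num_real.
(* Makes the bounded terms smaller than e t / 2. *)
have tb : (delta + c + 1) * 2 / e <= t by near: t; apply: nbhs_pinfty_ge; rewrite num_real.
have /andP[kt tk] := truncn_itv (ltW t0).
set k := Num.truncn t in kt tk.
have Kk : (maxn K1 K2 <= k)%N by rewrite /k truncn_ge_nat// ltW.
have kk : k%:R <= t <= k.+1%:R by rewrite kt ltW.
have h1 := H1 k t (leq_trans (leq_maxl _ _) Kk) kk.
have h2 := H2 k t (leq_trans (leq_maxr _ _) Kk) kk.
have tk' : t <= k%:R + 1 by move: (ltW tk); rewrite -natr1.
have dc0 : 0 <= delta + c by rewrite addr_ge0// ltW.
have et : (delta + c + 1) * 2 <= e * t by rewrite [e * t]mulrC -ler_pdivrMr.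
have hi : (h t)%:R <= (delta + e) * t.
  apply: (le_trans h1); apply: (@le_trans _ _ ((delta + c) * t)); first by rewrite ler_wpM2l.
  by rewrite ler_wpM2r ?(ltW t0)//; lra.
have lw : (delta - e) * t <= (h t)%:R.
  apply: le_trans h2.
  have ct : c * t <= e / 2 * t by rewrite ler_wpM2r// ltW.
  have [dc|dc] := leP 0 (delta - c).
    have : (delta - c) * (t - 1) <= (delta - c) * k%:R by rewrite ler_wpM2l//; lra.
    by rewrite mulrBr mulr1 !mulrBl; move: (_ * k%:R) => x; lra.
  have : (delta - c) * t <= (delta - c) * k%:R by rewrite ler_wnM2l// ltW.
  move=> H; apply: le_trans (lerB H (lexx 1)); rewrite !mulrBl; lra.
rewrite distrC ler_norml; apply/andP; split.
  by rewrite lerBrDr ler_pdivlMr// addrC.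
by rewrite lerBlDr ler_pdivrMr// addrC.
Unshelve. all: by end_near. Qed.

End almost_sure.

(** * The speed of the height *)

Section speed.
Context {R : realType} d {Omega : measurableType d}.
Variables (lambda mu : R) (Pb : R -> R).
Hypotheses (lambda_gt0 : 0 < lambda) (mu_ge0 : 0 <= mu).
Hypotheses (cP : continuous Pb) (P01 : unit_valued Pb).
Hypothesis PE : forall t, 0 <= t -> Pb t + mu * convol (empty_prob lambda Pb) Pb t = 1.
Hypothesis Pmin : forall t, 0 <= t -> expN mu t <= Pb t.
Variables (P : probability Omega R) (Y : nat -> Omega -> tree) (S : nat -> Omega -> R) (G : R ->
  Omega -> tree).
Hypothesis G_ctmc : is_ctmc (tree_rate lambda mu) Y S P root_tree G.
Local Notation L := (log_transform lambda Pb).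

Let law : jump_law (tree_rate lambda mu) P Y S root_tree. Proof. by case: G_ctmc. Qed.

Lemma ae_nonexplosive : {ae P, forall w, ~ explosive S w}.
Proof.
exists (explosive S); split => [||w /= /contrapT//].
  exact: (measurable_explosive law).
exact: (explosive0 lambda_gt0 mu_ge0 law).
Qed.

(** Multiplied by c, the hypothesis says that s + c L s < 0, the exponent of [tall_prob_le] at time
    k and level c k. The factor exp (2 s + c L s) in [C] comes from the level being taken at k + 1
    and the time at k + 2. *)
Lemma ae_height_upper c s : 0 < c -> 0 < s -> s / c + L s < 0 ->
  {ae P, forall w, exists K, forall k t, (K <= k)%N -> k%:R <= t <= k.+1%:R ->
    (height (G t w))%:R <= c * k%:R}.
Proof.
move=> c0 s0 sc.
have Ls : expR (L s) = child_transform lambda Pb s.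
  exact: (log_transformK lambda_gt0 mu_ge0 cP P01 Pmin).
have L0 : L s < 0 by have : 0 < s / c by [rewrite divr_gt0|]; move: sc; move: (L s) (s / c) => x
  y; lra.
have scL : s + c * L s < 0.
  by have : c * (s / c + L s) < 0 by [rewrite pmulr_rlt0|]; rewrite mulrDr mulrCA mulfV
    ?gt_eqF// mulr1.
pose m k := (Num.truncn (c * k%:R)).+1.
pose q := expR (s + c * L s).
pose C := (1 + expR mu) * expR (2 * s + c * L s).
have bound k : (P (tall_bad Y S (m k.+1) k.+1) <= (C * q ^+ k)%:E)%E.
  apply: (le_trans (tall_bad_prob lambda_gt0 mu_ge0 cP P01 PE Pmin G_ctmc _ _)).
  rewrite lee_fin /C -mulrA ler_wpM2l ?addr_ge0 ?expR_ge0//.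
  have k2 : 0 <= (k.+2%:R : R) by [].
  apply: (le_trans (tall_prob_le lambda_gt0 mu_ge0 cP P01 PE Pmin _ s0 k2)).
  rewrite -Ls -expRM_natl /q -expRM_natl -!expRD ler_expR.
  have : (m k.+1)%:R * L s <= c * k.+1%:R * L s by rewrite ler_wnM2r ?(ltW L0)// ltW// /m
    truncnS_gt.
  by rewrite -[k.+2%:R]natr1 -[k.+1%:R]natr1; move: (k%:R) => x; lra.
have q1 : q < 1 by rewrite -expR0 ltr_expR.
have mb k : measurable (tall_bad Y S (m k) k) by exact: (measurable_tall_bad G_ctmc).
have H := ae_eventually_not (expR_ge0 _) q1 mb bound.
apply: filterS2 ae_nonexplosive H => w nw [K HK]; exists K => k t Kk kt.
have := not_tall_bad G_ctmc nw (HK k Kk) kt; rewrite ltnS => hm.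
have ck0 : 0 <= c * k%:R by rewrite mulr_ge0// ltW.
by apply: (@le_trans _ _ (Num.truncn (c * k%:R))%:R); [rewrite ler_nat|rewrite truncn_le].
Qed.

(** Two speeds are inserted between [c] and 1 / g0. The gap from c2 to c3 makes a height below c2 k
    exponentially unlikely by [low_prob_linear]; the gap from c to c2 pays for a fall within a unit
    of time, at a factor 2 per level. *)
Lemma ae_height_lower kappa g0 c : 0 < kappa -> (forall t, 0 <= t -> kappa <= Pb t) ->
  0 < g0 -> (forall u, 0 < u -> 0 <= u * g0 + L u) -> 0 < c -> c < g0^-1 ->
  {ae P, forall w, exists K, forall k t, (K <= k)%N -> k%:R <= t <= k.+1%:R ->
    c * k%:R - 1 <= (height (G t w))%:R}.
Proof.
move=> k0 kP g00 L0 c0 cg.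
pose c2 := (c + g0^-1) / 2; pose c3 := (c2 + g0^-1) / 2.
have cc2 : c < c2 by rewrite /c2; lra.
have cc3 : c2 < c3 by rewrite /c3 /c2; lra.
have c3g : c3 < g0^-1 by rewrite /c3 /c2; lra.
clearbody c3; clearbody c2.
have c20 : 0 < c2 by exact: lt_trans cc2.
have c30 : 0 < c3 by exact: lt_trans cc3.
have gg : g0 < c3^-1 by rewrite -[g0]invrK ltf_pV2 ?posrE ?invr_gt0.
have [al [C [al0 C0 HR]]] := low_prob_linear lambda_gt0 mu_ge0 cP P01 PE Pmin k0 kP g00 gg L0.
have r1 : c2 / c3 < 1 by rewrite ltr_pdivrMr// mul1r.
pose m k := Num.truncn (c * k%:R); pose M k := Num.truncn (c2 * k%:R).
have mM k : (m k <= M k)%N by apply: le_truncn; rewrite ler_wpM2r// ltW.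
pose q1 := expR (- (al * (1 - c2 / c3))); pose q2 := expR (- ((c2 - c) * ln 2)).
have ln20 : 0 < ln 2 :> R by rewrite ln_gt0// ltr1n.
have q11 : q1 < 1 by rewrite -expR0 ltr_expR oppr_lt0 mulr_gt0// subr_gt0.
have q21 : q2 < 1 by rewrite -expR0 ltr_expR oppr_lt0 mulr_gt0// subr_gt0.
pose q := Num.max q1 q2.
have q0 : 0 <= q by rewrite le_max expR_ge0.
have qq : q < 1 by rewrite gt_max q11.
pose D1 := 2 * expR (al * C); pose D2 := expR mu * 2.
have D10 : 0 <= D1 by rewrite mulr_ge0 ?expR_ge0.
have D20 : 0 <= D2 by rewrite mulr_ge0 ?expR_ge0.
have bound k : (P (low_bad Y S (m k.+1) (M k.+1) k.+1) <= ((D1 + D2) * q ^+ k)%:E)%E.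
  apply: (le_trans (low_bad_prob lambda_gt0 mu_ge0 cP P01 PE G_ctmc _ _ (ltn0Sn k))).
  rewrite lee_fin [leRHS]mulrDl; set n := k.+1.
  have n0 : 0 <= n%:R :> R by [].
  have qk : q ^+ n <= q ^+ k by apply: ler_wiXn2l => //; exact: ltW.
  have M1 : (M n)%:R <= c2 * n%:R by rewrite truncn_le mulr_ge0// ltW.
  have M2 : c2 * n%:R <= (M n)%:R + 1 by rewrite natr1 ltW// truncnS_gt.
  have m1 : (m n)%:R <= c * n%:R by rewrite truncn_le mulr_ge0// ltW.
  apply: lerD.
  - rewrite /D1 -mulrA; apply: ler_wpM2l => //.
    apply: (le_trans (HR (M n) _ n0)).
    apply: (@le_trans _ _ (expR (al * C) * q1 ^+ n)).
      rewrite /q1 -expRM_natl -expRD ler_expR.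
      have : (M n)%:R / c3 <= c2 * n%:R / c3 by rewrite ler_wpM2r// invr_ge0 ltW.
      move=> H; have := ler_wpM2l (ltW al0) H; rewrite mulrAC.
      by move: (_ / c3) (c2 / c3) => x y; lra.
    rewrite ler_wpM2l ?expR_ge0//; apply: le_trans qk.
    by rewrite lerXn2r ?nnegrE ?expR_ge0// le_max lexx.
  - rewrite /D2 -mulrA ler_wpM2l ?expR_ge0//.
    have E2 j : 2 ^+ j = expR (j%:R * ln 2) :> R by rewrite expRM_natl lnK// posrE.
    rewrite !E2 -expRN -expRD; apply: (@le_trans _ _ (expR (ln 2) * q2 ^+ n)).
      rewrite /q2 -expRM_natl -expRD ler_expR.
      have := ler_wpM2r (ltW ln20) M2; have := ler_wpM2r (ltW ln20) m1.
      by move: (n%:R) ((M n)%:R) ((m n)%:R) (ln 2) => x y z w; lra.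
    rewrite lnK ?posrE// ler_wpM2l//; apply: le_trans qk.
    by rewrite lerXn2r ?nnegrE ?expR_ge0// le_max lexx orbT.
have mb k : measurable (low_bad Y S (m k) (M k) k) by exact: (measurable_low_bad G_ctmc).
have H := ae_eventually_not q0 qq mb bound.
apply: filterS2 ae_nonexplosive H => w nw [K HK]; exists K => k t Kk kt.
have := not_low_bad G_ctmc (mM k) nw (HK k Kk) kt => hm.
apply: (@le_trans _ _ (m k)%:R); last by rewrite ler_nat.
by rewrite lerBlDr natr1 ltW// truncnS_gt.
Qed.

Lemma ae_height_limit delta : 0 <= delta ->
  (forall c, delta < c -> exists s, 0 < s /\ s / c + L s < 0) ->
  (forall c, 0 < c -> c < delta ->
    {ae P, forall w, exists K, forall k t, (K <= k)%N -> k%:R <= t <= k.+1%:R ->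
      c * k%:R - 1 <= (height (G t w))%:R}) ->
  {ae P, forall w, (height (G t w))%:R / t @[t --> +oo] --> delta}.
Proof.
move=> d0 up lo.
have U : {ae P, forall w, forall j, exists K, forall k t, (K <= k)%N -> k%:R <= t <= k.+1%:R ->
    (height (G t w))%:R <= (delta + j.+1%:R^-1) * k%:R}.
  apply: ae_foralln => j; have j0 : 0 < (j.+1%:R : R)^-1 by rewrite invr_gt0 ltr0n.
  have [s [s0 sc]] := up (delta + j.+1%:R^-1) ltac:(by rewrite ltrDl).
  exact: (ae_height_upper (ltr_wpDl d0 j0) s0 sc).
have V : {ae P, forall w, forall j, 0 < delta - j.+1%:R^-1 -> exists K, forall k t, (K <= k)%N ->
    k%:R <= t <= k.+1%:R -> (delta - j.+1%:R^-1) * k%:R - 1 <= (height (G t w))%:R}.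
  apply: ae_foralln => j; have j0 : 0 < (j.+1%:R : R)^-1 by rewrite invr_gt0 ltr0n.
  have [dj|dj] := ltP 0 (delta - j.+1%:R^-1); last first.
    by apply: aeW.
  have := lo _ dj ltac:(by rewrite gtrBl).
  by apply: filterS => w H _.
by apply: filterS2 U V => w Uw Vw; exact: ratio_limit.
Qed.

End speed.

Theorem theorem4p2 (R : realType) (d : measure_display)
  (Omega : measurableType d) (P : probability Omega R)
  (lambda mu : R) (lambda_gt0 : 0 < lambda) (mu_ge0 : 0 <= mu)
  (Y : nat -> Omega -> tree) (S : nat -> Omega -> R) (G : R -> Omega -> tree)
  (G_ctmc : is_ctmc (tree_rate lambda mu) Y S P root_tree G)
  (p : R -> R) (p_lifetime : lifetime_distribution Y S P p) :
  exists delta : R,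
    [/\ 0 <= delta,
        {ae P, forall w, (height (G t w))%:R / t @[t --> +oo] --> delta},
        ~ positive_recurrent Y S P -> exists s : R, solves_b lambda p s delta,
        forall s c : R, solves_b lambda p s c -> c = delta
      & positive_recurrent Y S P -> delta = 0].
Proof.
have law : jump_law (tree_rate lambda mu) P Y S root_tree by case: G_ctmc.
have [Pb [cP P01 Pfix]] := survival_exists lambda_gt0 mu_ge0.
have PE t (t0 : 0 <= t) := survival_equation cP Pfix t0.
have Pmin t : 0 <= t -> expN mu t <= Pb t.
  move=> t0; rewrite Pfix /survival_map lerDl mulr_ge0//; apply: convol_ge0 => r /andP[r0 rt].
    exact: expR_ge0.
  by have /andP[] := birth_convol_unit lambda_gt0 cP P01 r0.
have pE t (t0 : 0 <= t) := lifetime_survival lambda_gt0 mu_ge0 law cP P01 PE p_lifetime t0.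
have Pdecr s t := @survival_nonincreasing R d Omega lambda mu lambda_gt0 mu_ge0 P Y S law Pb cP
  P01 PE s t.
have [[K PK]|noK] := pselect (exists K, forall t, 0 <= t -> integral_seg Pb 0 t <= K).
  have pr : positive_recurrent Y S P.
    exact: (positive_recurrent_of_bounded lambda_gt0 mu_ge0 law cP P01 PE PK).
  have zero c : 0 < c -> exists s, 0 < s /\ s / c + log_transform lambda Pb s < 0.
    exact: (speed_zero lambda_gt0 mu_ge0 cP P01 PE Pdecr PK Pmin).
  exists 0; split => //.
  - apply: (ae_height_limit lambda_gt0 mu_ge0 cP P01 PE Pmin G_ctmc (lexx 0) zero) => c c0.
    by rewrite ltNge (ltW c0).
  (* By [solves_b_tangent], a solution would contradict [zero] at its own speed, so the clause holds
     vacuously. *)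
  - move=> s c sol; have [_ c0 _ _] := sol; have [u [u0]] := zero c c0.
    by rewrite ltNge (solves_b_tangent lambda_gt0 mu_ge0 cP P01 Pmin pE sol u0).
have npr : ~ positive_recurrent Y S P.
  move=> pr; apply: noK.
  have rt0 : (0 <= \int[P]_w return_time Y S w)%E.
    by apply: integral_ge0 => w _; exact: (return_time_ge0 law).
  have rf : (\int[P]_w return_time Y S w)%E \is a fin_num by rewrite ge0_fin_numE.
  exists (fine (\int[P]_w return_time Y S w)%E + 1) => t t0.
  apply: (survival_integral_le lambda_gt0 mu_ge0 law cP P01 PE _ t0).
  by rewrite fineK.
have [kappa [k0 kP]] := survival_bounded_below lambda_gt0 mu_ge0 cP P01 PE Pdecr noK.
have [g [s [g0 s0 sg L0]]] := speed_exists lambda_gt0 mu_ge0 cP P01 Pmin k0 kP.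
have sol : solves_b lambda p s g^-1.
  apply/(solves_bP lambda_gt0 mu_ge0 cP P01 Pmin _ _ pE); split; rewrite ?invr_gt0 ?invrK//.
  apply: (log_transform_stationary lambda_gt0 mu_ge0 cP P01 Pmin s0) => u u0.
  by rewrite sg; exact: L0.
exists g^-1; split.
- by rewrite invr_ge0 ltW.
- apply: (ae_height_limit lambda_gt0 mu_ge0 cP P01 PE Pmin G_ctmc).
  + by rewrite invr_ge0 ltW.
  (* The same s serves every c above 1 / g, since s / c < s g. *)
  + move=> c gc; exists s; split => //; rewrite -sg ltrD2r ltr_pM2l//.
    have c0 : 0 < c by apply: lt_trans gc; rewrite invr_gt0.
    by rewrite -[g]invrK ltf_pV2 ?posrE ?invr_gt0.
  + move=> c c0 cg.
    exact: (ae_height_lower lambda_gt0 mu_ge0 cP P01 PE Pmin G_ctmc k0 kP g0 L0 c0 cg).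
- by move=> _; exists s.
- by move=> s' c sol'; apply: (solves_b_uniq lambda_gt0 mu_ge0 cP P01 Pmin pE sol' sol).
- by move=> /npr.
Qed.
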